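(* Let $q:\mathbb Z\to\mathbb R$ and $H=-\Delta+q$. Assume $q\in\ell^{1,1}$ if $H$ is generic, and $q\in\ell^{1,2}$ if $H$ is not generic. Then there is $C>0$ such that for all $t\in\mathbb R$ $$\big\|P_c(H)e^{itH}\big\|_{B(\ell^1(\mathbb Z),\ell^\infty(\mathbb Z))}\le C\langle t\rangle^{-1/3}.$$
   Context: $(\Delta u)(n)=u(n+1)+u(n-1)-2u(n)$; $\ell^{p,\sigma}$ is the weighted $\ell^p$ space on $\mathbb Z$ with weight $\langle n\rangle^\sigma$, $\langle n\rangle=\sqrt{1+n^2}$. $P_d(H)$ is the spectral projection onto the discrete spectrum (span of eigenvectors) of the bounded self-adjoint operator $H$ on $\ell^2$, and $P_c(H)=1-P_d(H)$. Jost solutions $f_\pm(n,\theta)$, $\operatorname{Im}\theta\le0$: solutions of $Hf=2(1-\cos\theta)f$ with $f_\pm(n,\theta)-e^{\mp in\theta}\to0$ as $n\to\pm\infty$ (defined via the Volterra equations $m_\pm=e^{\pm in\theta}f_\pm$, $m_+(n)=1+\sum_{\nu\ge n}D(n-\nu,\theta)q(\nu)m_+(\nu)$, $m_-(n)=1+\sum_{\nu\le n}D(\nu-n,\theta)q(\nu)m_-(\nu)$, $D(k,\theta)=(1-e^{2ik\theta})/(2i\sin\theta)$). Wronskian $[u,v](n)=u(n+1)v(n)-u(n)v(n+1)$, $W(\theta)=[f_+(\cdot,\theta),f_-(\cdot,\theta)]$. $H$ is generic if $W(\theta_0)\neq0$ for every $\theta_0\in\{0,\pi,-\pi\}$ (equivalently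 $0$ and $4$ are not resonances). *)

(* Defs.v *)
From Stdlib Require Import Reals ZArith.
Open Scope R_scope.

Definition Cx := (R * R)%type.
Definition Cadd (a b : Cx) : Cx := (fst a + fst b, snd a + snd b).
Definition Csub (a b : Cx) : Cx := (fst a - fst b, snd a - snd b).
Definition Cmul (a b : Cx) : Cx :=
  (fst a * fst b - snd a * snd b, fst a * snd b + snd a * fst b).
Definition Cscal (r : R) (a : Cx) : Cx := (r * fst a, r * snd a).
Definition Cconj (a : Cx) : Cx := (fst a, - snd a).
Definition Cmod (a : Cx) : R := sqrt (fst a ^ 2 + snd a ^ 2).
Fixpoint Cpow (a : Cx) (k : nat) : Cx :=
  match k with O => (1, 0) | S k' => Cmul a (Cpow a k') end.
Definition Cexpi (x : R) : Cx := (cos x, sin x).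

Definition bracket (x : R) : R := sqrt (1 + x ^ 2).

Definition symsum (f : Z -> R) (N : nat) : R :=
  sum_f_R0 (fun k => f (Z.of_nat k - Z.of_nat N)%Z) (2 * N).

Definition wl1 (sigma : nat) (q : Z -> R) : Prop :=
  exists B, forall N, symsum (fun n => bracket (IZR n) ^ sigma * Rabs (q n)) N <= B.

Definition Hop (q : Z -> R) (u : Z -> Cx) (n : Z) : Cx :=
  Csub (Csub (Cscal (2 + q n) (u n)) (u (n + 1)%Z)) (u (n - 1)%Z).
Definition Hpow (q : Z -> R) (k : nat) (u : Z -> Cx) : Z -> Cx := Nat.iter k (Hop q) u.

(** v = e^{itH} u, defined by the (pointwise convergent) exponential series
    v(n) = sum_k (i t)^k / k! (H^k u)(n).  H is bounded, so this agrees with the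
    operator exponential on l^2. *)
Definition expcoef (t : R) (k : nat) : Cx := Cscal (/ INR (fact k)) (Cpow (0, t) k).
Definition ExpItH (q : Z -> R) (t : R) (u v : Z -> Cx) : Prop :=
  forall n,
    infinite_sum (fun k => fst (Cmul (expcoef t k) (Hpow q k u n))) (fst (v n)) /\
    infinite_sum (fun k => snd (Cmul (expcoef t k) (Hpow q k u n))) (snd (v n)).

Definition InL2 (u : Z -> Cx) : Prop :=
  exists B, forall N, symsum (fun n => Cmod (u n) ^ 2) N <= B.
Definition Orth (f g : Z -> Cx) : Prop :=
  Un_cv (fun N => symsum (fun n => fst (Cmul (f n) (Cconj (g n)))) N) 0 /\
  Un_cv (fun N => symsum (fun n => snd (Cmul (f n) (Cconj (g n)))) N) 0.

Definition Eigvec (q : Z -> R) (e : Z -> Cx) : Prop :=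
  InL2 e /\ (exists n, e n <> (0, 0)) /\
  exists lam : Cx, forall n, Hop q e n = Cmul lam (e n).

(** Range of P_c(H) = 1 - P_d(H): orthogonal complement of the eigenvectors. *)
Definition ContSub (q : Z -> R) (w : Z -> Cx) : Prop :=
  InL2 w /\ forall e, Eigvec q e -> Orth w e.

Definition IsPc (q : Z -> R) (v w : Z -> Cx) : Prop :=
  ContSub q w /\ forall z, ContSub q z -> Orth (fun n => Csub (v n) (w n)) z.

Definition JostPlus (q : Z -> R) (th : R) (f : Z -> Cx) : Prop :=
  (forall n, Hop q f n = Cscal (2 * (1 - cos th)) (f n)) /\
  forall eps, 0 < eps -> exists N : Z, forall n, (N <= n)%Z ->
    Cmod (Csub (f n) (Cexpi (- IZR n * th))) < eps.
Definition JostMinus (q : Z -> R) (th : R) (f : Z -> Cx) : Prop :=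
  (forall n, Hop q f n = Cscal (2 * (1 - cos th)) (f n)) /\
  forall eps, 0 < eps -> exists N : Z, forall n, (n <= N)%Z ->
    Cmod (Csub (f n) (Cexpi (IZR n * th))) < eps.

Definition Wr (u v : Z -> Cx) (n : Z) : Cx :=
  Csub (Cmul (u (n + 1)%Z) (v n)) (Cmul (u n) (v (n + 1)%Z)).

Definition generic (q : Z -> R) : Prop :=
  forall th, (th = 0 \/ th = PI \/ th = - PI) ->
  forall fp fm, JostPlus q th fp -> JostMinus q th fm -> Wr fp fm 0 <> (0, 0).

(* Main.v *)
(** Put z = e^{i theta} and let h(n,m) = z^{|n-m|} m_+(max) m_-(min) (1 - z^2)/w, with w the Wronskian of m_+ and m_-.
    The density of the spectral measure on [0,4] is (1/pi) Re h d theta, so the kernel of P_c(H) e^{itH} is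
    K_t(n,m) = (1/pi) int_0^pi e^{it(2 - 2 cos theta)} Re h(n,m) d theta.

    Dispersive decay. For the truncated potentials the scattering relation T m_- = conj m_+ - R z^{2m} m_+ writes Re h
    as a sum of two terms Re (e^{iM theta} g(theta)) with |M| >= ||n| - |m|| and |g|, sin theta |g'| bounded uniformly.
    One moment of q gives this when w stays away from 0; otherwise |w| >= 2 sin theta and the second moment bounds
    m_+' and m_-' . The van der Corput lemma for the third derivative of the phase then gives |t|^{-1/3}, uniformly in
    M, and the same estimates at t = 0 show that q_n = K_0(n, .) is in l^2.

    Completeness. The functions m_+, m_- and w are absolutely convergent power series on the closed disc. After
    the zeros of w at z = 1, -1 are cancelled against 1 - z^2, finitely many zeros remain and all lie in the open
    disc. For a real polynomial p with p(lambda(z)) vanishing at these zeros, the circular mean of p(lambda) h does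
    not depend on the radius; comparing small circles with the unit circle gives p(H) q_n = p(H) delta_n.
    Since delta_n - q_n is in l^2, it is orthogonal to the orthogonal complement of the eigenvectors. Conversely q_n is
    orthogonal to each eigenvector e, of eigenvalue mu say: with chi = 1 - (lambda - mu)^2/c, the bounded sequence
    chi(H)^k q_n tends to 0 weakly while <chi(H)^k q_n, e> = <q_n, e>.
    Hence w(n) = <w, delta_n> = <w, q_n> = <v, q_n> = sum_m K_t(n,m) u(m) when w = P_c v and v = e^{itH} u. *)

From Stdlib Require Import Reals ZArith Lra Lia ClassicalEpsilon List.
From Coquelicot Require Import Coquelicot.
Require Import Defs.
Import Complex.
Open Scope R_scope.

(** * Oscillatory integrals *)

(** With one moment of q only sin theta times the angular derivative of the Jost functions is
    controlled. Amplitudes are therefore allowed a derivative of size 1/sin at the band edges. This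
    costs a logarithm, but near the edges the second derivative of the phase has size t, and the
    spare power of t pays for it. Derivative bounds are proved for truncated potentials only, with
    constants independent of the truncation; what passes to the limit are bounds on integrals over
    compact subintervals, and the strips left out are estimated by the sup bound. Completeness needs
    finitely many poles. Zeros of the Wronskian could a priori accumulate at a resonant edge; the
    edge zeros are divided out before counting, and this division is where the second moment pays.
    The remaining zeros stay away from the circle and are counted by Blaschke factors against the
    nonzero value at z = 0. The removing polynomial contains the conjugate of every factor, so it is
    real although nothing is known about the position of the zeros. *)

Ltac subst_derive f x v H :=
  replace (Derive (fun y : R => f y) x) with v
    by (symmetry; apply is_derive_unique; exact H).

(** Mean value theorem for [G - s F] with s = 1 and s = -1. A comparison of derivatives replaces the
    estimate of an integral of |f|, so that the majorants below can be given by explicit primitives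
    such as [atan] and [ln]. *)
Lemma derive_compare (F f G g : R -> R) (a b : R) :
  a <= b ->
  (forall x, a <= x <= b -> is_derive F x (f x)) ->
  (forall x, a <= x <= b -> is_derive G x (g x)) ->
  (forall x, a <= x <= b -> Rabs (f x) <= g x) ->
  Rabs (F b - F a) <= G b - G a.
Proof.
intros Hab HF HG Hfg.
assert (H : forall s, Rabs s = 1 -> s * (F b - F a) <= G b - G a).
{ intros s Hs.
  destruct (MVT_gen (fun x => G x - s * F x) a b (fun x => g x - s * f x)) as [c [Hc1 Hc2]].
  - rewrite Rmin_left, Rmax_right by lra. intros x Hx.
    apply (is_derive_minus G (fun x => s * F x)); [apply HG; lra|].
    apply is_derive_scal. apply HF. lra.
  - rewrite Rmin_left, Rmax_right by lra. intros x Hx.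
    apply derivable_continuous_pt. apply ex_derive_Reals_0.
    exists (g x - s * f x).
    apply (is_derive_minus G (fun x => s * F x)); [apply HG; lra|].
    apply is_derive_scal. apply HF. lra.
  - rewrite Rmin_left, Rmax_right in Hc1 by lra.
    assert (0 <= g c - s * f c).
    { specialize (Hfg c Hc1).
      assert (s * f c <= Rabs (s * f c)) by apply Rle_abs.
      rewrite Rabs_mult, Hs in H. lra. }
    assert (0 <= (g c - s * f c) * (b - a)) by (apply Rmult_le_pos; lra).
    lra. }
apply Rabs_le. split.
- specialize (H (-1)). rewrite Rabs_left in H by lra. lra.
- specialize (H 1). rewrite Rabs_right in H by lra. lra.
Qed.

Lemma is_derive_RInt_open (f : R -> R) (lo hi a x : R) :
  lo < a < hi -> lo < x < hi ->
  (forall y, lo < y < hi -> continuous f y) ->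
  is_derive (fun y => RInt f a y) x (f x).
Proof.
intros Ha Hx Hc.
apply is_derive_RInt with (a := a).
- assert (Hd : 0 < Rmin (x - lo) (hi - x)) by (apply Rmin_glb_lt; lra).
  exists (mkposreal _ Hd). intros y Hy.
  apply (RInt_correct f). apply ex_RInt_continuous. intros z Hz.
  apply Hc.
  unfold ball in Hy; simpl in Hy; unfold AbsRing_ball, abs, minus, plus, opp in Hy; simpl in Hy.
  assert (Hy2 := Rlt_le_trans _ _ _ Hy (Rmin_l _ _)).
  assert (Hy3 := Rlt_le_trans _ _ _ Hy (Rmin_r _ _)).
  apply Rabs_def2 in Hy2. apply Rabs_def2 in Hy3.
  destruct (Rle_dec a y).
  + rewrite Rmin_left, Rmax_right in Hz by lra. lra.
  + rewrite Rmin_right, Rmax_left in Hz by lra. lra.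
- now apply Hc.
Qed.

Lemma is_derive_cont (f : R -> R) (x l : R) : is_derive f x l -> continuous f x.
Proof. intros H. apply (ex_derive_continuous f x). now exists l. Qed.

(* Integration by parts against the bounded multiplier a = f1 / (L + f1^2),
   since cos f = cos f L/(L + f1^2) + cos f f1 a; this avoids splitting at the
   stationary point. *)
Lemma van_der_corput (f f1 f2 u u1 G g : R -> R) (lo hi a b L C0 : R) :
  lo < a -> a <= b -> b < hi -> 0 < L ->
  (forall x, lo < x < hi -> is_derive f x (f1 x)) ->
  (forall x, lo < x < hi -> is_derive f1 x (f2 x)) ->
  (forall x, lo < x < hi -> is_derive u x (u1 x)) ->
  (forall x, a <= x <= b -> is_derive G x (g x)) ->
  (forall x, a <= x <= b -> L <= f2 x) ->
  (forall x, a <= x <= b -> Rabs (u x) <= C0) ->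
  (forall x, a <= x <= b -> Rabs (u1 x) <= g x) ->
  Rabs (RInt (fun x => cos (f x) * u x) a b) <= (9 * C0 + (G b - G a)) / sqrt L.
Proof.
intros Hlo Hab Hhi HL Hf Hf1 Hu HG Hf2 Hu0 Hu1.
set (r := sqrt L).
assert (Hr : 0 < r) by now apply sqrt_lt_R0.
assert (Hrr : r * r = L) by (apply sqrt_sqrt; lra).
set (A := fun x => f1 x / (L + f1 x * f1 x)).
assert (Hden : forall x, 0 < L + f1 x * f1 x) by (intros x; nra).
set (S := fun x => sin (f x) * A x * u x).
set (F := fun x => RInt (fun x => cos (f x) * u x) a x - S x).
set (A1 := fun x => f2 x * (L - f1 x * f1 x) / (L + f1 x * f1 x) ^ 2).
assert (HC0 : 0 <= C0). { eapply Rle_trans; [apply Rabs_pos|apply (Hu0 a); lra]. }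
assert (HA1 : forall x, lo < x < hi -> is_derive A x (A1 x)).
{ intros x Hx. unfold A, A1. specialize (Hden x).
  auto_derive.
  - repeat split; try (eexists; now apply Hf1); lra.
  - subst_derive f1 x (f2 x) (Hf1 x Hx). field. lra. }
assert (HAb : forall x, Rabs (A x) <= / (2 * r)).
{ intros x. unfold A. specialize (Hden x).
  rewrite Rabs_div by lra. rewrite (Rabs_right (L + _)) by lra.
  apply Rle_div_l; [lra|].
  apply Rmult_le_reg_l with (2 * r); [lra|].
  replace (2 * r * (/ (2 * r) * (L + f1 x * f1 x))) with (L + f1 x * f1 x) by (field; lra).
  assert (Rabs (f1 x) * Rabs (f1 x) = f1 x * f1 x) by (rewrite <- Rabs_mult; apply Rabs_right, Rle_ge, Rle_0_sqr).
  assert (Hsq := Rle_0_sqr (r - Rabs (f1 x))). unfold Rsqr in Hsq. lra. }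
assert (HSb : forall x, a <= x <= b -> Rabs (S x) <= C0 * / (2 * r)).
{ intros x Hx. unfold S. rewrite !Rabs_mult.
  assert (Rabs (sin (f x)) <= 1) by (apply Rabs_le; apply SIN_bound).
  specialize (HAb x). specialize (Hu0 x Hx).
  assert (0 <= Rabs (sin (f x))) by apply Rabs_pos.
  assert (0 <= Rabs (A x)) by apply Rabs_pos.
  assert (0 <= Rabs (u x)) by apply Rabs_pos.
  assert (Rabs (sin (f x)) * Rabs (A x) <= 1 * / (2 * r)) by (apply Rmult_le_compat; auto).
  rewrite Rmult_comm. apply Rmult_le_compat; auto; try lra. nra. }
(* The primitive of f2 / (L + f1^2) is atan (f1 / r) / r with r^2 = L, whose increment is at most PI
   / r wherever f1 vanishes; this replaces the usual distance from the stationary point. *)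
assert (HF : Rabs (F b - F a) <= (2 * C0 * (atan (f1 b / r) / r) + G b / (2 * r)) - (2 * C0 * (atan (f1 a / r) / r) + G a / (2 * r))).
{ apply (derive_compare F (fun x => cos (f x) * u x - (cos (f x) * f1 x * A x * u x + sin (f x) * (A1 x * u x + A x * u1 x)))
    (fun x => 2 * C0 * (atan (f1 x / r) / r) + G x / (2 * r)) (fun x => 2 * C0 * (f2 x / (L + f1 x * f1 x)) + g x / (2 * r))); auto.
  - intros x Hx. unfold F.
    apply (is_derive_minus (fun x => RInt (fun x => cos (f x) * u x) a x) S).
    + apply (is_derive_RInt_open (fun x => cos (f x) * u x) lo hi); try lra.
      intros y Hy. apply (continuous_mult (fun x => cos (f x)) u).
      * apply (continuous_comp f cos). { apply (is_derive_cont _ _ (f1 y)). now apply Hf. }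
        apply continuity_pt_filterlim. apply continuity_cos.
      * apply (is_derive_cont _ _ (u1 y)). now apply Hu.
    + unfold S. assert (Hx' : lo < x < hi) by lra.
      assert (ex_derive f x) by (exists (f1 x); now apply Hf).
      assert (ex_derive A x) by (exists (A1 x); now apply HA1).
      assert (ex_derive u x) by (exists (u1 x); now apply Hu).
      auto_derive.
      * repeat split; assumption.
      * subst_derive f x (f1 x) (Hf x Hx'). subst_derive u x (u1 x) (Hu x Hx'). subst_derive A x (A1 x) (HA1 x Hx'). ring.
  - intros x Hx. assert (Hx' : lo < x < hi) by lra. specialize (Hden x).
    assert (ex_derive f1 x) by (exists (f2 x); now apply Hf1).
    assert (ex_derive G x) by (exists (g x); now apply HG).
    auto_derive.
    + repeat split; assumption.
    + subst_derive f1 x (f2 x) (Hf1 x Hx'). subst_derive G x (g x) (HG x Hx).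
      rewrite <- Hrr. rewrite <- Hrr in Hden. field. split; [|nra]. nra.
  - intros x Hx. specialize (Hden x). specialize (HAb x). specialize (Hf2 x Hx). specialize (Hu0 x Hx). specialize (Hu1 x Hx).
    replace (cos (f x) * u x - (cos (f x) * f1 x * A x * u x + sin (f x) * (A1 x * u x + A x * u1 x)))
      with (cos (f x) * (u x * (L / (L + f1 x * f1 x))) + - (sin (f x) * (A1 x * u x + A x * u1 x)))
      by (unfold A; field; lra).
    eapply Rle_trans; [apply Rabs_triang|].
    rewrite Rabs_Ropp, !Rabs_mult.
    assert (Hc : Rabs (cos (f x)) <= 1) by (apply Rabs_le; apply COS_bound).
    assert (Hs : Rabs (sin (f x)) <= 1) by (apply Rabs_le; apply SIN_bound).
    assert (H1 : Rabs (L / (L + f1 x * f1 x)) <= f2 x / (L + f1 x * f1 x)).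
    { rewrite Rabs_right. - apply Rmult_le_compat_r; [|lra]. apply Rlt_le, Rinv_0_lt_compat; lra.
      - apply Rle_ge, Rlt_le, Rdiv_lt_0_compat; lra. }
    assert (H2 : Rabs (A1 x) <= f2 x / (L + f1 x * f1 x)).
    { unfold A1. replace (f2 x * (L - f1 x * f1 x) / (L + f1 x * f1 x) ^ 2) with
        (f2 x / (L + f1 x * f1 x) * ((L - f1 x * f1 x) / (L + f1 x * f1 x))) by (field; lra).
      assert (0 <= f2 x / (L + f1 x * f1 x)) by (apply Rlt_le, Rdiv_lt_0_compat; lra).
      rewrite Rabs_mult, (Rabs_right (f2 x / _)) by lra.
      rewrite <- (Rmult_1_r (f2 x / (L + f1 x * f1 x))) at 2.
      apply Rmult_le_compat_l; auto.
      apply Rabs_le. split.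
      - apply Rmult_le_reg_r with (L + f1 x * f1 x); auto. unfold Rdiv. rewrite Rmult_assoc, Rinv_l by lra. nra.
      - apply Rmult_le_reg_r with (L + f1 x * f1 x); auto. unfold Rdiv. rewrite Rmult_assoc, Rinv_l by lra. nra. }
    assert (H3 : Rabs (A1 x * u x + A x * u1 x) <= f2 x / (L + f1 x * f1 x) * C0 + / (2 * r) * g x).
    { eapply Rle_trans; [apply Rabs_triang|]. rewrite !Rabs_mult.
      apply Rplus_le_compat; apply Rmult_le_compat; auto using Rabs_pos. }
    assert (H4 : Rabs (cos (f x)) * (Rabs (u x) * Rabs (L / (L + f1 x * f1 x))) <= 1 * (C0 * (f2 x / (L + f1 x * f1 x)))).
    { apply Rmult_le_compat; auto using Rabs_pos. apply Rmult_le_pos; apply Rabs_pos.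
      apply Rmult_le_compat; auto using Rabs_pos. }
    assert (H5 : Rabs (sin (f x)) * Rabs (A1 x * u x + A x * u1 x) <= 1 * (f2 x / (L + f1 x * f1 x) * C0 + / (2 * r) * g x)).
    { apply Rmult_le_compat; auto using Rabs_pos. }
    unfold Rdiv in *. lra. }
assert (HFa : F a = - S a). { unfold F. rewrite RInt_point. unfold zero; simpl. ring. }
assert (Hat : atan (f1 b / r) - atan (f1 a / r) <= 4).
{ assert (H1 := atan_bound (f1 b / r)). assert (H2 := atan_bound (f1 a / r)). assert (H3 := PI_4). lra. }
replace (RInt (fun x => cos (f x) * u x) a b) with ((F b - F a) + (S b + - S a)) by (unfold F at 1; rewrite HFa; ring).
eapply Rle_trans; [apply Rabs_triang|].
assert (H1 : Rabs (S b + - S a) <= C0 * / (2 * r) + C0 * / (2 * r)).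
{ eapply Rle_trans; [apply Rabs_triang|]. rewrite Rabs_Ropp. apply Rplus_le_compat; apply HSb; lra. }
assert (HGab : 0 <= G b - G a).
{ eapply Rle_trans; [apply Rabs_pos|]. apply (derive_compare (fun _ => 0) (fun _ => 0) G g); auto.
  - intros x Hx. apply (is_derive_const (V := R_NormedModule) 0).
  - intros x Hx. rewrite Rabs_R0. eapply Rle_trans; [apply Rabs_pos|now apply Hu1]. }
assert (Hri : 0 < / r) by now apply Rinv_0_lt_compat.
replace (/ (2 * r)) with (/ r / 2) in * by (field; lra).
replace (2 * C0 * (atan (f1 b / r) / r) + G b / (2 * r) - (2 * C0 * (atan (f1 a / r) / r) + G a / (2 * r)))
 with ((2 * C0 * (atan (f1 b / r) - atan (f1 a / r)) + (G b - G a) / 2) * / r) in HF by (field; lra).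
assert (2 * C0 * (atan (f1 b / r) - atan (f1 a / r)) <= 2 * C0 * 4) by (apply Rmult_le_compat_l; lra).
unfold Rdiv.
assert ((2 * C0 * (atan (f1 b / r) - atan (f1 a / r)) + (G b - G a) / 2) * / r <= (8 * C0 + (G b - G a)) * / r).
{ apply Rmult_le_compat_r; lra. }
lra.
Qed.

(** The derivative may blow up like 1 / sin at both band edges, the bound that one moment provides
    for the Jost functions. Nothing is required at 0 and PI, so integrals run over [e, PI - e]. *)
Definition amplitude (C0 C1 : R) (u : R -> R) : Prop :=
  exists u1 : R -> R, forall x, 0 < x < PI ->
    is_derive u x (u1 x) /\ Rabs (u x) <= C0 /\ Rabs (u1 x) <= C1 / sin x.

Lemma PI_gt_3 : 3 < PI.
Proof. assert (H := PI2_3_2). lra. Qed.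

(** Because x^2 <= 4 on this interval, x - x^3 / 6 is at least x / 3. *)
Lemma sin_ge_third (x : R) : 0 <= x <= PI / 2 -> x / 3 <= sin x.
Proof.
intros Hx. assert (H4 := PI_4).
destruct (Req_dec x 0) as [->|Hn]; [rewrite sin_0; lra|].
destruct (sin_bound x 0) as [H _]; try lra.
assert (Hxx : x * x <= 4) by nra.
unfold sin_approx, sin_term in H; simpl in H.
match type of H with ?l <= _ => replace l with (x - x * (x * x) / 6) in H by field end.
nra.
Qed.

Lemma amplitude_ge0 C0 C1 u : amplitude C0 C1 u -> 0 <= C0 /\ 0 <= C1.
Proof.
intros [u1 Hu]. assert (H3 := PI_gt_3).
destruct (Hu (PI / 2)) as [_ [H1 H2]]; [lra|].
rewrite sin_PI2, Rdiv_1_r in H2.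
split; eapply Rle_trans; eauto using Rabs_pos.
Qed.

Lemma amplitude_cont C0 C1 u x : amplitude C0 C1 u -> 0 < x < PI -> continuous u x.
Proof. intros [u1 Hu] Hx. apply (is_derive_cont _ _ (u1 x)). now apply Hu. Qed.

Lemma amplitude_reflect C0 C1 u : amplitude C0 C1 u -> amplitude C0 C1 (fun x => u (PI - x)).
Proof.
intros [u1 Hu]. exists (fun x => - u1 (PI - x)). intros x Hx.
destruct (Hu (PI - x)) as [H1 [H2 H3]]; [lra|].
split; [|split].
- replace (- u1 (PI - x)) with (scal (-1) (u1 (PI - x))) by (unfold scal; simpl; unfold mult; simpl; ring).
  apply (is_derive_comp u (fun x => PI - x)); auto.
  auto_derive; [exact I|ring].
- exact H2.
- rewrite Rabs_Ropp. now rewrite <- sin_PI_x.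
Qed.

Lemma ex_RInt_open (f : R -> R) lo hi a b :
  lo < a -> a <= b -> b < hi ->
  (forall x, lo < x < hi -> continuous f x) -> ex_RInt f a b.
Proof.
intros H1 H2 H3 H. apply (ex_RInt_continuous (V := R_CompleteNormedModule)). intros x.
rewrite Rmin_left, Rmax_right by lra. intros Hx. apply H. lra.
Qed.

Lemma abs_RInt_short (f : R -> R) lo hi a b C :
  lo < a -> a <= b -> b < hi ->
  (forall x, lo < x < hi -> continuous f x) -> (forall x, a <= x <= b -> Rabs (f x) <= C) ->
  Rabs (RInt f a b) <= (b - a) * C.
Proof.
intros H1 H2 H3 H HC. apply abs_RInt_le_const; auto. now apply (ex_RInt_open f lo hi).
Qed.

(** Folds the upper band edge onto the lower one, so that the estimates concern [e, PI / 2] only. *)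
Lemma RInt_reflect (f : R -> R) e :
  0 < e <= PI / 2 -> (forall x, 0 < x < PI -> continuous f x) ->
  RInt f e (PI - e) = RInt f e (PI / 2) + RInt (fun x => f (PI - x)) e (PI / 2).
Proof.
intros He Hf. assert (H3 := PI_gt_3).
rewrite <- (RInt_Chasles f e (PI / 2) (PI - e)); try (apply (ex_RInt_open f 0 PI); auto; lra).
unfold plus; simpl. f_equal.
assert (Hf' : forall x, 0 < x < PI -> continuous (fun x => f (PI - x)) x).
{ intros x Hx. apply (continuous_comp (fun x => PI - x) f).
  - apply (is_derive_cont _ _ (-1)). auto_derive; [exact I|ring].
  - apply Hf. lra. }
assert (H := RInt_comp_lin f (-1) PI e (PI / 2)).
replace (-1 * e + PI) with (PI - e) in H by ring.
replace (-1 * (PI / 2) + PI) with (PI / 2) in H by field.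
rewrite <- (opp_RInt_swap f (PI - e) (PI / 2)).
2:{ apply (ex_RInt_swap (V := R_NormedModule)). apply (ex_RInt_open f 0 PI); auto; lra. }
rewrite <- H.
2:{ apply (ex_RInt_swap (V := R_NormedModule)). apply (ex_RInt_open f 0 PI); auto; lra. }
rewrite <- (RInt_opp (V := R_CompleteNormedModule)).
- apply RInt_ext. intros x Hx. unfold opp, scal; simpl; unfold mult; simpl.
  replace (-1 * x + PI) with (PI - x) by ring. ring.
- apply (ex_RInt_open _ 0 PI); try lra. intros x Hx.
  apply (continuous_scal_r (-1) (fun x => f (-1 * x + PI))).
  apply (continuous_ext (fun x => f (PI - x))). { intros y; f_equal; ring. }
  now apply Hf'.
Qed.

Lemma cont_cosf_mult (f u : R -> R) x : continuous f x -> continuous u x -> continuous (fun x => cos (f x) * u x) x.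
Proof.
intros Hf Hu. apply (continuous_mult (fun x => cos (f x)) u); auto.
apply (continuous_comp f cos); auto. apply continuity_pt_filterlim. apply continuity_cos.
Qed.

Lemma ln_le_2sqrt x : 1 <= x -> ln x <= 2 * sqrt x.
Proof.
intros Hx. assert (0 < sqrt x) by (apply sqrt_lt_R0; lra).
assert (Hl : ln (sqrt x) <= sqrt x).
{ rewrite <- (ln_exp (sqrt x)) at 2. apply Rlt_le, ln_increasing; auto.
  assert (H0 := exp_ineq1 (sqrt x)). lra. }
rewrite <- (sqrt_sqrt x) at 1 by lra. rewrite ln_mult by auto. lra.
Qed.

Definition phase (t M c x : R) : R := t * (2 - 2 * cos x) + M * x + c.

Lemma is_derive_phase t M c x : is_derive (phase t M c) x (2 * t * sin x + M).
Proof. unfold phase. auto_derive; [exact I|ring]. Qed.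

Lemma is_derive_phase' t M x : is_derive (fun x => 2 * t * sin x + M) x (2 * t * cos x).
Proof. auto_derive; [exact I|ring]. Qed.

Lemma ln_ge_der C x : 0 < x -> is_derive (fun x => C * ln x) x (C / x).
Proof. intros Hx. auto_derive; [lra|field; lra]. Qed.

Lemma inv_sin_le C x : 0 <= C -> 0 < x <= PI / 2 -> C / sin x <= (3 * C) / x.
Proof.
intros HC Hx. assert (H := sin_ge_third x).
assert (0 < sin x) by (apply sin_gt_0; lra).
apply Rmult_le_reg_r with (sin x); auto. unfold Rdiv. rewrite Rmult_assoc, Rinv_l by lra.
apply Rmult_le_reg_r with x; [lra|].
replace (3 * C * / x * sin x * x) with (C * (3 * sin x)) by (field; lra). rewrite Rmult_1_r.
apply Rmult_le_compat_l; auto. lra.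
Qed.

Lemma vdc_piece C0 C1 u t M c a b L :
  amplitude C0 C1 u -> 0 < a -> a <= b -> b <= PI / 2 -> 0 < L ->
  (forall x, a <= x <= b -> L <= 2 * t * cos x) ->
  Rabs (RInt (fun x => cos (phase t M c x) * u x) a b) <= (9 * C0 + 3 * C1 * (ln b - ln a)) / sqrt L.
Proof.
intros Hamp Ha Hab Hb HL Hc. assert (H3 := PI_gt_3).
destruct (amplitude_ge0 _ _ _ Hamp) as [HC0 HC1]. destruct Hamp as [u1 Hu].
assert (H : Rabs (RInt (fun x => cos (phase t M c x) * u x) a b) <= (9 * C0 + (3 * C1 * ln b - 3 * C1 * ln a)) / sqrt L).
{ apply (van_der_corput _ (fun x => 2 * t * sin x + M) (fun x => 2 * t * cos x) u u1
    (fun x => 3 * C1 * ln x) (fun x => 3 * C1 / x) 0 PI a b L C0); auto; try lra.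
  - intros x _. apply is_derive_phase.
  - intros x _. apply is_derive_phase'.
  - intros x Hx. now apply Hu.
  - intros x Hx. apply ln_ge_der. lra.
  - intros x Hx. apply Hu. lra.
  - intros x Hx. eapply Rle_trans; [apply Hu; lra|]. apply inv_sin_le; auto. lra. }
replace (3 * C1 * (ln b - ln a)) with (3 * C1 * ln b - 3 * C1 * ln a) by ring. exact H.
Qed.

(** The interval is cut at 1/tau, 1 and PI/2 - 1/tau. The two end pieces have length at most 1/tau.
    On [1/tau, 1] the second derivative 2 t cos x of the phase is at least t, and the logarithm
    produced by the singular amplitude is at most 2 sqrt tau, which t^(-1/2), of order tau^(-3/2),
    can afford. On the third piece cos x >= 1 / (3 tau), so the second derivative is at least of
    order tau^2; here the inflection point PI/2 dictates the power 1/3. *)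
Lemma osc_half C0 C1 u t M c tau e :
  amplitude C0 C1 u -> 2 <= tau -> tau ^ 3 <= 2 * t -> 0 < e <= / tau ->
  Rabs (RInt (fun x => cos (phase t M c x) * u x) e (PI / 2)) <= 40 * (C0 + C1) / tau.
Proof.
intros Hamp Htau Ht He. assert (H3 := PI_gt_3). assert (H4 := PI_4).
destruct (amplitude_ge0 _ _ _ Hamp) as [HC0 HC1].
assert (Hit : 0 < / tau) by (apply Rinv_0_lt_compat; lra).
assert (Hit2 : / tau <= / 2) by (apply Rinv_le_contravar; lra).
assert (Ht0 : 0 < t) by nra.
assert (Hc : forall x, 0 < x < PI -> continuous (fun x => cos (phase t M c x) * u x) x).
{ intros x Hx. apply cont_cosf_mult. eapply is_derive_cont, is_derive_phase. eapply amplitude_cont; eauto. }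
assert (Hb : forall x, 0 < x < PI -> Rabs (cos (phase t M c x) * u x) <= C0).
{ intros x Hx. rewrite Rabs_mult. assert (Rabs (cos (phase t M c x)) <= 1) by (apply Rabs_le; apply COS_bound).
  destruct Hamp as [u1 Hu]. assert (Rabs (u x) <= C0) by (apply Hu; auto).
  rewrite <- (Rmult_1_l C0). apply Rmult_le_compat; auto using Rabs_pos. }
set (f := fun x => cos (phase t M c x) * u x) in *.
rewrite <- (RInt_Chasles f e (/ tau) (PI / 2)); try (apply (ex_RInt_open f 0 PI); auto; lra).
rewrite <- (RInt_Chasles f (/ tau) 1 (PI / 2)); try (apply (ex_RInt_open f 0 PI); auto; lra).
rewrite <- (RInt_Chasles f 1 (PI / 2 - / tau) (PI / 2)); try (apply (ex_RInt_open f 0 PI); auto; lra).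
unfold plus; simpl.
assert (P1 : Rabs (RInt f e (/ tau)) <= C0 * / tau).
{ eapply Rle_trans; [apply (abs_RInt_short f 0 PI _ _ C0); auto; try lra|].
  - intros x Hx. apply Hb. lra.
  - rewrite Rmult_comm. apply Rmult_le_compat_l; lra. }
assert (P4 : Rabs (RInt f (PI / 2 - / tau) (PI / 2)) <= C0 * / tau).
{ eapply Rle_trans; [apply (abs_RInt_short f 0 PI _ _ C0); auto; try lra|].
  - intros x Hx. apply Hb. lra.
  - lra. }
assert (P2 : Rabs (RInt f (/ tau) 1) <= 2 * (9 * C0 + 6 * C1) * / tau).
{ eapply Rle_trans; [apply (vdc_piece C0 C1 u t M c (/ tau) 1 t); auto; try lra|].
  - intros x Hx. assert (/ 2 <= cos x); [|nra].
    replace (/ 2) with (cos (PI / 3)) by (rewrite cos_PI3; field). apply cos_decr_1; lra.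
  - rewrite ln_1, ln_Rinv by lra.
    assert (Hl : ln tau <= 2 * sqrt tau) by (apply ln_le_2sqrt; lra).
    set (s := sqrt tau) in *. assert (Hs : s * s = tau) by (apply sqrt_sqrt; lra).
    assert (Hs0 : 0 < s) by (apply sqrt_lt_R0; lra).
    assert (Hs1 : 1 <= s) by nra.
    assert (Hq : s ^ 3 / 2 <= sqrt t).
    { rewrite <- (sqrt_pow2 (s ^ 3 / 2)).
      - apply sqrt_le_1_alt.
        replace ((s ^ 3 / 2) ^ 2) with ((s * s) ^ 3 / 4) by field. rewrite Hs.
        assert (0 < tau ^ 3) by (apply pow_lt; lra). lra.
      - assert (0 < s ^ 3) by (apply pow_lt; lra). lra. }
    assert (Hs3 : 0 < s ^ 3) by (apply pow_lt; lra).
    apply Rle_trans with ((9 * C0 + 6 * C1 * s) / (s ^ 3 / 2)).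
    + unfold Rdiv at 1 3. apply Rmult_le_compat.
      * assert (0 <= ln tau) by (rewrite <- ln_1; apply ln_le; lra). nra.
      * apply Rlt_le, Rinv_0_lt_compat. lra.
      * nra.
      * apply Rinv_le_contravar; lra.
    + rewrite <- Hs. apply Rle_div_l; [lra|].
      replace (2 * (9 * C0 + 6 * C1) * / (s * s) * (s ^ 3 / 2)) with ((9 * C0 + 6 * C1) * s) by (field; lra).
      nra. }
assert (P3 : Rabs (RInt f 1 (PI / 2 - / tau)) <= 2 * (9 * C0 + 3 * C1) * / tau).
(* The constant tau^2 / 4, below the available tau^2 / 3, has the exact square root tau / 2. *)
{ eapply Rle_trans; [apply (vdc_piece C0 C1 u t M c 1 (PI / 2 - / tau) (tau ^ 2 / 4)); auto; try lra|].
  - nra.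
  - intros x Hx. assert (Hcx : / tau / 3 <= cos x).
    { apply Rle_trans with (sin (/ tau)). apply sin_ge_third; lra.
      rewrite <- cos_shift. apply cos_decr_1; lra. }
    apply Rle_trans with (2 * t * (/ tau / 3)); [|nra].
    apply Rmult_le_reg_r with tau; [lra|].
    replace (2 * t * (/ tau / 3) * tau) with (2 / 3 * t) by (field; lra).
    assert (0 < tau ^ 3) by (apply pow_lt; lra). simpl in *; nra.
  - rewrite ln_1. replace (tau ^ 2 / 4) with ((tau / 2) ^ 2) by field.
    rewrite sqrt_pow2 by lra.
    assert (Hl : ln (PI / 2 - / tau) <= 1).
    { rewrite <- (ln_exp 1). apply ln_le; [lra|]. assert (H0 := exp_ineq1 1). lra. }
    apply Rle_div_l; [lra|].
    replace (2 * (9 * C0 + 3 * C1) * / tau * (tau / 2)) with (9 * C0 + 3 * C1) by (field; lra).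
    nra. }
assert (Hf : C0 * / tau + 2 * (9 * C0 + 6 * C1) * / tau + 2 * (9 * C0 + 3 * C1) * / tau + C0 * / tau <= 40 * (C0 + C1) / tau).
{ unfold Rdiv. nra. }
eapply Rle_trans; [apply Rabs_triang|].
eapply Rle_trans; [apply Rplus_le_compat_l, Rabs_triang|].
eapply Rle_trans; [apply Rplus_le_compat_l, Rplus_le_compat_l, Rabs_triang|].
lra.
Qed.

Lemma osc_full C0 C1 u t M c tau e :
  amplitude C0 C1 u -> 2 <= tau -> tau ^ 3 <= 2 * Rabs t -> 0 < e <= / tau ->
  Rabs (RInt (fun x => cos (phase t M c x) * u x) e (PI - e)) <= 80 * (C0 + C1) / tau.
Proof.
intros Hamp Htau Ht He. assert (H3 := PI_gt_3).
assert (Hit2 : / tau <= / 2) by (apply Rinv_le_contravar; lra).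
rewrite RInt_reflect; [|lra|].
2:{ intros x Hx. apply cont_cosf_mult. eapply is_derive_cont, is_derive_phase. eapply amplitude_cont; eauto. }
assert (K : forall t' M' c' u', amplitude C0 C1 u' -> tau ^ 3 <= 2 * Rabs t' ->
  Rabs (RInt (fun x => cos (phase t' M' c' x) * u' x) e (PI / 2)) <= 40 * (C0 + C1) / tau).
{ intros t' M' c' u' Ha' Ht'. destruct (Rle_dec 0 t').
  - apply osc_half; auto. rewrite Rabs_right in Ht' by lra. auto.
  - rewrite (RInt_ext _ (fun x => cos (phase (- t') (- M') (- c') x) * u' x)).
    + apply osc_half; auto. rewrite Rabs_left in Ht' by lra. auto.
    + intros x _. rewrite <- cos_neg. do 2 f_equal. unfold phase; ring. }
eapply Rle_trans; [apply Rabs_triang|].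
replace (80 * (C0 + C1) / tau) with (40 * (C0 + C1) / tau + 40 * (C0 + C1) / tau) by (field; lra).
apply Rplus_le_compat; [now apply K|].
(* The reflection maps 2 - 2 cos x to 4 minus itself, so t and M change sign while 4 t + M PI moves
   into the constant. *)
rewrite (RInt_ext _ (fun x => cos (phase (- t) (- M) (4 * t + M * PI + c) x) * u (PI - x))).
- apply (K (- t) (- M) (4 * t + M * PI + c) (fun x => u (PI - x))). now apply amplitude_reflect. now rewrite Rabs_Ropp.
- intros x _. do 2 f_equal. unfold phase. rewrite Rtrigo_facts.cos_pi_minus. ring.
Qed.

(** One integration by parts gains 1 / M and loses ln M, which is at most 4 M^(1/4). The resulting
    M^(-3/4) suffices because its square is summable over the integers. *)
Lemma dec_half C0 C1 u M c e :
  amplitude C0 C1 u -> 1 <= M -> 0 < e <= / M ->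
  Rabs (RInt (fun x => cos (M * x + c) * u x) e (PI / 2)) <= 20 * (C0 + C1) * sqrt (sqrt M) / M.
Proof.
intros Hamp HM He. assert (H3 := PI_gt_3). assert (H4 := PI_4).
destruct (amplitude_ge0 _ _ _ Hamp) as [HC0 HC1].
assert (Hi : 0 < / M) by (apply Rinv_0_lt_compat; lra).
assert (Hi1 : / M <= 1) by (rewrite <- Rinv_1; apply Rinv_le_contravar; lra).
assert (Hd : forall x, is_derive (fun x => M * x + c) x M) by (intros x; auto_derive; auto; ring).
assert (Hc : forall x, 0 < x < PI -> continuous (fun x => cos (M * x + c) * u x) x).
{ intros x Hx. apply cont_cosf_mult. eapply is_derive_cont, Hd. eapply amplitude_cont; eauto. }
destruct Hamp as [u1 Hu].
assert (Hb : forall x, 0 < x < PI -> Rabs (cos (M * x + c) * u x) <= C0).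
{ intros x Hx. rewrite Rabs_mult. assert (Rabs (cos (M * x + c)) <= 1) by (apply Rabs_le; apply COS_bound).
  assert (Rabs (u x) <= C0) by (apply Hu; auto).
  rewrite <- (Rmult_1_l C0). apply Rmult_le_compat; auto using Rabs_pos. }
set (f := fun x => cos (M * x + c) * u x) in *.
rewrite <- (RInt_Chasles f e (/ M) (PI / 2)); try (apply (ex_RInt_open f 0 PI); auto; lra).
unfold plus; simpl.
assert (P1 : Rabs (RInt f e (/ M)) <= C0 * / M).
{ eapply Rle_trans; [apply (abs_RInt_short f 0 PI _ _ C0); auto; try lra|].
  - intros x Hx. apply Hb. lra.
  - rewrite Rmult_comm. apply Rmult_le_compat_l; lra. }
set (S := fun x => sin (M * x + c) * u x / M).
assert (HS : forall x, 0 < x < PI -> Rabs (S x) <= C0 * / M).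
{ intros x Hx. unfold S, Rdiv. rewrite !Rabs_mult.
  assert (Rabs (sin (M * x + c)) <= 1) by (apply Rabs_le; apply SIN_bound).
  assert (Rabs (u x) <= C0) by (apply Hu; auto).
  rewrite (Rabs_right (/ M)) by lra. apply Rmult_le_compat_r; [lra|].
  rewrite <- (Rmult_1_l C0). apply Rmult_le_compat; auto using Rabs_pos. }
assert (P2 : Rabs ((RInt f (/ M) (PI / 2) - S (PI / 2)) - (RInt f (/ M) (/ M) - S (/ M))) <= 3 * C1 / M * ln (PI / 2) - 3 * C1 / M * ln (/ M)).
{ apply (derive_compare (fun x => RInt f (/ M) x - S x) (fun x => f x - (f x + sin (M * x + c) * u1 x / M))
    (fun x => 3 * C1 / M * ln x) (fun x => (3 * C1 / M) / x)); try lra.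
  - intros x Hx. apply (is_derive_minus (fun x => RInt f (/ M) x) S).
    + apply (is_derive_RInt_open f 0 PI); auto; lra.
    + assert (Hx' : 0 < x < PI) by lra. destruct (Hu x Hx') as [Hux _].
      unfold S. assert (ex_derive u x) by (now exists (u1 x)).
      auto_derive; [assumption|]. subst_derive u x (u1 x) Hux. unfold f. field. lra.
  - intros x Hx. apply ln_ge_der. lra.
  - intros x Hx. replace (f x - (f x + sin (M * x + c) * u1 x / M)) with (- (sin (M * x + c) * u1 x * / M)) by (unfold Rdiv; ring).
    rewrite Rabs_Ropp, !Rabs_mult, (Rabs_right (/ M)) by lra.
    assert (Rabs (sin (M * x + c)) <= 1) by (apply Rabs_le; apply SIN_bound).
    assert (Rabs (u1 x) <= 3 * C1 / x).
    { eapply Rle_trans; [apply Hu; lra|]. apply inv_sin_le; auto; lra. }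
    replace (3 * C1 / M / x) with (1 * (3 * C1 / x) * / M) by (field; lra).
    apply Rmult_le_compat_r; [lra|]. apply Rmult_le_compat; auto using Rabs_pos. }
rewrite RInt_point in P2. unfold zero in P2; simpl in P2.
assert (HSa := HS (PI / 2)). assert (HSb := HS (/ M)).
assert (Hln : ln (PI / 2) - ln (/ M) <= 5 * sqrt (sqrt M)).
{ rewrite ln_Rinv by lra.
  assert (Hl2 : ln (PI / 2) <= 1).
  { rewrite <- (ln_exp 1). apply ln_le; [lra|]. assert (H0 := exp_ineq1 1). lra. }
  assert (Hs1 : 1 <= sqrt M) by (rewrite <- sqrt_1; apply sqrt_le_1; lra).
  assert (Hs2 : 1 <= sqrt (sqrt M)) by (rewrite <- sqrt_1; apply sqrt_le_1; lra).
  assert (Hl := ln_le_2sqrt (sqrt M) Hs1).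
  assert (ln M = 2 * ln (sqrt M)) by (rewrite <- (sqrt_sqrt M) at 1 by lra; rewrite ln_mult by lra; ring).
  lra. }
assert (Hs1 : 1 <= sqrt M) by (rewrite <- sqrt_1; apply sqrt_le_1; lra).
assert (Hs2 : 1 <= sqrt (sqrt M)) by (rewrite <- sqrt_1; apply sqrt_le_1; lra).
set (s := sqrt (sqrt M)) in *.
assert (P3 : Rabs (RInt f (/ M) (PI / 2)) <= C0 * / M + C0 * / M + 3 * C1 / M * (5 * s)).
{ replace (RInt f (/ M) (PI / 2)) with (S (PI / 2) + (- S (/ M) + (RInt f (/ M) (PI / 2) - S (PI / 2) - (0 - S (/ M))))) by ring.
  eapply Rle_trans; [apply Rabs_triang|].
  eapply Rle_trans; [apply Rplus_le_compat_l, Rabs_triang|]. rewrite Rabs_Ropp.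
  assert (3 * C1 / M * (ln (PI / 2) - ln (/ M)) <= 3 * C1 / M * (5 * s)).
  { apply Rmult_le_compat_l; auto. unfold Rdiv. nra. }
  assert (Rabs (S (PI / 2)) <= C0 * / M) by (apply HS; lra).
  assert (Rabs (S (/ M)) <= C0 * / M) by (apply HS; lra). lra. }
eapply Rle_trans; [apply Rabs_triang|].
assert (C0 * / M * 1 <= C0 * / M * s) by (apply Rmult_le_compat_l; nra).
assert (0 <= C1 * / M * s) by (apply Rmult_le_pos; nra).
assert (0 <= C0 * / M * s) by (apply Rmult_le_pos; nra).
replace (20 * (C0 + C1) * s / M) with (20 * (C0 * / M * s) + 20 * (C1 * / M * s)) by (unfold Rdiv; ring).
unfold Rdiv in P3. nra.
Qed.

Lemma dec_full C0 C1 u M c e :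
  amplitude C0 C1 u -> 1 <= Rabs M -> 0 < e <= / Rabs M ->
  Rabs (RInt (fun x => cos (M * x + c) * u x) e (PI - e)) <= 40 * (C0 + C1) * sqrt (sqrt (Rabs M)) / Rabs M.
Proof.
intros Hamp HM He. assert (H3 := PI_gt_3).
assert (Hi1 : / Rabs M <= 1) by (rewrite <- Rinv_1; apply Rinv_le_contravar; lra).
rewrite RInt_reflect; [|lra|].
2:{ intros x Hx. apply cont_cosf_mult. apply (is_derive_cont _ _ M). auto_derive; [exact I|ring]. eapply amplitude_cont; eauto. }
assert (K : forall M' c' u', amplitude C0 C1 u' -> Rabs M' = Rabs M ->
  Rabs (RInt (fun x => cos (M' * x + c') * u' x) e (PI / 2)) <= 20 * (C0 + C1) * sqrt (sqrt (Rabs M)) / Rabs M).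
{ intros M' c' u' Ha' HM'. destruct (Rle_dec 0 M').
  - assert (E : M' = Rabs M) by (rewrite <- HM', Rabs_right; lra). rewrite E. now apply dec_half.
  - assert (E : M' = - Rabs M) by (rewrite <- HM', Rabs_left; lra).
    rewrite (RInt_ext _ (fun x => cos (Rabs M * x + - c') * u' x)).
    + now apply dec_half.
    + intros x _. rewrite <- cos_neg. do 2 f_equal. rewrite E. ring. }
eapply Rle_trans; [apply Rabs_triang|].
replace (40 * (C0 + C1) * sqrt (sqrt (Rabs M)) / Rabs M) with (20 * (C0 + C1) * sqrt (sqrt (Rabs M)) / Rabs M + 20 * (C0 + C1) * sqrt (sqrt (Rabs M)) / Rabs M) by (field; lra).
apply Rplus_le_compat; [now apply K|].
rewrite (RInt_ext _ (fun x => cos (- M * x + (M * PI + c)) * u (PI - x))).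
- apply (K (- M) (M * PI + c) (fun x => u (PI - x))). now apply amplitude_reflect. now rewrite Rabs_Ropp.
- intros x _. do 2 f_equal. ring.
Qed.

(** * Discrete Gronwall inequalities *)

Fixpoint psum (a : nat -> R) (n : nat) : R :=
  match n with O => 0 | S n => psum a n + a n end.

Lemma psum_ext a b n : (forall i, (i < n)%nat -> a i = b i) -> psum a n = psum b n.
Proof.
induction n as [|n IH]; intros H; simpl; auto. rewrite IH, H; auto.
Qed.

Lemma psum_le a b n : (forall i, (i < n)%nat -> a i <= b i) -> psum a n <= psum b n.
Proof.
induction n as [|n IH]; intros H; simpl; [lra|]. apply Rplus_le_compat; auto.
Qed.

Lemma psum_ge0 a n : (forall i, (i < n)%nat -> 0 <= a i) -> 0 <= psum a n.
Proof.
induction n as [|n IH]; intros H; simpl; [lra|]. apply Rplus_le_le_0_compat; auto.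
Qed.

Lemma psum_mono a m n : (forall i, 0 <= a i) -> (m <= n)%nat -> psum a m <= psum a n.
Proof.
intros H Hmn. induction Hmn as [|n Hmn IH]; [lra|]. simpl. specialize (H n). lra.
Qed.

(* x dominates the distance of a Jost solution from its limit and y its increments;
   the weighted combination x + W y is what grows only by a summable factor. *)
Lemma gronwall_pair (x y k : nat -> R) (F W : R) (n : nat) :
  0 <= F -> INR n <= W ->
  (forall i, 0 <= x i) -> (forall i, 0 <= y i) -> (forall i, 0 <= k i) ->
  (forall i, (i < n)%nat -> x (S i) <= x i + y (S i)) ->
  (forall i, (i < n)%nat -> y (S i) <= y i + k i * (x i + F)) ->
  forall i, (i <= n)%nat ->
  x i + (W - INR i) * y i + F <= (x O + W * y O + F) * exp (psum (fun j => (W - INR j) * k j) i).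
Proof.
intros HF HW Hx0 Hy0 Hk0 Hx Hy. induction i as [|i IH]; intros Hi.
- simpl. rewrite exp_0. lra.
- specialize (IH ltac:(lia)). specialize (Hx i ltac:(lia)). specialize (Hy i ltac:(lia)).
  assert (HWi : 0 <= W - INR i - 1).
  { assert (INR (S i) <= INR n) by (apply le_INR; lia). rewrite S_INR in *. lra. }
  rewrite S_INR. simpl psum. rewrite exp_plus, <- Rmult_assoc.
  set (A := x O + W * y O + F) in *. set (e := exp (psum _ i)) in *.
  set (w := W - INR i) in *.
  assert (Hexp := exp_ineq1_le (w * k i)).
  assert (Hphi : 0 <= x i + w * y i + F) by (specialize (Hx0 i); specialize (Hy0 i); nra).
  assert (Hstep : x (S i) + (w - 1) * y (S i) + F <= (x i + w * y i + F) * (1 + w * k i)).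
  { apply Rle_trans with (x i + w * y (S i) + F); [nra|].
    apply Rle_trans with (x i + w * (y i + k i * (x i + F)) + F); [nra|].
    assert (0 <= w * k i * (w * y i)).
    { specialize (Hk0 i). specialize (Hy0 i). apply Rmult_le_pos; apply Rmult_le_pos; lra. }
    nra. }
  replace (W - (INR i + 1)) with (w - 1) by (unfold w; ring).
  eapply Rle_trans; [exact Hstep|].
  apply Rmult_le_compat; auto.
  assert (0 <= w * k i) by (apply Rmult_le_pos; [lra|auto]). lra.
Qed.

(** Here x bounds the derivative of a Jost solution, y the derivative of its increments and z the
    increments themselves, while F bounds the solution. With w = W - i the combination x + w y + (w
    + 1)^2 z + 2 F grows at most by the factor 1 + (w + 1)^2 k. The weight of z is forced by w^2 + 2
    w <= (w + 1)^2, the term 2 w coming from the coupling 2 z. This is how the second moment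
    enters. *)
Lemma gronwall_triple (x y z k : nat -> R) (F W : R) (n : nat) :
  0 <= F -> INR n <= W ->
  (forall i, 0 <= x i) -> (forall i, 0 <= y i) -> (forall i, 0 <= z i) -> (forall i, 0 <= k i) ->
  (forall i, (i < n)%nat -> x (S i) <= x i + y (S i)) ->
  (forall i, (i < n)%nat -> y (S i) <= y i + 2 * z i + k i * (x i + F)) ->
  (forall i, (i < n)%nat -> z (S i) <= z i + k i * F) ->
  x O = 0 -> y O = 0 -> z O = 0 ->
  forall i, (i <= n)%nat ->
  x i <= 2 * F * exp (psum (fun j => (W - INR j + 1) ^ 2 * k j) i).
Proof.
intros HF HW Hx0 Hy0 Hz0 Hk0 Hx Hy Hz X0 Y0 Z0.
assert (H : forall i, (i <= n)%nat -> x i + (W - INR i) * y i + (W - INR i + 1) ^ 2 * z i + 2 * F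
  <= 2 * F * exp (psum (fun j => (W - INR j + 1) ^ 2 * k j) i)).
{ induction i as [|i IH]; intros Hi.
  - simpl. rewrite exp_0, X0, Y0, Z0. lra.
  - specialize (IH ltac:(lia)). specialize (Hx i ltac:(lia)). specialize (Hy i ltac:(lia)). specialize (Hz i ltac:(lia)).
    assert (HWi : 0 <= W - INR i - 1).
    { assert (INR (S i) <= INR n) by (apply le_INR; lia). rewrite S_INR in *. lra. }
    rewrite S_INR. simpl psum. rewrite exp_plus, <- Rmult_assoc.
    set (e := exp (psum _ i)) in *.
    set (w := W - INR i) in *.
    assert (Hexp := exp_ineq1_le ((w + 1) ^ 2 * k i)).
    specialize (Hx0 i). specialize (Hy0 i). specialize (Hz0 i). specialize (Hk0 i).
    assert (Hw2 : 0 <= (w + 1) ^ 2) by apply pow2_ge_0.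
    assert (Hphi : 0 <= x i + w * y i + (w + 1) ^ 2 * z i + 2 * F).
    { assert (0 <= w * y i) by (apply Rmult_le_pos; lra).
      assert (0 <= (w + 1) ^ 2 * z i) by (apply Rmult_le_pos; lra). lra. }
    replace (W - (INR i + 1)) with (w - 1) by (unfold w; ring).
    replace (w - 1 + 1) with w by ring.
    assert (Hstep : x (S i) + (w - 1) * y (S i) + w ^ 2 * z (S i) + 2 * F
       <= (x i + w * y i + (w + 1) ^ 2 * z i + 2 * F) * (1 + (w + 1) ^ 2 * k i)).
    { apply Rle_trans with (x i + w * y (S i) + w ^ 2 * z (S i) + 2 * F); [lra|].
      assert (w * y (S i) <= w * (y i + 2 * z i + k i * (x i + F))) by (apply Rmult_le_compat_l; lra).
      assert (w ^ 2 * z (S i) <= w ^ 2 * (z i + k i * F)) by (apply Rmult_le_compat_l; [apply pow2_ge_0|lra]).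
      assert (0 <= k i * x i) by (apply Rmult_le_pos; lra).
      assert (0 <= k i * F) by (apply Rmult_le_pos; lra).
      assert (0 <= w * y i) by (apply Rmult_le_pos; lra).
      assert (0 <= (w + 1) ^ 2 * z i) by (apply Rmult_le_pos; lra).
      assert (0 <= (w + 1) ^ 2 * k i) by (apply Rmult_le_pos; lra).
      assert (0 <= (w + 1) ^ 2 * k i * (w * y i)) by (apply Rmult_le_pos; lra).
      assert (0 <= (w + 1) ^ 2 * k i * ((w + 1) ^ 2 * z i)) by (apply Rmult_le_pos; lra).
      assert (w * (k i * x i) <= (w + 1) ^ 2 * (k i * x i)) by (apply Rmult_le_compat_r; nra).
      assert (w * (k i * F) <= (w + 1) ^ 2 * (k i * F)) by (apply Rmult_le_compat_r; nra).
      assert (w ^ 2 * (k i * F) <= (w + 1) ^ 2 * (k i * F)) by (apply Rmult_le_compat_r; nra).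
      nra. }
    eapply Rle_trans; [exact Hstep|].
    apply Rmult_le_compat; auto.
    assert (0 <= (w + 1) ^ 2 * k i) by (apply Rmult_le_pos; lra). lra. }
intros i Hi. specialize (H i Hi).
assert (HWi : 0 <= W - INR i) by (assert (INR i <= INR n) by (apply le_INR; lia); lra).
specialize (Hy0 i). specialize (Hz0 i).
assert (0 <= (W - INR i) * y i) by (apply Rmult_le_pos; lra).
assert (0 <= (W - INR i + 1) ^ 2 * z i) by (apply Rmult_le_pos; [apply pow2_ge_0|lra]). lra.
Qed.

(** * Derivatives of complex-valued functions of a real variable *)

Definition CDer (f : R -> C) (t : R) (l : C) : Prop :=
  is_derive (fun x => Re (f x)) t (Re l) /\ is_derive (fun x => Im (f x)) t (Im l).

Lemma CDer_const c t : CDer (fun _ => c) t 0.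
Proof. split; apply (is_derive_const (V := R_NormedModule)). Qed.

Lemma CDer_eq f t l l' : l = l' -> CDer f t l -> CDer f t l'.
Proof. now intros ->. Qed.

Lemma CDer_ext f g t l : (forall x, f x = g x) -> CDer f t l -> CDer g t l.
Proof.
intros E [H1 H2]. split; eapply is_derive_ext; try eassumption; intros x; simpl; now rewrite E.
Qed.

Lemma CDer_plus f g t a b : CDer f t a -> CDer g t b -> CDer (fun x => (f x + g x)%C) t (a + b)%C.
Proof.
intros [H1 H2] [H3 H4]. split; simpl.
- now apply (is_derive_plus (fun x => Re (f x)) (fun x => Re (g x))).
- now apply (is_derive_plus (fun x => Im (f x)) (fun x => Im (g x))).
Qed.

Lemma CDer_opp f t a : CDer f t a -> CDer (fun x => (- f x)%C) t (- a)%C.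
Proof.
intros [H1 H2]. split; simpl.
- now apply (is_derive_opp (fun x => Re (f x))).
- now apply (is_derive_opp (fun x => Im (f x))).
Qed.

Lemma CDer_minus f g t a b : CDer f t a -> CDer g t b -> CDer (fun x => (f x - g x)%C) t (a - b)%C.
Proof. intros H1 H2. apply CDer_plus; auto. now apply CDer_opp. Qed.

Lemma CDer_conj f t a : CDer f t a -> CDer (fun x => Cconj (f x)) t (Cconj a).
Proof.
intros [H1 H2]. split; simpl; auto. now apply (is_derive_opp (fun x => Im (f x))).
Qed.

Lemma is_derive_mult_R (f g : R -> R) t a b :
  is_derive f t a -> is_derive g t b -> is_derive (fun x => f x * g x) t (a * g t + f t * b).
Proof. intros H1 H2. apply (is_derive_mult f g); auto. intros; apply Rmult_comm. Qed.

Lemma CDer_mult f g t a b :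
  CDer f t a -> CDer g t b -> CDer (fun x => (f x * g x)%C) t (a * g t + f t * b)%C.
Proof.
intros [H1 H2] [H3 H4]. split; simpl.
- replace (fst a * fst (g t) - snd a * snd (g t) + (fst (f t) * fst b - snd (f t) * snd b))
   with ((fst a * fst (g t) + fst (f t) * fst b) - (snd a * snd (g t) + snd (f t) * snd b)) by ring.
  apply (is_derive_minus (fun x => fst (f x) * fst (g x)) (fun x => snd (f x) * snd (g x)));
  now apply is_derive_mult_R.
- replace (fst a * snd (g t) + snd a * fst (g t) + (fst (f t) * snd b + snd (f t) * fst b))
   with ((fst a * snd (g t) + fst (f t) * snd b) + (snd a * fst (g t) + snd (f t) * fst b)) by ring.
  apply (is_derive_plus (fun x => fst (f x) * snd (g x)) (fun x => snd (f x) * fst (g x)));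
  now apply is_derive_mult_R.
Qed.

Lemma CDer_inv f t a : CDer f t a -> f t <> 0%C -> CDer (fun x => (/ f x)%C) t (- a / (f t * f t))%C.
Proof.
intros [H1 H2] H0.
assert (Hn : fst (f t) ^ 2 + snd (f t) ^ 2 <> 0).
{ intros E. apply H0. assert (fst (f t) = 0 /\ snd (f t) = 0) as [E1 E2] by nra.
  destruct (f t); simpl in *; subst; reflexivity. }
set (p := fun x => Re (f x)) in *. set (q := fun x => Im (f x)) in *.
assert (ex_derive p t) by (now exists (Re a)). assert (ex_derive q t) by (now exists (Im a)).
assert (E : (- a / (f t * f t))%C = ((Re a * (q t ^ 2 - p t ^ 2) - 2 * p t * q t * Im a) / (p t ^ 2 + q t ^ 2) ^ 2,
  (- Im a * (p t ^ 2 - q t ^ 2) + 2 * p t * q t * Re a) / (p t ^ 2 + q t ^ 2) ^ 2)).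
{ unfold p, q, Re, Im. destruct (f t) as [u w]; destruct a as [x y]; simpl in *.
  unfold Cdiv, Cinv, Cmult, Copp; simpl.
  assert ((u * u - w * w) * (u * u - w * w) + (u * w + w * u) * (u * w + w * u) <> 0).
  { replace ((u * u - w * w) * (u * u - w * w) + (u * w + w * u) * (u * w + w * u)) with ((u * (u * 1) + w * (w * 1)) ^ 2) by ring.
    now apply pow_nonzero. }
  f_equal; field; repeat split; auto; simpl; rewrite ?Rmult_1_r in *; auto. }
rewrite E. split; simpl.
- change (is_derive (fun x => p x / (p x ^ 2 + q x ^ 2)) t ((Re a * (q t ^ 2 - p t ^ 2) - 2 * p t * q t * Im a) / (p t ^ 2 + q t ^ 2) ^ 2)).
  auto_derive; [repeat split; auto|]. subst_derive p t (Re a) H1. subst_derive q t (Im a) H2. field. exact Hn.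
- change (is_derive (fun x => - q x / (p x ^ 2 + q x ^ 2)) t ((- Im a * (p t ^ 2 - q t ^ 2) + 2 * p t * q t * Re a) / (p t ^ 2 + q t ^ 2) ^ 2)).
  auto_derive; [repeat split; auto|]. subst_derive p t (Re a) H1. subst_derive q t (Im a) H2. field. exact Hn.
Qed.

Definition expi (t : R) : C := (cos t, sin t).

Lemma CDer_expi t : CDer expi t (Ci * expi t)%C.
Proof.
split; simpl.
- replace (0 * cos t - 1 * sin t) with (- sin t) by ring. apply is_derive_cos || (auto_derive; [exact I|ring]).
- replace (0 * sin t + 1 * cos t) with (cos t) by ring. apply is_derive_sin || (auto_derive; [exact I|ring]).
Qed.

Lemma Cmod_expi t : Cmod (expi t) = 1.
Proof.
unfold Cmod, expi; simpl. replace (cos t * (cos t * 1) + sin t * (sin t * 1)) with 1; [apply sqrt_1|].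
assert (H := sin2_cos2 t). unfold Rsqr in H. lra.
Qed.

Lemma expi_plus a b : expi (a + b) = (expi a * expi b)%C.
Proof. unfold expi, Cmult; simpl. rewrite cos_plus, sin_plus. f_equal; ring. Qed.

Lemma expi_0 : expi 0 = 1%C.
Proof. unfold expi. rewrite cos_0, sin_0. reflexivity. Qed.

Lemma expi_conj t : Cconj (expi t) = expi (- t).
Proof. unfold expi, Cconj; simpl. now rewrite cos_neg, sin_neg. Qed.

Lemma expi_conj_mult t : (expi t * Cconj (expi t))%C = 1%C.
Proof. rewrite expi_conj, <- expi_plus, Rplus_opp_r. apply expi_0. Qed.

Lemma expi_pow t n : (expi t ^ n)%C = expi (INR n * t).
Proof.
induction n as [|n IH].
- simpl. rewrite Rmult_0_l, expi_0. reflexivity.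
- rewrite S_INR. replace ((INR n + 1) * t) with (t + INR n * t) by ring. rewrite expi_plus, <- IH. reflexivity.
Qed.

(** * The Jost recursion *)

(* With n = N - i: first component m(n), second component m(n) - m(n+1). *)
Fixpoint jost (z : C) (v : nat -> R) (i : nat) : C * C :=
  match i with
  | O => (RtoC 1, RtoC 0)
  | S i => let b := fst (jost z v i) in
           let d := (z * z * snd (jost z v i) + z * v i * b)%C in
           (b + d, d)%C
  end.

Lemma jost_ext z v v' n : (forall i, (i < n)%nat -> v i = v' i) -> jost z v n = jost z v' n.
Proof.
induction n as [|n IH]; intros H; simpl; auto.
now rewrite IH, H by auto.
Qed.

Lemma jost_conj z v n : jost (Cconj z) v n = (Cconj (fst (jost z v n)), Cconj (snd (jost z v n))).
Proof.
assert (Hr : forall r : R, Cconj r = r) by (intros r; unfold Cconj, RtoC; simpl; f_equal; ring).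
induction n as [|n IH].
- simpl. f_equal; symmetry; apply Hr.
- cbn [jost fst snd]. rewrite IH. cbn [fst snd]. rewrite !Cplus_conj, !Cmult_conj, Hr. reflexivity.
Qed.

Section JostBounds.
Variables (z : C) (v : nat -> R) (W : R) (n : nat).
Hypothesis Hz : Cmod z <= 1.
Hypothesis HW : INR n <= W.

Lemma Cmod_mult_le a : Cmod (z * a)%C <= Cmod a.
Proof.
rewrite Cmod_mult. rewrite <- (Rmult_1_l (Cmod a)) at 2.
apply Rmult_le_compat_r; auto using Cmod_ge_0.
Qed.

Lemma jost_step_d i :
  Cmod (snd (jost z v (S i))) <= Cmod (snd (jost z v i)) + Rabs (v i) * Cmod (fst (jost z v i)).
Proof.
cbn [jost snd fst]. eapply Rle_trans; [apply Cmod_triangle|]. apply Rplus_le_compat.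
- rewrite <- Cmult_assoc. eapply Rle_trans; [apply Cmod_mult_le|]. apply Cmod_mult_le.
- rewrite <- Cmult_assoc. eapply Rle_trans; [apply Cmod_mult_le|]. rewrite Cmod_mult, Cmod_R. lra.
Qed.

(** [gronwall_pair] with source F = 1, since |m| <= |m - 1| + 1. At the start m = 1 and the
    increment is 0, so the right-hand side is exactly the exponential minus 1. *)
Lemma jost_minus_1 i : (i <= n)%nat ->
  Cmod (fst (jost z v i) - 1)%C <= exp (psum (fun j => (W - INR j) * Rabs (v j)) i) - 1.
Proof.
intros Hi.
assert (H := gronwall_pair (fun i => Cmod (fst (jost z v i) - 1)%C) (fun i => Cmod (snd (jost z v i)))
  (fun i => Rabs (v i)) 1 W n).
assert (H' := H ltac:(lra) HW ltac:(intros; apply Cmod_ge_0) ltac:(intros; apply Cmod_ge_0) ltac:(intros; apply Rabs_pos)). clear H.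
cbv beta in H'.
assert (H1 : forall i, Cmod (fst (jost z v i)) <= Cmod (fst (jost z v i) - 1)%C + 1).
{ intros j. replace (fst (jost z v j)) with ((fst (jost z v j) - 1) + 1)%C at 1 by ring.
  eapply Rle_trans; [apply Cmod_triangle|]. rewrite Cmod_1. lra. }
assert (Hin : 0 <= (W - INR i) * Cmod (snd (jost z v i))).
{ apply Rmult_le_pos; [|apply Cmod_ge_0]. assert (INR i <= INR n) by (apply le_INR; lia). lra. }
assert (HA : forall j, (j < n)%nat -> Cmod (fst (jost z v (S j)) - 1)%C <= Cmod (fst (jost z v j) - 1)%C + Cmod (snd (jost z v (S j)))).
2: assert (HB : forall j, (j < n)%nat -> Cmod (snd (jost z v (S j))) <= Cmod (snd (jost z v j)) + Rabs (v j) * (Cmod (fst (jost z v j) - 1)%C + 1)).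
- intros j _. cbn [jost fst snd].
  eapply Rle_trans; [|apply Cmod_triangle]. right. f_equal. ring.
- intros j _. eapply Rle_trans; [apply jost_step_d|]. apply Rplus_le_compat_l, Rmult_le_compat_l; auto using Rabs_pos.
- assert (H2 := H' HA HB i Hi). cbv beta in H2. simpl (fst (jost z v 0)) in H2. simpl (snd (jost z v 0)) in H2.
  replace (1 - 1)%C with (RtoC 0) in H2 by ring. rewrite !Cmod_0 in H2. lra.
Qed.

Variable S1 : R.
Hypothesis HS1 : forall i, (i <= n)%nat -> psum (fun j => (W - INR j) * Rabs (v j)) i <= S1.

Lemma S1_ge0 : 0 <= S1.
Proof. apply Rle_trans with (2 := HS1 0 ltac:(lia)). simpl; lra. Qed.

Lemma jost_minus_1_bound i : (i <= n)%nat -> Cmod (fst (jost z v i) - 1)%C <= exp S1 - 1.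
Proof.
intros Hi. eapply Rle_trans; [now apply jost_minus_1|].
apply Rplus_le_compat_r. destruct (HS1 i Hi) as [H|H]; [left; now apply exp_increasing|right; now rewrite H].
Qed.

Lemma jost_bound i : (i <= n)%nat -> Cmod (fst (jost z v i)) <= exp S1.
Proof.
intros Hi. replace (fst (jost z v i)) with ((fst (jost z v i) - 1) + 1)%C by ring.
eapply Rle_trans; [apply Cmod_triangle|]. rewrite Cmod_1. assert (H := jost_minus_1_bound i Hi). lra.
Qed.

End JostBounds.

(** * Angular derivative of the Jost recursion *)

Fixpoint jost_der (z : C) (v : nat -> R) (i : nat) : C * C :=
  match i with
  | O => (RtoC 0, RtoC 0)
  | S i => let b := fst (jost z v i) in let d := snd (jost z v i) in
           let b' := fst (jost_der z v i) in let d' := snd (jost_der z v i) in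
           let e := (z * z * d' + (Ci + Ci) * z * z * d + v i * (z * b' + Ci * z * b))%C in
           (b' + e, e)%C
  end.

Lemma jost_der_correct v i t :
  CDer (fun t => fst (jost (expi t) v i)) t (fst (jost_der (expi t) v i)) /\
  CDer (fun t => snd (jost (expi t) v i)) t (snd (jost_der (expi t) v i)).
Proof.
induction i as [|i [IH1 IH2]].
- cbn [jost jost_der fst snd]. split; apply CDer_const.
- assert (H : CDer (fun t => snd (jost (expi t) v (S i))) t (snd (jost_der (expi t) v (S i)))).
  { cbn [jost jost_der fst snd].
    eapply CDer_eq; [|apply CDer_plus; [apply CDer_mult; [apply CDer_mult; apply CDer_expi|exact IH2]|
      apply CDer_mult; [apply CDer_mult; [apply CDer_expi|apply CDer_const]|exact IH1]]].
    cbv beta; ring. }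
  split; [|exact H].
  cbn [jost jost_der fst snd]. cbn [jost jost_der fst snd] in H. apply CDer_plus; auto.
Qed.

(* sin t * (d/dt) m = X + kap - cos t (m - 1), where kap carries the derivative of
   z^(2k) and (X, E) solves the same recursion as (m, increments) with source kap. *)
Fixpoint jost_kap (z : C) (v : nat -> R) (i : nat) : C :=
  match i with
  | O => 0%C
  | S i => (z * z * jost_kap z v i + z * snd (jost z v (S i)))%C
  end.

Fixpoint jost_X (z : C) (v : nat -> R) (i : nat) : C * C :=
  match i with
  | O => (RtoC 0, RtoC 0)
  | S i => let y := (fst (jost_X z v i) + jost_kap z v i - Re z * (fst (jost z v i) - 1))%C in
           let e := (z * z * snd (jost_X z v i) + z * v i * y)%C in
           (fst (jost_X z v i) + e, e)%C
  end.

Definition jost_Y z v i : C := (fst (jost_X z v i) + jost_kap z v i - Re z * (fst (jost z v i) - 1))%C.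

(** Differentiating powers of z inserts weights proportional to the distance, hence a second moment;
    the factor sin t telescopes them into [jost_kap]. The induction also carries the identity for
    the increments, multiplied by z^2: then [jost_kap] at the previous index occurs only through z^2
    kap = kap' - z d', and nothing has to be divided. The computation rests on cos t - i sin t =
    1/z, used as z^2 (c - w) = z. *)
Lemma sin_jost_der t v i :
  (sin t * fst (jost_der (expi t) v i))%C = jost_Y (expi t) v i.
Proof.
set (z := expi t). set (w := (Ci * sin t)%C). set (c := RtoC (cos t)).
assert (Hz : z = (c + w)%C) by (unfold z, expi, c, w, RtoC, Ci, Cplus, Cmult; simpl; f_equal; ring).
assert (Hzz : (z * z * (c - w))%C = z).
{ assert (E : (c - w)%C = Cconj z) by (unfold z, expi, c, w, RtoC, Ci, Cminus, Cplus, Copp, Cmult, Cconj; simpl; f_equal; ring).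
  rewrite E, <- Cmult_assoc. unfold z at 2 3. rewrite expi_conj_mult. ring. }
assert (H : (sin t * fst (jost_der z v i))%C = jost_Y z v i /\
  (z * z * (sin t * snd (jost_der z v i)))%C =
  (z * z * snd (jost_X z v i) + (z * z - 1) * (jost_kap z v i - z * snd (jost z v i)) + w * (z * z) * snd (jost z v i))%C).
{ induction i as [|i [IH1 IH2]].
  - unfold jost_Y. simpl. split; ring.
  - assert (Hd : (sin t * snd (jost_der z v (S i)))%C =
      (snd (jost_X z v (S i)) + (z * z - 1) * jost_kap z v i + w * snd (jost z v (S i)))%C).
    { cbn [jost_der jost_X jost fst snd].
      change (fst (jost_X z v i) + jost_kap z v i - Re z * (fst (jost z v i) - 1))%C with (jost_Y z v i).
      transitivity (z * z * (sin t * snd (jost_der z v i)) + (w + w) * (z * z) * snd (jost z v i)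
        + v i * (z * (sin t * fst (jost_der z v i)) + w * z * fst (jost z v i)))%C.
      { unfold w; ring. }
      rewrite IH1, IH2.
      transitivity (z * z * snd (jost_X z v i) + z * v i * jost_Y z v i + (z * z - 1) * jost_kap z v i
        + w * (z * z * snd (jost z v i) + z * v i * fst (jost z v i))
        + snd (jost z v i) * (z - z * z * (z - (w + w))))%C; [ring|].
      replace (z - (w + w))%C with (c - w)%C by (rewrite Hz; ring). rewrite Hzz. ring. }
    split.
    + transitivity (sin t * fst (jost_der z v i) + sin t * snd (jost_der z v (S i)))%C.
      { cbn [jost_der fst snd]. ring. }
      rewrite IH1, Hd. unfold jost_Y. cbn [jost_X jost_kap jost fst snd].
      change (Re z) with (cos t). fold c.
      set (d := (z * z * snd (jost z v i) + z * v i * fst (jost z v i))%C).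
      replace w with (z - c)%C by (rewrite Hz; ring). ring.
    + rewrite Hd. cbn [jost_kap]. ring. }
apply H.
Qed.

Section JostDerBounds.
Variables (z : C) (v : nat -> R) (W : R) (n : nat).
Hypothesis Hz : Cmod z <= 1.
Hypothesis HW : INR n <= W.
Variable S1 : R.
Hypothesis HS1 : forall i, (i <= n)%nat -> psum (fun j => (W - INR j) * Rabs (v j)) i <= S1.

Let E := exp S1.

Lemma E_ge1 : 1 <= E.
Proof. unfold E. rewrite <- exp_0. destruct (S1_ge0 v W n S1 HS1) as [H|H]; [left; now apply exp_increasing|right; now rewrite H]. Qed.

Lemma exp_psum_le i : (i <= n)%nat -> exp (psum (fun j => (W - INR j) * Rabs (v j)) i) <= E.
Proof. intros Hi. unfold E. destruct (HS1 i Hi) as [H|H]; [left; now apply exp_increasing|right; now rewrite H]. Qed.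

Lemma gronwall_S1 (x y : nat -> R) (F : R) :
  0 <= F ->
  (forall i, 0 <= x i) -> (forall i, 0 <= y i) ->
  (forall i, (i < n)%nat -> x (S i) <= x i + y (S i)) ->
  (forall i, (i < n)%nat -> y (S i) <= y i + Rabs (v i) * (x i + F)) ->
  x O = 0 -> y O = 0 ->
  forall i, (i <= n)%nat -> x i <= F * E.
Proof.
intros HF Hx0 Hy0 Hx Hy X0 Y0 i Hi.
assert (H := gronwall_pair x y (fun i => Rabs (v i)) F W n HF HW Hx0 Hy0 ltac:(intros; apply Rabs_pos) Hx Hy i Hi).
rewrite X0, Y0 in H.
assert (0 <= (W - INR i) * y i).
{ apply Rmult_le_pos; auto. assert (INR i <= INR n) by (apply le_INR; lia). lra. }
assert (H2 := exp_psum_le i Hi).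
assert (F * exp (psum (fun j : nat => (W - INR j) * Rabs (v j)) i) <= F * E) by (apply Rmult_le_compat_l; auto).
nra.
Qed.

(** In modulus the steps of [jost_kap] are bounded by the increments of m, exactly as those of m -
    1, so the same Gronwall estimate applies with source [E], the bound for m. *)
Lemma jost_kap_bound i : (i <= n)%nat -> Cmod (jost_kap z v i) <= E * E.
Proof.
apply (gronwall_S1 (fun i => Cmod (jost_kap z v i)) (fun i => Cmod (snd (jost z v i)))).
- assert (H := E_ge1). lra.
- intros; apply Cmod_ge_0.
- intros; apply Cmod_ge_0.
- intros j Hj. cbn [jost_kap]. eapply Rle_trans; [apply Cmod_triangle|]. apply Rplus_le_compat.
  + rewrite <- Cmult_assoc. eapply Rle_trans; [now apply Cmod_mult_le|]. now apply Cmod_mult_le.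
  + now apply Cmod_mult_le.
- intros j Hj. eapply Rle_trans; [now apply jost_step_d|]. apply Rplus_le_compat_l, Rmult_le_compat_l; [apply Rabs_pos|].
  assert (H1 := Cmod_ge_0 (jost_kap z v j)).
  assert (H2 := jost_bound z v W n Hz HW S1 HS1 j ltac:(lia)). fold E in H2. lra.
- simpl. apply Cmod_0.
- simpl. apply Cmod_0.
Qed.

Hypothesis Hre : Rabs (Re z) <= 1.

Lemma jost_Y_le i : (i <= n)%nat -> Cmod (jost_Y z v i) <= Cmod (fst (jost_X z v i)) + 2 * (E * E).
Proof.
intros Hi. unfold jost_Y, Cminus. eapply Rle_trans; [apply Cmod_triangle|].
rewrite Cmod_opp, Cmod_mult, Cmod_R.
assert (H1 := Cmod_triangle (fst (jost_X z v i)) (jost_kap z v i)).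
assert (H2 := jost_kap_bound i Hi).
assert (H3 := jost_minus_1_bound z v W n Hz HW S1 HS1 i Hi). fold E in H3. unfold Cminus in H3.
assert (H4 := E_ge1).
assert (H5 := Cmod_ge_0 (fst (jost z v i) + - (1))%C).
assert (Rabs (Re z) * Cmod (fst (jost z v i) + - (1))%C <= 1 * (E - 1)) by (apply Rmult_le_compat; auto using Rabs_pos).
nra.
Qed.

Lemma jost_Y_bound i : (i <= n)%nat -> Cmod (jost_Y z v i) <= 4 * (E * E * E).
Proof.
intros Hi. assert (H4 := E_ge1).
assert (H : Cmod (fst (jost_X z v i)) <= 2 * (E * E) * E).
{ apply (gronwall_S1 (fun i => Cmod (fst (jost_X z v i))) (fun i => Cmod (snd (jost_X z v i)))); auto.
  - nra.
  - intros; apply Cmod_ge_0.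
  - intros; apply Cmod_ge_0.
  - intros j Hj. cbn [jost_X fst snd]. apply Cmod_triangle.
  - intros j Hj. cbn [jost_X fst snd]. fold (jost_Y z v j).
    eapply Rle_trans; [apply Cmod_triangle|]. apply Rplus_le_compat.
    + rewrite <- Cmult_assoc. eapply Rle_trans; [now apply Cmod_mult_le|]. now apply Cmod_mult_le.
    + rewrite <- Cmult_assoc. eapply Rle_trans; [now apply Cmod_mult_le|]. rewrite Cmod_mult, Cmod_R.
      apply Rmult_le_compat_l; [apply Rabs_pos|]. apply jost_Y_le. lia.
  - simpl. apply Cmod_0.
  - simpl. apply Cmod_0. }
assert (H2 := jost_Y_le i Hi). nra.
Qed.

Variable S2 : R.
Hypothesis HS2 : forall i, (i <= n)%nat -> psum (fun j => (W - INR j + 1) ^ 2 * Rabs (v j)) i <= S2.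

Lemma jost_der_bound i : (i <= n)%nat -> Cmod (fst (jost_der z v i)) <= 2 * E * exp S2.
Proof.
intros Hi. assert (H4 := E_ge1).
eapply Rle_trans.
- apply (gronwall_triple (fun i => Cmod (fst (jost_der z v i))) (fun i => Cmod (snd (jost_der z v i)))
    (fun i => Cmod (snd (jost z v i))) (fun i => Rabs (v i)) E W n); auto; try (intros; apply Cmod_ge_0); try lra.
  + intros; apply Rabs_pos.
  + intros j Hj. cbn [jost_der fst snd]. apply Cmod_triangle.
  + intros j Hj. cbn [jost_der fst snd].
    eapply Rle_trans; [apply Cmod_triangle|]. apply Rplus_le_compat.
    * eapply Rle_trans; [apply Cmod_triangle|]. apply Rplus_le_compat.
      -- rewrite <- Cmult_assoc. eapply Rle_trans; [now apply Cmod_mult_le|]. now apply Cmod_mult_le.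
      -- replace ((Ci + Ci) * z * z * snd (jost z v j))%C with (z * (z * (Ci * snd (jost z v j) + Ci * snd (jost z v j))))%C by ring.
         eapply Rle_trans; [now apply Cmod_mult_le|]. eapply Rle_trans; [now apply Cmod_mult_le|].
         eapply Rle_trans; [apply Cmod_triangle|]. rewrite !Cmod_mult, Cmod_Ci. lra.
    * rewrite Cmod_mult, Cmod_R. apply Rmult_le_compat_l; [apply Rabs_pos|].
      eapply Rle_trans; [apply Cmod_triangle|]. apply Rplus_le_compat; [now apply Cmod_mult_le|].
      replace (Ci * z * fst (jost z v j))%C with (z * (Ci * fst (jost z v j)))%C by ring.
      eapply Rle_trans; [now apply Cmod_mult_le|]. rewrite Cmod_mult, Cmod_Ci, Rmult_1_l.
      apply (jost_bound z v W n Hz HW S1 HS1); lia.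
  + intros j Hj. eapply Rle_trans; [now apply jost_step_d|]. apply Rplus_le_compat_l, Rmult_le_compat_l; [apply Rabs_pos|].
    apply (jost_bound z v W n Hz HW S1 HS1); lia.
  + simpl; apply Cmod_0.
  + simpl; apply Cmod_0.
  + simpl; apply Cmod_0.
- apply Rmult_le_compat_l; [lra|]. destruct (HS2 i Hi) as [H|H]; [left; now apply exp_increasing|right; now rewrite H].
Qed.

End JostDerBounds.

(** * Scattering for finitely supported potentials *)

Lemma Z_const {T : Type} (A : Z -> T) : (forall n, A (n - 1)%Z = A n) -> forall n m, A n = A m.
Proof.
intros H.
assert (H1 : forall (k : nat) n, A (n - Z.of_nat k)%Z = A n).
{ induction k as [|k IH]; intros n; [f_equal; lia|].
  rewrite <- (IH n), <- (H (n - Z.of_nat k)%Z). f_equal; lia. }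
intros n m. destruct (Z_le_gt_dec n m).
- rewrite <- (H1 (Z.to_nat (m - n)) m). f_equal; lia.
- rewrite <- (H1 (Z.to_nat (n - m)) n). f_equal; lia.
Qed.

Definition refl (v : Z -> R) : Z -> R := fun n => v (- n)%Z.

(* m_+ and m_- when v vanishes outside [-N, N]. *)
Definition mplus (v : Z -> R) (N : nat) (z : C) (n : Z) : C :=
  fst (jost z (fun i => v (Z.of_nat N - Z.of_nat i)%Z) (Z.to_nat (Z.of_nat N - n))).
Definition mminus (v : Z -> R) (N : nat) (z : C) (n : Z) : C := mplus (refl v) N z (- n).

Definition supported (v : Z -> R) (N : nat) := forall n, (Z.of_nat N < Z.abs n)%Z -> v n = 0.

Lemma supported_refl v N : supported v N -> supported (refl v) N.
Proof. intros H n Hn. apply H. now rewrite Z.abs_opp. Qed.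

Lemma mplus_ext v v' N z n : (forall k, v k = v' k) -> mplus v N z n = mplus v' N z n.
Proof. intros H. unfold mplus. f_equal. apply jost_ext. auto. Qed.

Lemma mplus_refl_refl v N z n : mplus (refl (refl v)) N z n = mplus v N z n.
Proof. apply mplus_ext. intros k. unfold refl. f_equal. lia. Qed.

Lemma mplus_large v N z n : (Z.of_nat N <= n)%Z -> mplus v N z n = 1%C.
Proof. intros H. unfold mplus. replace (Z.to_nat _) with O by lia. reflexivity. Qed.

Lemma mplus_rec_le v N z n : (n <= Z.of_nat N)%Z ->
  mplus v N z (n - 1) = ((1 + z * z + z * v n) * mplus v N z n - z * z * mplus v N z (n + 1))%C.
Proof.
intros H. unfold mplus. set (V := fun i => v (Z.of_nat N - Z.of_nat i)%Z).
replace (Z.to_nat (Z.of_nat N - (n - 1))) with (S (Z.to_nat (Z.of_nat N - n))) by lia.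
assert (HV : V (Z.to_nat (Z.of_nat N - n)) = v n) by (unfold V; f_equal; lia).
cbn [jost fst snd]. rewrite HV.
(* At n = N the truncation in [Z.to_nat] gives index 0 for both N and N + 1, in agreement with m = 1
   from N on. *)
destruct (Z.eq_dec n (Z.of_nat N)) as [E|E].
- replace (Z.to_nat (Z.of_nat N - n)) with O by lia. replace (Z.to_nat (Z.of_nat N - (n + 1))) with O by lia. simpl. ring.
- replace (Z.to_nat (Z.of_nat N - n)) with (S (Z.to_nat (Z.of_nat N - (n + 1)))) by lia.
  cbn [jost fst snd]. ring.
Qed.

Lemma mplus_rec v N z n : supported v N ->
  mplus v N z (n - 1) = ((1 + z * z + z * v n) * mplus v N z n - z * z * mplus v N z (n + 1))%C.
Proof.
intros Hs. destruct (Z_le_gt_dec n (Z.of_nat N)); [now apply mplus_rec_le|].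
rewrite Hs by lia. rewrite !mplus_large by lia. ring.
Qed.

Lemma mminus_rec v N z n : supported v N ->
  mminus v N z (n + 1) = ((1 + z * z + z * v n) * mminus v N z n - z * z * mminus v N z (n - 1))%C.
Proof.
intros Hs. unfold mminus.
replace (- (n + 1))%Z with (- n - 1)%Z by lia. replace (- (n - 1))%Z with (- n + 1)%Z by lia.
rewrite mplus_rec by now apply supported_refl. do 3 f_equal. unfold refl. now rewrite Z.opp_involutive.
Qed.

Lemma mplus_conj v N z n : mplus v N (Cconj z) n = Cconj (mplus v N z n).
Proof. unfold mplus. now rewrite jost_conj. Qed.

(** For f_+(n) = z^n P(n) and f_-(n) = z^(-n) M(n) this is -z [f_+, f_-](n). The factor z makes it a
    polynomial in z and the values of P and M, which extends to z = 0. *)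
Definition wronsk (P M : Z -> C) (z : C) (n : Z) : C := (P n * M (n + 1)%Z - z * z * P (n + 1)%Z * M n)%C.

Lemma wronsk_const (P M : Z -> C) (z : C) (v : Z -> R) :
  (forall n, P (n - 1)%Z = ((1 + z * z + z * v n) * P n - z * z * P (n + 1)%Z)%C) ->
  (forall n, M (n + 1)%Z = ((1 + z * z + z * v n) * M n - z * z * M (n - 1)%Z)%C) ->
  forall n m, wronsk P M z n = wronsk P M z m.
Proof.
intros HP HM. apply (Z_const (wronsk P M z)). intros n. unfold wronsk.
replace (n - 1 + 1)%Z with n by lia. rewrite HP, HM. ring.
Qed.

(* z^|n-m| m_+(max) m_-(min) T, i.e. f_+(max) f_-(min) times the transmission factor. *)
Definition kern (P M : Z -> C) (T z : C) (n m : Z) : C :=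
  (z ^ (Z.abs_nat (n - m)) * P (Z.max n m) * M (Z.min n m) * T)%C.

Lemma kern_sym P M T z n m : kern P M T z n m = kern P M T z m n.
Proof. unfold kern. rewrite Z.max_comm, Z.min_comm. do 4 f_equal. lia. Qed.

Section FiniteScattering.
Variables (v : Z -> R) (N : nat) (z : C).
Hypothesis Hs : supported v N.
Hypothesis Hz : (z * Cconj z)%C = 1%C.

Let P := mplus v N z.
Let M := mminus v N z.
Let w := wronsk P M z 0.
Let wt := (M 1%Z * Cconj (P 0%Z) - M 0%Z * Cconj (P 1%Z))%C.

Lemma Cconj_R (r : R) : Cconj r = r.
Proof. unfold Cconj, RtoC; simpl; f_equal; ring. Qed.

Lemma conjP_rec n :
  (z * z * Cconj (P (n - 1)%Z))%C = ((1 + z * z + z * v n) * Cconj (P n) - Cconj (P (n + 1)%Z))%C.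
Proof.
unfold P. rewrite mplus_rec by auto. rewrite Cminus_conj, !Cmult_conj, !Cplus_conj, !Cmult_conj, !Cconj_R.
set (zb := Cconj z) in *. set (a := Cconj _). set (b := Cconj _).
transitivity ((z * z + (z * zb) * (z * zb) + (z * zb) * z * v n) * a - (z * zb) * (z * zb) * b)%C; [ring|].
rewrite Hz. ring.
Qed.

(** Up to a factor z this is the Wronskian of f_+ and its conjugate, which solve the same real
    equation when |z| = 1. It is evaluated at n = N, where P is 1. *)
Lemma flux_plus n : (z * z * P (n + 1)%Z * Cconj (P n) - P n * Cconj (P (n + 1)%Z))%C = (z * z - 1)%C.
Proof.
assert (H := Z_const (fun n => z * z * P (n + 1)%Z * Cconj (P n) - P n * Cconj (P (n + 1)%Z))%C).
cbv beta in H. rewrite (H) with (m := Z.of_nat N).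
- unfold P. rewrite !mplus_large by lia. rewrite Cconj_R. ring.
- intros k. replace (k - 1 + 1)%Z with k by lia.
  transitivity (P k * (z * z * Cconj (P (k - 1)%Z)) - P (k - 1)%Z * Cconj (P k))%C; [ring|].
  rewrite conjP_rec. unfold P at 4. rewrite mplus_rec by auto. fold P. unfold P. ring.
Qed.

(** The left side is z^(2m + 1) times the Wronskian of f_- and the conjugate of f_+, a constant;
    hence the power z^(2m). [wt] is the numerator of the reflection coefficient. *)
Lemma wt_shift (m : nat) :
  (M (Z.of_nat m + 1)%Z * Cconj (P (Z.of_nat m)) - M (Z.of_nat m) * Cconj (P (Z.of_nat m + 1)%Z))%C = (z ^ (2 * m) * wt)%C.
Proof.
induction m as [|m IH].
- simpl. unfold wt. ring.
- replace (2 * S m)%nat with (S (S (2 * m))) by lia.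
  replace (z ^ S (S (2 * m)) * wt)%C with (z * z * (z ^ (2 * m) * wt))%C by (simpl; ring).
  rewrite <- IH. set (k := Z.of_nat (S m)).
  replace (Z.of_nat m) with (k - 1)%Z by (unfold k; lia). replace (k - 1 + 1)%Z with k by lia.
  unfold M at 1. rewrite mminus_rec by auto. fold M.
  assert (H := conjP_rec k).
  transitivity (Cconj (P k) * ((1 + z * z + z * v k) * M k - z * z * M (k - 1)%Z) - M k * Cconj (P (k + 1)%Z))%C.
  { unfold M; ring. }
  replace (Cconj (P (k + 1)%Z)) with ((1 + z * z + z * v k) * Cconj (P k) - z * z * Cconj (P (k - 1)%Z))%C by (rewrite H; ring).
  ring.
Qed.

Lemma wronsk_w n : wronsk P M z n = w.
Proof.
apply (wronsk_const P M z v).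
- intros k. now apply mplus_rec.
- intros k. now apply mminus_rec.
Qed.

(** Three solutions of a second-order equation are dependent: f_-, conj f_+ and f_+, with their
    Wronskians as coefficients. Divided by w this is the scattering relation, with T = (1 - z^2) / w
    and R = wt / w. *)
Lemma reflection_identity (m : nat) :
  ((1 - z * z) * M (Z.of_nat m))%C = (w * Cconj (P (Z.of_nat m)) - z ^ (2 * m) * wt * P (Z.of_nat m))%C.
Proof.
rewrite <- wt_shift, <- (wronsk_w (Z.of_nat m)). unfold wronsk.
assert (H := flux_plus (Z.of_nat m)).
transitivity (- M (Z.of_nat m) * (z * z - 1))%C; [ring|]. rewrite <- H. ring.
Qed.

End FiniteScattering.

Lemma Cmod2_eq (a : C) : RtoC (Cmod a ^ 2) = (a * Cconj a)%C.
Proof. apply Cmod2_conj. Qed.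

(** Divided by |w|^2 this is |R|^2 + |T|^2 = 1; it comes from multiplying the flux identity of f_+
    with that of f_-. It yields |w| >= |1 - z^2| and |wt| <= |w|, the bounds on which everything at
    a resonant edge rests. *)
Lemma unitarity (v : Z -> R) (N : nat) (z : C) :
  supported v N -> (z * Cconj z)%C = 1%C ->
  Cmod (wronsk (mplus v N z) (mminus v N z) z 0) ^ 2 =
  Cmod (mminus v N z 1 * Cconj (mplus v N z 0) - mminus v N z 0 * Cconj (mplus v N z 1)) ^ 2
  + Cmod (1 - z * z) ^ 2.
Proof.
intros Hs Hz. apply RtoC_inj. rewrite RtoC_plus, !Cmod2_eq. unfold wronsk. simpl (0 + 1)%Z.
assert (H1 := flux_plus v N z Hs Hz 0). simpl (0 + 1)%Z in H1.
assert (H2 := flux_plus (refl v) N z (supported_refl _ _ Hs) Hz (-1)). simpl (-1 + 1)%Z in H2.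
change (mplus (refl v) N z 0) with (mminus v N z 0) in H2.
change (mplus (refl v) N z (-1)) with (mminus v N z 1) in H2.
rewrite !Cminus_conj, !Cmult_conj, !Cconj_conj, Cconj_R.
set (a := mplus v N z 0) in *. set (b := mplus v N z 1) in *. set (c := mminus v N z 0) in *. set (d := mminus v N z 1) in *.
set (zb := Cconj z) in *. set (ab := Cconj a) in *. set (bb := Cconj b) in *. set (cb := Cconj c) in *. set (db := Cconj d) in *.
assert (E : ((1 - z * z) * (1 - zb * zb))%C = (- (zb * zb) * ((z * z * b * ab - a * bb) * (z * z * c * db - d * cb)))%C).
{ rewrite H1, H2.
  transitivity ((z * zb) * (z * zb) * ((1 - z * z) * (1 - zb * zb)))%C; [rewrite Hz; ring|].
  transitivity (- (zb * zb) * ((z * z - 1) * (z * z - (z * zb) * (z * zb))))%C; [ring|]. rewrite Hz. ring. }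
rewrite E.
transitivity (a * d * ab * db - zb * zb * a * d * bb * cb - z * z * b * c * ab * db + (z * zb) * (z * zb) * b * c * bb * cb)%C; [ring|].
transitivity ((d * ab - c * bb) * (db * a - cb * b) - zb * zb * a * bb * d * cb - (z * zb) * (z * zb) * z * z * b * ab * c * db
   + (z * zb) * (z * zb) * b * ab * d * cb + (z * zb) * (z * zb) * a * bb * c * db)%C; [rewrite Hz; ring|ring].
Qed.

Lemma wronsk_reflect v N z : supported v N ->
  wronsk (mplus (refl v) N z) (mminus (refl v) N z) z 0 = wronsk (mplus v N z) (mminus v N z) z 0.
Proof.
intros Hs. rewrite (wronsk_const (mplus v N z) (mminus v N z) z v) with (m := (-1)%Z).
2: intros; now apply mplus_rec. 2: intros; now apply mminus_rec.
unfold wronsk, mminus. rewrite !mplus_refl_refl. simpl. ring.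
Qed.

Lemma kern_reflect v N z T n m :
  kern (mplus (refl v) N z) (mminus (refl v) N z) T z (- m) (- n) = kern (mplus v N z) (mminus v N z) T z n m.
Proof.
unfold kern, mminus. rewrite mplus_refl_refl.
replace (Z.abs_nat (- m - - n)) with (Z.abs_nat (n - m)) by lia.
replace (Z.max (- m) (- n)) with (- Z.min n m)%Z by lia.
replace (- Z.min (- m) (- n))%Z with (Z.max n m) by lia. ring.
Qed.

(* The weight s is [sin] for one moment of the potential and 1 for two moments. *)
Definition camplitude (s : R -> R) (B : R) (f : R -> C) : Prop :=
  exists f1 : R -> C, forall t, 0 < t < PI ->
    CDer f t (f1 t) /\ Cmod (f t) <= B /\ s t * Cmod (f1 t) <= B.

Definition weight (s : R -> R) : Prop := forall t, 0 < t < PI -> 0 <= s t <= 1.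

Lemma weight_sin : weight sin.
Proof. intros t Ht. split; [apply Rlt_le, sin_gt_0; lra|apply SIN_bound]. Qed.

Lemma weight_1 : weight (fun _ => 1).
Proof. intros t Ht. lra. Qed.

Lemma camplitude_ext s B f g : (forall t, 0 < t < PI -> f t = g t) -> (forall t, f t = g t) -> camplitude s B f -> camplitude s B g.
Proof.
intros H H' [f1 Hf]. exists f1. intros t Ht. destruct (Hf t Ht) as [H1 [H2 H3]]. split; [|split; auto].
- eapply CDer_ext; eauto.
- now rewrite <- H.
Qed.

Lemma camplitude_le s B B' f : B <= B' -> camplitude s B f -> camplitude s B' f.
Proof.
intros H [f1 Hf]. exists f1. intros t Ht. destruct (Hf t Ht) as [H1 [H2 H3]]. repeat split; try apply H1; lra.
Qed.

Lemma camplitude_mult s B B' f g : weight s -> camplitude s B f -> camplitude s B' g ->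
  camplitude s (2 * (B * B')) (fun t => (f t * g t)%C).
Proof.
intros Hs [f1 Hf] [g1 Hg]. exists (fun t => (f1 t * g t + f t * g1 t)%C). intros t Ht.
destruct (Hf t Ht) as [F1 [F2 F3]]. destruct (Hg t Ht) as [G1 [G2 G3]]. destruct (Hs t Ht) as [S0 S1].
assert (HB := Rle_trans _ _ _ (Cmod_ge_0 _) F2). assert (HB' := Rle_trans _ _ _ (Cmod_ge_0 _) G2).
assert (HBB : 0 <= B * B') by (apply Rmult_le_pos; auto).
split; [now apply CDer_mult|split].
- rewrite Cmod_mult. assert (Cmod (f t) * Cmod (g t) <= B * B') by (apply Rmult_le_compat; auto using Cmod_ge_0). lra.
- apply Rle_trans with (s t * Cmod (f1 t) * Cmod (g t) + Cmod (f t) * (s t * Cmod (g1 t))).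
  + replace (s t * Cmod (f1 t) * Cmod (g t) + Cmod (f t) * (s t * Cmod (g1 t))) with (s t * (Cmod (f1 t) * Cmod (g t) + Cmod (f t) * Cmod (g1 t))) by ring.
    apply Rmult_le_compat_l; auto. rewrite <- !Cmod_mult. apply Cmod_triangle.
  + assert (s t * Cmod (f1 t) * Cmod (g t) <= B * B').
    { apply Rmult_le_compat; auto using Cmod_ge_0. apply Rmult_le_pos; auto using Cmod_ge_0. }
    assert (Cmod (f t) * (s t * Cmod (g1 t)) <= B * B').
    { apply Rmult_le_compat; auto using Cmod_ge_0. apply Rmult_le_pos; auto using Cmod_ge_0. }
    lra.
Qed.

Lemma camplitude_minus s B B' f g : weight s -> camplitude s B f -> camplitude s B' g ->
  camplitude s (B + B') (fun t => (f t - g t)%C).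
Proof.
intros Hs [f1 Hf] [g1 Hg]. exists (fun t => (f1 t - g1 t)%C). intros t Ht.
destruct (Hf t Ht) as [F1 [F2 F3]]. destruct (Hg t Ht) as [G1 [G2 G3]]. destruct (Hs t Ht) as [S0 S1].
split; [now apply CDer_minus|split].
- unfold Cminus. eapply Rle_trans; [apply Cmod_triangle|]. rewrite Cmod_opp. lra.
- assert (Cmod (f1 t - g1 t)%C <= Cmod (f1 t) + Cmod (g1 t)).
  { unfold Cminus. eapply Rle_trans; [apply Cmod_triangle|]. rewrite Cmod_opp. lra. }
  assert (s t * Cmod (f1 t - g1 t)%C <= s t * (Cmod (f1 t) + Cmod (g1 t))) by (apply Rmult_le_compat_l; auto). lra.
Qed.

Lemma camplitude_conj s B f : camplitude s B f -> camplitude s B (fun t => Cconj (f t)).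
Proof.
intros [f1 Hf]. exists (fun t => Cconj (f1 t)). intros t Ht. destruct (Hf t Ht) as [F1 [F2 F3]].
rewrite !Cmod_conj. split; [now apply CDer_conj|now split].
Qed.

Lemma CDer_expi2 t : CDer (fun t => (expi t * expi t)%C) t ((Ci + Ci) * (expi t * expi t))%C.
Proof. eapply CDer_eq; [|apply CDer_mult; apply CDer_expi]. cbv beta. ring. Qed.

Lemma Cmod_2Ci : Cmod (Ci + Ci) <= 2.
Proof. eapply Rle_trans; [apply Cmod_triangle|]. rewrite Cmod_Ci. lra. Qed.

Lemma camplitude_expi2 s : weight s -> camplitude s 2 (fun t => (expi t * expi t)%C).
Proof.
intros Hs. exists (fun t => ((Ci + Ci) * (expi t * expi t))%C). intros t Ht. destruct (Hs t Ht) as [S0 S1].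
split; [apply CDer_expi2|]. rewrite !Cmod_mult, Cmod_expi. assert (H := Cmod_2Ci). assert (H0 := Cmod_ge_0 (Ci + Ci)). split; nra.
Qed.

Lemma camplitude_amplitude B f : camplitude sin B f ->
  amplitude B B (fun t => Re (f t)) /\ amplitude B B (fun t => Im (f t)).
Proof.
intros [f1 Hf].
assert (Hi : forall t, 0 < t < PI -> Cmod (f1 t) <= B / sin t).
{ intros t Ht. destruct (Hf t Ht) as [_ [_ F3]]. assert (0 < sin t) by (apply sin_gt_0; lra).
  apply Rmult_le_reg_r with (sin t); auto. unfold Rdiv. rewrite Rmult_assoc, Rinv_l by lra. lra. }
assert (Him : forall c : C, Rabs (Im c) <= Cmod c).
{ intros c. eapply Rle_trans; [|apply Rmax_Cmod]. apply Rmax_r. }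
split; [exists (fun t => Re (f1 t))|exists (fun t => Im (f1 t))]; intros t Ht; destruct (Hf t Ht) as [[F1 F1'] [F2 F3]];
specialize (Hi t Ht).
- split; [exact F1|]. split; (eapply Rle_trans; [apply re_le_Cmod|assumption]).
- split; [exact F1'|]. split; (eapply Rle_trans; [apply Him|assumption]).
Qed.

Lemma Cmod_1_minus_expi2 t : 0 < t < PI -> Cmod (1 - expi t * expi t) = 2 * sin t.
Proof.
intros Ht. assert (Hsin : 0 < sin t) by (apply sin_gt_0; lra).
assert (E : (1 - expi t * expi t)%C = (- (Ci + Ci) * sin t * expi t)%C).
{ assert (H := expi_conj_mult t).
  rewrite <- H. transitivity (- expi t * (expi t - Cconj (expi t)))%C; [ring|].
  replace (expi t - Cconj (expi t))%C with ((Ci + Ci) * sin t)%C; [ring|].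
  unfold expi, Ci, Cminus, Cplus, Copp, Cmult, Cconj, RtoC; simpl; f_equal; ring. }
rewrite E, !Cmod_mult, Cmod_expi, Cmod_opp, Cmod_R, Rabs_right by lra.
replace (Ci + Ci)%C with (RtoC 2 * Ci)%C.
- rewrite Cmod_mult, Cmod_Ci, Cmod_R, Rabs_right by lra. ring.
- unfold Ci, Cmult, Cplus, RtoC; simpl; f_equal; ring.
Qed.

(** The lower bound sin t * c <= |w| s covers both regimes at once: s = sin with |w| >= c, and s = 1
    with |w| >= 2 sin t. In either one, a derivative controlled with weight s becomes, after
    division by |w|, a derivative controlled with weight sin. By unitarity |1 - z^2| and |wt| are at
    most |w|, so the quotients themselves are bounded by 1. *)
Lemma scatter_amplitudes (s : R -> R) (B c : R) (w wt : R -> C) :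
  weight s -> camplitude s B w -> camplitude s B wt -> 0 < c -> 1 <= B ->
  (forall t, 0 < t < PI -> Cmod (w t) ^ 2 = Cmod (wt t) ^ 2 + Cmod (1 - expi t * expi t) ^ 2) ->
  (forall t, 0 < t < PI -> sin t * c <= Cmod (w t) * s t) ->
  c <= 1 ->
  camplitude sin (10 * B / c) (fun t => ((1 - expi t * expi t) / w t)%C) /\
  camplitude sin (10 * B / c) (fun t => (- (wt t / w t))%C).
Proof.
intros Hs [w1 Hw] [wt1 Hwt] Hc HB Hu Hlow Hc1.
assert (Hci : 1 <= / c) by (rewrite <- Rinv_1; apply Rinv_le_contravar; lra).
assert (HBc : 1 <= B / c) by (unfold Rdiv; nra).
assert (Hpos : forall t, 0 < t < PI -> 2 * sin t <= Cmod (w t) /\ Cmod (wt t) <= Cmod (w t) /\ 0 < sin t).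
{ intros t Ht. assert (Hsin : 0 < sin t) by (apply sin_gt_0; lra). specialize (Hu t Ht). rewrite Cmod_1_minus_expi2 in Hu by auto.
  assert (H1 := Cmod_ge_0 (w t)). assert (H2 := Cmod_ge_0 (wt t)).
  split; [|split]; auto; apply Rsqr_incr_0_var; auto; unfold Rsqr; nra. }
assert (Hkey : forall t, 0 < t < PI -> forall x, 0 <= x -> s t * x <= B -> sin t * x / Cmod (w t) <= B / c).
{ intros t Ht x Hx Hsx. destruct (Hpos t Ht) as [P1 [P2 P3]]. specialize (Hlow t Ht).
  assert (0 < Cmod (w t)) by lra.
  apply Rle_div_l; auto. apply Rmult_le_reg_r with c; auto.
  replace (B / c * Cmod (w t) * c) with (Cmod (w t) * B) by (field; lra).
  apply Rle_trans with (Cmod (w t) * (s t * x)); [|apply Rmult_le_compat_l; lra].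
  replace (sin t * x * c) with (sin t * c * x) by ring. replace (Cmod (w t) * (s t * x)) with (Cmod (w t) * s t * x) by ring.
  apply Rmult_le_compat_r; auto. }
assert (Hq : forall (a a1 : R -> C), (forall t, 0 < t < PI -> CDer a t (a1 t) /\ Cmod (a t) <= Cmod (w t) /\ sin t * Cmod (a1 t) / Cmod (w t) <= B / c) ->
  camplitude sin (10 * B / c) (fun t => (a t / w t)%C)).
{ intros a a1 Ha. exists (fun t => (a1 t * / w t + a t * (- w1 t / (w t * w t)))%C). intros t Ht.
  destruct (Hw t Ht) as [W1 [W2 W3]]. destruct (Ha t Ht) as [A1 [A2 A3]]. destruct (Hpos t Ht) as [P1 [P2 P3]].
  assert (Hw0 : 0 < Cmod (w t)) by lra. assert (Hwn : w t <> 0%C) by now apply Cmod_gt_0.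
  split; [|split].
  - apply (CDer_mult a (fun t => / w t)%C); auto. now apply CDer_inv.
  - rewrite Cmod_div by auto. apply Rle_div_l; auto. apply Rle_trans with (1 * Cmod (w t)); [lra|]. apply Rmult_le_compat_r; [lra|].
    unfold Rdiv in *. lra.
  - assert (H1 := Hkey t Ht (Cmod (w1 t)) (Cmod_ge_0 _) W3).
    apply Rle_trans with (sin t * (Cmod (a1 t) / Cmod (w t) + Cmod (a t) * (Cmod (w1 t) / (Cmod (w t) * Cmod (w t))))).
    + apply Rmult_le_compat_l; [lra|]. eapply Rle_trans; [apply Cmod_triangle|].
      rewrite !Cmod_mult, Cmod_inv by auto. rewrite Cmod_div by (apply Cmod_gt_0; rewrite Cmod_mult; nra).
      rewrite Cmod_opp, Cmod_mult. unfold Rdiv. lra.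
    + assert (sin t * (Cmod (a t) * (Cmod (w1 t) / (Cmod (w t) * Cmod (w t)))) <= B / c).
      { replace (sin t * (Cmod (a t) * (Cmod (w1 t) / (Cmod (w t) * Cmod (w t))))) with
          (Cmod (a t) / Cmod (w t) * (sin t * Cmod (w1 t) / Cmod (w t))) by (field; lra).
        rewrite <- (Rmult_1_l (B / c)). assert (0 <= Cmod (w1 t)) by apply Cmod_ge_0. apply Rmult_le_compat; auto.
        - apply Rdiv_le_0_compat; auto using Cmod_ge_0.
        - apply Rdiv_le_0_compat; auto. apply Rmult_le_pos; lra.
        - apply Rle_div_l; auto. lra. }
      rewrite Rmult_plus_distr_l.
      replace (sin t * (Cmod (a1 t) / Cmod (w t))) with (sin t * Cmod (a1 t) / Cmod (w t)) by (unfold Rdiv; ring).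
      unfold Rdiv in *. lra. }
split.
- apply (Hq (fun t => (1 - expi t * expi t)%C) (fun t => (0 - (Ci + Ci) * (expi t * expi t))%C)).
  intros t Ht. destruct (Hpos t Ht) as [P1 [P2 P3]]. split; [|split].
  + apply CDer_minus; [apply CDer_const|apply CDer_expi2].
  + rewrite Cmod_1_minus_expi2; auto.
  + replace (0 - (Ci + Ci) * (expi t * expi t))%C with (- ((Ci + Ci) * (expi t * expi t)))%C by ring.
    rewrite Cmod_opp, !Cmod_mult, Cmod_expi. assert (H2 := Cmod_2Ci).
    apply Rle_trans with 1; auto. apply Rle_div_l; nra.
- apply camplitude_ext with (f := fun t => ((- wt t) / w t)%C).
  1,2: intros t; intros; unfold Cdiv; ring.
  apply (Hq (fun t => (- wt t)%C) (fun t => (- wt1 t)%C)).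
  intros t Ht. destruct (Hwt t Ht) as [V1 [V2 V3]]. destruct (Hpos t Ht) as [P1 [P2 P3]]. rewrite !Cmod_opp.
  split; [now apply CDer_opp|split; [assumption|]]. apply Hkey; auto using Cmod_ge_0.
Qed.

(** * Oscillatory integrals and amplitudes of the truncated kernel *)

Lemma RInt_two (f g h : R -> R) e :
  0 < e <= PI / 2 ->
  (forall x, 0 < x < PI -> continuous f x) -> (forall x, 0 < x < PI -> continuous g x) ->
  (forall x, 0 < x < PI -> h x = f x + g x) ->
  RInt h e (PI - e) = RInt f e (PI - e) + RInt g e (PI - e).
Proof.
intros He Hf Hg Hh. assert (H3 := PI_gt_3).
rewrite <- (RInt_plus (V := R_CompleteNormedModule) f g) by (apply (ex_RInt_open _ 0 PI); auto; lra).
apply RInt_ext. rewrite Rmin_left, Rmax_right by lra. intros x Hx. apply Hh. lra.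
Qed.

Lemma bound_Re_by_cos (f : R -> R) (B K e : R) (M : R) (g : R -> C) :
  0 < e <= PI / 2 -> camplitude sin B g ->
  (forall x, continuous f x) ->
  (forall s c u, s = 1 \/ s = -1 -> amplitude B B u -> Rabs (RInt (fun x => cos (f x + (s * M * x + c)) * u x) e (PI - e)) <= K) ->
  Rabs (RInt (fun x => cos (f x) * Re (expi (M * x) * g x)%C) e (PI - e)) <= 2 * K.
Proof.
intros He Hg Hf HK. assert (H3 := PI_gt_3).
destruct (camplitude_amplitude _ _ Hg) as [Hr Hi].
assert (Hc : forall s c u, amplitude B B u -> forall x, 0 < x < PI -> continuous (fun x => cos (f x + (s * M * x + c)) * u x) x).
{ intros s c u Hu x Hx. apply (cont_cosf_mult (fun x => f x + (s * M * x + c))).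
  - apply (continuous_plus f (fun x => s * M * x + c)); auto. apply (is_derive_cont _ _ (s * M)). auto_derive; [exact I|ring].
  - eapply amplitude_cont; eauto. }
(* The product of a cosine with the real part of a wave is split into four cosines. The shift by
   PI/2 turns the sines multiplying [Im (g x)] into cosines, so that one estimate for cosines serves
   all terms. *)
set (A1 := fun x => cos (f x + (1 * M * x + 0)) * Re (g x)).
set (A2 := fun x => cos (f x + (-1 * M * x + 0)) * Re (g x)).
set (A3 := fun x => cos (f x + (1 * M * x + - (PI / 2))) * Im (g x)).
set (A4 := fun x => cos (f x + (-1 * M * x + - (PI / 2))) * Im (g x)).
assert (E : RInt (fun x => cos (f x) * Re (expi (M * x) * g x)%C) e (PI - e) =
   (RInt (fun x => / 2 * A1 x) e (PI - e) + RInt (fun x => / 2 * A2 x) e (PI - e)) + (RInt (fun x => - / 2 * A3 x) e (PI - e) + RInt (fun x => / 2 * A4 x) e (PI - e))).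
{ assert (C1 : forall r s c u, amplitude B B u -> forall x, 0 < x < PI -> continuous (fun x => r * (cos (f x + (s * M * x + c)) * u x)) x).
  { intros r s c u Hu x Hx. apply (continuous_scal_r r (fun x => cos (f x + (s * M * x + c)) * u x)). now apply Hc. }
  rewrite <- (RInt_two (fun x => / 2 * A1 x) (fun x => / 2 * A2 x) (fun x => / 2 * A1 x + / 2 * A2 x)); auto; try (apply C1; auto).
  rewrite <- (RInt_two (fun x => - / 2 * A3 x) (fun x => / 2 * A4 x) (fun x => - / 2 * A3 x + / 2 * A4 x)); auto; try (apply C1; auto).
  apply RInt_two; auto.
  - intros x Hx. apply (continuous_plus (fun x => / 2 * A1 x) (fun x => / 2 * A2 x)); apply C1; auto.
  - intros x Hx. apply (continuous_plus (fun x => - / 2 * A3 x) (fun x => / 2 * A4 x)); apply C1; auto.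
  - intros x Hx. unfold A1, A2, A3, A4.
    replace (1 * M * x + 0) with (M * x) by ring. replace (-1 * M * x + 0) with (- (M * x)) by ring.
    replace (f x + (1 * M * x + - (PI / 2))) with (- (PI / 2 - (f x + M * x))) by ring.
    replace (f x + (-1 * M * x + - (PI / 2))) with (- (PI / 2 - (f x + - (M * x)))) by ring.
    rewrite !(cos_neg (PI / 2 - _)), !cos_shift, !cos_plus, !sin_plus, !cos_neg, !sin_neg.
    unfold expi, Cmult; simpl. unfold Re, Im. field. }
rewrite E.
assert (D : forall r s c u, Rabs r = / 2 -> s = 1 \/ s = -1 -> amplitude B B u -> Rabs (RInt (fun x => r * (cos (f x + (s * M * x + c)) * u x)) e (PI - e)) <= K / 2).
{ intros r s c u Hr' Hs Hu. rewrite (RInt_scal (V := R_CompleteNormedModule) (fun x => cos (f x + (s * M * x + c)) * u x)).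
  - unfold scal; simpl; unfold mult; simpl. rewrite Rabs_mult, Hr'. specialize (HK s c u Hs Hu). lra.
  - apply (ex_RInt_open _ 0 PI); try lra. now apply Hc. }
assert (Rabs (/ 2) = / 2) by (apply Rabs_right; lra).
assert (Rabs (- / 2) = / 2) by (rewrite Rabs_Ropp; apply Rabs_right; lra).
eapply Rle_trans; [apply Rabs_triang|]. eapply Rle_trans; [apply Rplus_le_compat; apply Rabs_triang|].
assert (Rabs (RInt (fun x : R => / 2 * A1 x) e (PI - e)) <= K / 2) by (apply D; auto).
assert (Rabs (RInt (fun x : R => / 2 * A2 x) e (PI - e)) <= K / 2) by (apply D; auto).
assert (Rabs (RInt (fun x : R => - / 2 * A3 x) e (PI - e)) <= K / 2) by (apply D; auto).
assert (Rabs (RInt (fun x : R => / 2 * A4 x) e (PI - e)) <= K / 2) by (apply D; auto).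
lra.
Qed.

Lemma osc_Re B g t M c tau e :
  camplitude sin B g -> 2 <= tau -> tau ^ 3 <= 2 * Rabs t -> 0 < e <= / tau ->
  Rabs (RInt (fun x => cos (t * (2 - 2 * cos x) + c) * Re (expi (M * x) * g x)%C) e (PI - e)) <= 320 * B / tau.
Proof.
intros Hg Htau Ht He. assert (H3 := PI_gt_3).
assert (Hit2 : / tau <= / 2) by (apply Rinv_le_contravar; lra).
replace (320 * B / tau) with (2 * (80 * (B + B) / tau)) by (field; lra).
apply (bound_Re_by_cos (fun x => t * (2 - 2 * cos x) + c) B); auto; try lra.
- intros x. apply (is_derive_cont _ _ (2 * t * sin x)). auto_derive; [exact I|ring].
- intros s c' u _ Hu.
  rewrite (RInt_ext _ (fun x => cos (phase t (s * M) (c + c') x) * u x)).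
  + now apply osc_full.
  + intros x _. do 2 f_equal. unfold phase. ring.
Qed.

Lemma dec_Re B g M e :
  camplitude sin B g -> 1 <= Rabs M -> 0 < e <= / Rabs M ->
  Rabs (RInt (fun x => Re (expi (M * x) * g x)%C) e (PI - e)) <= 160 * B * sqrt (sqrt (Rabs M)) / Rabs M.
Proof.
intros Hg HM He. assert (H3 := PI_gt_3).
assert (Hi1 : / Rabs M <= 1) by (rewrite <- Rinv_1; apply Rinv_le_contravar; lra).
replace (160 * B * sqrt (sqrt (Rabs M)) / Rabs M) with (2 * (40 * (B + B) * sqrt (sqrt (Rabs M)) / Rabs M)) by (field; lra).
rewrite (RInt_ext _ (fun x => cos 0 * Re (expi (M * x) * g x)%C)).
2:{ intros x _. now rewrite cos_0, Rmult_1_l. }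
apply (bound_Re_by_cos (fun x => 0) B); auto; try lra.
- intros x. apply continuous_const.
- intros s c u Hs Hu.
  assert (Hsm : Rabs (s * M) = Rabs M).
  { rewrite Rabs_mult. destruct Hs as [-> | ->]; [rewrite Rabs_R1|rewrite Rabs_left by lra]; ring. }
  rewrite (RInt_ext _ (fun x => cos ((s * M) * x + c) * u x)).
  + rewrite <- Hsm. apply dec_full; rewrite ?Hsm; auto.
  + intros x _. do 2 f_equal. ring.
Qed.

(** The sum runs over the sites N, ..., 0 with weight site + 1. These are the sites seen by m_+(n)
    for n >= -1, and -1 is reached because the Wronskian at 0 involves m_-(1), the reflected m_+ at
    -1. *)
Definition jost_S1 (v : Z -> R) (N : nat) (S1 : R) :=
  forall i, (i <= S N)%nat -> psum (fun j => (INR (S N) - INR j) * Rabs (v (Z.of_nat N - Z.of_nat j)%Z)) i <= S1.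
Definition jost_S2 (v : Z -> R) (N : nat) (S2 : R) :=
  forall i, (i <= S N)%nat -> psum (fun j => (INR (S N) - INR j + 1) ^ 2 * Rabs (v (Z.of_nat N - Z.of_nat j)%Z)) i <= S2.

Lemma mplus_camp_sin v N S1 n : jost_S1 v N S1 -> (-1 <= n)%Z ->
  camplitude sin (4 * (exp S1 * exp S1 * exp S1)) (fun t => mplus v N (expi t) n).
Proof.
intros HS Hn. unfold mplus. set (V := fun i => v _). set (i := Z.to_nat _).
assert (Hi : (i <= S N)%nat) by (unfold i; lia).
exists (fun t => fst (jost_der (expi t) V i)). intros t Ht.
assert (Hz : Cmod (expi t) <= 1) by (rewrite Cmod_expi; lra).
assert (HE : 1 <= exp S1) by (apply (E_ge1 V (INR (S N)) (S N) S1 HS)).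
split; [apply jost_der_correct|split].
- eapply Rle_trans; [apply (jost_bound _ V (INR (S N)) (S N) Hz (Rle_refl _) S1 HS); auto|]. nra.
- assert (Hsin : 0 < sin t) by (apply sin_gt_0; lra).
  rewrite <- (Rabs_right (sin t)) by lra. rewrite <- Cmod_R, <- Cmod_mult, sin_jost_der.
  apply (jost_Y_bound _ V (INR (S N)) (S N) Hz (Rle_refl _) S1 HS); auto.
  unfold expi; simpl. apply Rabs_le. apply COS_bound.
Qed.

Lemma mplus_camp_1 v N S1 S2 n : jost_S1 v N S1 -> jost_S2 v N S2 -> (-1 <= n)%Z ->
  camplitude (fun _ => 1) (2 * exp S1 * exp S2) (fun t => mplus v N (expi t) n).
Proof.
intros HS HS2 Hn. unfold mplus. set (V := fun i => v _). set (i := Z.to_nat _).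
assert (Hi : (i <= S N)%nat) by (unfold i; lia).
exists (fun t => fst (jost_der (expi t) V i)). intros t Ht.
assert (Hz : Cmod (expi t) <= 1) by (rewrite Cmod_expi; lra).
assert (HE : 1 <= exp S1) by (apply (E_ge1 V (INR (S N)) (S N) S1 HS)).
assert (HE2 : 1 <= exp S2).
{ rewrite <- exp_0. specialize (HS2 O ltac:(lia)). simpl in HS2. destruct HS2 as [H|H]; [left; now apply exp_increasing|right; now rewrite H]. }
split; [apply jost_der_correct|split].
- eapply Rle_trans; [apply (jost_bound _ V (INR (S N)) (S N) Hz (Rle_refl _) S1 HS); auto|]. nra.
- rewrite Rmult_1_l. apply (jost_der_bound _ V (INR (S N)) (S N) Hz (Rle_refl _) S1 HS S2 HS2); auto.
Qed.

Definition rho_fin (v : Z -> R) (N : nat) (n m : Z) (t : R) : R :=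
  let z := expi t in let P := mplus v N z in let M := mminus v N z in
  Re (kern P M ((1 - z * z) / wronsk P M z 0)%C z n m).

Definition wfin v N t := wronsk (mplus v N (expi t)) (mminus v N (expi t)) (expi t) 0.

(* Generic: the Wronskian is bounded below; nongeneric: two moments of v. *)
Definition regular (v : Z -> R) (N : nat) (B c : R) : Prop :=
  (forall t, 0 < t < PI -> c <= Cmod (wfin v N t)) \/ (jost_S2 v N B /\ jost_S2 (refl v) N B).

Definition two_waves (B : R) (L : Z) (r : R -> R) : Prop :=
  exists (M1 M2 : Z) g1 g2, (L <= Z.abs M1)%Z /\ (L <= Z.abs M2)%Z /\ camplitude sin B g1 /\ camplitude sin B g2 /\
  forall t, 0 < t < PI -> r t = Re (expi (IZR M1 * t) * g1 t)%C + Re (expi (IZR M2 * t) * g2 t)%C.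

Lemma Re_plus a b : Re (a + b)%C = Re a + Re b.
Proof. reflexivity. Qed.

Lemma wfin_refl v N t : supported v N -> wfin (refl v) N t = wfin v N t.
Proof. intros H. unfold wfin. now apply wronsk_reflect. Qed.

Definition wtfin v N t := (mminus v N (expi t) 1 * Cconj (mplus v N (expi t) 0) - mminus v N (expi t) 0 * Cconj (mplus v N (expi t) 1))%C.

Lemma TR_camp S1 S2 c : 0 < c <= 1 -> exists B, 1 <= B /\ forall v N, supported v N ->
  jost_S1 v N S1 -> jost_S1 (refl v) N S1 -> regular v N S2 c ->
  camplitude sin B (fun t => ((1 - expi t * expi t) / wfin v N t)%C) /\
  camplitude sin B (fun t => (- (wtfin v N t / wfin v N t))%C).
Proof.
intros Hc.
set (A := 4 * (exp S1 * exp S1 * exp S1) + 2 * exp S1 * exp S2).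
set (B := 2 * (A * A) + 2 * (2 * (2 * A) * A) + 1).
assert (HA : 0 < A).
{ unfold A. assert (0 < exp S1) by apply exp_pos. assert (0 < exp S2) by apply exp_pos.
  assert (0 < exp S1 * exp S1 * exp S1) by (repeat apply Rmult_lt_0_compat; auto).
  assert (0 < exp S1 * exp S2) by (repeat apply Rmult_lt_0_compat; auto). nra. }
assert (HB : 1 <= B) by (unfold B; nra).
exists (10 * B / c). split.
{ assert (1 <= / c) by (rewrite <- Rinv_1; apply Rinv_le_contravar; lra). unfold Rdiv. nra. }
intros v N Hsup HS HSr Hreg.
assert (G : forall s, weight s -> (forall v', (v' = v \/ v' = refl v) -> forall n, (-1 <= n)%Z -> camplitude s A (fun t => mplus v' N (expi t) n)) ->
  camplitude s B (wfin v N) /\ camplitude s B (wtfin v N)).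
{ intros s Hs HJ.
  assert (P0 := HJ v (or_introl eq_refl) 0%Z ltac:(lia)). assert (P1 := HJ v (or_introl eq_refl) 1%Z ltac:(lia)).
  assert (M0 := HJ (refl v) (or_intror eq_refl) 0%Z ltac:(lia)). assert (M1 := HJ (refl v) (or_intror eq_refl) (-1)%Z ltac:(lia)).
  split.
  - apply (camplitude_le s (2 * (A * A) + 2 * (2 * (2 * A) * A))); [unfold B; lra|].
    unfold wfin, wronsk. apply camplitude_minus; auto.
    + apply camplitude_mult; auto.
    + apply camplitude_mult; auto. apply camplitude_mult; auto. now apply camplitude_expi2.
  - apply (camplitude_le s (2 * (A * A) + 2 * (A * A))); [unfold B; nra|].
    unfold wtfin. apply camplitude_minus; auto; apply camplitude_mult; auto; now apply camplitude_conj. }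
assert (Hun : forall t, 0 < t < PI -> Cmod (wfin v N t) ^ 2 = Cmod (wtfin v N t) ^ 2 + Cmod (1 - expi t * expi t) ^ 2).
{ intros t Ht. apply unitarity; auto. apply expi_conj_mult. }
destruct Hreg as [Hgen|[HS2 HS2r]].
- destruct (G sin weight_sin) as [G1 G2].
  { intros v' Hv' n Hn. apply (camplitude_le sin (4 * (exp S1 * exp S1 * exp S1))).
    - unfold A. assert (0 < exp S1) by apply exp_pos. assert (0 < exp S2) by apply exp_pos. nra.
    - apply mplus_camp_sin; auto. destruct Hv' as [-> | ->]; auto. }
  apply (scatter_amplitudes sin); auto; try lra; try apply weight_sin.
  intros t Ht. assert (Hsin : 0 < sin t) by (apply sin_gt_0; lra). rewrite Rmult_comm. apply Rmult_le_compat_r; auto. lra.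
- destruct (G (fun _ => 1) weight_1) as [G1 G2].
  { intros v' Hv' n Hn. apply (camplitude_le (fun _ => 1) (2 * exp S1 * exp S2)).
    - unfold A. assert (0 < exp S1) by apply exp_pos. assert (0 < exp S1 * exp S1 * exp S1) by (repeat apply Rmult_lt_0_compat; auto). nra.
    - apply mplus_camp_1; auto; destruct Hv' as [-> | ->]; auto. }
  apply (scatter_amplitudes (fun _ => 1)); auto; try lra; try apply weight_1.
  intros t Ht. assert (Hsin : 0 < sin t) by (apply sin_gt_0; lra).
  assert (2 * sin t <= Cmod (wfin v N t)).
  { specialize (Hun t Ht). rewrite Cmod_1_minus_expi2 in Hun by auto. assert (H1 := Cmod_ge_0 (wfin v N t)).
    apply Rsqr_incr_0_var; auto; unfold Rsqr. assert (H2 := pow2_ge_0 (Cmod (wtfin v N t))). nra. }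
  nra.
Qed.

Lemma rho_fin_sym v N n m t : rho_fin v N n m t = rho_fin v N m n t.
Proof. unfold rho_fin. now rewrite kern_sym. Qed.

Lemma rho_fin_refl v N n m t : supported v N -> rho_fin (refl v) N (- m) (- n) t = rho_fin v N n m t.
Proof.
intros H. unfold rho_fin. cbv zeta. rewrite wronsk_reflect by auto. now rewrite kern_reflect.
Qed.

Lemma wfin_neq0 v N t : supported v N -> 0 < t < PI -> wfin v N t <> 0%C.
Proof.
intros H Ht E. assert (Hsin : 0 < sin t) by (apply sin_gt_0; lra).
assert (U := unitarity v N (expi t) H (expi_conj_mult t)). fold (wfin v N t) in U. rewrite E, Cmod_0 in U.
rewrite Cmod_1_minus_expi2 in U by auto.
match type of U with _ = ?a ^ 2 + _ => assert (H2 := pow2_ge_0 a) end. nra.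
Qed.

(** A uniform bound for m_+ is available on n >= -1, and one for m_- on the opposite side. If n and
    m lie on the same side of 0, the factor evaluated on its bad side is replaced through the
    scattering relation, which gives frequencies n - m and n + m. On opposite sides both factors are
    already in their good range. Symmetry and reflection reduce every position to these two
    cases. *)
Lemma rho_two_waves S1 S2 c : 0 < c <= 1 -> exists B, 1 <= B /\ forall v N, supported v N ->
  jost_S1 v N S1 -> jost_S1 (refl v) N S1 -> regular v N S2 c ->
  forall n m, two_waves B (Z.abs (Z.abs n - Z.abs m)) (rho_fin v N n m).
Proof.
intros Hc. destruct (TR_camp S1 S2 c Hc) as [B0 [HB0 HTR]].
set (A := 4 * (exp S1 * exp S1 * exp S1)).
assert (HA : 1 <= A \/ A < 1) by (destruct (Rle_dec 1 A); [left|right]; lra).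
assert (HA0 : 0 < A) by (unfold A; assert (0 < exp S1 * exp S1 * exp S1) by (repeat apply Rmult_lt_0_compat; apply exp_pos); lra).
set (B := 2 * (2 * (A * A) * B0) + 2 * (A * A) + B0).
exists B. split; [unfold B; nra|].
intros v N Hsup HS HSr Hreg.
assert (Hreg' : regular (refl v) N S2 c).
{ destruct Hreg as [H|[H1 H2]]; [left; intros t Ht; rewrite wfin_refl by auto; auto|right]. split; auto.
  intros i Hi. rewrite (psum_ext _ (fun j => (INR (S N) - INR j + 1) ^ 2 * Rabs (v (Z.of_nat N - Z.of_nat j)%Z))); auto.
  intros j _. unfold refl. now rewrite Z.opp_involutive. }
assert (HSrr : jost_S1 (refl (refl v)) N S1).
{ intros i Hi. rewrite (psum_ext _ (fun j => (INR (S N) - INR j) * Rabs (v (Z.of_nat N - Z.of_nat j)%Z))); auto.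
  intros j _. unfold refl. now rewrite Z.opp_involutive. }
assert (Hb : forall v, supported v N -> jost_S1 v N S1 -> jost_S1 (refl v) N S1 -> regular v N S2 c ->
  forall n m, (0 <= m)%Z -> (m <= n)%Z -> two_waves B (Z.abs (Z.abs n - Z.abs m)) (rho_fin v N n m)).
{ clear v Hsup HS HSr Hreg Hreg' HSrr. intros v Hsup HS HSr Hreg n m Hm Hmn. destruct (HTR v N Hsup HS HSr Hreg) as [HT HR].
  assert (Hn1 := mplus_camp_sin v N S1 n HS ltac:(lia)). assert (Hm1 := mplus_camp_sin v N S1 m HS ltac:(lia)). fold A in Hn1, Hm1.
  exists (n - m)%Z, (n + m)%Z,
    (fun t => (mplus v N (expi t) n * Cconj (mplus v N (expi t) m))%C),
    (fun t => (mplus v N (expi t) n * mplus v N (expi t) m * - (wtfin v N t / wfin v N t))%C).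
  split; [lia|]. split; [lia|]. split; [|split].
  - apply (camplitude_le _ (2 * (A * A))); [unfold B; nra|]. apply camplitude_mult; auto using weight_sin, camplitude_conj.
  - apply (camplitude_le _ (2 * (2 * (A * A) * B0))); [unfold B; nra|]. apply camplitude_mult; auto using weight_sin. apply camplitude_mult; auto using weight_sin.
  - intros t Ht. rewrite <- Re_plus. unfold rho_fin. cbv zeta. f_equal. unfold kern.
    fold (wfin v N t). rewrite Z.max_l, Z.min_r by lia.
    set (k := Z.to_nat m). assert (Hk : m = Z.of_nat k) by lia.
    assert (HI := reflection_identity v N (expi t) Hsup (expi_conj_mult t) k). rewrite <- Hk in HI.
    fold (wfin v N t) in HI. fold (wtfin v N t) in HI.
    assert (Hw := wfin_neq0 v N t Hsup Ht).
    replace (IZR (n - m) * t) with (INR (Z.abs_nat (n - m)) * t) by (rewrite INR_IZR_INZ; do 2 f_equal; lia).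
    replace (IZR (n + m) * t) with (INR (Z.abs_nat (n - m)) * t + INR (2 * k) * t).
    2:{ rewrite !INR_IZR_INZ, <- Rmult_plus_distr_r, <- plus_IZR. do 2 f_equal. lia. }
    rewrite expi_plus, <- !expi_pow.
    transitivity (expi t ^ Z.abs_nat (n - m) * mplus v N (expi t) n * (((1 - expi t * expi t) * mminus v N (expi t) m) / wfin v N t))%C.
    { unfold Cdiv. ring. }
    rewrite HI. field. exact Hw. }
assert (Ha : forall n m, (m <= n)%Z -> two_waves B (Z.abs (Z.abs n - Z.abs m)) (rho_fin v N n m)).
{ intros n m Hmn. destruct (Z_le_gt_dec 0 m); [now apply Hb|]. destruct (Z_le_gt_dec n 0).
  - destruct (Hb (refl v) (supported_refl _ _ Hsup) HSr HSrr Hreg' (- m)%Z (- n)%Z ltac:(lia) ltac:(lia)) as [M1 [M2 [g1 [g2 [H1 [H2 [H3 [H4 H5]]]]]]]].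
    exists M1, M2, g1, g2. split; [lia|]. split; [lia|]. split; [auto|]. split; [auto|]. intros t Ht. rewrite <- H5 by auto. now rewrite rho_fin_refl.
  - destruct (HTR v N Hsup HS HSr Hreg) as [HT HR].
    assert (Hn1 := mplus_camp_sin v N S1 n HS ltac:(lia)). assert (Hm1 := mplus_camp_sin (refl v) N S1 (-m) HSr ltac:(lia)). fold A in Hn1, Hm1.
    (* One wave is enough here; the second amplitude is an expression that cancels to zero. *)
    exists (n - m)%Z, (n - m)%Z, (fun t => (mplus v N (expi t) n * mminus v N (expi t) m * ((1 - expi t * expi t) / wfin v N t))%C), (fun t => (mplus v N (expi t) n * mminus v N (expi t) m * ((1 - expi t * expi t) / wfin v N t) - mplus v N (expi t) n * mminus v N (expi t) m * ((1 - expi t * expi t) / wfin v N t))%C).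
    assert (HC : camplitude sin (2 * (2 * (A * A) * B0)) (fun t => (mplus v N (expi t) n * mminus v N (expi t) m * ((1 - expi t * expi t) / wfin v N t))%C)).
    { apply camplitude_mult; auto using weight_sin. apply camplitude_mult; auto using weight_sin. }
    split; [lia|]. split; [lia|]. split; [|split].
    + apply (camplitude_le _ (2 * (2 * (A * A) * B0))); [unfold B; nra|]. exact HC.
    + exists (fun _ => 0%C). intros t Ht. assert (HB1 : 0 <= B) by (unfold B; nra). split; [|split].
      * apply (CDer_ext (fun _ => 0%C)); [intros; ring|apply CDer_const].
      * replace (_ - _)%C with (RtoC 0) by ring. now rewrite Cmod_0.
      * rewrite Cmod_0. lra.
    + intros t Ht. rewrite <- Re_plus. unfold rho_fin. cbv zeta. f_equal. unfold kern. fold (wfin v N t).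
      rewrite Z.max_l, Z.min_r by lia. rewrite expi_pow.
      replace (INR (Z.abs_nat (n - m)) * t) with (IZR (n - m) * t) by (rewrite INR_IZR_INZ; do 2 f_equal; lia). ring. }
intros n m. destruct (Z_le_gt_dec m n); [now apply Ha|].
destruct (Ha m n ltac:(lia)) as [M1 [M2 [g1 [g2 [H1 [H2 [H3 [H4 H5]]]]]]]].
exists M1, M2, g1, g2. split; [lia|]. split; [lia|]. split; [auto|]. split; [auto|]. intros t Ht. rewrite <- H5 by auto. apply rho_fin_sym.
Qed.

(** * Absolutely summable power series on the closed disc *)

Fixpoint csum (a : nat -> C) (n : nat) : C :=
  match n with O => 0%C | S n => (csum a n + a n)%C end.

Lemma csum_ext a b n : (forall i, (i < n)%nat -> a i = b i) -> csum a n = csum b n.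
Proof. induction n as [|n IH]; intros H; simpl; auto. rewrite IH, H; auto. Qed.

Lemma csum_plus a b n : csum (fun k => (a k + b k)%C) n = (csum a n + csum b n)%C.
Proof. induction n as [|n IH]; simpl; [ring|]. rewrite IH. ring. Qed.

Lemma csum_scal c a n : csum (fun k => (c * a k)%C) n = (c * csum a n)%C.
Proof. induction n as [|n IH]; simpl; [ring|]. rewrite IH. ring. Qed.

Lemma csum_diff a m n : (m <= n)%nat -> Cmod (csum a n - csum a m) <= psum (fun k => Cmod (a k)) n - psum (fun k => Cmod (a k)) m.
Proof.
intros H. induction H as [|n H IH].
- replace (csum a m - csum a m)%C with (RtoC 0) by ring. rewrite Cmod_0. lra.
- simpl. replace (csum a n + a n - csum a m)%C with ((csum a n - csum a m) + a n)%C by ring.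
  eapply Rle_trans; [apply Cmod_triangle|]. lra.
Qed.

Lemma psum_plus a b n : psum (fun k => a k + b k) n = psum a n + psum b n.
Proof. induction n as [|n IH]; simpl; [ring|]. rewrite IH. ring. Qed.

Lemma psum_scal c a n : psum (fun k => c * a k) n = c * psum a n.
Proof. induction n as [|n IH]; simpl; [ring|]. rewrite IH. ring. Qed.

Lemma psum_S0 a n : psum a (S n) = a O + psum (fun k => a (S k)) n.
Proof. induction n as [|n IH]; [simpl; ring|]. change (psum a (S (S n))) with (psum a (S n) + a (S n)). rewrite IH. simpl. ring. Qed.

Lemma csum_S0 a n : csum a (S n) = (a O + csum (fun k => a (S k)) n)%C.
Proof. induction n as [|n IH]; [simpl; ring|]. change (csum a (S (S n))) with (csum a (S n) + a (S n))%C. rewrite IH. simpl. ring. Qed.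

Definition nrm (x : nat -> C) (K : nat) : R := psum (fun k => Cmod (x k)) K.
(** Membership in the Wiener algebra of the closed disc with norm at most B, stated on partial sums;
    the estimates on coefficients are made at a fixed [K]. *)
Definition l1 (x : nat -> C) (B : R) : Prop := forall K, nrm x K <= B.

Lemma nrm_ge0 x K : 0 <= nrm x K.
Proof. apply psum_ge0. intros; apply Cmod_ge_0. Qed.

Lemma nrm_mono x J K : (J <= K)%nat -> nrm x J <= nrm x K.
Proof. apply psum_mono. intros; apply Cmod_ge_0. Qed.

Lemma nrm_plus x y K : nrm (fun k => (x k + y k)%C) K <= nrm x K + nrm y K.
Proof. unfold nrm. rewrite <- psum_plus. apply psum_le. intros; apply Cmod_triangle. Qed.

Lemma nrm_scal c x K : nrm (fun k => (c * x k)%C) K = Cmod c * nrm x K.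
Proof. unfold nrm. rewrite <- psum_scal. apply psum_ext. intros; apply Cmod_mult. Qed.

Lemma l1_ge0 x B : l1 x B -> 0 <= B.
Proof. intros H. apply (H O). Qed.

Lemma bounded_tail (a : nat -> R) (B : R) : (forall k, 0 <= a k) -> (forall K, psum a K <= B) ->
  forall eps, 0 < eps -> exists K0, forall J K, (K0 <= J)%nat -> (J <= K)%nat -> psum a K - psum a J <= eps.
Proof.
intros Ha HB eps He.
assert (Hl : ex_finite_lim_seq (psum a)).
{ apply ex_finite_lim_seq_incr with B; auto. intros n. simpl. specialize (Ha n). lra. }
destruct Hl as [l Hl]. apply is_lim_seq_spec in Hl. destruct (Hl (mkposreal (eps / 2) ltac:(lra))) as [K0 HK0]. simpl in HK0.
exists K0. intros J K HJ HK.
assert (H1 := HK0 J HJ). assert (H2 := HK0 K ltac:(lia)). apply Rabs_def2 in H1. apply Rabs_def2 in H2. lra.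
Qed.

Lemma l1_tail x B : l1 x B -> forall eps, 0 < eps -> exists K0, forall J K, (K0 <= J)%nat -> (J <= K)%nat -> nrm x K - nrm x J <= eps.
Proof. intros H. apply bounded_tail with B; auto. intros; apply Cmod_ge_0. Qed.

Lemma Cmod_le_ReIm c : Cmod c <= Rabs (Re c) + Rabs (Im c).
Proof.
apply Rsqr_incr_0_var; [|apply Rplus_le_le_0_compat; apply Rabs_pos].
assert (H := Cmod2_alt c). unfold Rsqr. simpl in H. rewrite !Rmult_1_r in H. rewrite H.
assert (Rabs (Re c) * Rabs (Re c) = Re c * Re c) by (rewrite <- Rabs_mult; apply Rabs_right, Rle_ge, Rle_0_sqr).
assert (Rabs (Im c) * Rabs (Im c) = Im c * Im c) by (rewrite <- Rabs_mult; apply Rabs_right, Rle_ge, Rle_0_sqr).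
assert (0 <= Rabs (Re c) * Rabs (Im c)) by (apply Rmult_le_pos; apply Rabs_pos). lra.
Qed.

Lemma im_le_Cmod c : Rabs (Im c) <= Cmod c.
Proof. eapply Rle_trans; [|apply Rmax_Cmod]. apply Rmax_r. Qed.

Lemma C_eq_of_close (a b : C) : (forall eps, 0 < eps -> Cmod (a - b) <= eps) -> a = b.
Proof.
intros H. assert (E : Cmod (a - b) = 0).
{ assert (H1 := Cmod_ge_0 (a - b)). destruct H1 as [H1|H1]; auto. specialize (H (Cmod (a - b) / 2) ltac:(lra)). lra. }
apply Cmod_eq_0 in E. replace a with ((a - b) + b)%C by ring. rewrite E. ring.
Qed.

(** Total and componentwise: [Lim_seq] has some value for every sequence, and it is known to be the
    limit where [clim_cconv] applies. *)
Definition clim (a : nat -> C) : C := (real (Lim_seq (fun n => Re (a n))), real (Lim_seq (fun n => Im (a n)))).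

Definition cconv (a : nat -> C) (l : C) : Prop :=
  forall eps, 0 < eps -> exists K0, forall K, (K0 <= K)%nat -> Cmod (l - a K) <= eps.

Lemma cconv_unique a l l' : cconv a l -> cconv a l' -> l = l'.
Proof.
intros H H'. apply C_eq_of_close. intros eps He.
destruct (H (eps / 2) ltac:(lra)) as [K0 HK0]. destruct (H' (eps / 2) ltac:(lra)) as [K1 HK1].
specialize (HK0 (Nat.max K0 K1) ltac:(lia)). specialize (HK1 (Nat.max K0 K1) ltac:(lia)).
set (c := a _) in *. replace (l - l')%C with ((l - c) - (l' - c))%C by ring.
unfold Cminus at 1. eapply Rle_trans; [apply Cmod_triangle|]. rewrite Cmod_opp. lra.
Qed.

Lemma clim_cconv a : (forall eps, 0 < eps -> exists K0, forall J K, (K0 <= J)%nat -> (J <= K)%nat -> Cmod (a K - a J) <= eps) ->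
  cconv a (clim a).
Proof.
intros H.
assert (G : forall f : C -> R, (forall c, Rabs (f c) <= Cmod c) -> (forall a b, f (a - b)%C = f a - f b) ->
  is_lim_seq (fun n => f (a n)) (real (Lim_seq (fun n => f (a n))))).
{ intros f Hf Hfm.
  apply Lim_seq_correct'. apply ex_lim_seq_cauchy_corr. intros eps. destruct (H (eps / 2)) as [K0 HK0]. { destruct eps; simpl; lra. }
  exists K0. intros n m Hn Hm.
  assert (HS : forall J K, (K0 <= J)%nat -> (J <= K)%nat -> Rabs (f (a K) - f (a J)) < eps).
  { intros J K HJ HK. rewrite <- Hfm. eapply Rle_lt_trans; [apply Hf|]. eapply Rle_lt_trans; [apply HK0; auto|]. destruct eps; simpl; lra. }
  destruct (Nat.le_ge_cases m n); [now apply HS|]. rewrite Rabs_minus_sym. now apply HS. }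
assert (G1 := G Re re_le_Cmod ltac:(intros; reflexivity)). assert (G2 := G Im im_le_Cmod ltac:(intros; reflexivity)).
intros eps He.
apply is_lim_seq_spec in G1. apply is_lim_seq_spec in G2.
destruct (G1 (mkposreal (eps / 2) ltac:(lra))) as [K1 HK1]. destruct (G2 (mkposreal (eps / 2) ltac:(lra))) as [K2 HK2]. simpl in HK1, HK2.
exists (Nat.max K1 K2). intros K HK. specialize (HK1 K ltac:(lia)). specialize (HK2 K ltac:(lia)).
eapply Rle_trans; [apply Cmod_le_ReIm|].
change (Re (clim a - a K)) with (real (Lim_seq (fun n => Re (a n))) - Re (a K)).
change (Im (clim a - a K)) with (real (Lim_seq (fun n => Im (a n))) - Im (a K)).
rewrite Rabs_minus_sym in HK1. rewrite Rabs_minus_sym in HK2. lra.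
Qed.

Definition cps (x : nat -> C) (z : C) (K : nat) : C := csum (fun k => (x k * z ^ k)%C) K.
Definition ev (x : nat -> C) (z : C) : C := clim (cps x z).

Lemma Cmod_pow_le1 z k : Cmod z <= 1 -> Cmod (z ^ k) <= 1.
Proof. intros H. rewrite Cmod_pow. rewrite <- (pow1 k). apply pow_incr. split; auto using Cmod_ge_0. Qed.

Lemma cps_diff x z J K : Cmod z <= 1 -> (J <= K)%nat -> Cmod (cps x z K - cps x z J) <= nrm x K - nrm x J.
Proof.
intros Hz H. unfold cps, nrm. induction H as [|K H IH].
- replace (_ - _)%C with (RtoC 0) by ring. rewrite Cmod_0. lra.
- simpl. match goal with |- Cmod (?a + ?b - ?c)%C <= _ => replace (a + b - c)%C with ((a - c) + b)%C by ring end.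
  eapply Rle_trans; [apply Cmod_triangle|].
  assert (Cmod (x K * z ^ K)%C <= Cmod (x K)).
  { rewrite Cmod_mult. assert (H1 := Cmod_pow_le1 z K Hz). assert (H2 := Cmod_ge_0 (x K)). assert (H3 := Cmod_ge_0 (z ^ K)). nra. }
  lra.
Qed.

Lemma ev_cconv x B z : l1 x B -> Cmod z <= 1 -> cconv (cps x z) (ev x z).
Proof.
intros Hx Hz. apply clim_cconv. intros eps He. destruct (l1_tail x B Hx eps He) as [K0 HK0].
exists K0. intros J K HJ HK. eapply Rle_trans; [now apply cps_diff|]. now apply HK0.
Qed.

Lemma ev_approx x B z eps J : l1 x B -> Cmod z <= 1 -> (forall K, (J <= K)%nat -> nrm x K - nrm x J <= eps) ->
  Cmod (ev x z - cps x z J) <= eps.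
Proof.
intros Hx Hz HJ. apply le_epsilon. intros e He.
destruct (ev_cconv x B z Hx Hz e He) as [K0 HK0]. set (K := Nat.max K0 J).
specialize (HK0 K ltac:(lia)). specialize (HJ K ltac:(lia)).
replace (ev x z - cps x z J)%C with ((cps x z K - cps x z J) + (ev x z - cps x z K))%C by ring.
eapply Rle_trans; [apply Cmod_triangle|]. apply Rplus_le_compat; auto.
eapply Rle_trans; [apply cps_diff; auto; lia|]. exact HJ.
Qed.

Lemma ev_unif x B : l1 x B -> forall eps, 0 < eps -> exists K0, forall K, (K0 <= K)%nat -> forall z, Cmod z <= 1 -> Cmod (ev x z - cps x z K) <= eps.
Proof.
intros Hx eps He. destruct (l1_tail x B Hx eps He) as [K0 HK0]. exists K0. intros K HK z Hz.
apply ev_approx with B; auto.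
Qed.

Lemma ev_unique x B z l : l1 x B -> Cmod z <= 1 -> cconv (cps x z) l -> ev x z = l.
Proof. intros Hx Hz H. apply cconv_unique with (cps x z); auto. now apply ev_cconv with B. Qed.

Lemma ev_bound x B z : l1 x B -> Cmod z <= 1 -> Cmod (ev x z) <= B.
Proof.
intros Hx Hz. replace (ev x z) with (ev x z - cps x z 0)%C by (unfold cps; simpl; ring).
apply ev_approx with B; auto. intros K _. specialize (Hx K). unfold nrm at 2; simpl. lra.
Qed.

Lemma ev_ext x y z : (forall k, x k = y k) -> ev x z = ev y z.
Proof.
intros H. unfold ev, clim. f_equal; f_equal; apply Lim_seq_ext; intros K; f_equal; apply csum_ext; intros; now rewrite H.
Qed.

Lemma l1_plus x y A B : l1 x A -> l1 y B -> l1 (fun k => (x k + y k)%C) (A + B).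
Proof. intros HA HB K. eapply Rle_trans; [apply nrm_plus|]. specialize (HA K). specialize (HB K). lra. Qed.

Lemma l1_scal c x A : l1 x A -> l1 (fun k => (c * x k)%C) (Cmod c * A).
Proof. intros HA K. rewrite nrm_scal. apply Rmult_le_compat_l; auto using Cmod_ge_0. Qed.

Lemma cconv_plus a b l l' : cconv a l -> cconv b l' -> cconv (fun n => (a n + b n)%C) (l + l')%C.
Proof.
intros H H' eps He.
destruct (H (eps / 2) ltac:(lra)) as [K0 HK0]. destruct (H' (eps / 2) ltac:(lra)) as [K1 HK1].
exists (Nat.max K0 K1). intros K HK. specialize (HK0 K ltac:(lia)). specialize (HK1 K ltac:(lia)).
replace (l + l' - (a K + b K))%C with ((l - a K) + (l' - b K))%C by ring. eapply Rle_trans; [apply Cmod_triangle|]. lra.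
Qed.

Lemma cconv_scal c a l : cconv a l -> cconv (fun n => (c * a n)%C) (c * l)%C.
Proof.
intros H eps He. assert (Hc := Cmod_ge_0 c).
destruct (H (eps / (Cmod c + 1))) as [K0 HK0]. { apply Rdiv_lt_0_compat; lra. }
exists K0. intros K HK. specialize (HK0 K HK). replace (c * l - c * a K)%C with (c * (l - a K))%C by ring.
rewrite Cmod_mult. apply Rle_trans with ((Cmod c + 1) * (eps / (Cmod c + 1))); [|right; field; lra].
apply Rmult_le_compat; auto using Cmod_ge_0; lra.
Qed.

Lemma cconv_ext a b l : (forall n, a n = b n) -> cconv a l -> cconv b l.
Proof. intros E H eps He. destruct (H eps He) as [K0 HK0]. exists K0. intros K HK. rewrite <- E. auto. Qed.

Lemma ev_plus x y A B z : l1 x A -> l1 y B -> Cmod z <= 1 -> ev (fun k => (x k + y k)%C) z = (ev x z + ev y z)%C.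
Proof.
intros HA HB Hz. apply ev_unique with (A + B); auto; [now apply l1_plus|].
apply (cconv_ext (fun n => (cps x z n + cps y z n)%C)).
- intros n. unfold cps. rewrite <- csum_plus. apply csum_ext. intros; ring.
- apply cconv_plus; eapply ev_cconv; eauto.
Qed.

Lemma ev_scal c x A z : l1 x A -> Cmod z <= 1 -> ev (fun k => (c * x k)%C) z = (c * ev x z)%C.
Proof.
intros HA Hz. apply ev_unique with (Cmod c * A); auto; [now apply l1_scal|].
apply (cconv_ext (fun n => (c * cps x z n)%C)).
- intros n. unfold cps. rewrite <- csum_scal. apply csum_ext. intros; ring.
- apply cconv_scal; eapply ev_cconv; eauto.
Qed.

Definition sh (x : nat -> C) (k : nat) : C := match k with O => 0%C | S k => x k end.

Lemma nrm_sh x K : nrm (sh x) K <= nrm x K.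
Proof.
destruct K as [|K]; [unfold nrm; simpl; lra|].
unfold nrm. rewrite psum_S0. simpl (sh x 0). rewrite Cmod_0. simpl. assert (H := Cmod_ge_0 (x K)).
change (psum (fun k => Cmod (sh x (S k))) K) with (psum (fun k => Cmod (x k)) K). lra.
Qed.

Lemma l1_sh x A : l1 x A -> l1 (sh x) A.
Proof. intros H K. eapply Rle_trans; [apply nrm_sh|auto]. Qed.

Lemma ev_sh x A z : l1 x A -> Cmod z <= 1 -> ev (sh x) z = (z * ev x z)%C.
Proof.
intros HA Hz. apply ev_unique with A; auto; [now apply l1_sh|].
assert (H := cconv_scal z _ _ (ev_cconv x A z HA Hz)).
intros eps He. destruct (H eps He) as [K0 HK0]. exists (S K0). intros K HK. destruct K as [|K]; [lia|].
specialize (HK0 K ltac:(lia)). unfold cps. rewrite csum_S0. simpl (sh x 0).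
rewrite (csum_ext (fun k => (sh x (S k) * z ^ S k)%C) (fun k => (z * (x k * z ^ k))%C)).
- rewrite csum_scal. replace (0 * z ^ 0 + z * csum (fun k => (x k * z ^ k)%C) K)%C with (z * cps x z K)%C by (unfold cps; ring). exact HK0.
- intros k _. simpl. ring.
Qed.

Definition delta0 (k : nat) : C := match k with O => 1%C | _ => 0%C end.

Lemma cps_delta0 z K : cps delta0 z (S K) = 1%C.
Proof. induction K as [|K IH]; unfold cps in *; [simpl; ring|]. simpl in *. rewrite IH. ring. Qed.

Lemma l1_delta0 : l1 delta0 1.
Proof.
intros K. assert (nrm delta0 (S K) = 1).
{ induction K as [|K IH]; unfold nrm in *; simpl in *; [rewrite Cmod_1; ring|]. rewrite IH, Cmod_0. ring. }
rewrite <- H. apply nrm_mono. lia.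
Qed.

Lemma ev_delta0 z : Cmod z <= 1 -> ev delta0 z = 1%C.
Proof.
intros Hz. apply ev_unique with 1; auto; [apply l1_delta0|].
intros eps He. exists 1%nat. intros K HK. destruct K as [|K]; [lia|]. rewrite cps_delta0.
replace (1 - 1)%C with (RtoC 0) by ring. rewrite Cmod_0. lra.
Qed.

Lemma ev_0 x A : l1 x A -> ev x 0 = x O.
Proof.
intros HA. apply ev_unique with A; auto. { rewrite Cmod_0; lra. }
intros eps He. exists 1%nat. intros K HK. destruct K as [|K]; [lia|]. unfold cps. rewrite csum_S0.
rewrite (csum_ext _ (fun k => (0 * 0)%C)). { rewrite csum_scal. simpl. replace (_ - _)%C with (RtoC 0) by ring. rewrite Cmod_0. lra. }
intros k _. simpl. ring.
Qed.

Lemma ev_close x y A A' d z : l1 x A -> l1 y A' -> l1 (fun k => (x k - y k)%C) d -> Cmod z <= 1 -> Cmod (ev x z - ev y z) <= d.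
Proof.
intros HA HA' Hd Hz.
assert (E : ev (fun k => (y k + (x k - y k))%C) z = (ev y z + ev (fun k => (x k - y k)%C) z)%C) by (eapply ev_plus; eauto).
rewrite (ev_ext _ x) in E by (intros; ring). rewrite E.
replace (ev y z + ev (fun k => (x k - y k)%C) z - ev y z)%C with (ev (fun k => (x k - y k)%C) z) by ring.
now apply ev_bound.
Qed.

(** The Cauchy product written as a sum of shifts x_j z^j y, whose terms j > k vanish; norms and
    evaluation then follow from linearity and from [sh]. *)
Definition conv (x y : nat -> C) (k : nat) : C := csum (fun j => (x j * Nat.iter j sh y k)%C) (S k).

Definition conv_part (x y : nat -> C) (J : nat) (k : nat) : C := csum (fun j => (x j * Nat.iter j sh y k)%C) J.

Lemma iter_sh_small y j k : (k < j)%nat -> Nat.iter j sh y k = 0%C.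
Proof.
revert k. induction j as [|j IH]; intros k H; [lia|]. simpl. destruct k as [|k]; simpl; auto. apply IH. lia.
Qed.

Lemma conv_part_eq x y J k : (k < J)%nat -> conv_part x y J k = conv x y k.
Proof.
intros H. unfold conv_part, conv. induction H as [|J H IH]; auto. simpl csum at 1. rewrite IH, iter_sh_small by lia. ring.
Qed.

Lemma nrm_iter_sh y j K : nrm (Nat.iter j sh y) K <= nrm y K.
Proof. induction j as [|j IH]; simpl; [lra|]. eapply Rle_trans; [apply nrm_sh|auto]. Qed.

Lemma conv_part_diff x y I J K : (I <= J)%nat ->
  nrm (fun k => (conv_part x y J k - conv_part x y I k)%C) K <= (nrm x J - nrm x I) * nrm y K.
Proof.
intros H. induction H as [|J H IH].
- unfold nrm at 1. rewrite (psum_ext _ (fun k => 0 * 0)). { rewrite psum_scal. lra. }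
  intros k _. replace (_ - _)%C with (RtoC 0) by ring. rewrite Cmod_0; ring.
- apply Rle_trans with (nrm (fun k => ((conv_part x y J k - conv_part x y I k) + x J * Nat.iter J sh y k)%C) K).
  + right. apply psum_ext. intros k _. f_equal. unfold conv_part. simpl. ring.
  + eapply Rle_trans; [apply nrm_plus|]. rewrite nrm_scal.
    assert (H1 : Cmod (x J) * nrm (Nat.iter J sh y) K <= Cmod (x J) * nrm y K) by (apply Rmult_le_compat_l; auto using Cmod_ge_0, nrm_iter_sh).
    replace (nrm x (S J)) with (nrm x J + Cmod (x J)) by reflexivity. lra.
Qed.

Lemma nrm_conv_diff x y I K : (I <= K)%nat ->
  nrm (fun k => (conv x y k - conv_part x y I k)%C) K <= (nrm x K - nrm x I) * nrm y K.
Proof.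
intros H. eapply Rle_trans; [|apply (conv_part_diff x y I K K H)]. right. apply psum_ext.
intros k Hk. now rewrite (conv_part_eq x y K k Hk).
Qed.

Lemma l1_conv x y A B : l1 x A -> l1 y B -> l1 (conv x y) (A * B).
Proof.
intros HA HB K. assert (H := nrm_conv_diff x y 0 K ltac:(lia)).
apply Rle_trans with (nrm (fun k => (conv x y k - conv_part x y 0 k)%C) K).
- right. apply psum_ext. intros k _. f_equal. unfold conv_part; simpl. ring.
- eapply Rle_trans; [exact H|]. unfold nrm at 2; simpl. rewrite Rminus_0_r. apply Rmult_le_compat; auto using nrm_ge0.
Qed.

Lemma l1_iter_sh y B j : l1 y B -> l1 (Nat.iter j sh y) B.
Proof. intros H K. eapply Rle_trans; [apply nrm_iter_sh|auto]. Qed.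

Lemma ev_iter_sh y B j z : l1 y B -> Cmod z <= 1 -> ev (Nat.iter j sh y) z = (z ^ j * ev y z)%C.
Proof.
intros HB Hz. induction j as [|j IH].
- simpl. ring.
- simpl. rewrite (ev_sh _ B) by (auto; now apply l1_iter_sh). rewrite IH. ring.
Qed.

Lemma ev_conv_part x y A B J z : l1 x A -> l1 y B -> Cmod z <= 1 ->
  l1 (conv_part x y J) (nrm x J * B) /\ ev (conv_part x y J) z = (cps x z J * ev y z)%C.
Proof.
intros HA HB Hz. induction J as [|J [IH1 IH2]].
- assert (L : l1 (conv_part x y 0) 0).
  { intros K. unfold nrm, conv_part; simpl. rewrite (psum_ext _ (fun k => 0 * 0)); [rewrite psum_scal; lra|]. intros; rewrite Cmod_0; ring. }
  split.
  + replace (nrm x 0 * B) with 0 by (unfold nrm; simpl; ring). exact L.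
  + unfold cps; simpl. replace (0 * ev y z)%C with (RtoC 0) by ring.
    apply Cmod_eq_0. apply Rle_antisym; [|apply Cmod_ge_0]. now apply ev_bound.
- assert (L1 : l1 (fun k => (x J * Nat.iter J sh y k)%C) (Cmod (x J) * B)) by (apply l1_scal; now apply l1_iter_sh).
  split.
  + replace (nrm x (S J) * B) with (nrm x J * B + Cmod (x J) * B) by (unfold nrm; simpl; ring).
    apply (l1_plus (conv_part x y J) (fun k => (x J * Nat.iter J sh y k)%C)); auto.
  + change (conv_part x y (S J)) with (fun k => (conv_part x y J k + x J * Nat.iter J sh y k)%C).
    rewrite (ev_plus _ _ _ _ _ IH1 L1 Hz), IH2. rewrite (ev_scal _ _ B) by (auto; now apply l1_iter_sh).
    rewrite (ev_iter_sh _ B) by auto. unfold cps; simpl. ring.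
Qed.

Lemma ev_conv x y A B z : l1 x A -> l1 y B -> Cmod z <= 1 -> ev (conv x y) z = (ev x z * ev y z)%C.
Proof.
intros HA HB Hz. assert (HA0 := l1_ge0 _ _ HA). assert (HB0 := l1_ge0 _ _ HB).
apply C_eq_of_close. intros eps He.
set (e := eps / (2 * (B + 1))). assert (He' : 0 < e) by (apply Rdiv_lt_0_compat; lra).
destruct (l1_tail x A HA e He') as [K0 HK0].
destruct (ev_conv_part x y A B K0 z HA HB Hz) as [L1 L2].
assert (D : l1 (fun k => (conv x y k - conv_part x y K0 k)%C) (e * B)).
{ intros K. apply Rle_trans with (nrm (fun k => (conv x y k - conv_part x y K0 k)%C) (Nat.max K K0)); [apply nrm_mono; lia|].
  eapply Rle_trans; [apply nrm_conv_diff; lia|]. apply Rmult_le_compat; auto using nrm_ge0.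
  - assert (H := nrm_mono x K0 (Nat.max K K0) ltac:(lia)). lra.
  - apply HK0; lia. }
assert (H1 := ev_close _ _ _ _ _ z (l1_conv x y A B HA HB) L1 D Hz). rewrite L2 in H1.
assert (H2 : Cmod (ev x z - cps x z K0) <= e) by (apply ev_approx with A; auto).
replace (ev (conv x y) z - ev x z * ev y z)%C with ((ev (conv x y) z - cps x z K0 * ev y z) - (ev x z - cps x z K0) * ev y z)%C by ring.
unfold Cminus at 1. eapply Rle_trans; [apply Cmod_triangle|]. rewrite Cmod_opp, Cmod_mult.
assert (H3 := ev_bound y B z HB Hz).
assert (Cmod (ev x z - cps x z K0) * Cmod (ev y z) <= e * B) by (apply Rmult_le_compat; auto using Cmod_ge_0).
assert (e * (2 * (B + 1)) = eps) by (unfold e; field; lra). nra.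
Qed.

(** The norm of the series z x'(z). It is finite for the Jost functions under a second moment and is
    the price of dividing by z - a when a lies on the circle. *)
Definition wnrm (x : nat -> C) (K : nat) : R := psum (fun k => INR k * Cmod (x k)) K.
Definition w1 (x : nat -> C) (B : R) : Prop := forall K, wnrm x K <= B.

Lemma wnrm_ge0 x K : 0 <= wnrm x K.
Proof. apply psum_ge0. intros; apply Rmult_le_pos; auto using Cmod_ge_0, pos_INR. Qed.

Lemma wnrm_plus x y K : wnrm (fun k => (x k + y k)%C) K <= wnrm x K + wnrm y K.
Proof.
unfold wnrm. rewrite <- psum_plus. apply psum_le. intros. rewrite <- Rmult_plus_distr_l.
apply Rmult_le_compat_l; [apply pos_INR|apply Cmod_triangle].
Qed.

Lemma wnrm_scal c x K : wnrm (fun k => (c * x k)%C) K = Cmod c * wnrm x K.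
Proof. unfold wnrm. rewrite <- psum_scal. apply psum_ext. intros; rewrite Cmod_mult; ring. Qed.

Lemma wnrm_sh x K : wnrm (sh x) K <= wnrm x K + nrm x K.
Proof.
destruct K as [|K]; [unfold wnrm, nrm; simpl; lra|].
unfold wnrm at 1. rewrite psum_S0. simpl (sh x 0). rewrite Cmod_0.
rewrite (psum_ext _ (fun k => INR k * Cmod (x k) + Cmod (x k))).
- rewrite psum_plus. unfold wnrm, nrm. simpl psum.
  assert (0 <= INR K * Cmod (x K)) by (apply Rmult_le_pos; auto using Cmod_ge_0, pos_INR). assert (H0 := Cmod_ge_0 (x K)). lra.
- intros k _. rewrite S_INR. simpl. ring.
Qed.

Lemma wnrm_iter_sh y j K : wnrm (Nat.iter j sh y) K <= wnrm y K + INR j * nrm y K.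
Proof.
induction j as [|j IH]; [simpl; lra|]. rewrite S_INR. simpl. eapply Rle_trans; [apply wnrm_sh|].
assert (H := nrm_iter_sh y j K). lra.
Qed.

Lemma w1_conv x y A B A' B' : l1 x A -> l1 y B -> w1 x A' -> w1 y B' -> w1 (conv x y) (A * B' + A' * B).
Proof.
intros HA HB HA' HB' K.
assert (H : forall J, wnrm (conv_part x y J) K <= nrm x J * wnrm y K + wnrm x J * nrm y K).
{ induction J as [|J IH].
  - unfold wnrm at 1, conv_part, nrm, wnrm; simpl. rewrite (psum_ext _ (fun k => 0 * 0)); [rewrite psum_scal; lra|]. intros; rewrite Cmod_0; ring.
  - change (conv_part x y (S J)) with (fun k => (conv_part x y J k + x J * Nat.iter J sh y k)%C).
    eapply Rle_trans; [apply wnrm_plus|]. rewrite wnrm_scal.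
    assert (H1 : Cmod (x J) * wnrm (Nat.iter J sh y) K <= Cmod (x J) * (wnrm y K + INR J * nrm y K)) by (apply Rmult_le_compat_l; auto using Cmod_ge_0, wnrm_iter_sh).
    replace (nrm x (S J)) with (nrm x J + Cmod (x J)) by reflexivity.
    replace (wnrm x (S J)) with (wnrm x J + INR J * Cmod (x J)) by reflexivity. lra. }
apply Rle_trans with (wnrm (conv_part x y K) K).
- right. apply psum_ext. intros k Hk. now rewrite conv_part_eq.
- eapply Rle_trans; [apply H|]. apply Rplus_le_compat; apply Rmult_le_compat; auto using nrm_ge0, wnrm_ge0.
Qed.

(** * Jost coefficients *)

(** [jost] on Taylor coefficients, multiplication by z becoming [sh]. Estimates in the coefficient
    norm hold on the whole closed disc at once and survive the limit of the truncations coefficient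
    by coefficient. *)
Fixpoint cjost (v : nat -> R) (i : nat) : (nat -> C) * (nat -> C) :=
  match i with
  | O => (delta0, fun _ => RtoC 0)
  | S i => let b := fst (cjost v i) in
           let d := (fun k => (sh (sh (snd (cjost v i))) k + v i * sh b k)%C) in
           ((fun k => (b k + d k)%C), d)
  end.

Lemma nrm_0 K : nrm (fun _ => RtoC 0) K = 0.
Proof. unfold nrm. rewrite (psum_ext _ (fun k => 0 * 0)); [rewrite psum_scal; ring|]. intros; rewrite Cmod_0; ring. Qed.

Lemma wnrm_0 K : wnrm (fun _ => RtoC 0) K = 0.
Proof. unfold wnrm. rewrite (psum_ext _ (fun k => 0 * 0)); [rewrite psum_scal; ring|]. intros; rewrite Cmod_0; ring. Qed.

Lemma nrm_delta0_le K : nrm delta0 K <= 1.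
Proof. apply l1_delta0. Qed.

Lemma nrm_fext x y K : (forall k, x k = y k) -> nrm x K = nrm y K.
Proof. intros H. apply psum_ext. intros; now rewrite H. Qed.

(** The two potentials agree after p extra sites, so the difference obeys the recursion without any
    source and is governed by its value after those p steps. *)
Lemma cjost_diff_step v v' p K i : (forall i, v' (i + p)%nat = v i) ->
  nrm (fun k => (fst (cjost v' (S i + p)) k - fst (cjost v (S i)) k)%C) K <=
    nrm (fun k => (fst (cjost v' (i + p)) k - fst (cjost v i) k)%C) K + nrm (fun k => (snd (cjost v' (S i + p)) k - snd (cjost v (S i)) k)%C) K /\
  nrm (fun k => (snd (cjost v' (S i + p)) k - snd (cjost v (S i)) k)%C) K <=
    nrm (fun k => (snd (cjost v' (i + p)) k - snd (cjost v i) k)%C) K + Rabs (v i) * nrm (fun k => (fst (cjost v' (i + p)) k - fst (cjost v i) k)%C) K.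
Proof.
intros Hv. simpl Nat.add. cbn [cjost fst snd]. rewrite Hv. split.
- eapply Rle_trans; [|apply nrm_plus]. right. apply nrm_fext. intros k. ring.
- set (D := fun k => (snd (cjost v' (i + p)) k - snd (cjost v i) k)%C).
  set (Bd := fun k => (fst (cjost v' (i + p)) k - fst (cjost v i) k)%C).
  apply Rle_trans with (nrm (fun k => (sh (sh D) k + v i * sh Bd k)%C) K).
  + right. apply nrm_fext. intros k. unfold D, Bd. destruct k as [|[|k]]; simpl; ring.
  + eapply Rle_trans; [apply nrm_plus|]. rewrite nrm_scal, Cmod_R.
    apply Rplus_le_compat.
    * eapply Rle_trans; apply nrm_sh.
    * apply Rmult_le_compat_l; [apply Rabs_pos|apply nrm_sh].
Qed.

Lemma cjost_step v K i :
  nrm (fun k => (fst (cjost v (S i)) k - delta0 k)%C) K <= nrm (fun k => (fst (cjost v i) k - delta0 k)%C) K + nrm (snd (cjost v (S i))) K /\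
  nrm (snd (cjost v (S i))) K <= nrm (snd (cjost v i)) K + Rabs (v i) * nrm (fst (cjost v i)) K /\
  nrm (fst (cjost v i)) K <= nrm (fun k => (fst (cjost v i) k - delta0 k)%C) K + 1.
Proof.
cbn [cjost fst snd]. split; [|split].
- eapply Rle_trans; [|apply nrm_plus]. right. apply nrm_fext. intros k. ring.
- eapply Rle_trans; [apply nrm_plus|]. rewrite nrm_scal, Cmod_R. apply Rplus_le_compat.
  + eapply Rle_trans; apply nrm_sh.
  + apply Rmult_le_compat_l; [apply Rabs_pos|apply nrm_sh].
- apply Rle_trans with (nrm (fun k => ((fst (cjost v i) k - delta0 k) + delta0 k)%C) K).
  + right. apply nrm_fext. intros; ring.
  + eapply Rle_trans; [apply nrm_plus|]. assert (H := nrm_delta0_le K). lra.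
Qed.

Lemma cjost_minus_1 v W n K i : INR n <= W -> (i <= n)%nat ->
  nrm (fun k => (fst (cjost v i) k - delta0 k)%C) K + (W - INR i) * nrm (snd (cjost v i)) K
   <= exp (psum (fun j => (W - INR j) * Rabs (v j)) i) - 1.
Proof.
intros HW Hi.
assert (H := gronwall_pair (fun i => nrm (fun k => (fst (cjost v i) k - delta0 k)%C) K) (fun i => nrm (snd (cjost v i)) K)
  (fun i => Rabs (v i)) 1 W n ltac:(lra) HW ltac:(intros; apply nrm_ge0) ltac:(intros; apply nrm_ge0) ltac:(intros; apply Rabs_pos)).
cbv beta in H.
assert (H1 : forall j, (j < n)%nat -> nrm (fun k => (fst (cjost v (S j)) k - delta0 k)%C) K <= nrm (fun k => (fst (cjost v j) k - delta0 k)%C) K + nrm (snd (cjost v (S j))) K).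
{ intros j _. apply cjost_step. }
assert (H2 : forall j, (j < n)%nat -> nrm (snd (cjost v (S j))) K <= nrm (snd (cjost v j)) K + Rabs (v j) * (nrm (fun k => (fst (cjost v j) k - delta0 k)%C) K + 1)).
{ intros j _. destruct (cjost_step v K j) as [_ [A1 A2]]. eapply Rle_trans; [exact A1|]. apply Rplus_le_compat_l, Rmult_le_compat_l; auto using Rabs_pos. }
assert (H3 := H H1 H2 i Hi). cbn [cjost fst snd] in H3. rewrite nrm_0 in H3.
rewrite (nrm_fext (fun k => (delta0 k - delta0 k)%C) (fun _ => RtoC 0)), nrm_0 in H3 by (intros; ring). lra.
Qed.

Lemma ev_cjost v i z : Cmod z <= 1 -> (exists A, l1 (fst (cjost v i)) A) /\ (exists A, l1 (snd (cjost v i)) A) /\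
  ev (fst (cjost v i)) z = fst (jost z v i) /\ ev (snd (cjost v i)) z = snd (jost z v i).
Proof.
intros Hz. induction i as [|i [[A HA] [[B HB] [IH1 IH2]]]].
- cbn [cjost jost fst snd]. split; [|split; [|split]].
  + exists 1. apply l1_delta0.
  + exists 0. intros K. rewrite nrm_0; lra.
  + now apply ev_delta0.
  + apply Cmod_eq_0. apply Rle_antisym; [|apply Cmod_ge_0]. apply ev_bound; auto. intros K. rewrite nrm_0; lra.
- set (D := fun k => (sh (sh (snd (cjost v i))) k + v i * sh (fst (cjost v i)) k)%C).
  assert (L1 : l1 (sh (sh (snd (cjost v i)))) B) by (now repeat apply l1_sh).
  assert (L2 : l1 (fun k => (v i * sh (fst (cjost v i)) k)%C) (Cmod (v i) * A)) by (apply l1_scal; now apply l1_sh).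
  assert (LD : l1 D (B + Cmod (v i) * A)) by (apply (l1_plus _ _ _ _ L1 L2)).
  assert (ED : ev D z = snd (jost z v (S i))).
  { unfold D. rewrite (ev_plus _ _ _ _ _ L1 L2 Hz). rewrite (ev_scal _ _ A) by (auto; now apply l1_sh).
    rewrite (ev_sh _ B) by (auto; now apply l1_sh). rewrite (ev_sh _ B), (ev_sh _ A) by auto. cbn [jost snd]. rewrite IH1, IH2. ring. }
  split; [|split; [|split]].
  + exists (A + (B + Cmod (v i) * A)). apply (l1_plus _ _ _ _ HA LD).
  + exists (B + Cmod (v i) * A). exact LD.
  + change (fst (cjost v (S i))) with (fun k => (fst (cjost v i) k + D k)%C).
    rewrite (ev_plus _ _ _ _ _ HA LD Hz), IH1, ED. reflexivity.
  + exact ED.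
Qed.

Lemma cjost_weighted v W n S1 S2 K i : INR n <= W -> (i <= n)%nat ->
  (forall i, (i <= n)%nat -> psum (fun j => (W - INR j) * Rabs (v j)) i <= S1) ->
  (forall i, (i <= n)%nat -> psum (fun j => (W - INR j + 1) ^ 2 * Rabs (v j)) i <= S2) ->
  wnrm (fst (cjost v i)) K <= 2 * exp S1 * exp S2.
Proof.
intros HW Hi HS1 HS2.
assert (Hb : forall j, (j <= n)%nat -> nrm (fst (cjost v j)) K <= exp S1).
{ intros j Hj. destruct (cjost_step v K j) as [_ [_ A2]]. assert (A1 := cjost_minus_1 v W n K j HW Hj).
  assert (0 <= (W - INR j) * nrm (snd (cjost v j)) K).
  { apply Rmult_le_pos; auto using nrm_ge0. assert (INR j <= INR n) by (apply le_INR; lia). lra. }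
  assert (exp (psum (fun j => (W - INR j) * Rabs (v j)) j) <= exp S1).
  { destruct (HS1 j Hj) as [H1|H1]; [left; now apply exp_increasing|right; now rewrite H1]. }
  lra. }
eapply Rle_trans.
- apply (gronwall_triple (fun i => wnrm (fst (cjost v i)) K) (fun i => wnrm (snd (cjost v i)) K) (fun i => nrm (snd (cjost v i)) K) (fun i => Rabs (v i)) (exp S1) W n); auto;
    try (intros; apply wnrm_ge0); try (intros; apply nrm_ge0); try (intros; apply Rabs_pos).
  + left; apply exp_pos.
  + intros j Hj. cbn [cjost fst snd]. apply wnrm_plus.
  + intros j Hj. cbn [cjost fst snd]. eapply Rle_trans; [apply wnrm_plus|]. rewrite wnrm_scal, Cmod_R.
    apply Rplus_le_compat.
    * eapply Rle_trans; [apply wnrm_sh|]. assert (H1 := wnrm_sh (snd (cjost v j)) K). assert (H2 := nrm_sh (snd (cjost v j)) K). lra.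
    * apply Rmult_le_compat_l; [apply Rabs_pos|]. eapply Rle_trans; [apply wnrm_sh|]. apply Rplus_le_compat_l. apply Hb. lia.
  + intros j Hj. destruct (cjost_step v K j) as [_ [A1 _]]. eapply Rle_trans; [exact A1|].
    apply Rplus_le_compat_l, Rmult_le_compat_l; [apply Rabs_pos|]. apply Hb. lia.
  + cbn [cjost fst]. unfold wnrm. rewrite (psum_ext _ (fun k => 0 * 0)); [rewrite psum_scal; ring|].
    intros k _. destruct k; simpl delta0; [simpl; ring|rewrite Cmod_0; ring].
  + apply wnrm_0.
  + apply nrm_0.
- apply Rmult_le_compat_l; [assert (H := exp_pos S1); lra|]. destruct (HS2 i Hi) as [H1|H1]; [left; now apply exp_increasing|right; now rewrite H1].
Qed.

(** * Limit of the Jost solutions of truncations *)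

Lemma psum_rev a n i : (i <= n)%nat -> psum (fun j => a (n - 1 - j)%nat) i = psum a n - psum a (n - i).
Proof.
induction i as [|i IH]; intros H.
- simpl. rewrite Nat.sub_0_r. ring.
- simpl. rewrite IH by lia. replace (n - i)%nat with (S (n - S i)) by lia. simpl.
  replace (n - 1 - i)%nat with (n - S i)%nat by lia. ring.
Qed.

(** The moment over the sites -c, -c + 1, ..., weighted by the distance to -c: what the recursion
    from N down to a site n >= -c accumulates. *)
Definition moment (q : Z -> R) (c : nat) (k : nat) : R := psum (fun l => INR l * Rabs (q (Z.of_nat l - Z.of_nat c)%Z)) k.
Definition moment2 (q : Z -> R) (c : nat) (k : nat) : R := psum (fun l => (INR l + 1) ^ 2 * Rabs (q (Z.of_nat l - Z.of_nat c)%Z)) k.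

Definition revp (q : Z -> R) (N : nat) (i : nat) : R := q (Z.of_nat N - Z.of_nat i)%Z.

Lemma moment_rev q c N i : (i <= N + c)%nat ->
  psum (fun j => (INR (N + c) - INR j) * Rabs (revp q N j)) i = moment q c (S (N + c)) - moment q c (S (N + c) - i).
Proof.
intros Hi. unfold moment. rewrite <- psum_rev by lia. apply psum_ext. intros j Hj.
replace (S (N + c) - 1 - j)%nat with (N + c - j)%nat by lia. rewrite minus_INR by lia. f_equal. f_equal. unfold revp. f_equal. lia.
Qed.

Lemma moment2_rev q c N i : (i <= N + c)%nat ->
  psum (fun j => (INR (N + c) - INR j + 1) ^ 2 * Rabs (revp q N j)) i = moment2 q c (S (N + c)) - moment2 q c (S (N + c) - i).
Proof.
intros Hi. unfold moment2. rewrite <- psum_rev by lia. apply psum_ext. intros j Hj.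
replace (S (N + c) - 1 - j)%nat with (N + c - j)%nat by lia. rewrite minus_INR by lia. f_equal. f_equal. unfold revp. f_equal. lia.
Qed.

Lemma moment_ge0 q c n : 0 <= moment q c n.
Proof. apply psum_ge0. intros; apply Rmult_le_pos; auto using Rabs_pos, pos_INR. Qed.

Lemma moment2_ge0 q c n : 0 <= moment2 q c n.
Proof. apply psum_ge0. intros; apply Rmult_le_pos; auto using Rabs_pos, pow2_ge_0. Qed.

Lemma exp_le x y : x <= y -> exp x <= exp y.
Proof. intros [H|H]; [left; now apply exp_increasing|right; now rewrite H]. Qed.

Definition bcoef (q : Z -> R) (N : nat) (n : Z) : nat -> C := fst (cjost (revp q N) (Z.to_nat (Z.of_nat N - n))).

Section JostLimit.
Variable q : Z -> R.
Hypothesis Hmom : forall c, exists B, forall k, moment q c k <= B.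

Lemma bcoef_minus_1 c N n K : (- Z.of_nat c <= n)%Z ->
  nrm (fun k => (bcoef q N n k - delta0 k)%C) K <= exp (moment q c (S (N + c)) - moment q c (S (N + c) - Z.to_nat (Z.of_nat N - n))) - 1.
Proof.
intros Hn. unfold bcoef. set (i := Z.to_nat _). assert (Hi : (i <= N + c)%nat) by (unfold i; lia).
assert (H := cjost_minus_1 (revp q N) (INR (N + c)) (N + c) K i (Rle_refl _) Hi).
rewrite moment_rev in H by auto.
assert (0 <= (INR (N + c) - INR i) * nrm (snd (cjost (revp q N) i)) K).
{ apply Rmult_le_pos; auto using nrm_ge0. assert (INR i <= INR (N + c)) by (apply le_INR; lia). lra. }
lra.
Qed.

(** [gronwall_pair] with F = 0 for the difference. At the site N the shorter truncation is 1, so the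
    initial value is m - 1 of the longer one together with its weighted increment, controlled by a
    tail of the moment; propagation from N to n multiplies it by at most [exp B]. *)
Lemma bcoef_diff c B N N' n K : (forall k, moment q c k <= B) -> (- Z.of_nat c <= n)%Z -> (n <= Z.of_nat N)%Z -> (N <= N')%nat ->
  nrm (fun k => (bcoef q N' n k - bcoef q N n k)%C) K <= exp B * (exp (moment q c (S (N' + c)) - moment q c (S (N + c))) - 1).
Proof.
intros HB Hn HnN HNN. set (p := (N' - N)%nat). set (i := Z.to_nat (Z.of_nat N - n)).
unfold bcoef. replace (Z.to_nat (Z.of_nat N' - n)) with (i + p)%nat by (unfold i, p; lia). fold i.
assert (Hv : forall j, revp q N' (j + p) = revp q N j) by (intros j; unfold revp, p; f_equal; lia).
assert (Hi : (i <= N + c)%nat) by (unfold i; lia).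
assert (H := gronwall_pair (fun i => nrm (fun k => (fst (cjost (revp q N') (i + p)) k - fst (cjost (revp q N) i) k)%C) K)
  (fun i => nrm (fun k => (snd (cjost (revp q N') (i + p)) k - snd (cjost (revp q N) i) k)%C) K) (fun i => Rabs (revp q N i)) 0 (INR (N + c)) (N + c)
  (Rle_refl _) (Rle_refl _) ltac:(intros; apply nrm_ge0) ltac:(intros; apply nrm_ge0) ltac:(intros; apply Rabs_pos)).
cbv beta in H.
assert (G : forall j, (j <= N + c)%nat -> nrm (fun k => (fst (cjost (revp q N') (j + p)) k - fst (cjost (revp q N) j) k)%C) K +
  (INR (N + c) - INR j) * nrm (fun k => (snd (cjost (revp q N') (j + p)) k - snd (cjost (revp q N) j) k)%C) K + 0 <=
  (nrm (fun k => (fst (cjost (revp q N') (0 + p)) k - fst (cjost (revp q N) 0) k)%C) K + INR (N + c) * nrm (fun k => (snd (cjost (revp q N') (0 + p)) k - snd (cjost (revp q N) 0) k)%C) K + 0)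
   * exp (psum (fun j => (INR (N + c) - INR j) * Rabs (revp q N j)) j)).
{ apply H.
  - intros j _. now apply cjost_diff_step.
  - intros j _. rewrite Rplus_0_r. now apply cjost_diff_step. }
clear H. specialize (G i Hi). rewrite moment_rev in G by auto.
assert (Hp : (p <= N' + c)%nat) by (unfold p; lia).
assert (H0 := cjost_minus_1 (revp q N') (INR (N' + c)) (N' + c) K p (Rle_refl _) Hp). rewrite moment_rev in H0 by auto.
replace (S (N' + c) - p)%nat with (S (N + c)) in H0 by (unfold p; lia).
replace (INR (N' + c) - INR p) with (INR (N + c)) in H0 by (rewrite <- minus_INR by auto; f_equal; unfold p; lia).
simpl (0 + p)%nat in G. simpl (fst (cjost (revp q N) 0)) in G. simpl (snd (cjost (revp q N) 0)) in G.
rewrite (nrm_fext (fun k => (snd (cjost (revp q N') p) k - 0)%C) (snd (cjost (revp q N') p))) in G by (intros; ring).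
set (X := nrm _ K + INR (N + c) * _) in H0.
assert (HX : 0 <= X). { unfold X. apply Rplus_le_le_0_compat; [apply nrm_ge0|]. apply Rmult_le_pos; auto using nrm_ge0, pos_INR. }
fold X in G. rewrite !Rplus_0_r in G.
assert (0 <= (INR (N + c) - INR i) * nrm (fun k => (snd (cjost (revp q N') (i + p)) k - snd (cjost (revp q N) i) k)%C) K).
{ apply Rmult_le_pos; auto using nrm_ge0. assert (INR i <= INR (N + c)) by (apply le_INR; lia). lra. }
assert (HE : exp (moment q c (S (N + c)) - moment q c (S (N + c) - i)) <= exp B).
{ apply exp_le. assert (H1 := moment_ge0 q c (S (N + c) - i)). specialize (HB (S (N + c))). lra. }
assert (HE0 := exp_pos (moment q c (S (N + c)) - moment q c (S (N + c) - i))).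
rewrite (Rmult_comm (exp B)). eapply Rle_trans; [|apply Rmult_le_compat; [exact HX|apply Rlt_le, HE0|exact H0|exact HE]].
lra.
Qed.

Lemma moment_tail c : forall eps, 0 < eps -> exists K0, forall J K, (K0 <= J)%nat -> (J <= K)%nat -> moment q c K - moment q c J <= eps.
Proof.
destruct (Hmom c) as [B HB]. apply bounded_tail with B; auto.
intros; apply Rmult_le_pos; auto using Rabs_pos, pos_INR.
Qed.

Lemma exp_minus_1_small eps : 0 < eps -> exists d, 0 < d /\ forall x, x <= d -> exp x - 1 <= eps.
Proof.
intros He. exists (ln (1 + eps)). split.
- rewrite <- ln_1. apply ln_increasing; lra.
- intros x Hx. apply exp_le in Hx. rewrite exp_ln in Hx by lra. lra.
Qed.

Lemma bcoef_cauchy n eps : 0 < eps -> exists N0, forall N N' K, (N0 <= N)%nat -> (N <= N')%nat ->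
  nrm (fun k => (bcoef q N' n k - bcoef q N n k)%C) K <= eps.
Proof.
intros He. set (c := Z.to_nat (- n)). destruct (Hmom c) as [B HB].
assert (HEB := exp_pos B).
destruct (exp_minus_1_small (eps / exp B)) as [d [Hd Hx]]. { apply Rdiv_lt_0_compat; auto. }
destruct (moment_tail c d Hd) as [K0 HK0].
exists (Nat.max K0 (Z.to_nat n)). intros N N' K HN HN'.
eapply Rle_trans; [apply (bcoef_diff c B); auto; unfold c; lia|].
replace eps with (exp B * (eps / exp B)) by (field; lra).
apply Rmult_le_compat_l; [lra|]. apply Hx. apply HK0; lia.
Qed.

Definition blim (n : Z) (k : nat) : C := clim (fun N => bcoef q N n k).

Lemma nrm_ge_coef x k : Cmod (x k) <= nrm x (S k).
Proof. unfold nrm; simpl. assert (H := psum_ge0 (fun k => Cmod (x k)) k ltac:(intros; apply Cmod_ge_0)). lra. Qed.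

Lemma blim_cconv n k : cconv (fun N => bcoef q N n k) (blim n k).
Proof.
apply clim_cconv. intros eps He. destruct (bcoef_cauchy n eps He) as [N0 HN0]. exists N0. intros J K HJ HK.
eapply Rle_trans; [|apply (HN0 J K (S k) HJ HK)]. apply (nrm_ge_coef (fun k => (bcoef q K n k - bcoef q J n k)%C) k).
Qed.

(* Fatou for finite sums *)
Lemma nrm_limit (x : nat -> nat -> C) (l y : nat -> C) K e N0 :
  (forall k, cconv (fun N => x N k) (l k)) -> (forall N, (N0 <= N)%nat -> nrm (fun k => (x N k - y k)%C) K <= e) ->
  nrm (fun k => (l k - y k)%C) K <= e.
Proof.
intros Hl Hx. apply le_epsilon. intros eps He.
assert (H : forall J, exists N, (N0 <= N)%nat /\ nrm (fun k => (l k - x N k)%C) J <= eps).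
{ intros J. assert (H : exists N1, forall N, (N1 <= N)%nat -> nrm (fun k => (l k - x N k)%C) J <= eps * (INR J / (INR J + 1))).
  { assert (G : forall e', 0 < e' -> exists N1, forall N, (N1 <= N)%nat -> nrm (fun k => (l k - x N k)%C) J <= INR J * e').
    { intros e' He'. induction J as [|J [N1 HN1]].
      - exists O. intros. unfold nrm; simpl. lra.
      - destruct (Hl J e' He') as [N2 HN2]. exists (Nat.max N1 N2). intros N HN. specialize (HN1 N ltac:(lia)). specialize (HN2 N ltac:(lia)).
        unfold nrm in *. rewrite S_INR. cbn [psum]. cbv beta in HN2. lra. }
    assert (HJ := pos_INR J).
    destruct (G (eps / (INR J + 1))) as [N1 HN1]. { apply Rdiv_lt_0_compat; lra. }
    exists N1. intros N HN. specialize (HN1 N HN). eapply Rle_trans; [exact HN1|]. right. field. lra. }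
  destruct H as [N1 HN1]. exists (Nat.max N0 N1). split; [lia|]. eapply Rle_trans; [apply HN1; lia|].
  assert (HJ := pos_INR J). rewrite <- (Rmult_1_r eps) at 2. apply Rmult_le_compat_l; [lra|]. apply Rle_div_l; lra. }
destruct (H K) as [N [HN HN']]. specialize (Hx N HN).
apply Rle_trans with (nrm (fun k => ((l k - x N k) + (x N k - y k))%C) K).
- right. apply nrm_fext. intros; ring.
- eapply Rle_trans; [apply nrm_plus|]. lra.
Qed.

Lemma blim_close n eps : 0 < eps -> exists N0, forall N, (N0 <= N)%nat -> l1 (fun k => (blim n k - bcoef q N n k)%C) eps.
Proof.
intros He. destruct (bcoef_cauchy n eps He) as [N0 HN0]. exists N0. intros N HN K.
apply (nrm_limit (fun N k => bcoef q N n k) (blim n) (bcoef q N n) K eps N).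
- intros k. apply blim_cconv.
- intros N' HN'. now apply HN0.
Qed.

Lemma blim_minus_1 c n K B : (- Z.of_nat c <= n)%Z -> (forall N, (Z.to_nat n <= N)%nat -> moment q c (S (N + c)) - moment q c (S (Z.to_nat (n + Z.of_nat c))) <= B) ->
  nrm (fun k => (blim n k - delta0 k)%C) K <= exp B - 1.
Proof.
intros Hn HB. apply (nrm_limit (fun N k => bcoef q N n k) (blim n) delta0 K _ (Z.to_nat n)).
- intros k. apply blim_cconv.
- intros N HN. eapply Rle_trans; [apply (bcoef_minus_1 c); auto|]. apply Rplus_le_compat_r, exp_le.
  replace (S (N + c) - Z.to_nat (Z.of_nat N - n))%nat with (S (Z.to_nat (n + Z.of_nat c))) by lia. now apply HB.
Qed.

Lemma blim_l1 n : exists A, l1 (blim n) A.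
Proof.
set (c := Z.to_nat (- n)). destruct (Hmom c) as [B HB]. exists (exp B). intros K.
assert (H := blim_minus_1 c n K B ltac:(unfold c; lia)).
assert (nrm (fun k => (blim n k - delta0 k)%C) K <= exp B - 1).
{ apply H. intros N _. specialize (HB (S (N + c))). assert (H1 := moment_ge0 q c (S (Z.to_nat (n + Z.of_nat c)))). lra. }
apply Rle_trans with (nrm (fun k => ((blim n k - delta0 k) + delta0 k)%C) K).
- right. apply nrm_fext. intros; ring.
- eapply Rle_trans; [apply nrm_plus|]. assert (H1 := nrm_delta0_le K). lra.
Qed.

Lemma blim_w1 n : (forall c, exists B, forall k, moment2 q c k <= B) -> exists A, w1 (blim n) A.
Proof.
intros Hm2. set (c := Z.to_nat (- n)). destruct (Hmom c) as [S1 HS1]. destruct (Hm2 c) as [S2 HS2].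
exists (2 * exp S1 * exp S2 + 1). intros K.
assert (Hb : forall N, wnrm (bcoef q N n) K <= 2 * exp S1 * exp S2).
{ intros N. destruct (Z_le_gt_dec n (Z.of_nat N)).
  - apply (cjost_weighted (revp q N) (INR (N + c)) (N + c)); try apply Rle_refl.
    + unfold c; lia.
    + intros i Hi. rewrite moment_rev by auto. assert (H1 := moment_ge0 q c (S (N + c) - i)). specialize (HS1 (S (N + c))). lra.
    + intros i Hi. rewrite moment2_rev by auto. assert (H1 := moment2_ge0 q c (S (N + c) - i)). specialize (HS2 (S (N + c))). lra.
  - unfold bcoef. replace (Z.to_nat (Z.of_nat N - n)) with O by lia. cbn [cjost fst].
    apply Rle_trans with 0.
    + right. unfold wnrm. rewrite (psum_ext _ (fun k => 0 * 0)); [rewrite psum_scal; ring|].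
      intros k _. destruct k; simpl delta0; [simpl; ring|rewrite Cmod_0; ring].
    + assert (H1 := exp_pos S1). assert (H2 := exp_pos S2). nra. }
(* On the first K coefficients the weighted norm is at most K + 1 times the norm, so closeness 1 /
   (K + 1) costs only the additional 1. *)
destruct (blim_close n (1 / (INR K + 1))) as [N0 HN0]. { assert (H := pos_INR K). apply Rdiv_lt_0_compat; lra. }
specialize (HN0 N0 (Nat.le_refl _) K). specialize (Hb N0).
apply Rle_trans with (wnrm (fun k => (bcoef q N0 n k + (blim n k - bcoef q N0 n k))%C) K).
- right. apply psum_ext. intros k _. do 2 f_equal. ring.
- eapply Rle_trans; [apply wnrm_plus|]. apply Rplus_le_compat; auto.
  assert (HK := pos_INR K).
  apply Rle_trans with ((INR K + 1) * nrm (fun k => (blim n k - bcoef q N0 n k)%C) K).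
  + unfold wnrm, nrm. rewrite <- psum_scal. apply psum_le. intros k Hk. apply Rmult_le_compat_r; [apply Cmod_ge_0|].
    assert (INR k <= INR K) by (apply le_INR; lia). lra.
  + apply Rle_trans with ((INR K + 1) * (1 / (INR K + 1))); [apply Rmult_le_compat_l; lra|right; field; lra].
Qed.

Definition mlim (z : C) (n : Z) : C := ev (blim n) z.

Lemma bcoef_ev N n z : Cmod z <= 1 -> ev (bcoef q N n) z = mplus q N z n.
Proof. intros Hz. unfold bcoef, mplus. apply (ev_cjost (revp q N) _ z Hz). Qed.

Lemma mlim_unif n eps : 0 < eps -> exists N0, forall N, (N0 <= N)%nat -> forall z, Cmod z <= 1 -> Cmod (mlim z n - mplus q N z n) <= eps.
Proof.
intros He. destruct (blim_close n eps He) as [N0 HN0]. exists N0. intros N HN z Hz.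
rewrite <- bcoef_ev by auto. destruct (blim_l1 n) as [A HA]. destruct (ev_cjost (revp q N) (Z.to_nat (Z.of_nat N - n)) z Hz) as [[B HB] _].
unfold mlim. apply (ev_close (blim n) (bcoef q N n) A B eps); auto.
Qed.

Lemma mlim_cconv n z : Cmod z <= 1 -> cconv (fun N => mplus q N z n) (mlim z n).
Proof. intros Hz eps He. destruct (mlim_unif n eps He) as [N0 HN0]. exists N0. intros N HN. now apply HN0. Qed.

Lemma mlim_rec n z : Cmod z <= 1 ->
  mlim z (n - 1) = ((1 + z * z + z * q n) * mlim z n - z * z * mlim z (n + 1))%C.
Proof.
intros Hz.
(* The shift by [Z.to_nat n] keeps n at or below the truncation site, where the recursion holds for
   the full q. *)
apply cconv_unique with (fun N => mplus q (N + Z.to_nat n) z (n - 1)%Z).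
- intros eps He. destruct (mlim_cconv (n - 1) z Hz eps He) as [N0 HN0]. exists N0. intros N HN. apply HN0. lia.
- apply (cconv_ext (fun N => ((1 + z * z + z * q n) * mplus q (N + Z.to_nat n) z n + (- (z * z)) * mplus q (N + Z.to_nat n) z (n + 1)%Z)%C)).
  + intros N. rewrite mplus_rec_le by lia. ring.
  + replace ((1 + z * z + z * q n) * mlim z n - z * z * mlim z (n + 1))%C with ((1 + z * z + z * q n) * mlim z n + (- (z * z)) * mlim z (n + 1))%C by ring.
    apply cconv_plus; apply cconv_scal; intros eps He.
    * destruct (mlim_cconv n z Hz eps He) as [N0 HN0]. exists N0. intros N HN. apply HN0. lia.
    * destruct (mlim_cconv (n + 1) z Hz eps He) as [N0 HN0]. exists N0. intros N HN. apply HN0. lia.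
Qed.

Lemma mlim_conj n z : Cmod z <= 1 -> mlim (Cconj z) n = Cconj (mlim z n).
Proof.
intros Hz. apply cconv_unique with (fun N => mplus q N (Cconj z) n).
- apply mlim_cconv. now rewrite Cmod_conj.
- intros eps He. destruct (mlim_cconv n z Hz eps He) as [N0 HN0]. exists N0. intros N HN.
  rewrite mplus_conj, <- Cminus_conj, Cmod_conj. now apply HN0.
Qed.

(** At z = 0 every increment vanishes. This normalises the Wronskian to 1 and the kernel to the
    identity at the centre of the disc. *)
Lemma mlim_at_0 n : mlim 0 n = 1%C.
Proof.
apply cconv_unique with (fun N => mplus q N 0 n).
- apply mlim_cconv. rewrite Cmod_0; lra.
- intros eps He. exists O. intros N _.
  assert (H : forall i v, fst (jost 0 v i) = 1%C).
  { intros i v. induction i as [|i IH]; [reflexivity|]. cbn [jost fst snd]. rewrite IH. ring. }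
  unfold mplus. rewrite H. replace (1 - 1)%C with (RtoC 0) by ring. rewrite Cmod_0; lra.
Qed.

Lemma mlim_infty eps : 0 < eps -> exists n0, forall n z, (n0 <= n)%Z -> Cmod z <= 1 -> Cmod (mlim z n - 1) <= eps.
Proof.
intros He. destruct (exp_minus_1_small eps He) as [d [Hd Hx]]. destruct (moment_tail 0 d Hd) as [K0 HK0].
exists (Z.of_nat K0). intros n z Hn Hz. unfold mlim. rewrite <- (ev_delta0 z) by auto.
destruct (blim_l1 n) as [A HA]. apply (ev_close (blim n) delta0 A 1 eps z); auto; [apply l1_delta0|].
intros K. eapply Rle_trans; [apply (blim_minus_1 0 n K d)|].
- lia.
- intros N HN. apply HK0; lia.
- now apply Hx; lra.
Qed.

End JostLimit.

(** * Uniform continuity, division by zeros and lower bounds on the disc *)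

Lemma pow_lip z z' k : Cmod z <= 1 -> Cmod z' <= 1 -> Cmod (z ^ k - z' ^ k) <= INR k * Cmod (z - z').
Proof.
intros Hz Hz'. induction k as [|k IH].
- simpl. replace (1 - 1)%C with (RtoC 0) by ring. rewrite Cmod_0. lra.
- rewrite S_INR. replace (z ^ S k - z' ^ S k)%C with (z * (z ^ k - z' ^ k) + (z - z') * z' ^ k)%C by (simpl; ring).
  eapply Rle_trans; [apply Cmod_triangle|]. rewrite !Cmod_mult.
  assert (H1 := Cmod_pow_le1 z' k Hz'). assert (H2 := Cmod_ge_0 (z - z')). assert (H3 := Cmod_ge_0 (z ^ k - z' ^ k)).
  assert (Cmod z * Cmod (z ^ k - z' ^ k) <= 1 * Cmod (z ^ k - z' ^ k)) by (apply Rmult_le_compat_r; auto).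
  assert (Cmod (z - z') * Cmod (z' ^ k) <= Cmod (z - z') * 1) by (apply Rmult_le_compat_l; auto). lra.
Qed.

Lemma cps_lip x z z' K : Cmod z <= 1 -> Cmod z' <= 1 -> Cmod (cps x z K - cps x z' K) <= wnrm x K * Cmod (z - z').
Proof.
intros Hz Hz'. unfold cps, wnrm. induction K as [|K IH].
- simpl. replace (0 - 0)%C with (RtoC 0) by ring. rewrite Cmod_0. lra.
- simpl. match goal with |- Cmod (?a + ?b * ?p - (?c + ?b * ?r))%C <= _ => replace (a + b * p - (c + b * r))%C with ((a - c) + b * (p - r))%C by ring end.
  eapply Rle_trans; [apply Cmod_triangle|]. rewrite Cmod_mult.
  assert (H := pow_lip z z' K Hz Hz').
  assert (Cmod (x K) * Cmod (z ^ K - z' ^ K) <= Cmod (x K) * (INR K * Cmod (z - z'))) by (apply Rmult_le_compat_l; auto using Cmod_ge_0). lra.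
Qed.

Lemma ev_uc x B : l1 x B -> forall eps, 0 < eps -> exists d, 0 < d /\ forall z z', Cmod z <= 1 -> Cmod z' <= 1 -> Cmod (z - z') < d -> Cmod (ev x z - ev x z') <= eps.
Proof.
intros Hx eps He. destruct (ev_unif x B Hx (eps / 3) ltac:(lra)) as [K HK]. specialize (HK K (Nat.le_refl _)).
assert (Hw := wnrm_ge0 x K).
exists (eps / 3 / (wnrm x K + 1)). split. { apply Rdiv_lt_0_compat; lra. }
intros z z' Hz Hz' Hd.
replace (ev x z - ev x z')%C with ((ev x z - cps x z K) + (cps x z K - cps x z' K) + - (ev x z' - cps x z' K))%C by ring.
eapply Rle_trans; [apply Cmod_triangle|]. eapply Rle_trans; [apply Rplus_le_compat_r, Cmod_triangle|]. rewrite Cmod_opp.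
assert (H1 := HK z Hz). assert (H2 := HK z' Hz'). assert (H3 := cps_lip x z z' K Hz Hz').
assert (wnrm x K * Cmod (z - z') <= eps / 3).
{ apply Rle_trans with ((wnrm x K + 1) * (eps / 3 / (wnrm x K + 1))); [|right; field; lra].
  apply Rmult_le_compat; auto using Cmod_ge_0; lra. }
lra.
Qed.

Lemma ev_tail_pow x B z J : l1 x B -> Cmod z <= 1 -> Cmod (ev x z - cps x z J) <= Cmod z ^ J * B.
Proof.
intros Hx Hz. apply le_epsilon. intros e He.
destruct (ev_cconv x B z Hx Hz e He) as [K0 HK0]. set (K := Nat.max K0 J). specialize (HK0 K ltac:(lia)).
replace (ev x z - cps x z J)%C with ((cps x z K - cps x z J) + (ev x z - cps x z K))%C by ring.
eapply Rle_trans; [apply Cmod_triangle|]. apply Rplus_le_compat; auto.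
assert (H : Cmod (cps x z K - cps x z J) <= Cmod z ^ J * (nrm x K - nrm x J)).
{ assert (HJK : (J <= K)%nat) by lia. clear HK0. induction HJK as [|K1 HJK IH].
  - replace (_ - _)%C with (RtoC 0) by ring. rewrite Cmod_0. lra.
  - replace (cps x z (S K1) - cps x z J)%C with ((cps x z K1 - cps x z J) + x K1 * z ^ K1)%C by (unfold cps; simpl; ring).
    eapply Rle_trans; [apply Cmod_triangle|]. rewrite Cmod_mult, Cmod_pow.
    replace (nrm x (S K1)) with (nrm x K1 + Cmod (x K1)) by reflexivity.
    assert (Cmod z ^ K1 <= Cmod z ^ J).
    { replace K1 with (J + (K1 - J))%nat by lia. rewrite pow_add. rewrite <- (Rmult_1_r (Cmod z ^ J)) at 2.
      apply Rmult_le_compat_l; [apply pow_le, Cmod_ge_0|]. rewrite <- (pow1 (K1 - J)). apply pow_incr. split; auto using Cmod_ge_0. }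
    assert (Cmod (x K1) * Cmod z ^ K1 <= Cmod (x K1) * Cmod z ^ J) by (apply Rmult_le_compat_l; auto using Cmod_ge_0). lra. }
eapply Rle_trans; [exact H|]. apply Rmult_le_compat_l; [apply pow_le, Cmod_ge_0|].
assert (H1 := nrm_ge0 x J). specialize (Hx K). lra.
Qed.

Lemma weighted_tail x B Bw z J : l1 x B -> w1 x Bw -> Cmod z <= 1 -> INR J * Cmod (ev x z - cps x z J) <= Bw.
Proof.
intros Hx Hw Hz. destruct J as [|J]. { simpl INR. rewrite Rmult_0_l. eapply Rle_trans; [apply (wnrm_ge0 x 0)|apply Hw]. }
assert (HJ : 0 < INR (S J)) by (apply lt_0_INR; lia). rewrite Rmult_comm. apply Rle_div_r; auto.
apply ev_approx with B; auto. intros K HK. apply Rle_div_r; auto.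
assert (H : (nrm x K - nrm x (S J)) * INR (S J) <= wnrm x K - wnrm x (S J)).
{ induction HK as [|K HK IH]; [lra|]. unfold nrm, wnrm in *. set (j := S J) in *. cbn [psum].
  assert (INR j * Cmod (x K) <= INR K * Cmod (x K)) by (apply Rmult_le_compat_r; [apply Cmod_ge_0|apply le_INR; lia]). lra. }
assert (H1 := wnrm_ge0 x (S J)). specialize (Hw K). lra.
Qed.

(** The coefficients of x(z) / (z - a), by division starting from the constant term. If x vanishes
    at a, the partial sum is minus the tail of the series, which is how these coefficients are
    bounded. *)
Definition quot (x : nat -> C) (a : C) (k : nat) : C := (- (cps x a (S k)) / a ^ (S k))%C.

Lemma quot_eq x (a : C) k : a <> 0%C -> x k = (sh (quot x a) k + (- a) * quot x a k)%C.
Proof.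
intros Ha. assert (Hp : forall j, (a ^ j)%C <> 0%C).
{ intros j. apply Cmod_gt_0. rewrite Cmod_pow. apply pow_lt. now apply Cmod_gt_0. }
unfold quot. destruct k as [|k].
- unfold cps. simpl. field. exact Ha.
- change (sh (fun k0 => - cps x a (S k0) / a ^ S k0)%C (S k)) with (- cps x a (S k) / a ^ S k)%C.
  change (cps x a (S (S k))) with (cps x a (S k) + x (S k) * a ^ S k)%C.
  change (a ^ S (S k))%C with (a * a ^ S k)%C. field. split; auto.
Qed.

Lemma quot_coef_le x (a : C) k : a <> 0%C -> Cmod (quot x a k) <= Cmod (x (S k)) + Cmod a * Cmod (quot x a (S k)).
Proof.
intros Ha. assert (H := quot_eq x a (S k) Ha). change (sh (quot x a) (S k)) with (quot x a k) in H.
replace (quot x a k) with (x (S k) + a * quot x a (S k))%C at 1 by (rewrite H; ring).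
eapply Rle_trans; [apply Cmod_triangle|]. rewrite Cmod_mult. lra.
Qed.

Lemma quot_ev x (a z : C) A B : l1 x B -> l1 (quot x a) A -> a <> 0%C -> Cmod z <= 1 -> ev x z = ((z - a) * ev (quot x a) z)%C.
Proof.
intros Hx HA Ha Hz. rewrite (ev_ext x (fun k => (sh (quot x a) k + (- a) * quot x a k)%C)) by (intros; now apply quot_eq).
rewrite (ev_plus _ _ A (Cmod (- a) * A)); auto.
- rewrite (ev_sh _ A), (ev_scal _ _ A); auto. ring.
- now apply l1_sh.
- now apply l1_scal.
Qed.

Lemma quot_bound x (a : C) k B : l1 x B -> a <> 0%C -> Cmod a <= 1 -> ev x a = 0%C -> Cmod (quot x a k) <= B.
Proof.
intros Hx Ha Ha1 H0. assert (H := ev_tail_pow x B a (S k) Hx Ha1). rewrite H0 in H.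
assert (Hp : 0 < Cmod a ^ S k) by (apply pow_lt; now apply Cmod_gt_0).
unfold quot. rewrite Cmod_div.
- rewrite Cmod_opp, Cmod_pow. apply Rle_div_l; auto. replace (0 - cps x a (S k))%C with (- cps x a (S k))%C in H by ring. rewrite Cmod_opp in H. lra.
- apply Cmod_gt_0. now rewrite Cmod_pow.
Qed.

(** Summing |q_k| <= |x_(k+1)| + |a| |q_(k+1)| allows the right side to be absorbed because |a| < 1;
    the one boundary term is bounded by B. *)
Lemma quot_l1_inside x (a : C) B : l1 x B -> a <> 0%C -> Cmod a < 1 -> ev x a = 0%C -> l1 (quot x a) (2 * B / (1 - Cmod a)).
Proof.
intros Hx Ha Ha1 H0 K.
assert (H : nrm (quot x a) K <= nrm x (S K) + Cmod a * (nrm (quot x a) K + Cmod (quot x a K))).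
{ induction K as [|K IH].
  - unfold nrm; simpl. assert (H1 := Cmod_ge_0 (x O)). assert (H2 := Cmod_ge_0 (quot x a 0)). assert (H3 := Cmod_ge_0 a). nra.
  - assert (H1 := quot_coef_le x a K Ha). unfold nrm in *. cbn [psum] in *. lra. }
assert (H1 := quot_bound x a K B Hx Ha ltac:(lra) H0). specialize (Hx (S K)).
assert (H2 := Cmod_ge_0 (quot x a K)). assert (H3 := Cmod_ge_0 a). apply Rle_div_r; [lra|]. nra.
Qed.

(** On the circle nothing can be absorbed. Summation by parts leaves the weighted norm of x and a
    boundary term K |q_K|, itself controlled by the weighted tail. Here a resonance costs a second
    moment. *)
Lemma quot_l1_boundary x (a : C) B Bw : l1 x B -> w1 x Bw -> Cmod a = 1 -> ev x a = 0%C -> l1 (quot x a) (2 * Bw).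
Proof.
intros Hx Hw Ha1 H0 K. assert (Ha : a <> 0%C) by (apply Cmod_gt_0; lra).
assert (H : nrm (quot x a) K <= wnrm x (S K) + INR K * Cmod (quot x a K)).
{ induction K as [|K IH].
  - unfold nrm, wnrm; simpl. lra.
  - assert (H1 := quot_coef_le x a K Ha). rewrite Ha1, Rmult_1_l in H1. unfold nrm, wnrm in *. set (X := psum (fun k => INR k * Cmod (x k)) (S K)) in *. cbn [psum] in *. fold X.
    change (psum (fun k : nat => INR k * Cmod (x k)) K + INR K * Cmod (x K)) with X.
    rewrite S_INR. assert (0 <= INR K) by apply pos_INR.
    assert (INR K * Cmod (quot x a K) <= INR K * (Cmod (x (S K)) + Cmod (quot x a (S K)))) by (apply Rmult_le_compat_l; auto). lra. }
assert (H1 := weighted_tail x B Bw a (S K) Hx Hw ltac:(lra)). rewrite H0 in H1.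
assert (H2 : Cmod (quot x a K) = Cmod (0 - cps x a (S K))%C).
{ unfold quot. rewrite Cmod_div. - rewrite Cmod_pow, Ha1, pow1, Cmod_opp. replace (0 - cps x a (S K))%C with (- cps x a (S K))%C by ring. rewrite Cmod_opp. field.
  - apply Cmod_gt_0. rewrite Cmod_pow, Ha1, pow1. lra. }
rewrite <- H2, S_INR in H1. assert (H3 := Cmod_ge_0 (quot x a K)). specialize (Hw (S K)). lra.
Qed.

Lemma is_derive_Re_expi (d : C) (k : R) t : is_derive (fun t => Re (d * expi (k * t))%C) t (Re (d * (Ci * k) * expi (k * t))%C).
Proof.
unfold expi, Re, Cmult; simpl. auto_derive; [exact I|]. ring.
Qed.

Lemma is_RInt_mode (d : C) k : is_RInt (fun t => Re (d * expi t ^ (S k))%C) (- PI) PI 0.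
Proof.
assert (Hk : INR (S k) <> 0) by (apply not_0_INR; lia).
assert (HkC : RtoC (INR (S k)) <> 0%C) by (intros E; apply Hk; now apply RtoC_inj).
assert (HCi : Ci <> 0%C) by (intros E; apply (f_equal fst) in E as E1; apply (f_equal snd) in E; simpl in E, E1; lra).
set (d' := (d / (Ci * INR (S k)))%C).
assert (H : is_RInt (fun t => Re (d' * (Ci * INR (S k)) * expi (INR (S k) * t))%C) (- PI) PI
  (minus (Re (d' * expi (INR (S k) * PI))%C) (Re (d' * expi (INR (S k) * - PI))%C))).
{ apply (is_RInt_derive (fun t => Re (d' * expi (INR (S k) * t))%C)).
  - intros x _. apply is_derive_Re_expi.
  - intros x _. eapply is_derive_cont. apply is_derive_Re_expi. }
replace (minus (Re (d' * expi (INR (S k) * PI))%C) (Re (d' * expi (INR (S k) * - PI))%C)) with 0 in H.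
- apply (is_RInt_ext (fun t => Re (d' * (Ci * INR (S k)) * expi (INR (S k) * t))%C)); auto.
  intros x _. f_equal. rewrite expi_pow. unfold d'. field. split; auto.
- assert (Hs : sin (INR (S k) * PI) = 0) by (apply sin_eq_0_1; exists (Z.of_nat (S k)); now rewrite INR_IZR_INZ).
  replace (INR (S k) * - PI) with (- (INR (S k) * PI)) by ring. set (y := INR (S k) * PI) in *.
  unfold expi. rewrite cos_neg, sin_neg, Hs. unfold Re, Cmult, minus, plus, opp; simpl. ring.
Qed.

Lemma is_RInt_cps (c : C) x K : is_RInt (fun t => Re (c * cps x (expi t) (S K))%C) (- PI) PI (2 * PI * Re (c * x O)%C).
Proof.
induction K as [|K IH].
- apply (is_RInt_ext (fun t => Re (c * x O)%C)).
  + intros t _. f_equal. unfold cps. simpl. ring.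
  + replace (2 * PI * Re (c * x O)%C) with (scal (PI - - PI) (Re (c * x O)%C)) by (unfold scal; simpl; unfold mult; simpl; ring).
    apply (is_RInt_const (V := R_NormedModule)).
- apply (is_RInt_ext (fun t => plus (Re (c * cps x (expi t) (S K))%C) (Re (c * x (S K) * expi t ^ S K)%C))).
  + intros t _. transitivity (Re (c * cps x (expi t) (S K) + c * x (S K) * expi t ^ S K)%C); [reflexivity|].
    replace (c * cps x (expi t) (S K) + c * x (S K) * expi t ^ S K)%C with (c * cps x (expi t) (S (S K)))%C; [reflexivity|].
    change (cps x (expi t) (S (S K))) with (cps x (expi t) (S K) + x (S K) * expi t ^ S K)%C. ring.
  + replace (2 * PI * Re (c * x O)%C) with (plus (2 * PI * Re (c * x O)%C) 0) by (unfold plus; simpl; ring).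
    apply (is_RInt_plus (V := R_NormedModule)); auto. apply is_RInt_mode.
Qed.

Lemma mean_value_ineq x B S0 : l1 x B -> (forall z, Cmod z = 1 -> Cmod (ev x z) <= S0) -> Cmod (x O) <= S0.
Proof.
intros Hx HS. assert (HP := PI_RGT_0).
destruct (Req_dec (Cmod (x O)) 0) as [E|E].
{ rewrite E. eapply Rle_trans; [apply Cmod_ge_0|apply (HS 1%C Cmod_1)]. }
assert (E0 : 0 < Cmod (x O)) by (assert (H := Cmod_ge_0 (x O)); lra).
apply le_epsilon. intros eps He. destruct (ev_unif x B Hx eps He) as [K HK].
specialize (HK (S K) ltac:(lia)).
(* The unimodular c rotates [x O] to the positive axis, so that an integral of real parts
   suffices. *)
set (c := (Cconj (x O) / Cmod (x O))%C).
assert (Hcn : RtoC (Cmod (x O)) <> 0%C) by (intros E1; apply E; now apply RtoC_inj).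
assert (Hc : Cmod c = 1).
{ unfold c. rewrite Cmod_div by auto. rewrite Cmod_conj, Cmod_R, Rabs_right by lra. field. lra. }
assert (Hcx : Re (c * x O)%C = Cmod (x O)).
{ unfold c. replace (Cconj (x O) / Cmod (x O) * x O)%C with (RtoC (Cmod (x O))); [reflexivity|].
  transitivity (RtoC (Cmod (x O) ^ 2) / Cmod (x O))%C.
  - rewrite RtoC_pow. simpl. field. auto.
  - rewrite Cmod2_conj. field. auto. }
assert (H := is_RInt_cps c x K). rewrite Hcx in H.
assert (Hb : 2 * PI * Cmod (x O) <= scal (PI - - PI) (S0 + eps)).
{ apply (is_RInt_le (fun t => Re (c * cps x (expi t) (S K))%C) (fun _ => S0 + eps) (- PI) PI); auto; try lra.
  - apply (is_RInt_const (V := R_NormedModule)).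
  - intros t _. eapply Rle_trans; [apply Rle_abs|]. eapply Rle_trans; [apply re_le_Cmod|].
    rewrite Cmod_mult, Hc, Rmult_1_l.
    replace (cps x (expi t) (S K)) with (ev x (expi t) - (ev x (expi t) - cps x (expi t) (S K)))%C by ring.
    unfold Cminus at 1. eapply Rle_trans; [apply Cmod_triangle|]. rewrite Cmod_opp.
    apply Rplus_le_compat; [apply HS, Cmod_expi|apply HK; rewrite Cmod_expi; lra]. }
unfold scal in Hb; simpl in Hb; unfold mult in Hb; simpl in Hb. nra.
Qed.

Lemma unit_expi z : Cmod z = 1 -> exists t, - PI <= t <= PI /\ z = expi t.
Proof.
intros H. destruct z as [x y].
assert (Hxy : x * x + y * y = 1).
{ assert (H1 := Cmod2_alt (x, y)). rewrite H in H1. simpl in H1. lra. }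
assert (Hx : -1 <= x <= 1) by nra.
assert (Hb := acos_bound x).
destruct (Rle_dec 0 y).
- exists (acos x). split; [lra|]. unfold expi. rewrite cos_acos, sin_acos by lra. f_equal.
  replace (1 - x²) with (y * y) by (unfold Rsqr; lra). symmetry. now apply sqrt_square.
- exists (- acos x). split; [lra|]. unfold expi. rewrite cos_neg, sin_neg, cos_acos, sin_acos by lra. f_equal.
  replace (1 - x²) with ((- y) * (- y)) by (unfold Rsqr; lra). rewrite sqrt_square by lra. ring.
Qed.

(** The gauge chosen at each point is at once a radius and a lower bound for |x(z)| within that
    radius; at a point outside the disc it is a radius too small to meet the disc. Compactness of
    the square makes the gauge uniform. *)
Lemma disc_lower_bound x B : l1 x B -> (forall z, Cmod z <= 1 -> ev x z <> 0%C) -> exists c, 0 < c /\ forall z, Cmod z <= 1 -> c <= Cmod (ev x z).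
Proof.
intros Hx Hn.
assert (H : forall u v : R, exists d : posreal, forall z, Rabs (Re z - u) < d -> Rabs (Im z - v) < d -> Cmod z <= 1 -> d <= Cmod (ev x z)).
{ intros u v. set (z0 := (u, v) : C).
  assert (Hz0 : forall d z, Rabs (Re z - u) < d -> Rabs (Im z - v) < d -> Cmod (z - z0) < 2 * d).
  { intros d z H1 H2. eapply Rle_lt_trans; [apply Cmod_le_ReIm|]. unfold z0. simpl. unfold Re, Im in *. unfold Rminus in *. lra. }
  destruct (Rle_dec (Cmod z0) 1) as [H1|H1].
  - assert (Hp : 0 < Cmod (ev x z0)) by (apply Cmod_gt_0; auto).
    destruct (ev_uc x B Hx (Cmod (ev x z0) / 2) ltac:(lra)) as [d [Hd Huc]].
    assert (Hm : 0 < Rmin (d / 2) (Cmod (ev x z0) / 2)) by (apply Rmin_glb_lt; lra).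
    exists (mkposreal _ Hm). simpl. intros z Hr Hi Hz. eapply Rle_trans; [apply Rmin_r|].
    assert (Hmm := Rmin_l (d / 2) (Cmod (ev x z0) / 2)).
    assert (Hzz : Cmod (z - z0) < d) by (specialize (Hz0 _ z Hr Hi); lra).
    specialize (Huc z0 z H1 Hz). rewrite <- Cmod_opp in Hzz. replace (- (z - z0))%C with (z0 - z)%C in Hzz by ring. specialize (Huc Hzz).
    replace (ev x z0) with ((ev x z0 - ev x z) + ev x z)%C in Huc at 2 by ring.
    assert (Ht := Cmod_triangle (ev x z0 - ev x z) (ev x z)).
    replace (ev x z0 - ev x z + ev x z)%C with (ev x z0) in * by ring. lra.
  - assert (Hm : 0 < (Cmod z0 - 1) / 2) by lra. exists (mkposreal _ Hm). simpl. intros z Hr Hi Hz.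
    specialize (Hz0 _ z Hr Hi). exfalso.
    assert (Ht := Cmod_triangle (z0 - z) z). replace (z0 - z + z)%C with z0 in Ht by ring.
    rewrite <- Cmod_opp in Hz0. replace (- (z - z0))%C with (z0 - z)%C in Hz0 by ring. lra. }
destruct (compactness_value_2d (-1) 1 (-1) 1 (fun u v => proj1_sig (constructive_indefinite_description _ (H u v)))) as [d Hd].
exists d. split; [apply cond_pos|]. intros z Hz.
assert (Hr := re_le_Cmod z). assert (Hi := im_le_Cmod z).
assert (Hr1 : -1 <= Re z <= 1) by (apply Rabs_le_between; lra). assert (Hi1 : -1 <= Im z <= 1) by (apply Rabs_le_between; lra).
apply Rnot_lt_le. intros Hlt. apply (Hd (Re z) (Im z) Hr1 Hi1). intros [u [v [_ [_ [H1 [H2 H3]]]]]].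
destruct (constructive_indefinite_description _ (H u v)) as [d' Hd']. simpl in *.
specialize (Hd' z H1 H2 Hz). lra.
Qed.

Lemma circle_lower_bound x B : l1 x B -> (forall z, Cmod z = 1 -> ev x z <> 0%C) -> exists c, 0 < c /\ forall z, Cmod z = 1 -> c <= Cmod (ev x z).
Proof.
intros Hx Hn. assert (HP := PI_RGT_0).
destruct (continuity_ab_min (fun t => Cmod (ev x (expi t))) (- PI) PI ltac:(lra)) as [t0 [Hmin Ht0]].
- intros t _. intros eps He. destruct (ev_uc x B Hx (eps / 2) ltac:(lra)) as [d [Hd Huc]].
  exists (d / 2). split; [lra|]. intros t' [_ Ht']. simpl in *. unfold Rdist in *.
  assert (Hlip : Cmod (expi t' - expi t) < d).
  { eapply Rle_lt_trans; [apply Cmod_le_ReIm|]. simpl.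
    assert (Hab : forall a b, a <= b -> Rabs (cos b - cos a) <= b - a /\ Rabs (sin b - sin a) <= b - a).
    { intros a b Hab. split.
      - apply (derive_compare cos (fun t => - sin t) (fun t => t) (fun _ => 1)); auto.
        + intros; apply is_derive_cos.
        + intros; apply (is_derive_id (K := R_AbsRing)).
        + intros y _. rewrite Rabs_Ropp. apply Rabs_le, SIN_bound.
      - apply (derive_compare sin cos (fun t => t) (fun _ => 1)); auto.
        + intros; apply is_derive_sin.
        + intros; apply (is_derive_id (K := R_AbsRing)).
        + intros y _. apply Rabs_le, COS_bound. }
    destruct (Rle_dec t t') as [Hl|Hl].
    - destruct (Hab t t' Hl) as [A1 A2]. rewrite Rabs_right in Ht' by lra. unfold Rminus in *. lra.
    - destruct (Hab t' t ltac:(lra)) as [A1 A2]. rewrite Rabs_left in Ht' by lra.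
      rewrite Rabs_minus_sym in A1. rewrite Rabs_minus_sym in A2. unfold Rminus in *. lra. }
  specialize (Huc (expi t') (expi t) ltac:(rewrite Cmod_expi; lra) ltac:(rewrite Cmod_expi; lra) Hlip).
  assert (T1 := Cmod_triangle (ev x (expi t') - ev x (expi t)) (ev x (expi t))).
  assert (T2 := Cmod_triangle (- (ev x (expi t') - ev x (expi t))) (ev x (expi t'))).
  replace (ev x (expi t') - ev x (expi t) + ev x (expi t))%C with (ev x (expi t')) in T1 by ring.
  replace (- (ev x (expi t') - ev x (expi t)) + ev x (expi t'))%C with (ev x (expi t)) in T2 by ring.
  rewrite Cmod_opp in T2. apply Rabs_def1; lra.
- exists (Cmod (ev x (expi t0))). split.
  + apply Cmod_gt_0. apply Hn. apply Cmod_expi.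
  + intros z Hz. destruct (unit_expi z Hz) as [t [Ht ->]]. now apply Hmin.
Qed.

(** * Blaschke factorisation *)

Fixpoint lprod (f : C -> C) (l : list C) : C :=
  match l with nil => 1%C | a :: l => (f a * lprod f l)%C end.

Lemma lprod_neq_0 (f : C -> C) l : (forall a, In a l -> f a <> 0%C) -> lprod f l <> 0%C.
Proof.
induction l as [|a l IH]; intros H; simpl.
- intros E. apply RtoC_inj in E. lra.
- apply Cmult_neq_0; [apply H; now left|apply IH; intros; apply H; now right].
Qed.

Lemma one_minus_conj_neq0 (a z : C) : Cmod a < 1 -> Cmod z <= 1 -> (1 - Cconj a * z)%C <> 0%C.
Proof.
intros Ha Hz E. assert (H : (Cconj a * z)%C = 1%C) by (replace (Cconj a * z)%C with (1 - (1 - Cconj a * z))%C by ring; rewrite E; ring).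
assert (H1 : Cmod (Cconj a * z) = 1) by (rewrite H; apply Cmod_1). rewrite Cmod_mult, Cmod_conj in H1.
assert (H2 := Cmod_ge_0 a). assert (H3 := Cmod_ge_0 z). nra.
Qed.

Lemma blaschke_factor_mod (a z : C) : Cmod z = 1 -> Cmod (1 - Cconj a * z) = Cmod (z - a).
Proof.
intros Hz. assert (Hzz : (z * Cconj z)%C = 1%C).
{ rewrite <- Cmod2_conj, Hz. f_equal. ring. }
replace (1 - Cconj a * z)%C with (z * Cconj (z - a))%C.
- rewrite Cmod_mult, Cmod_conj, Hz. ring.
- rewrite Cminus_conj. rewrite <- Hzz. ring.
Qed.

(** u is x divided by the Blaschke factors (z - a) / (1 - conj a z) for a in l, written without
    denominators. These factors are unimodular on the circle and keep |u| = |x| there, whereas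
    dividing out a zero of modulus at most s multiplies |u(0)| by at least 1/s. *)
Definition chain (x : nat -> C) (s : R) (l : list C) (u : nat -> C) : Prop :=
  (exists B, l1 u B) /\ (forall a, In a l -> 0 < Cmod a < 1) /\
  (forall z, Cmod z <= 1 -> (ev x z * lprod (fun a => 1 - Cconj a * z) l)%C = (ev u z * lprod (fun a => z - a) l)%C) /\
  (forall z, Cmod z = 1 -> Cmod (ev u z) = Cmod (ev x z)) /\
  Cmod (x O) <= s ^ (length l) * Cmod (u O).

Lemma chain_step x B s l u (a : C) : l1 x B -> 0 < s < 1 -> x O <> 0%C -> (forall z, Cmod z = 1 -> ev x z <> 0%C) ->
  (forall z, Cmod z <= 1 -> ev x z = 0%C -> Cmod z <= s) ->
  chain x s l u -> Cmod a <= 1 -> ev u a = 0%C -> exists u', chain x s (a :: l) u'.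
Proof.
intros Hx Hs Hx0 Hcirc Hzero [[Bu Hu] [Hl [He [Hm H0]]]] Ha Hua.
assert (Hax : ev x a = 0%C).
{ assert (E := He a Ha). rewrite Hua, Cmult_0_l in E. apply NNPP. intros Hn.
  apply (Cmult_neq_0 _ _ Hn (lprod_neq_0 (fun b => 1 - Cconj b * a)%C l ltac:(intros b Hb; apply one_minus_conj_neq0; auto; apply Hl; auto))). exact E. }
assert (Has : Cmod a <= s) by (apply Hzero; auto).
assert (Hu0 : u O <> 0%C).
{ intros E. rewrite E, Cmod_0 in H0. apply Cmod_gt_0 in Hx0. lra. }
assert (Ha0 : a <> 0%C) by (intros ->; rewrite (ev_0 u Bu Hu) in Hua; auto).
set (v := quot u a).
assert (Hv : l1 v (2 * Bu / (1 - Cmod a))) by (apply quot_l1_inside; auto; lra).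
set (Bv := 2 * Bu / (1 - Cmod a)) in *.
assert (L2 : l1 (fun k => (- Cconj a * sh v k)%C) (Cmod (- Cconj a) * Bv)) by (apply l1_scal; now apply l1_sh).
assert (L3 := l1_plus _ _ _ _ Hv L2).
assert (Ev : forall z, Cmod z <= 1 -> ev (fun k => (v k + - Cconj a * sh v k)%C) z = ((1 - Cconj a * z) * ev v z)%C).
{ intros z Hz. rewrite (ev_plus _ _ _ _ z Hv L2 Hz), (ev_scal _ _ Bv), (ev_sh _ Bv); auto; [ring|now apply l1_sh]. }
assert (Eu : forall z, Cmod z <= 1 -> ev u z = ((z - a) * ev v z)%C) by (intros z Hz; now apply (quot_ev u a z Bv Bu)).
exists (fun k => (v k + - Cconj a * sh v k)%C).
split; [|split; [|split; [|split]]].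
- eexists. exact L3.
- intros b [<-|Hb]; [|now apply Hl]. split; [now apply Cmod_gt_0|lra].
- intros z Hz. simpl. rewrite Ev by auto.
  transitivity ((1 - Cconj a * z) * (ev x z * lprod (fun b => (1 - Cconj b * z)%C) l))%C; [ring|]. rewrite He, Eu by auto. ring.
- intros z Hz. rewrite <- Hm by auto. rewrite Ev, Eu by lra. rewrite !Cmod_mult, blaschke_factor_mod; auto.
- simpl. assert (Hv0 : u O = (- a * v O)%C) by (assert (E := quot_eq u a 0 Ha0); simpl in E; rewrite E; fold v; ring).
  replace (v O + - Cconj a * 0)%C with (v O) by ring.
  rewrite Hv0, Cmod_mult, Cmod_opp in H0. eapply Rle_trans; [exact H0|].
  assert (Hv0' := Cmod_ge_0 (v O)). assert (Hpow : 0 <= s ^ length l) by (apply pow_le; lra).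
  replace (s * s ^ length l * Cmod (v O)) with (s ^ length l * (s * Cmod (v O))) by ring.
  apply Rmult_le_compat_l; auto. apply Rmult_le_compat_r; auto.
Qed.

(** A chain of length k gives |x(0)| <= s^k |u(0)| <= s^k B, by the mean value inequality for u and
    |u| = |x| on the circle. Since x(0) is not 0, chains cannot be arbitrarily long, so at some
    stage u has no zero in the closed disc and compactness bounds it below. *)
Lemma blaschke_factorisation x B : l1 x B -> x O <> 0%C -> (forall z, Cmod z = 1 -> ev x z <> 0%C) ->
  exists (l : list C) (u : nat -> C), (exists Bu, l1 u Bu) /\ (forall a, In a l -> 0 < Cmod a < 1) /\
  (forall z, Cmod z <= 1 -> (ev x z * lprod (fun a => 1 - Cconj a * z) l)%C = (ev u z * lprod (fun a => z - a) l)%C) /\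
  (exists c, 0 < c /\ forall z, Cmod z <= 1 -> c <= Cmod (ev u z)).
Proof.
intros Hx Hx0 Hcirc.
assert (Hs : exists s, 0 < s < 1 /\ forall z, Cmod z <= 1 -> ev x z = 0%C -> Cmod z <= s).
{ destruct (circle_lower_bound x B Hx Hcirc) as [c [Hc Hcb]].
  destruct (ev_uc x B Hx (c / 2) ltac:(lra)) as [d [Hd Huc]].
  (* A zero of modulus above 1 - d/2 would be within d of its radial projection on the circle, where
     |x| >= c. *)
  set (s := Rmax (1 / 2) (1 - d / 2)). assert (Hs1 := Rmax_l (1 / 2) (1 - d / 2)). assert (Hs2 := Rmax_r (1 / 2) (1 - d / 2)). fold s in Hs1, Hs2.
  exists s. split; [split; [lra|apply Rmax_lub_lt; lra]|].
  intros z Hz Hz0. apply Rnot_lt_le. intros Hlt.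
  assert (Hzp : 0 < Cmod z) by lra. assert (Hzn : RtoC (Cmod z) <> 0%C) by (intros E; apply RtoC_inj in E; lra).
  assert (Hz1 : Cmod (z / Cmod z)%C = 1) by (rewrite Cmod_div, Cmod_R, Rabs_right by (auto; lra); field; lra).
  assert (Hdist : Cmod (z / Cmod z - z)%C < d).
  { replace (z / Cmod z - z)%C with (z / Cmod z * (RtoC (1 - Cmod z)))%C.
    - rewrite Cmod_mult, Hz1, Cmod_R, Rabs_right by lra. lra.
    - rewrite RtoC_minus. field. auto. }
  specialize (Huc _ _ ltac:(rewrite Hz1; lra) Hz Hdist). specialize (Hcb _ Hz1). rewrite Hz0 in Huc.
  replace (ev x (z / Cmod z) - 0)%C with (ev x (z / Cmod z)%C) in Huc by ring. lra. }
destruct Hs as [s [Hs Hzero]].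
apply NNPP. intros Hno.
assert (Hall : forall k, exists l u, length l = k /\ chain x s l u).
{ induction k as [|k [l [u [Hk Hch]]]].
  - exists nil, x. split; auto. split; [now exists B|]. split; [intros a []|]. split; [intros; reflexivity|]. split; [auto|]. simpl. lra.
  - assert (Hz : exists a, Cmod a <= 1 /\ ev u a = 0%C).
    { apply NNPP. intros Hn. apply Hno. destruct Hch as [[Bu Hu] [Hl [He _]]]. exists l, u. split; [now exists Bu|]. split; auto. split; auto.
      apply (disc_lower_bound u Bu Hu). intros z Hz E. apply Hn. now exists z. }
    destruct Hz as [a [Ha Hua]]. destruct (chain_step x B s l u a Hx Hs Hx0 Hcirc Hzero Hch Ha Hua) as [u' Hu'].
    exists (a :: l), u'. split; [simpl; now rewrite Hk|auto]. }
assert (Hx0' : 0 < Cmod (x O)) by now apply Cmod_gt_0.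
assert (HB : 0 <= B) by (apply l1_ge0 with x; auto).
destruct (pow_lt_1_zero s ltac:(rewrite Rabs_right; lra) (Cmod (x O) / (B + 1))) as [k Hk].
{ apply Rdiv_lt_0_compat; lra. }
destruct (Hall k) as [l [u [Hl [[Bu Hu] [_ [_ [Hm H0]]]]]]]. rewrite Hl in H0.
specialize (Hk k (Nat.le_refl _)). rewrite Rabs_right in Hk by (apply Rle_ge, pow_le; lra).
assert (Hmv : Cmod (u O) <= B).
{ apply (mean_value_ineq u Bu B Hu). intros z Hz. rewrite Hm by auto. apply ev_bound; auto. lra. }
assert (s ^ k * Cmod (u O) <= s ^ k * (B + 1)) by (apply Rmult_le_compat_l; [apply pow_le; lra|lra]).
assert (s ^ k * (B + 1) < Cmod (x O) / (B + 1) * (B + 1)) by (apply Rmult_lt_compat_r; lra).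
replace (Cmod (x O) / (B + 1) * (B + 1)) with (Cmod (x O)) in * by (field; lra). lra.
Qed.

(** * Circular means of holomorphic functions *)

(* A quantitative C^{1,1} form of complex differentiability, stable under products and
   inverses, which makes the circular means quadratically close and hence constant. *)
Definition holo (D : C -> Prop) (f f1 : C -> C) : Prop :=
  exists K, 0 <= K /\ forall z z', D z -> D z' ->
    Cmod (f z) <= K /\ Cmod (f1 z) <= K /\ Cmod (f z' - f z - (z' - z) * f1 z) <= K * Cmod (z' - z) ^ 2.

Definition in_disc (D : C -> Prop) := forall z, D z -> Cmod z <= 1.

Lemma holo_const D c : holo D (fun _ => c) (fun _ => RtoC 0).
Proof.
exists (Cmod c). split; [apply Cmod_ge_0|]. intros z z' _ _. rewrite Cmod_0.
split; [lra|]. split; [apply Cmod_ge_0|]. replace (c - c - (z' - z) * 0)%C with (RtoC 0) by ring. rewrite Cmod_0.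
apply Rmult_le_pos; [apply Cmod_ge_0|apply pow2_ge_0].
Qed.

Lemma holo_id D : in_disc D -> holo D (fun z => z) (fun _ => RtoC 1).
Proof.
intros HD. exists 1. split; [lra|]. intros z z' Hz Hz'. rewrite Cmod_1. split; [now apply HD|]. split; [lra|].
replace (z' - z - (z' - z) * 1)%C with (RtoC 0) by ring. rewrite Cmod_0. rewrite Rmult_1_l. apply pow2_ge_0.
Qed.

Lemma holo_plus D f f1 g g1 : holo D f f1 -> holo D g g1 -> holo D (fun z => (f z + g z)%C) (fun z => (f1 z + g1 z)%C).
Proof.
intros [K [HK Hf]] [L [HL Hg]]. exists (K + L). split; [lra|]. intros z z' Hz Hz'.
destruct (Hf z z' Hz Hz') as [F1 [F2 F3]]. destruct (Hg z z' Hz Hz') as [G1 [G2 G3]].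
split; [eapply Rle_trans; [apply Cmod_triangle|lra]|]. split; [eapply Rle_trans; [apply Cmod_triangle|lra]|].
replace (f z' + g z' - (f z + g z) - (z' - z) * (f1 z + g1 z))%C with ((f z' - f z - (z' - z) * f1 z) + (g z' - g z - (z' - z) * g1 z))%C by ring.
eapply Rle_trans; [apply Cmod_triangle|]. lra.
Qed.

Lemma Cmod_diff_le2 D z z' : in_disc D -> D z -> D z' -> Cmod (z' - z) <= 2.
Proof.
intros HD Hz Hz'. unfold Cminus. eapply Rle_trans; [apply Cmod_triangle|]. rewrite Cmod_opp.
specialize (HD z Hz) as H1. specialize (HD z' Hz') as H2. lra.
Qed.

Lemma holo_lip D f f1 : in_disc D -> holo D f f1 -> exists K, 0 <= K /\ forall z z', D z -> D z' -> Cmod (f z' - f z) <= K * Cmod (z' - z).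
Proof.
intros HD [K [HK Hf]]. exists (3 * K). split; [lra|]. intros z z' Hz Hz'. destruct (Hf z z' Hz Hz') as [F1 [F2 F3]].
replace (f z' - f z)%C with ((f z' - f z - (z' - z) * f1 z) + (z' - z) * f1 z)%C by ring.
eapply Rle_trans; [apply Cmod_triangle|]. rewrite Cmod_mult.
assert (H := Cmod_diff_le2 D z z' HD Hz Hz'). assert (H0 := Cmod_ge_0 (z' - z)).
assert (Cmod (z' - z) * Cmod (f1 z) <= Cmod (z' - z) * K) by (apply Rmult_le_compat_l; auto).
assert (K * Cmod (z' - z) ^ 2 <= K * (2 * Cmod (z' - z))) by (apply Rmult_le_compat_l; nra). nra.
Qed.

Lemma holo_mult D f f1 g g1 : in_disc D -> holo D f f1 -> holo D g g1 ->
  holo D (fun z => (f z * g z)%C) (fun z => (f1 z * g z + f z * g1 z)%C).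
Proof.
intros HD Hf0 Hg0. destruct (holo_lip D g g1 HD Hg0) as [M [HM Hlip]].
destruct Hf0 as [K [HK Hf]]. destruct Hg0 as [L [HL Hg]].
exists (2 * (K * L) + K * M). assert (HKL : 0 <= K * L) by (apply Rmult_le_pos; auto). assert (HKM : 0 <= K * M) by (apply Rmult_le_pos; auto).
split; [lra|]. intros z z' Hz Hz'.
destruct (Hf z z' Hz Hz') as [F1 [F2 F3]]. destruct (Hg z z' Hz Hz') as [G1 [G2 G3]]. destruct (Hg z' z Hz' Hz) as [G4 _].
specialize (Hlip z z' Hz Hz').
split; [|split].
- rewrite Cmod_mult. assert (Cmod (f z) * Cmod (g z) <= K * L) by (apply Rmult_le_compat; auto using Cmod_ge_0). lra.
- eapply Rle_trans; [apply Cmod_triangle|]. rewrite !Cmod_mult.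
  assert (Cmod (f1 z) * Cmod (g z) <= K * L) by (apply Rmult_le_compat; auto using Cmod_ge_0).
  assert (Cmod (f z) * Cmod (g1 z) <= K * L) by (apply Rmult_le_compat; auto using Cmod_ge_0). lra.
- replace (f z' * g z' - f z * g z - (z' - z) * (f1 z * g z + f z * g1 z))%C with
   ((f z' - f z - (z' - z) * f1 z) * g z' + f z * (g z' - g z - (z' - z) * g1 z) + (z' - z) * f1 z * (g z' - g z))%C by ring.
  eapply Rle_trans; [apply Cmod_triangle|]. eapply Rle_trans; [apply Rplus_le_compat_r, Cmod_triangle|]. rewrite !Cmod_mult.
  set (h := Cmod (z' - z)) in *. assert (Hh : 0 <= h) by apply Cmod_ge_0.
  assert (Cmod (f z' - f z - (z' - z) * f1 z) * Cmod (g z') <= K * h ^ 2 * L) by (apply Rmult_le_compat; auto using Cmod_ge_0).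
  assert (Cmod (f z) * Cmod (g z' - g z - (z' - z) * g1 z) <= K * (L * h ^ 2)) by (apply Rmult_le_compat; auto using Cmod_ge_0).
  assert (h * Cmod (f1 z) * Cmod (g z' - g z) <= h * K * (M * h)).
  { apply Rmult_le_compat; auto using Cmod_ge_0. apply Rmult_le_pos; auto using Cmod_ge_0. apply Rmult_le_compat_l; auto. }
  nra.
Qed.

Lemma holo_inv D f f1 c : in_disc D -> holo D f f1 -> 0 < c -> (forall z, D z -> c <= Cmod (f z)) ->
  holo D (fun z => (/ f z)%C) (fun z => (- f1 z / (f z * f z))%C).
Proof.
intros HD Hf0 Hc Hlow. destruct (holo_lip D f f1 HD Hf0) as [M [HM Hlip]]. destruct Hf0 as [K [HK Hf]].
set (J := / c + K / c ^ 2 + (K * K + K * M) / c ^ 3).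
assert (H1 : 0 < / c) by now apply Rinv_0_lt_compat.
assert (H2 : 0 <= K / c ^ 2) by (apply Rdiv_le_0_compat; [auto|apply pow_lt; auto]).
assert (H3 : 0 <= (K * K + K * M) / c ^ 3) by (apply Rdiv_le_0_compat; [nra|apply pow_lt; auto]).
exists J. split; [unfold J; lra|]. intros z z' Hz Hz'.
destruct (Hf z z' Hz Hz') as [F1 [F2 F3]]. specialize (Hlip z z' Hz Hz').
assert (L1 := Hlow z Hz). assert (L2 := Hlow z' Hz').
assert (N1 : f z <> 0%C) by (apply Cmod_gt_0; lra). assert (N2 : f z' <> 0%C) by (apply Cmod_gt_0; lra).
assert (Hi : / Cmod (f z) <= / c) by (apply Rinv_le_contravar; auto).
assert (Hi' : / Cmod (f z') <= / c) by (apply Rinv_le_contravar; auto).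
assert (Hi0 : 0 < / Cmod (f z)) by (apply Rinv_0_lt_compat; lra). assert (Hi0' : 0 < / Cmod (f z')) by (apply Rinv_0_lt_compat; lra).
assert (Hff : / Cmod (f z) * / Cmod (f z) <= / c * / c) by (apply Rmult_le_compat; lra).
split; [|split].
- rewrite Cmod_inv by auto. unfold J. lra.
- unfold Cdiv. rewrite Cmod_mult, Cmod_opp, Cmod_inv by (now apply Cmult_neq_0). rewrite Cmod_mult, Rinv_mult.
  assert (Cmod (f1 z) * (/ Cmod (f z) * / Cmod (f z)) <= K * (/ c * / c)).
  { apply Rmult_le_compat; auto using Cmod_ge_0. nra. }
  replace (K * (/ c * / c)) with (K / c ^ 2) in H by (field; lra). unfold J. lra.
- replace (/ f z' - / f z - (z' - z) * (- f1 z / (f z * f z)))%C with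
   ((- (f z' - f z - (z' - z) * f1 z) * f z + (z' - z) * f1 z * (f z' - f z)) * (/ f z * / f z * / f z'))%C by (field; auto).
  rewrite Cmod_mult, !Cmod_mult, !Cmod_inv by auto. set (h := Cmod (z' - z)) in *. assert (Hh : 0 <= h) by apply Cmod_ge_0.
  apply Rle_trans with (((K * K + K * M) * h ^ 2) * (/ c * / c * / c)).
  + apply Rmult_le_compat; auto using Cmod_ge_0.
    * apply Rmult_le_pos; nra.
    * eapply Rle_trans; [apply Cmod_triangle|]. rewrite !Cmod_mult, Cmod_opp.
      assert (Cmod (f z' - f z - (z' - z) * f1 z) * Cmod (f z) <= K * h ^ 2 * K) by (apply Rmult_le_compat; auto using Cmod_ge_0).
      fold h. assert (h * Cmod (f1 z) * Cmod (f z' - f z) <= h * K * (M * h)).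
      { apply Rmult_le_compat; auto using Cmod_ge_0. apply Rmult_le_pos; auto using Cmod_ge_0. apply Rmult_le_compat_l; auto. }
      nra.
    * apply Rmult_le_compat; try lra. nra.
  + replace ((K * K + K * M) * h ^ 2 * (/ c * / c * / c)) with ((K * K + K * M) / c ^ 3 * h ^ 2) by (field; lra).
    apply Rmult_le_compat_r; [apply pow2_ge_0|]. unfold J. lra.
Qed.

Fixpoint dpow (z : C) (k : nat) : C := match k with O => 0%C | S k => (z * dpow z k + z ^ k)%C end.

Lemma Cmod_pow_le z r k : Cmod z <= r -> Cmod (z ^ k) <= r ^ k.
Proof. intros H. rewrite Cmod_pow. apply pow_incr. split; auto using Cmod_ge_0. Qed.

Lemma dpow_bound z r k : 0 < r -> Cmod z <= r -> r * Cmod (dpow z k) <= INR k * r ^ k.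
Proof.
intros Hr Hz. induction k as [|k IH]; [simpl; rewrite Cmod_0; lra|].
rewrite S_INR. change (dpow z (S k)) with (z * dpow z k + z ^ k)%C.
assert (H1 := Cmod_triangle (z * dpow z k) (z ^ k)). rewrite Cmod_mult in H1.
assert (H2 := Cmod_pow_le z r k Hz). assert (H3 := Cmod_ge_0 (dpow z k)).
assert (Cmod z * Cmod (dpow z k) <= r * Cmod (dpow z k)) by (apply Rmult_le_compat_r; auto).
simpl pow. assert (r * (r * Cmod (dpow z k)) <= r * (INR k * r ^ k)) by (apply Rmult_le_compat_l; lra).
assert (r * Cmod (z * dpow z k + z ^ k)%C <= r * (r * Cmod (dpow z k) + r ^ k)) by (apply Rmult_le_compat_l; lra). lra.
Qed.

Lemma pow_second_order z z' r k : 0 < r -> Cmod z <= r -> Cmod z' <= r ->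
  r ^ 2 * Cmod (z' ^ k - z ^ k - (z' - z) * dpow z k) <= INR k ^ 2 * r ^ k * Cmod (z' - z) ^ 2.
Proof.
intros Hr Hz Hz'. set (h := Cmod (z' - z)). assert (Hh : 0 <= h) by apply Cmod_ge_0.
induction k as [|k IH].
- simpl. replace (1 - 1 - (z' - z) * 0)%C with (RtoC 0) by ring. rewrite Cmod_0. lra.
- replace (z' ^ S k - z ^ S k - (z' - z) * dpow z (S k))%C with (z' * (z' ^ k - z ^ k - (z' - z) * dpow z k) + (z' - z) * (z' - z) * dpow z k)%C by (simpl; ring).
  set (E := (z' ^ k - z ^ k - (z' - z) * dpow z k)%C) in *.
  assert (H1 := Cmod_triangle (z' * E) ((z' - z) * (z' - z) * dpow z k)). rewrite !Cmod_mult in H1. fold h in H1.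
  assert (H2 := dpow_bound z r k Hr Hz). assert (H3 := Cmod_ge_0 E). assert (H4 := Cmod_ge_0 (dpow z k)).
  assert (Cmod z' * Cmod E <= r * Cmod E) by (apply Rmult_le_compat_r; auto).
  set (X := Cmod (z' * E + (z' - z) * (z' - z) * dpow z k)%C) in *.
  assert (A1 : r ^ 2 * X <= r ^ 2 * (r * Cmod E + h * h * Cmod (dpow z k))) by (apply Rmult_le_compat_l; [apply pow2_ge_0|lra]).
  assert (A2 : r * (r ^ 2 * Cmod E) <= r * (INR k ^ 2 * r ^ k * h ^ 2)) by (apply Rmult_le_compat_l; lra).
  assert (A3 : r * h ^ 2 * (r * Cmod (dpow z k)) <= r * h ^ 2 * (INR k * r ^ k)) by (apply Rmult_le_compat_l; auto; apply Rmult_le_pos; [lra|apply pow2_ge_0]).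
  rewrite S_INR. simpl pow in *. assert (A4 : 0 <= r * r ^ k * (h * h)) by (apply Rmult_le_pos; [apply Rmult_le_pos; [lra|apply pow_le; lra]|nra]).
  assert (A5 : 0 <= INR k) by apply pos_INR.
  assert (A6 : 0 <= (INR k + 1) * (r * r ^ k * (h * h))) by (apply Rmult_le_pos; lra). nra.
Qed.

(** Bernoulli's inequality for (1/s)^k with s^2 = r bounds k s^k, and the square of this bound is
    the claim. *)
Lemma sq_geom_bounded r : 0 < r < 1 -> exists M, 0 <= M /\ forall k, INR k ^ 2 * r ^ k <= M.
Proof.
intros Hr. set (s := sqrt r). assert (Hs : s * s = r) by (apply sqrt_sqrt; lra).
assert (Hs0 : 0 < s) by (apply sqrt_lt_R0; lra). assert (Hs1 : s < 1) by nra.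
set (d := / s - 1). assert (Hd : 0 < d).
{ unfold d. assert (1 < / s); [|lra]. rewrite <- Rinv_1. apply Rinv_lt_contravar; lra. }
exists ((/ d) ^ 2). split; [apply pow2_ge_0|]. intros k.
assert (H : INR k * s ^ k <= / d).
{ assert (Hp := poly k d Hd). replace (1 + d) with (/ s) in Hp by (unfold d; ring).
  rewrite pow_inv in Hp. assert (Hsk : 0 < s ^ k) by (apply pow_lt; auto).
  apply Rmult_le_reg_r with d; auto. rewrite Rinv_l by lra.
  assert (INR k * d <= / s ^ k) by lra.
  assert (s ^ k * (INR k * d) <= s ^ k * / s ^ k) by (apply Rmult_le_compat_l; lra). rewrite Rinv_r in H0 by lra. lra. }
assert (H0 : 0 <= INR k * s ^ k) by (apply Rmult_le_pos; [apply pos_INR|apply pow_le; lra]).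
rewrite <- Hs, Rpow_mult_distr. replace (INR k ^ 2 * (s ^ k * s ^ k)) with ((INR k * s ^ k) ^ 2) by ring.
apply pow_incr. lra.
Qed.

Definition dev (x : nat -> C) (z : C) : C := clim (fun K => csum (fun k => (x k * dpow z k)%C) K).

(** The second-order remainder of z^k is at most k^2 r^(k-2) |z' - z|^2, and k^2 r^k is bounded for
    r < 1. The remainders are summed against the coefficients at a finite order, with the limit
    taken afterwards. *)
Lemma holo_ev x B r : l1 x B -> 0 < r < 1 -> holo (fun z => Cmod z <= r) (ev x) (dev x).
Proof.
intros Hx Hr. assert (HB := l1_ge0 _ _ Hx). destruct (sq_geom_bounded r Hr) as [M [HM HMk]].
assert (Hdp : forall z k, Cmod z <= r -> Cmod (dpow z k) <= M / r).
{ intros z k Hz. apply Rle_div_r; [lra|]. rewrite Rmult_comm. eapply Rle_trans; [apply dpow_bound; auto; lra|].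
  eapply Rle_trans; [|apply (HMk k)]. apply Rmult_le_compat_r; [apply pow_le; lra|].
  destruct k as [|k]; [simpl; lra|]. assert (1 <= INR (S k)) by (rewrite S_INR; assert (H := pos_INR k); lra). nra. }
assert (Hcd : forall z J K, Cmod z <= r -> (J <= K)%nat -> Cmod (csum (fun k => (x k * dpow z k)%C) K - csum (fun k => (x k * dpow z k)%C) J) <= M / r * (nrm x K - nrm x J)).
{ intros z J K Hz HJK. eapply Rle_trans; [now apply csum_diff|].
  induction HJK as [|K HJK IH]; [lra|]. cbn [psum]. replace (nrm x (S K)) with (nrm x K + Cmod (x K)) by reflexivity.
  rewrite Cmod_mult. assert (H := Hdp z K Hz). assert (Cmod (x K) * Cmod (dpow z K) <= Cmod (x K) * (M / r)) by (apply Rmult_le_compat_l; auto using Cmod_ge_0). lra. }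
assert (HMr : 0 <= M / r) by (apply Rdiv_le_0_compat; lra).
assert (Hcv : forall z, Cmod z <= r -> cconv (fun K => csum (fun k => (x k * dpow z k)%C) K) (dev x z)).
{ intros z Hz. apply clim_cconv. intros eps He. destruct (l1_tail x B Hx (eps / (M / r + 1))) as [K0 HK0]. { apply Rdiv_lt_0_compat; lra. }
  exists K0. intros J K HJ HK. eapply Rle_trans; [now apply Hcd|].
  assert (H := HK0 J K HJ HK). assert (H1 := nrm_mono x J K HK).
  apply Rle_trans with ((M / r + 1) * (eps / (M / r + 1))); [apply Rmult_le_compat; lra|right; field; lra]. }
assert (HMB : 0 <= M / r * B) by (apply Rmult_le_pos; auto). assert (HMB2 : 0 <= M / r ^ 2 * B) by (apply Rmult_le_pos; auto; apply Rdiv_le_0_compat; [lra|apply pow_lt; lra]).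
exists (B + M / r * B + M / r ^ 2 * B). split; [lra|]. intros z z' Hz Hz'.
split; [|split].
- assert (H := ev_bound x B z Hx ltac:(lra)). lra.
- apply Rle_trans with (M / r * B); [|lra]. apply le_epsilon. intros e He.
  destruct (Hcv z Hz e He) as [K HK]. specialize (HK K (Nat.le_refl _)).
  replace (dev x z) with ((csum (fun k => (x k * dpow z k)%C) K - csum (fun k => (x k * dpow z k)%C) 0) + (dev x z - csum (fun k => (x k * dpow z k)%C) K))%C by (simpl; ring).
  eapply Rle_trans; [apply Cmod_triangle|]. apply Rplus_le_compat; auto. eapply Rle_trans; [apply Hcd; auto; lia|].
  apply Rmult_le_compat_l; auto. specialize (Hx K). unfold nrm at 2; simpl. lra.
- apply Rle_trans with (M / r ^ 2 * B * Cmod (z' - z) ^ 2).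
  2:{ apply Rmult_le_compat_r; [apply pow2_ge_0|lra]. }
  apply le_epsilon. intros e He.
  set (h := Cmod (z' - z)). assert (Hh : 0 <= h) by apply Cmod_ge_0.
  set (e' := e / (3 + h)). assert (He' : 0 < e') by (apply Rdiv_lt_0_compat; lra).
  destruct (Hcv z Hz e' He') as [K1 HK1]. destruct (ev_unif x B Hx e' He') as [K2 HK2].
  set (K := Nat.max K1 K2). specialize (HK1 K ltac:(lia)). specialize (HK2 K ltac:(lia)).
  assert (U1 := HK2 z ltac:(lra)). assert (U2 := HK2 z' ltac:(lra)).
  set (P := (cps x z' K - cps x z K - (z' - z) * csum (fun k => (x k * dpow z k)%C) K)%C).
  assert (HP : Cmod P <= M / r ^ 2 * B * h ^ 2).
  { assert (G : r ^ 2 * Cmod P <= M * h ^ 2 * nrm x K).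
    { unfold P, cps. clear HK1 HK2 U1 U2 P. induction K as [|K IH].
      - simpl csum. replace (0 - 0 - (z' - z) * 0)%C with (RtoC 0) by ring. rewrite Cmod_0. unfold nrm; simpl. lra.
      - cbn [csum]. set (X := (csum (fun k => (x k * z' ^ k)%C) K - csum (fun k => (x k * z ^ k)%C) K - (z' - z) * csum (fun k => (x k * dpow z k)%C) K)%C) in IH.
        match goal with |- r ^ 2 * Cmod ?Y <= _ => replace Y with (X + x K * (z' ^ K - z ^ K - (z' - z) * dpow z K))%C by (unfold X; ring) end.
        assert (H1 := Cmod_triangle X (x K * (z' ^ K - z ^ K - (z' - z) * dpow z K))). rewrite Cmod_mult in H1.
        assert (H2 := pow_second_order z z' r K ltac:(lra) Hz Hz'). fold h in H2.
        replace (nrm x (S K)) with (nrm x K + Cmod (x K)) by reflexivity.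
        assert (H3 : INR K ^ 2 * r ^ K * h ^ 2 <= M * h ^ 2) by (apply Rmult_le_compat_r; [apply pow2_ge_0|auto]).
        assert (H4 : Cmod (x K) * (r ^ 2 * Cmod (z' ^ K - z ^ K - (z' - z) * dpow z K)) <= Cmod (x K) * (M * h ^ 2)) by (apply Rmult_le_compat_l; [apply Cmod_ge_0|lra]).
        assert (H5 : 0 <= r ^ 2) by apply pow2_ge_0.
        assert (r ^ 2 * Cmod (X + x K * (z' ^ K - z ^ K - (z' - z) * dpow z K))%C <= r ^ 2 * (Cmod X + Cmod (x K) * Cmod (z' ^ K - z ^ K - (z' - z) * dpow z K))) by (apply Rmult_le_compat_l; auto). lra. }
    replace (M / r ^ 2 * B * h ^ 2) with (M * h ^ 2 * B / r ^ 2) by (field; lra). apply Rle_div_r; [apply pow_lt; lra|].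
    rewrite Rmult_comm. eapply Rle_trans; [exact G|]. apply Rmult_le_compat_l; [apply Rmult_le_pos; [auto|apply pow2_ge_0]|apply Hx]. }
  replace (ev x z' - ev x z - (z' - z) * dev x z)%C with
    (P + ((ev x z' - cps x z' K) + (- (ev x z - cps x z K) + - ((z' - z) * (dev x z - csum (fun k => (x k * dpow z k)%C) K)))))%C by (unfold P; ring).
  eapply Rle_trans; [apply Cmod_triangle|]. apply Rplus_le_compat; auto.
  eapply Rle_trans; [apply Cmod_triangle|]. eapply Rle_trans; [apply Rplus_le_compat_l, Cmod_triangle|]. rewrite !Cmod_opp, Cmod_mult. fold h.
  assert (h * Cmod (dev x z - csum (fun k => (x k * dpow z k)%C) K) <= h * e') by (apply Rmult_le_compat_l; auto).
  assert (e' * (3 + h) = e) by (unfold e'; field; lra). lra.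
Qed.

Lemma holo_sub D D' f f1 : (forall z, D' z -> D z) -> holo D f f1 -> holo D' f f1.
Proof. intros H [K [HK Hf]]. exists K. split; auto. Qed.

Definition ucont (D : C -> Prop) (f : C -> C) : Prop :=
  (exists K, 0 <= K /\ forall z, D z -> Cmod (f z) <= K) /\
  forall eps, 0 < eps -> exists d, 0 < d /\ forall z z', D z -> D z' -> Cmod (z - z') < d -> Cmod (f z - f z') <= eps.

Lemma ucont_const D c : ucont D (fun _ => c).
Proof.
split. { exists (Cmod c). split; [apply Cmod_ge_0|intros; lra]. }
intros eps He. exists 1. split; [lra|]. intros. replace (c - c)%C with (RtoC 0) by ring. rewrite Cmod_0. lra.
Qed.

Lemma ucont_id D : in_disc D -> ucont D (fun z => z).
Proof.
intros HD. split. { exists 1. split; [lra|auto]. }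
intros eps He. exists eps. split; auto. intros; lra.
Qed.

Lemma ucont_plus D f g : ucont D f -> ucont D g -> ucont D (fun z => (f z + g z)%C).
Proof.
intros [[K [HK Hf]] Hf'] [[L [HL Hg]] Hg']. split.
- exists (K + L). split; [lra|]. intros z Hz. eapply Rle_trans; [apply Cmod_triangle|]. specialize (Hf z Hz). specialize (Hg z Hz). lra.
- intros eps He. destruct (Hf' (eps / 2) ltac:(lra)) as [d [Hd H1]]. destruct (Hg' (eps / 2) ltac:(lra)) as [d' [Hd' H2]].
  exists (Rmin d d'). split; [now apply Rmin_glb_lt|]. intros z z' Hz Hz' Hzz.
  specialize (H1 z z' Hz Hz' (Rlt_le_trans _ _ _ Hzz (Rmin_l _ _))). specialize (H2 z z' Hz Hz' (Rlt_le_trans _ _ _ Hzz (Rmin_r _ _))).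
  replace (f z + g z - (f z' + g z'))%C with ((f z - f z') + (g z - g z'))%C by ring. eapply Rle_trans; [apply Cmod_triangle|]. lra.
Qed.

Lemma ucont_mult D f g : ucont D f -> ucont D g -> ucont D (fun z => (f z * g z)%C).
Proof.
intros [[K [HK Hf]] Hf'] [[L [HL Hg]] Hg']. split.
- exists (K * L). split; [now apply Rmult_le_pos|]. intros z Hz. rewrite Cmod_mult. apply Rmult_le_compat; auto using Cmod_ge_0.
- intros eps He. destruct (Hf' (eps / (2 * (L + 1)))) as [d [Hd H1]]. { apply Rdiv_lt_0_compat; lra. }
  destruct (Hg' (eps / (2 * (K + 1)))) as [d' [Hd' H2]]. { apply Rdiv_lt_0_compat; lra. }
  exists (Rmin d d'). split; [now apply Rmin_glb_lt|]. intros z z' Hz Hz' Hzz.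
  specialize (H1 z z' Hz Hz' (Rlt_le_trans _ _ _ Hzz (Rmin_l _ _))). specialize (H2 z z' Hz Hz' (Rlt_le_trans _ _ _ Hzz (Rmin_r _ _))).
  replace (f z * g z - f z' * g z')%C with ((f z - f z') * g z + f z' * (g z - g z'))%C by ring. eapply Rle_trans; [apply Cmod_triangle|]. rewrite !Cmod_mult.
  assert (Cmod (f z - f z') * Cmod (g z) <= eps / (2 * (L + 1)) * (L + 1)).
  { apply Rmult_le_compat; auto using Cmod_ge_0. specialize (Hg z Hz). lra. }
  assert (Cmod (f z') * Cmod (g z - g z') <= (K + 1) * (eps / (2 * (K + 1)))).
  { apply Rmult_le_compat; auto using Cmod_ge_0. specialize (Hf z' Hz'). lra. }
  replace (eps / (2 * (L + 1)) * (L + 1)) with (eps / 2) in H by (field; lra). replace ((K + 1) * (eps / (2 * (K + 1)))) with (eps / 2) in H0 by (field; lra). lra.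
Qed.

Lemma ucont_inv D f c : ucont D f -> 0 < c -> (forall z, D z -> c <= Cmod (f z)) -> ucont D (fun z => (/ f z)%C).
Proof.
intros [_ Hf'] Hc Hlow.
assert (Hi : forall z, D z -> f z <> 0%C /\ / Cmod (f z) <= / c /\ 0 < / Cmod (f z)).
{ intros z Hz. specialize (Hlow z Hz). split; [apply Cmod_gt_0; lra|]. split; [apply Rinv_le_contravar; auto|apply Rinv_0_lt_compat; lra]. }
assert (Hc' : 0 < / c) by now apply Rinv_0_lt_compat.
split.
- exists (/ c). split; [lra|]. intros z Hz. destruct (Hi z Hz) as [N [H1 H2]]. now rewrite Cmod_inv.
- intros eps He. destruct (Hf' (eps * (c * c))) as [d [Hd H1]]. { apply Rmult_lt_0_compat; nra. }
  exists d. split; auto. intros z z' Hz Hz' Hzz. specialize (H1 z z' Hz Hz' Hzz).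
  destruct (Hi z Hz) as [N [I1 I2]]. destruct (Hi z' Hz') as [N' [I1' I2']].
  replace (/ f z - / f z')%C with (- (f z - f z') * (/ f z * / f z'))%C by (field; auto). rewrite !Cmod_mult, Cmod_opp, !Cmod_inv by auto.
  apply Rle_trans with (eps * (c * c) * (/ c * / c)); [|right; field; lra].
  apply Rmult_le_compat; auto using Cmod_ge_0. nra. apply Rmult_le_compat; lra.
Qed.

Lemma ucont_ev x B D : in_disc D -> l1 x B -> ucont D (ev x).
Proof.
intros HD Hx. split.
- exists B. split; [eapply l1_ge0; eauto|]. intros z Hz. apply ev_bound; auto.
- intros eps He. destruct (ev_uc x B Hx eps He) as [d [Hd H]]. exists d. split; auto.
Qed.

Lemma holo_ucont D f f1 : in_disc D -> holo D f f1 -> ucont D f.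
Proof.
intros HD Hf. destruct (holo_lip D f f1 HD Hf) as [M [HM Hl]]. destruct Hf as [K [HK Hf]]. split.
- exists K. split; auto. intros z Hz. now apply (Hf z z).
- intros eps He. exists (eps / (M + 1)). split; [apply Rdiv_lt_0_compat; lra|]. intros z z' Hz Hz' Hd.
  eapply Rle_trans; [now apply Hl|]. apply Rle_trans with ((M + 1) * (eps / (M + 1))); [|right; field; lra].
  apply Rmult_le_compat; auto using Cmod_ge_0; lra.
Qed.

Lemma expi_lip a b : Cmod (expi a - expi b) <= 2 * Rabs (a - b).
Proof.
eapply Rle_trans; [apply Cmod_le_ReIm|]. simpl.
assert (Hab : forall a b, a <= b -> Rabs (cos b - cos a) <= b - a /\ Rabs (sin b - sin a) <= b - a).
{ clear. intros a b Hab. split.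
  - apply (derive_compare cos (fun t => - sin t) (fun t => t) (fun _ => 1)); auto.
    + intros; apply is_derive_cos.
    + intros; apply (is_derive_id (K := R_AbsRing)).
    + intros y _. rewrite Rabs_Ropp. apply Rabs_le, SIN_bound.
  - apply (derive_compare sin cos (fun t => t) (fun _ => 1)); auto.
    + intros; apply is_derive_sin.
    + intros; apply (is_derive_id (K := R_AbsRing)).
    + intros y _. apply Rabs_le, COS_bound. }
destruct (Rle_dec a b) as [H|H].
- destruct (Hab a b H) as [H1 H2]. rewrite (Rabs_left1 (a - b)) by lra. rewrite Rabs_minus_sym in H1. rewrite Rabs_minus_sym in H2. unfold Rminus in *. lra.
- destruct (Hab b a ltac:(lra)) as [H1 H2]. rewrite (Rabs_right (a - b)) by lra. unfold Rminus in *. lra.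
Qed.

(** Real part only, and without the factor 1 / (2 PI). *)
Definition mean (F : C -> C) (r : R) : R := RInt (fun t => Re (F (r * expi t)%C)) (- PI) PI.

Lemma Cmod_circle r t : 0 <= r -> Cmod (r * expi t) = r.
Proof. intros Hr. rewrite Cmod_mult, Cmod_expi, Cmod_R, Rabs_right; lra. Qed.

Lemma cont_circle D F r t : 0 < r <= 1 -> ucont D F -> (forall t, D (r * expi t)%C) -> continuous (fun t => Re (F (r * expi t)%C)) t.
Proof.
intros Hr [_ HF] HD. apply continuity_pt_filterlim. intros eps He.
destruct (HF (eps / 2) ltac:(lra)) as [d [Hd H]]. exists (d / 2). split; [lra|]. intros t' [_ Ht']. simpl in *. unfold Rdist in *.
apply Rle_lt_trans with (eps / 2); [|lra]. change (Re (F (r * expi t')%C) - Re (F (r * expi t)%C)) with (Re (F (r * expi t') - F (r * expi t))%C).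
eapply Rle_trans; [apply re_le_Cmod|]. apply H; auto.
replace (r * expi t' - r * expi t)%C with (r * (expi t' - expi t))%C by ring. rewrite Cmod_mult, Cmod_R, Rabs_right by lra.
assert (H1 := expi_lip t' t). assert (H2 := Cmod_ge_0 (expi t' - expi t)). nra.
Qed.

Lemma ex_RInt_mean D F r a b : 0 < r <= 1 -> ucont D F -> (forall t, D (r * expi t)%C) -> ex_RInt (fun t => Re (F (r * expi t)%C)) a b.
Proof.
intros Hr HF HD. apply (ex_RInt_continuous (V := R_CompleteNormedModule)). intros t _. now apply (cont_circle D).
Qed.

Lemma is_derive_quadratic (R0 : R -> R) t K : (forall y, Rabs (R0 y) <= K * (y - t) ^ 2) -> is_derive R0 t 0.
Proof.
intros H. assert (H0 : R0 t = 0).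
{ specialize (H t). replace ((t - t) ^ 2) with 0 in H by ring. rewrite Rmult_0_r in H. assert (H1 := Rabs_pos (R0 t)).
  destruct (Req_dec (R0 t) 0); auto. assert (H2 := Rabs_no_R0 _ H0). lra. }
apply is_derive_Reals. intros eps He.
assert (Hd : 0 < eps / (Rabs K + 1)) by (apply Rdiv_lt_0_compat; [auto|assert (Hk := Rabs_pos K); lra]).
exists (mkposreal _ Hd). intros h Hh Hhd. simpl in Hhd. rewrite H0, !Rminus_0_r, Rabs_div by auto.
specialize (H (t + h)). replace (t + h - t) with h in H by ring.
assert (Hp : 0 < Rabs h) by now apply Rabs_pos_lt. apply Rlt_div_l; auto.
eapply Rle_lt_trans; [exact H|]. rewrite <- Rsqr_pow2, (Rsqr_abs h). unfold Rsqr.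
assert (Hk := Rle_abs K). assert (Hk0 := Rabs_pos K).
apply Rle_lt_trans with (Rabs K * (Rabs h * Rabs h)); [apply Rmult_le_compat_r; nra|].
rewrite <- Rmult_assoc. apply Rmult_lt_compat_r; auto.
apply Rle_lt_trans with ((Rabs K + 1) * Rabs h); [nra|].
apply Rlt_le_trans with ((Rabs K + 1) * (eps / (Rabs K + 1))); [apply Rmult_lt_compat_l; lra|right; field; lra].
Qed.

(** The integrand is the radial derivative of Re F, and r times it is the angular derivative of Im F
    (r e^(it)), which integrates to 0 over a full turn. *)
Lemma mean_derivative_zero D F F1 r : in_disc D -> holo D F F1 -> 0 < r <= 1 -> (forall t, D (r * expi t)%C) ->
  is_RInt (fun t => Re (expi t * F1 (r * expi t))%C) (- PI) PI 0.
Proof.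
intros HD HF Hr Hcirc. assert (HF' := HF). destruct HF' as [K [HK Hq]].
assert (Hder : forall t, is_derive (fun t => Im (F (r * expi t)%C)) t (r * Re (expi t * F1 (r * expi t))%C)).
{ intros t. set (z := (r * expi t)%C). set (c := F1 z).
  set (A := fun y => Im (F z) + Im ((r * expi y - z) * c)%C).
  set (R0 := fun y => Im (F (r * expi y)%C) - A y).
  apply (is_derive_ext (fun y => R0 y + A y)). { intros y. unfold R0. simpl. ring. }
  replace (r * Re (expi t * c)%C) with (0 + r * Re (expi t * c)%C) by ring.
  apply (is_derive_plus R0 A).
  - apply (is_derive_quadratic R0 t (K * 4)). intros y. unfold R0, A.
    replace (Im (F (r * expi y)%C) - (Im (F z) + Im ((r * expi y - z) * c)%C)) with (Im (F (r * expi y) - F z - (r * expi y - z) * c)%C).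
    2:{ unfold Cminus, Cplus, Copp, Im; simpl; ring. }
    eapply Rle_trans; [apply im_le_Cmod|]. eapply Rle_trans; [apply (Hq z (r * expi y)%C (Hcirc t) (Hcirc y))|].
    rewrite Rmult_assoc. apply Rmult_le_compat_l; auto. unfold z. replace (r * expi y - r * expi t)%C with (r * (expi y - expi t))%C by ring.
    rewrite Cmod_mult, Cmod_R, Rabs_right by lra. assert (H1 := expi_lip y t). assert (H2 := Cmod_ge_0 (expi y - expi t)).
    assert (H3 : r * Cmod (expi y - expi t) <= 2 * Rabs (y - t)) by nra.
    apply Rle_trans with ((2 * Rabs (y - t)) ^ 2); [apply pow_incr; split; auto; nra|].
    right. replace ((2 * Rabs (y - t)) ^ 2) with (4 * (Rabs (y - t) * Rabs (y - t))) by ring. rewrite <- Rabs_mult, Rabs_right by (apply Rle_ge, Rle_0_sqr). ring.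
  - unfold A. destruct c as [c1 c2]. unfold z, expi, Cmult, Cminus, Cplus, Copp, Re, Im, RtoC; simpl. auto_derive; [exact I|]. ring. }
assert (HF1c : forall t, continuous (fun t => Re (expi t * F1 (r * expi t))%C) t).
{ intros t. apply continuity_pt_filterlim. intros eps He.
  set (L := 2 * (K + 2 * K)). assert (HL : 0 <= L) by (unfold L; lra).
  exists (eps / (L + 1)). assert (Hd : 0 < eps / (L + 1)) by (apply Rdiv_lt_0_compat; lra). split; auto.
  intros t' [_ Ht']. change (Rabs (t' - t) < eps / (L + 1)) in Ht'.
  change (Rabs (Re (expi t' * F1 (r * expi t'))%C - Re (expi t * F1 (r * expi t))%C) < eps).
  change (Re (expi t' * F1 (r * expi t'))%C - Re (expi t * F1 (r * expi t))%C) with (Re (expi t' * F1 (r * expi t') - expi t * F1 (r * expi t))%C).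
  eapply Rle_lt_trans; [apply re_le_Cmod|].
  replace (expi t' * F1 (r * expi t') - expi t * F1 (r * expi t))%C with ((expi t' - expi t) * F1 (r * expi t') + expi t * (F1 (r * expi t') - F1 (r * expi t)))%C by ring.
  eapply Rle_lt_trans; [apply Cmod_triangle|]. rewrite !Cmod_mult, Cmod_expi, Rmult_1_l.
  set (z := (r * expi t)%C). set (z' := (r * expi t')%C).
  destruct (Hq z z' (Hcirc t) (Hcirc t')) as [_ [B1 B2]]. destruct (Hq z' z (Hcirc t') (Hcirc t)) as [_ [B3 B4]].
  assert (Hlip := expi_lip t' t). assert (Hpos := Cmod_ge_0 (expi t' - expi t)).
  assert (Hzz : Cmod (z' - z) <= Cmod (expi t' - expi t)).
  { unfold z, z'. replace (r * expi t' - r * expi t)%C with (r * (expi t' - expi t))%C by ring. rewrite Cmod_mult, Cmod_R, Rabs_right by lra. nra. }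
  (* [holo] asserts no regularity of F1; adding the expansions at z and at z' shows that it is
     Lipschitz. *)
  assert (HF1 : Cmod (F1 z' - F1 z) <= 2 * K * Cmod (z' - z)).
  { set (h := (z' - z)%C) in *. destruct (Req_dec (Cmod h) 0) as [E|E].
    - assert (z' = z). { apply Cmod_eq_0 in E. unfold h in E. replace z' with ((z' - z) + z)%C by ring. rewrite E. ring. }
      rewrite H. replace (F1 z - F1 z)%C with (RtoC 0) by ring. rewrite Cmod_0. rewrite E. lra.
    - assert (Hh : 0 < Cmod h) by (assert (H := Cmod_ge_0 h); lra).
      apply Rmult_le_reg_l with (Cmod h); auto. rewrite <- Cmod_mult.
      replace (h * (F1 z' - F1 z))%C with ((F z' - F z - h * F1 z) + (F z - F z' - (z - z') * F1 z'))%C by (unfold h; ring).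
      eapply Rle_trans; [apply Cmod_triangle|]. replace (Cmod (z - z')) with (Cmod h) in B4 by (rewrite <- Cmod_opp; f_equal; unfold h; ring). nra. }
  assert (Cmod (expi t' - expi t) * Cmod (F1 z') <= Cmod (expi t' - expi t) * K) by (apply Rmult_le_compat_l; auto).
  assert (2 * K * Cmod (z' - z) <= 2 * K * Cmod (expi t' - expi t)) by (apply Rmult_le_compat_l; lra).
  assert (E1 : (L + 1) * Rabs (t' - t) < (L + 1) * (eps / (L + 1))) by (apply Rmult_lt_compat_l; lra).
  replace ((L + 1) * (eps / (L + 1))) with eps in E1 by (field; lra).
  assert (E2 : (K + 2 * K) * Cmod (expi t' - expi t) <= (K + 2 * K) * (2 * Rabs (t' - t))) by (apply Rmult_le_compat_l; lra).
  assert (E3 := Rabs_pos (t' - t)). unfold L in *. nra. }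
assert (H : is_RInt (fun t => r * Re (expi t * F1 (r * expi t))%C) (- PI) PI (minus (Im (F (r * expi PI)%C)) (Im (F (r * expi (- PI))%C)))).
{ apply (is_RInt_derive (fun t => Im (F (r * expi t)%C))).
  - intros t _. apply Hder.
  - intros t _. apply (continuous_scal_r r (fun t => Re (expi t * F1 (r * expi t))%C)). apply HF1c. }
replace (expi (- PI)) with (expi PI) in H.
2:{ unfold expi. rewrite cos_neg, sin_neg, sin_PI. f_equal. ring. }
replace (minus (Im (F (r * expi PI)%C)) (Im (F (r * expi PI)%C))) with 0 in H by (symmetry; apply (plus_opp_r (G := R_AbelianGroup))).
apply (is_RInt_ext (fun t => scal (/ r) (r * Re (expi t * F1 (r * expi t))%C))).
- intros t _. unfold scal; simpl; unfold mult; simpl. field. lra.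
- replace 0 with (scal (/ r) 0) by (unfold scal; simpl; unfold mult; simpl; ring). now apply (is_RInt_scal (V := R_NormedModule)).
Qed.

(** A subdivision into n equal steps bounds the total increment by K (b - a)^2 / n. *)
Lemma quadratic_const (f : R -> R) a b K : a <= b -> (forall x y, a <= x <= b -> a <= y <= b -> Rabs (f y - f x) <= K * (y - x) ^ 2) -> f a = f b.
Proof.
intros Hab H.
assert (G : forall n : nat, Rabs (f b - f a) <= K * (b - a) ^ 2 / INR (S n)).
{ intros n. assert (Hn : 0 < INR (S n)) by (apply lt_0_INR; lia). set (h := (b - a) / INR (S n)).
  assert (Hh : 0 <= h) by (apply Rdiv_le_0_compat; lra).
  assert (Hhn : INR (S n) * h = b - a) by (unfold h; field; lra).
  assert (I : forall j, (j <= S n)%nat -> Rabs (f (a + INR j * h) - f a) <= INR j * (K * h ^ 2)).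
  { induction j as [|j IH]; intros Hj.
    - simpl. replace (a + 0 * h) with a by ring. rewrite Rminus_diag, Rabs_R0. lra.
    - specialize (IH ltac:(lia)). rewrite S_INR.
      replace (f (a + (INR j + 1) * h) - f a) with ((f (a + (INR j + 1) * h) - f (a + INR j * h)) + (f (a + INR j * h) - f a)) by ring.
      eapply Rle_trans; [apply Rabs_triang|].
      assert (Hjn : INR (S j) <= INR (S n)) by (apply le_INR; lia). rewrite S_INR in Hjn. assert (Hj0 := pos_INR j).
      assert (INR j * h <= (INR j + 1) * h) by nra. assert ((INR j + 1) * h <= b - a) by (rewrite <- Hhn; apply Rmult_le_compat_r; auto).
      assert (0 <= INR j * h) by (apply Rmult_le_pos; auto).
      assert (H1q := H (a + INR j * h) (a + (INR j + 1) * h) ltac:(lra) ltac:(lra)).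
      replace (a + (INR j + 1) * h - (a + INR j * h)) with h in H1q by ring. lra. }
  specialize (I (S n) (Nat.le_refl _)). replace (a + INR (S n) * h) with b in I by lra. eapply Rle_trans; [exact I|]. right. unfold h. field. lra. }
destruct (Req_dec (f b - f a) 0) as [E|E]; [lra|]. exfalso.
assert (Hp : 0 < Rabs (f b - f a)) by now apply Rabs_pos_lt.
destruct (archimed_cor1 (Rabs (f b - f a) / (Rabs (K * (b - a) ^ 2) + 1))) as [N [HN1 HN2]].
{ apply Rdiv_lt_0_compat; auto. assert (H0 := Rabs_pos (K * (b - a) ^ 2)). lra. }
destruct N as [|N]; [lia|]. specialize (G N). assert (HNp : 0 < INR (S N)) by (apply lt_0_INR; lia).
set (X := Rabs (K * (b - a) ^ 2)) in *. assert (HX : 0 <= X) by apply Rabs_pos. assert (HX2 : K * (b - a) ^ 2 <= X) by apply Rle_abs.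
assert (K * (b - a) ^ 2 / INR (S N) <= X * / INR (S N)) by (apply Rmult_le_compat_r; [apply Rlt_le, Rinv_0_lt_compat; auto|auto]).
assert (X * / INR (S N) <= (X + 1) * / INR (S N)) by (apply Rmult_le_compat_r; [apply Rlt_le, Rinv_0_lt_compat; auto|lra]).
assert ((X + 1) * / INR (S N) < (X + 1) * (Rabs (f b - f a) / (X + 1))) by (apply Rmult_lt_compat_l; lra).
replace ((X + 1) * (Rabs (f b - f a) / (X + 1))) with (Rabs (f b - f a)) in * by (field; lra). lra.
Qed.

(** Expanding F at radius x, the term of first order in y - x integrates to 0, so the mean changes
    by a quadratic amount only. *)
Lemma mean_const D F F1 r1 r2 : in_disc D -> holo D F F1 -> 0 < r1 -> r1 <= r2 -> r2 <= 1 ->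
  (forall z, r1 <= Cmod z <= r2 -> D z) -> mean F r1 = mean F r2.
Proof.
intros HD HF Hr1 Hr12 Hr2 Hann. assert (HF' := HF). destruct HF' as [K [HK Hq]].
assert (HP := PI_RGT_0).
apply (quadratic_const (mean F) r1 r2 (2 * PI * K)); auto.
intros x y Hx Hy.
assert (Hcx : forall t, D (x * expi t)%C) by (intros t; apply Hann; rewrite Cmod_circle; lra).
assert (Hcy : forall t, D (y * expi t)%C) by (intros t; apply Hann; rewrite Cmod_circle; lra).
assert (Hu := holo_ucont D F F1 HD HF).
assert (H0 := mean_derivative_zero D F F1 x HD HF ltac:(lra) Hcx).
assert (E : is_RInt (fun t => minus (minus (Re (F (y * expi t)%C)) (Re (F (x * expi t)%C))) (scal (y - x) (Re (expi t * F1 (x * expi t))%C))) (- PI) PI (minus (minus (mean F y) (mean F x)) (scal (y - x) 0))).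
{ apply (is_RInt_minus (V := R_NormedModule)).
  - apply (is_RInt_minus (V := R_NormedModule)); apply (RInt_correct (V := R_CompleteNormedModule)); apply (ex_RInt_mean D); auto; lra.
  - now apply (is_RInt_scal (V := R_NormedModule)). }
assert (B : Rabs (minus (minus (mean F y) (mean F x)) (scal (y - x) 0)) <= (PI - - PI) * (K * (y - x) ^ 2)).
{ apply (norm_RInt_le_const (V := R_NormedModule) (fun t => minus (minus (Re (F (y * expi t)%C)) (Re (F (x * expi t)%C))) (scal (y - x) (Re (expi t * F1 (x * expi t))%C))) (- PI) PI); auto; [lra|].
  intros t _. destruct (Hq (x * expi t)%C (y * expi t)%C (Hcx t) (Hcy t)) as [_ [_ Q]].
  replace (y * expi t - x * expi t)%C with ((y - x)%R * expi t)%C in Q by (rewrite RtoC_minus; ring).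
  rewrite Cmod_mult, Cmod_expi, Cmod_R, Rmult_1_r in Q.
  replace (Rabs (y - x) ^ 2) with ((y - x) ^ 2) in Q by (rewrite RPow_abs; symmetry; apply Rabs_right, Rle_ge, pow2_ge_0).
  eapply Rle_trans; [|exact Q]. eapply Rle_trans; [|apply re_le_Cmod]. right. unfold norm; simpl. unfold abs; simpl. f_equal.
  unfold minus, plus, opp, scal; simpl; unfold mult; simpl. unfold Cminus, Cplus, Copp, Cmult, RtoC, Re; simpl. ring. }
unfold minus, plus, opp, scal in B; simpl in B; unfold mult in B; simpl in B.
replace (mean F y - mean F x) with (mean F y + - mean F x + - ((y - x) * 0)) by ring. lra.
Qed.

Lemma mean_boundary A F L : ucont A F -> (forall z, 1 / 2 <= Cmod z <= 1 -> A z) -> (forall r, 1 / 2 <= r < 1 -> mean F r = L) -> mean F 1 = L.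
Proof.
intros HF HA Hr. assert (HP := PI_RGT_0).
apply Rminus_diag_uniq. destruct (Req_dec (mean F 1 - L) 0) as [E|E]; auto. exfalso.
assert (Hp : 0 < Rabs (mean F 1 - L)) by now apply Rabs_pos_lt.
set (e := Rabs (mean F 1 - L) / (4 * PI)). assert (He : 0 < e) by (apply Rdiv_lt_0_compat; lra).
assert (HF' := HF). destruct HF' as [_ HF2]. destruct (HF2 e He) as [d [Hd H]].
set (r := Rmax (1 / 2) (1 - d / 2)). assert (Hr1 := Rmax_l (1 / 2) (1 - d / 2)). assert (Hr2 := Rmax_r (1 / 2) (1 - d / 2)). fold r in Hr1, Hr2.
assert (Hr3 : r < 1) by (apply Rmax_lub_lt; lra).
assert (Hc : forall x, 1 / 2 <= x <= 1 -> forall t, A (x * expi t)%C) by (intros x Hx t; apply HA; rewrite Cmod_circle; lra).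
assert (B : Rabs (minus (mean F 1) (mean F r)) <= (PI - - PI) * e).
{ apply (norm_RInt_le_const (V := R_NormedModule) (fun t => minus (Re (F (1 * expi t)%C)) (Re (F (r * expi t)%C))) (- PI) PI); [lra| |].
  - intros t _. eapply Rle_trans; [|apply (H (1 * expi t)%C (r * expi t)%C)].
    + eapply Rle_trans; [|apply re_le_Cmod]. right. reflexivity.
    + apply Hc; lra.
    + apply Hc; lra.
    + replace (1 * expi t - r * expi t)%C with ((1 - r)%R * expi t)%C by (rewrite RtoC_minus; ring). rewrite Cmod_mult, Cmod_expi, Cmod_R, Rabs_right by lra. lra.
  - apply (is_RInt_minus (V := R_NormedModule)); apply (RInt_correct (V := R_CompleteNormedModule)); apply (ex_RInt_mean A); auto; try lra; apply Hc; lra. }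
rewrite (Hr r ltac:(lra)) in B. change (minus (mean F 1) L) with (mean F 1 - L) in B.
assert ((PI - - PI) * e = Rabs (mean F 1 - L) / 2) by (unfold e; field; lra). lra.
Qed.

Lemma mean_center F F1 rho : 0 < rho <= 1 -> holo (fun z => Cmod z <= rho) F F1 -> mean F rho = 2 * PI * Re (F 0%C).
Proof.
intros Hrho HF. assert (HP := PI_RGT_0).
assert (HD : in_disc (fun z => Cmod z <= rho)) by (intros z Hz; lra).
destruct (holo_lip _ F F1 HD HF) as [M [HM Hl]].
assert (B : forall x, 0 < x <= rho -> Rabs (mean F rho - 2 * PI * Re (F 0%C)) <= 2 * PI * M * x).
{ intros x Hx. rewrite <- (mean_const _ F F1 x rho HD HF); try lra.
  2:{ intros z Hz; lra. }
  assert (Hi : is_RInt (fun t => minus (Re (F (x * expi t)%C)) (Re (F 0%C))) (- PI) PI (minus (mean F x) (scal (PI - - PI) (Re (F 0%C))))).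
  { apply (is_RInt_minus (V := R_NormedModule)).
    - apply (RInt_correct (V := R_CompleteNormedModule)). apply (ex_RInt_mean (fun z => Cmod z <= rho)); [lra|now apply (holo_ucont _ F F1)|]. intros t. rewrite Cmod_circle; lra.
    - apply (is_RInt_const (V := R_NormedModule)). }
  eapply Rle_trans; [|].
  2:{ replace (2 * PI * M * x) with ((PI - - PI) * (M * x)) by ring. apply Rle_refl. }
  eapply Rle_trans; [|apply (norm_RInt_le_const (V := R_NormedModule) (fun t => minus (Re (F (x * expi t)%C)) (Re (F 0%C))) (- PI) PI (minus (mean F x) (scal (PI - - PI) (Re (F 0%C)))) (M * x)); [lra| |exact Hi]].
  - right. unfold norm; simpl; unfold abs; simpl. f_equal. unfold minus, plus, opp, scal; simpl; unfold mult; simpl. ring.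
  - intros t _. eapply Rle_trans; [|eapply Rle_trans; [apply (Hl 0%C (x * expi t)%C)|]].
    + eapply Rle_trans; [|apply re_le_Cmod]. right. reflexivity.
    + rewrite Cmod_0; lra.
    + rewrite Cmod_circle; lra.
    + replace (x * expi t - 0)%C with (x * expi t)%C by ring. rewrite Cmod_circle; lra. }
apply Rminus_diag_uniq. destruct (Req_dec (mean F rho - 2 * PI * Re (F 0%C)) 0) as [E|E]; auto. exfalso.
set (X := mean F rho - 2 * PI * Re (F 0%C)) in *. assert (Hp : 0 < Rabs X) by now apply Rabs_pos_lt.
set (x := Rmin rho (Rabs X / (2 * (2 * PI * M + 1)))).
assert (HPM : 0 <= 2 * PI * M) by (apply Rmult_le_pos; lra).
assert (Hx1 : 0 < Rabs X / (2 * (2 * PI * M + 1))) by (apply Rdiv_lt_0_compat; lra).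
assert (Hx : 0 < x <= rho) by (unfold x; split; [apply Rmin_glb_lt; lra|apply Rmin_l]).
specialize (B x Hx). assert (Hx2 : x <= Rabs X / (2 * (2 * PI * M + 1))) by apply Rmin_r.
assert (2 * PI * M * x <= (2 * PI * M + 1) * (Rabs X / (2 * (2 * PI * M + 1)))) by (apply Rmult_le_compat; lra).
replace ((2 * PI * M + 1) * (Rabs X / (2 * (2 * PI * M + 1)))) with (Rabs X / 2) in H by (field; lra). lra.
Qed.

(** * Moments of the potential *)

Lemma symsum_psum f N : symsum f N = psum (fun k => f (Z.of_nat k - Z.of_nat N)%Z) (S (2 * N)).
Proof.
unfold symsum. generalize (2 * N)%nat. intros n. induction n as [|n IH]; simpl; [ring|].
simpl in IH. rewrite IH. reflexivity.
Qed.

Lemma psum_add a m n : psum a (m + n) = psum a m + psum (fun k => a (m + k)%nat) n.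
Proof.
induction n as [|n IH]; simpl; [rewrite Nat.add_0_r; ring|]. rewrite Nat.add_succ_r. simpl. rewrite IH. ring.
Qed.

Lemma symsum_range (g : Z -> R) B : (forall n, 0 <= g n) -> (forall N, symsum g N <= B) ->
  forall (a : Z) k, psum (fun l => g (Z.of_nat l + a)%Z) k <= B.
Proof.
intros Hg HB a k. set (N := (Z.abs_nat a + k)%nat). set (p := Z.to_nat (a + Z.of_nat N)).
apply Rle_trans with (2 := HB N). rewrite symsum_psum.
apply Rle_trans with (psum (fun j => g (Z.of_nat j - Z.of_nat N)%Z) (p + k)).
- rewrite psum_add. rewrite (psum_ext (fun l => g (Z.of_nat l + a)%Z) (fun l => g (Z.of_nat (p + l) - Z.of_nat N)%Z)).
  + assert (H := psum_ge0 (fun j => g (Z.of_nat j - Z.of_nat N)%Z) p (fun i _ => Hg _)). lra.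
  + intros i _. f_equal. unfold p, N. lia.
- apply psum_mono; auto. unfold p, N. lia.
Qed.

Lemma symsum_refl f N : symsum (fun n => f (- n)%Z) N = symsum f N.
Proof.
rewrite !symsum_psum.
set (a := fun k => f (Z.of_nat k - Z.of_nat N)%Z).
rewrite (psum_ext _ (fun j => a (S (2 * N) - 1 - j)%nat)).
- rewrite (psum_rev a (S (2 * N)) (S (2 * N))) by lia. rewrite Nat.sub_diag. simpl. ring.
- intros j Hj. unfold a. f_equal. lia.
Qed.

Lemma bracket_opp n : bracket (IZR (- n)) = bracket (IZR n).
Proof. unfold bracket. rewrite opp_IZR. f_equal. ring. Qed.

Lemma wl1_refl s q : wl1 s q -> wl1 s (refl q).
Proof.
intros [B HB]. exists B. intros N. rewrite <- (HB N). right. rewrite <- symsum_refl.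
rewrite !symsum_psum. apply psum_ext. intros i _. unfold refl. rewrite bracket_opp, Z.opp_involutive. reflexivity.
Qed.

Lemma bracket_ge1 x : 1 <= bracket x.
Proof. unfold bracket. rewrite <- sqrt_1 at 1. apply sqrt_le_1_alt. assert (H := pow2_ge_0 x). lra. Qed.

Lemma bracket_ge x : x <= bracket x.
Proof.
unfold bracket. destruct (Rle_dec 0 x).
- rewrite <- (sqrt_square x) at 1 by auto. apply sqrt_le_1_alt. simpl. lra.
- assert (H := sqrt_pos (1 + x ^ 2)). lra.
Qed.

Lemma wl1_moment q : wl1 1 q -> forall c, exists B, forall k, moment q c k <= B.
Proof.
intros [B HB] c. exists ((1 + INR c) * B). intros k.
assert (H := symsum_range (fun n => bracket (IZR n) ^ 1 * Rabs (q n)) B).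
assert (H1 : psum (fun l => (fun n => bracket (IZR n) ^ 1 * Rabs (q n)) (Z.of_nat l + - Z.of_nat c)%Z) k <= B).
{ apply H; auto. intros n. apply Rmult_le_pos; [|apply Rabs_pos]. apply pow_le. assert (H1 := bracket_ge1 (IZR n)). lra. }
assert (Hc := pos_INR c).
apply Rle_trans with ((1 + INR c) * psum (fun l => (fun n => bracket (IZR n) ^ 1 * Rabs (q n)) (Z.of_nat l + - Z.of_nat c)%Z) k).
- rewrite <- psum_scal. apply psum_le. intros l _. cbv beta. change (Z.of_nat l + - Z.of_nat c)%Z with (Z.of_nat l - Z.of_nat c)%Z.
  rewrite <- Rmult_assoc. apply Rmult_le_compat_r; [apply Rabs_pos|]. rewrite pow_1.
  assert (H2 := bracket_ge1 (IZR (Z.of_nat l - Z.of_nat c))). assert (H3 := bracket_ge (IZR (Z.of_nat l - Z.of_nat c))).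
  set (b := bracket _) in *. rewrite minus_IZR, <- !INR_IZR_INZ in H3. nra.
- apply Rmult_le_compat_l; lra.
Qed.

Lemma wl1_moment2 q : wl1 2 q -> forall c, exists B, forall k, moment2 q c k <= B.
Proof.
intros [B HB] c. exists ((2 + INR c) ^ 2 * B). intros k.
assert (H := symsum_range (fun n => bracket (IZR n) ^ 2 * Rabs (q n)) B).
assert (H1 : psum (fun l => (fun n => bracket (IZR n) ^ 2 * Rabs (q n)) (Z.of_nat l + - Z.of_nat c)%Z) k <= B).
{ apply H; auto. intros n. apply Rmult_le_pos; [|apply Rabs_pos]. apply pow_le. assert (H1 := bracket_ge1 (IZR n)). lra. }
assert (Hc := pos_INR c).
apply Rle_trans with ((2 + INR c) ^ 2 * psum (fun l => (fun n => bracket (IZR n) ^ 2 * Rabs (q n)) (Z.of_nat l + - Z.of_nat c)%Z) k).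
- rewrite <- psum_scal. apply psum_le. intros l _. cbv beta. change (Z.of_nat l + - Z.of_nat c)%Z with (Z.of_nat l - Z.of_nat c)%Z.
  rewrite <- Rmult_assoc. apply Rmult_le_compat_r; [apply Rabs_pos|]. rewrite <- Rpow_mult_distr.
  assert (H2 := bracket_ge1 (IZR (Z.of_nat l - Z.of_nat c))). assert (H3 := bracket_ge (IZR (Z.of_nat l - Z.of_nat c))).
  set (b := bracket _) in *. rewrite minus_IZR, <- !INR_IZR_INZ in H3. assert (Hl := pos_INR l). apply pow_incr. nra.
- apply Rmult_le_compat_l; [apply pow2_ge_0|lra].
Qed.

(** * Truncations *)

Definition cut (q : Z -> R) (N : nat) (n : Z) : R := if Z_le_dec (Z.abs n) (Z.of_nat N) then q n else 0.

Lemma cut_supported q N : supported (cut q N) N.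
Proof. intros n Hn. unfold cut. destruct (Z_le_dec _ _); [lia|auto]. Qed.

Lemma cut_refl q N n : refl (cut q N) n = cut (refl q) N n.
Proof. unfold refl, cut. rewrite Z.abs_opp. reflexivity. Qed.

(** m_+(n) is built from the sites n + 1, ..., N. *)
Lemma mplus_cut q N z n : (- Z.of_nat N <= n)%Z -> mplus (cut q N) N z n = mplus q N z n.
Proof.
intros Hn. unfold mplus. f_equal. apply jost_ext. intros i Hi. unfold cut. destruct (Z_le_dec _ _); [auto|lia].
Qed.

Lemma mminus_cut q N z n : (n <= Z.of_nat N)%Z -> mminus (cut q N) N z n = mplus (refl q) N z (- n).
Proof.
intros Hn. unfold mminus. rewrite <- (mplus_cut (refl q)) by lia. apply mplus_ext. apply cut_refl.
Qed.

Lemma jost_S1_cut q N B : (forall k, moment q 1 k <= B) -> jost_S1 (cut q N) N B.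
Proof.
intros HB i Hi. rewrite (psum_ext _ (fun j => (INR (N + 1) - INR j) * Rabs (revp q N j))).
- rewrite moment_rev by lia. assert (H := moment_ge0 q 1 (S (N + 1) - i)). specialize (HB (S (N + 1))). lra.
- intros j Hj. replace (N + 1)%nat with (S N) by lia. do 2 f_equal. unfold cut, revp. destruct (Z_le_dec _ _); [auto|lia].
Qed.

Lemma jost_S2_cut q N B : (forall k, moment2 q 1 k <= B) -> jost_S2 (cut q N) N B.
Proof.
intros HB i Hi. rewrite (psum_ext _ (fun j => (INR (N + 1) - INR j + 1) ^ 2 * Rabs (revp q N j))).
- rewrite moment2_rev by lia. assert (H := moment2_ge0 q 1 (S (N + 1) - i)). specialize (HB (S (N + 1))). lra.
- intros j Hj. replace (N + 1)%nat with (S N) by lia. do 2 f_equal. unfold cut, revp. destruct (Z_le_dec _ _); [auto|lia].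
Qed.

Lemma jost_S1_ext v v' N B : (forall n, v n = v' n) -> jost_S1 v N B -> jost_S1 v' N B.
Proof. intros E H i Hi. rewrite <- (H i Hi). right. apply psum_ext. intros; now rewrite E. Qed.

Lemma jost_S2_ext v v' N B : (forall n, v n = v' n) -> jost_S2 v N B -> jost_S2 v' N B.
Proof. intros E H i Hi. rewrite <- (H i Hi). right. apply psum_ext. intros; now rewrite E. Qed.

Definition uconv (D : C -> Prop) (fN : nat -> C -> C) (f : C -> C) : Prop :=
  (exists K, 0 <= K /\ forall z, D z -> Cmod (f z) <= K) /\
  forall eps, 0 < eps -> exists N0, forall N, (N0 <= N)%nat -> forall z, D z -> Cmod (fN N z - f z) <= eps.

Lemma uconv_const D f : (exists K, 0 <= K /\ forall z, D z -> Cmod (f z) <= K) -> uconv D (fun _ => f) f.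
Proof.
intros H. split; auto. intros eps He. exists O. intros N _ z _. replace (f z - f z)%C with (RtoC 0) by ring. rewrite Cmod_0; lra.
Qed.

Lemma uconv_minus D fN f gN g : uconv D fN f -> uconv D gN g -> uconv D (fun N z => (fN N z - gN N z)%C) (fun z => (f z - g z)%C).
Proof.
intros [[K [HK Hf]] Hf'] [[L [HL Hg]] Hg']. split.
- exists (K + L). split; [lra|]. intros z Hz. unfold Cminus. eapply Rle_trans; [apply Cmod_triangle|]. rewrite Cmod_opp. specialize (Hf z Hz). specialize (Hg z Hz). lra.
- intros eps He. destruct (Hf' (eps / 2) ltac:(lra)) as [d H1]. destruct (Hg' (eps / 2) ltac:(lra)) as [d' H2].
  exists (Nat.max d d'). intros N HN z Hz. specialize (H1 N ltac:(lia) z Hz). specialize (H2 N ltac:(lia) z Hz).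
  replace (fN N z - gN N z - (f z - g z))%C with ((fN N z - f z) + - (gN N z - g z))%C by ring. eapply Rle_trans; [apply Cmod_triangle|]. rewrite Cmod_opp. lra.
Qed.

Lemma uconv_mult D fN f gN g : uconv D fN f -> uconv D gN g -> uconv D (fun N z => (fN N z * gN N z)%C) (fun z => (f z * g z)%C).
Proof.
intros [[K [HK Hf]] Hf'] [[L [HL Hg]] Hg']. split.
- exists (K * L). split; [now apply Rmult_le_pos|]. intros z Hz. rewrite Cmod_mult. apply Rmult_le_compat; auto using Cmod_ge_0.
- intros eps He.
  set (e1 := Rmin 1 (eps / (2 * (L + 1)))). assert (He1 : 0 < e1) by (unfold e1; apply Rmin_glb_lt; [lra|apply Rdiv_lt_0_compat; lra]).
  set (e2 := eps / (2 * (K + 1))). assert (He2 : 0 < e2) by (apply Rdiv_lt_0_compat; lra).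
  destruct (Hf' e1 He1) as [d H1]. destruct (Hg' e2 He2) as [d' H2].
  exists (Nat.max d d'). intros N HN z Hz. specialize (H1 N ltac:(lia) z Hz). specialize (H2 N ltac:(lia) z Hz).
  replace (fN N z * gN N z - f z * g z)%C with (fN N z * (gN N z - g z) + (fN N z - f z) * g z)%C by ring. eapply Rle_trans; [apply Cmod_triangle|]. rewrite !Cmod_mult.
  assert (Cmod (fN N z) <= K + 1).
  { replace (fN N z) with ((fN N z - f z) + f z)%C by ring. eapply Rle_trans; [apply Cmod_triangle|]. specialize (Hf z Hz). assert (e1 <= 1) by apply Rmin_l. lra. }
  assert (Cmod (fN N z) * Cmod (gN N z - g z) <= (K + 1) * e2) by (apply Rmult_le_compat; auto using Cmod_ge_0).
  assert (Cmod (fN N z - f z) * Cmod (g z) <= (eps / (2 * (L + 1))) * (L + 1)).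
  { apply Rmult_le_compat; auto using Cmod_ge_0. - eapply Rle_trans; [exact H1|apply Rmin_r]. - specialize (Hg z Hz). lra. }
  replace ((K + 1) * e2) with (eps / 2) in H0 by (unfold e2; field; lra). replace (eps / (2 * (L + 1)) * (L + 1)) with (eps / 2) in H3 by (field; lra). lra.
Qed.

Lemma uconv_inv D fN f c : uconv D fN f -> 0 < c -> (forall z, D z -> c <= Cmod (f z)) -> (forall N z, D z -> c <= Cmod (fN N z)) ->
  uconv D (fun N z => (/ fN N z)%C) (fun z => (/ f z)%C).
Proof.
intros [_ Hf'] Hc Hlow HlowN.
assert (Hi : forall x, c <= Cmod x -> x <> 0%C /\ / Cmod x <= / c /\ 0 < / Cmod x).
{ intros x Hx. split; [apply Cmod_gt_0; lra|]. split; [apply Rinv_le_contravar; auto|apply Rinv_0_lt_compat; lra]. }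
assert (Hc' : 0 < / c) by now apply Rinv_0_lt_compat.
split.
- exists (/ c). split; [lra|]. intros z Hz. destruct (Hi _ (Hlow z Hz)) as [N [H1 H2]]. now rewrite Cmod_inv.
- intros eps He. destruct (Hf' (eps * (c * c))) as [d H1]. { apply Rmult_lt_0_compat; nra. }
  exists d. intros M HM z Hz. specialize (H1 M HM z Hz).
  destruct (Hi _ (Hlow z Hz)) as [N [I1 I2]]. destruct (Hi _ (HlowN M z Hz)) as [N' [I1' I2']].
  replace (/ fN M z - / f z)%C with (- (fN M z - f z) * (/ f z * / fN M z))%C by (field; auto). rewrite !Cmod_mult, Cmod_opp, !Cmod_inv by auto.
  apply Rle_trans with (eps * (c * c) * (/ c * / c)); [|right; field; lra].
  apply Rmult_le_compat; auto using Cmod_ge_0. nra. apply Rmult_le_compat; lra.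
Qed.

Lemma uconv_sub D D' fN f : (forall z, D' z -> D z) -> uconv D fN f -> uconv D' fN f.
Proof.
intros H [[K [HK Hf]] H2]. split; [exists K; auto|]. intros eps He. destruct (H2 eps He) as [N0 HN0]. exists N0. auto.
Qed.

Lemma uconv_shift D fN gN f N1 : (forall N z, (N1 <= N)%nat -> D z -> fN N z = gN N z) -> uconv D fN f -> uconv D gN f.
Proof.
intros H [H1 H2]. split; auto. intros eps He. destruct (H2 eps He) as [N0 HN0]. exists (Nat.max N0 N1). intros N HN z Hz. rewrite <- H by (auto; lia). apply HN0; auto; lia.
Qed.

Definition disc (z : C) : Prop := Cmod z <= 1.

Lemma uconv_mlim q n : (forall c, exists B, forall k, moment q c k <= B) -> uconv disc (fun N z => mplus q N z n) (fun z => mlim q z n).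
Proof.
intros H. split.
- destruct (blim_l1 q H n) as [A HA]. exists A. split; [eapply l1_ge0; eauto|]. intros z Hz. apply ev_bound; auto.
- intros eps He. destruct (mlim_unif q H n eps He) as [N0 HN0]. exists N0. intros N HN z Hz. specialize (HN0 N HN z Hz).
  rewrite <- Cmod_opp. replace (- (mplus q N z n - mlim q z n))%C with (mlim q z n - mplus q N z n)%C by ring. exact HN0.
Qed.

(** * Jost functions and Wronskian of the full potential *)

Section Potential.
Variable q : Z -> R.
Hypothesis Hq : wl1 1 q.

Let HM := wl1_moment q Hq.
Let HMr := wl1_moment (refl q) (wl1_refl 1 q Hq).

(* [Pl], [Mi] are the paper's m_+, m_- at z = e^(-i theta), and [ww] is - z W(theta). *)
Definition Pl (z : C) (n : Z) : C := mlim q z n.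
Definition Mi (z : C) (n : Z) : C := mlim (refl q) z (- n).
Definition ww (z : C) : C := wronsk (Pl z) (Mi z) z 0.

Lemma Pl_rec z n : disc z -> Pl z (n - 1) = ((1 + z * z + z * q n) * Pl z n - z * z * Pl z (n + 1))%C.
Proof. intros Hz. now apply mlim_rec. Qed.

Lemma Mi_rec z n : disc z -> Mi z (n + 1) = ((1 + z * z + z * q n) * Mi z n - z * z * Mi z (n - 1))%C.
Proof.
intros Hz. unfold Mi. replace (- (n + 1))%Z with (- n - 1)%Z by lia. replace (- (n - 1))%Z with (- n + 1)%Z by lia.
rewrite mlim_rec by auto. unfold refl at 1. now rewrite Z.opp_involutive.
Qed.

Lemma ww_const z n : disc z -> wronsk (Pl z) (Mi z) z n = ww z.
Proof.
intros Hz. apply (wronsk_const (Pl z) (Mi z) z q).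
- intros k. now apply Pl_rec.
- intros k. now apply Mi_rec.
Qed.

Lemma uconv_Pl n : uconv disc (fun N z => mplus (cut q N) N z n) (fun z => Pl z n).
Proof.
apply (uconv_shift disc (fun N z => mplus q N z n) _ _ (Z.abs_nat n)).
- intros N z HN _. rewrite mplus_cut; auto. lia.
- now apply uconv_mlim.
Qed.

Lemma uconv_Mi n : uconv disc (fun N z => mminus (cut q N) N z n) (fun z => Mi z n).
Proof.
apply (uconv_shift disc (fun N z => mplus (refl q) N z (- n)) _ _ (Z.abs_nat n)).
- intros N z HN _. rewrite mminus_cut; auto. lia.
- now apply uconv_mlim.
Qed.

Lemma uconv_zz : uconv disc (fun _ z => (z * z)%C) (fun z => (z * z)%C).
Proof.
apply (uconv_const disc (fun z => (z * z)%C)). exists 1. split; [lra|]. intros z Hz. unfold disc in Hz. rewrite Cmod_mult. assert (H := Cmod_ge_0 z). nra.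
Qed.

Lemma uconv_ww : uconv disc (fun N z => wronsk (mplus (cut q N) N z) (mminus (cut q N) N z) z 0) ww.
Proof.
unfold ww, wronsk. apply (uconv_minus disc (fun N z => mplus (cut q N) N z 0%Z * mminus (cut q N) N z (0 + 1)%Z)%C (fun z => Pl z 0%Z * Mi z (0 + 1)%Z)%C
  (fun N z => z * z * mplus (cut q N) N z (0 + 1)%Z * mminus (cut q N) N z 0%Z)%C (fun z => z * z * Pl z (0 + 1)%Z * Mi z 0%Z)%C).
- apply (uconv_mult disc (fun N z => mplus (cut q N) N z 0%Z) (fun z => Pl z 0%Z) (fun N z => mminus (cut q N) N z (0 + 1)%Z) (fun z => Mi z (0 + 1)%Z)); [apply uconv_Pl|apply uconv_Mi].
- apply (uconv_mult disc (fun N z => z * z * mplus (cut q N) N z (0 + 1)%Z)%C (fun z => z * z * Pl z (0 + 1)%Z)%C (fun N z => mminus (cut q N) N z 0%Z) (fun z => Mi z 0%Z)); [|apply uconv_Mi].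
  apply (uconv_mult disc (fun _ z => (z * z)%C) (fun z => (z * z)%C) (fun N z => mplus (cut q N) N z (0 + 1)%Z) (fun z => Pl z (0 + 1)%Z)); [apply uconv_zz|apply uconv_Pl].
Qed.

(** The inequality given by unitarity of the truncations survives their uniform convergence. *)
Lemma ww_lower z : Cmod z = 1 -> Cmod (1 - z * z) <= Cmod (ww z).
Proof.
intros Hz. apply le_epsilon. intros eps He.
destruct uconv_ww as [_ H]. destruct (H eps He) as [N0 HN0]. specialize (HN0 N0 (Nat.le_refl _) z ltac:(unfold disc; lra)).
set (wN := wronsk _ _ z 0) in HN0.
assert (Hzz : (z * Cconj z)%C = 1%C) by (rewrite <- Cmod2_conj, Hz; f_equal; ring).
assert (U := unitarity (cut q N0) N0 z (cut_supported q N0) Hzz). fold wN in U.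
assert (Hle : Cmod (1 - z * z) <= Cmod wN).
{ apply Rsqr_incr_0_var; [|apply Cmod_ge_0]. unfold Rsqr. match type of U with _ = ?a ^ 2 + _ => assert (Ha := pow2_ge_0 a) end. nra. }
assert (T := Cmod_triangle (wN - ww z) (ww z)). replace (wN - ww z + ww z)%C with wN in T by ring. lra.
Qed.

(** Taylor coefficients of m_+(0) m_-(1) - z^2 m_+(1) m_-(0), where m_-(1) is the Jost function of
    the reflected potential at -1. *)
Definition wc (k : nat) : C :=
  (conv (blim q 0) (blim (refl q) (-1)) k + (-1) * sh (sh (conv (blim q 1) (blim (refl q) 0))) k)%C.

Lemma wc_spec : (exists B, l1 wc B) /\ (forall z, disc z -> ev wc z = ww z).
Proof.
destruct (blim_l1 q HM 0) as [A0 H0]. destruct (blim_l1 q HM 1) as [A1 H1].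
destruct (blim_l1 (refl q) HMr (-1)) as [B1 H2]. destruct (blim_l1 (refl q) HMr 0) as [B0 H3].
assert (L1 := l1_conv _ _ _ _ H0 H2). assert (L2 := l1_conv _ _ _ _ H1 H3).
assert (L3 : l1 (fun k => (-1) * sh (sh (conv (blim q 1) (blim (refl q) 0))) k)%C (Cmod (-1) * (A1 * B0))) by (apply l1_scal; now repeat apply l1_sh).
split; [eexists; exact (l1_plus _ _ _ _ L1 L3)|].
intros z Hz. unfold wc. rewrite (ev_plus _ _ _ _ z L1 L3 Hz). rewrite (ev_scal _ _ (A1 * B0)) by (auto; now repeat apply l1_sh).
rewrite (ev_sh _ (A1 * B0)) by (auto; now apply l1_sh). rewrite (ev_sh _ (A1 * B0)) by auto.
rewrite (ev_conv _ _ A0 B1), (ev_conv _ _ A1 B0) by auto. unfold ww, wronsk, Pl, Mi, mlim. simpl Z.opp. simpl Z.add. ring.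
Qed.

Lemma wc_w1 : wl1 2 q -> exists B, w1 wc B.
Proof.
intros Hq2.
assert (HM2 := wl1_moment2 q Hq2). assert (HM2r := wl1_moment2 (refl q) (wl1_refl 2 q Hq2)).
destruct (blim_l1 q HM 0) as [A0 H0]. destruct (blim_l1 q HM 1) as [A1 H1].
destruct (blim_l1 (refl q) HMr (-1)) as [B1 H2]. destruct (blim_l1 (refl q) HMr 0) as [B0 H3].
destruct (blim_w1 q HM 0 HM2) as [A0' H0']. destruct (blim_w1 q HM 1 HM2) as [A1' H1'].
destruct (blim_w1 (refl q) HMr (-1) HM2r) as [B1' H2']. destruct (blim_w1 (refl q) HMr 0 HM2r) as [B0' H3'].
assert (W1 := w1_conv _ _ _ _ _ _ H0 H2 H0' H2'). assert (W2 := w1_conv _ _ _ _ _ _ H1 H3 H1' H3').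
assert (L2 := l1_conv _ _ _ _ H1 H3).
eexists. intros K. unfold wc. eapply Rle_trans; [apply wnrm_plus|]. rewrite wnrm_scal.
apply Rplus_le_compat; [apply W1|]. apply Rmult_le_compat_l; [apply Cmod_ge_0|].
eapply Rle_trans; [apply wnrm_sh|]. eapply Rle_trans; [apply Rplus_le_compat; [apply wnrm_sh|apply nrm_sh]|].
apply Rplus_le_compat; [apply Rplus_le_compat; [apply W2|apply L2]|apply L2].
Qed.

Lemma ww_0 : ww 0 = 1%C.
Proof. unfold ww, wronsk, Pl, Mi. rewrite !mlim_at_0; auto. ring. Qed.

Lemma ww_conj z : disc z -> ww (Cconj z) = Cconj (ww z).
Proof.
intros Hz. unfold ww, wronsk, Pl, Mi. rewrite !mlim_conj by auto. rewrite Cminus_conj, !Cmult_conj. reflexivity.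
Qed.

Lemma Csub_eq a b : Csub a b = (a - b)%C.
Proof. unfold Csub, Cminus, Cplus, Copp; simpl. f_equal; ring. Qed.

Lemma Cscal_eq r a : Cscal r a = (r * a)%C.
Proof. unfold Cscal, Cmult, RtoC; simpl. f_equal; ring. Qed.

Lemma Hop_eq u n : Hop q u n = ((2 + q n)%R * u n - u (n + 1)%Z - u (n - 1)%Z)%C.
Proof.
unfold Hop, Csub, Cscal, Cminus, Copp, Cplus, Cmult, RtoC. simpl. f_equal; ring.
Qed.

Lemma expi_unit t : disc (expi t).
Proof. unfold disc. rewrite Cmod_expi. lra. Qed.

(** Genericity speaks of all solutions with Jost asymptotics; to draw from it that the Wronskian
    does not vanish at z = 1 and z = -1, such solutions are exhibited with z = e^(-i theta). *)
Lemma jost_plus_spec th : JostPlus q th (fun n => (expi (- IZR n * th) * Pl (expi (- th)) n)%C).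
Proof.
split.
- intros n. rewrite Hop_eq, Cscal_eq. cbv beta. match goal with |- ?a = ?b => change (@eq C a b) end.
  set (z := expi (- th)).
  assert (Ep : expi (- IZR (n + 1) * th) = (z * expi (- IZR n * th))%C).
  { unfold z. rewrite <- expi_plus. f_equal. rewrite plus_IZR. ring. }
  assert (Hzz : (z * Cconj z)%C = 1%C) by apply expi_conj_mult.
  assert (Em : expi (- IZR (n - 1) * th) = (Cconj z * expi (- IZR n * th))%C).
  { unfold z. rewrite expi_conj, <- expi_plus. f_equal. rewrite minus_IZR. ring. }
  rewrite Ep, Em. set (x := expi (- IZR n * th)).
  assert (Hc : RtoC (2 * (1 - cos th)) = ((1 + 1) - z - Cconj z)%C).
  { unfold z, expi, Cconj, RtoC, Cminus, Cplus, Copp; simpl. rewrite cos_neg. f_equal; ring. }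
  rewrite Hc, RtoC_plus. replace (RtoC 2) with (1 + 1)%C by (rewrite <- RtoC_plus; f_equal; ring).
  rewrite (Pl_rec z n (expi_unit _)).
  transitivity (x * ((1 + 1 + q n) * Pl z n - z * Pl z (n + 1)%Z - Cconj z * Pl z n - (z * Cconj z) * z * Pl z n - (z * Cconj z) * q n * Pl z n + (z * Cconj z) * z * Pl z (n + 1)%Z))%C; [ring|].
  rewrite Hzz. ring.
- intros eps He. destruct (mlim_infty q HM (eps / 2) ltac:(lra)) as [n0 Hn0]. exists n0. intros n Hn.
  rewrite Csub_eq. replace (expi (- IZR n * th) * Pl (expi (- th)) n - Cexpi (- IZR n * th))%C with (expi (- IZR n * th) * (Pl (expi (- th)) n - 1))%C.
  + change (Defs.Cmod ?x) with (Cmod x). rewrite Cmod_mult, Cmod_expi, Rmult_1_l. specialize (Hn0 n (expi (- th)) Hn (expi_unit _)). unfold Pl. lra.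
  + change (Cexpi (- IZR n * th)) with (expi (- IZR n * th)). ring.
Qed.

Lemma jost_minus_spec th : JostMinus q th (fun n => (expi (IZR n * th) * Mi (expi (- th)) n)%C).
Proof.
split.
- intros n. rewrite Hop_eq, Cscal_eq. cbv beta. match goal with |- ?a = ?b => change (@eq C a b) end.
  set (z := expi (- th)).
  assert (Ep : expi (IZR (n + 1) * th) = (Cconj z * expi (IZR n * th))%C).
  { unfold z. rewrite expi_conj, <- expi_plus. f_equal. rewrite plus_IZR. ring. }
  assert (Hzz : (z * Cconj z)%C = 1%C) by apply expi_conj_mult.
  assert (Em : expi (IZR (n - 1) * th) = (z * expi (IZR n * th))%C).
  { unfold z. rewrite <- expi_plus. f_equal. rewrite minus_IZR. ring. }
  rewrite Ep, Em. set (x := expi (IZR n * th)).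
  assert (Hc : RtoC (2 * (1 - cos th)) = ((1 + 1) - z - Cconj z)%C).
  { unfold z, expi, Cconj, RtoC, Cminus, Cplus, Copp; simpl. rewrite cos_neg. f_equal; ring. }
  rewrite Hc, RtoC_plus. replace (RtoC 2) with (1 + 1)%C by (rewrite <- RtoC_plus; f_equal; ring).
  rewrite (Mi_rec z n (expi_unit _)).
  transitivity (x * ((1 + 1 + q n) * Mi z n - z * Mi z (n - 1)%Z - Cconj z * Mi z n - (z * Cconj z) * z * Mi z n - (z * Cconj z) * q n * Mi z n + (z * Cconj z) * z * Mi z (n - 1)%Z))%C; [ring|].
  rewrite Hzz. ring.
- intros eps He. destruct (mlim_infty (refl q) HMr (eps / 2) ltac:(lra)) as [n0 Hn0]. exists (- n0)%Z. intros n Hn.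
  rewrite Csub_eq. replace (expi (IZR n * th) * Mi (expi (- th)) n - Cexpi (IZR n * th))%C with (expi (IZR n * th) * (Mi (expi (- th)) n - 1))%C.
  + change (Defs.Cmod ?x) with (Cmod x). rewrite Cmod_mult, Cmod_expi, Rmult_1_l. specialize (Hn0 (- n)%Z (expi (- th)) ltac:(lia) (expi_unit _)). unfold Mi. lra.
  + change (Cexpi (IZR n * th)) with (expi (IZR n * th)). ring.
Qed.

Lemma generic_ww th : generic q -> th = 0 \/ th = PI -> ww (expi (- th)) <> 0%C.
Proof.
intros Hg Hth E.
apply (Hg th ltac:(tauto) _ _ (jost_plus_spec th) (jost_minus_spec th)).
unfold Wr. rewrite Csub_eq. simpl Z.add.
change Cmul with Cmult. match goal with |- ?a = ?b => change (@eq C a b) end.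
set (z := expi (- th)) in *.
replace (- IZR 1 * th) with (- th) by (simpl; ring). replace (- IZR 0 * th) with 0 by (simpl; ring).
replace (IZR 1 * th) with (- - th) by (simpl; ring). replace (IZR 0 * th) with 0 by (simpl; ring).
rewrite <- (expi_conj (- th)). fold z. rewrite expi_0.
assert (Hzz : (z * Cconj z)%C = 1%C) by apply expi_conj_mult.
transitivity (- (Cconj z) * ww z)%C; [|rewrite E; unfold Cmult, RtoC; simpl; f_equal; ring].
unfold ww, wronsk. simpl Z.add.
transitivity (z * Pl z 1%Z * Mi z 0%Z - Cconj z * Pl z 0%Z * Mi z 1%Z)%C; [ring|].
transitivity ((z * Cconj z) * z * Pl z 1%Z * Mi z 0%Z - Cconj z * Pl z 0%Z * Mi z 1%Z)%C; [rewrite Hzz; ring|ring].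
Qed.

Lemma ww_circle_neq0 z : Cmod z = 1 -> z <> 1%C -> z <> (-1)%C -> ww z <> 0%C.
Proof.
intros Hz H1 H2 E. assert (H := ww_lower z Hz). rewrite E, Cmod_0 in H.
assert (E1 : (1 - z * z)%C = 0%C) by (apply Cmod_eq_0; assert (H0 := Cmod_ge_0 (1 - z * z)); lra).
assert (E2 : ((1 - z) * (1 + z))%C = 0%C) by (rewrite <- E1; ring).
assert (N1 : (1 - z)%C <> 0%C). { intros E3. apply H1. replace z with (1 - (1 - z))%C by ring. rewrite E3. ring. }
assert (N2 : (1 + z)%C <> 0%C). { intros E3. apply H2. replace z with ((1 + z) - 1)%C by ring. rewrite E3. unfold Cminus, Cplus, Copp, RtoC; simpl; f_equal; ring. }
now apply (Cmult_neq_0 _ _ N1 N2).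
Qed.

(* Cancelling the zeros of the Wronskian at the band edges makes T = (1 - z^2)/w continuous there. *)
Definition edge_factor (e V : nat -> C) : Prop :=
  (exists B, l1 e B) /\ (exists B, l1 V B) /\ (forall z, Cmod z = 1 -> ev V z <> 0%C) /\ ev V 0 <> 0%C /\
  (forall z, disc z -> (ev e z * ww z)%C = ((1 - z * z) * ev V z)%C).

(** Away from the edges V inherits non-vanishing from the Wronskian. If V vanished at an edge a with
    e(a) <> 0, then at nearby points of the circle |e| |E'| = |1 - z^2| <= |w| = |E'| |V| would give
    |e| <= |V|, against continuity. Unitarity thus says that the zero of the Wronskian at an edge is
    at most simple. *)
Lemma edge_factor_intro e V (E' : C -> C) Be BV :
  l1 e Be -> l1 V BV -> (forall z, disc z -> ww z = (E' z * ev V z)%C) -> (forall z, disc z -> (ev e z * E' z)%C = (1 - z * z)%C) ->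
  (forall a, a = RtoC 1 \/ a = RtoC (-1) -> ww a <> 0%C \/ ev e a <> 0%C) -> edge_factor e V.
Proof.
intros He HV Hw HE Ha.
assert (HcV : forall z, Cmod z = 1 -> z <> 1%C -> z <> (-1)%C -> ev V z <> 0%C).
{ intros z Hz H1 H2 E. apply (ww_circle_neq0 z Hz H1 H2). rewrite Hw by (unfold disc; lra). rewrite E. ring. }
split; [now exists Be|]. split; [now exists BV|].
assert (Hd : forall z, disc z -> (ev e z * ww z)%C = ((1 - z * z) * ev V z)%C).
{ intros z Hz. rewrite <- HE, Hw by auto. ring. }
split; [|split; auto].
- intros z Hz. assert (Hzd : disc z) by (unfold disc; lra).
  destruct (classic (z = RtoC 1 \/ z = RtoC (-1))) as [Hpm|Hpm]; [|apply HcV; auto].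
  destruct (Ha z Hpm) as [H1|H1]. { intros E. apply H1. rewrite Hw by auto. rewrite E. ring. }
  intros E. apply Cmod_gt_0 in H1. set (d0 := Cmod (ev e z)) in *.
  destruct (ev_uc e Be He (d0 / 3) ltac:(lra)) as [d1 [Hd1 U1]]. destruct (ev_uc V BV HV (d0 / 3) ltac:(lra)) as [d2 [Hd2 U2]].
  set (t := Rmin 1 (Rmin (d1 / 3) (d2 / 3))).
  assert (Ht0 : 0 < t) by (unfold t; repeat apply Rmin_glb_lt; lra). assert (Ht1 : t <= 1) by apply Rmin_l.
  assert (Ht2 : t <= d1 / 3) by (eapply Rle_trans; [apply Rmin_r|apply Rmin_l]). assert (Ht3 : t <= d2 / 3) by (eapply Rle_trans; [apply Rmin_r|apply Rmin_r]).
  set (y := (z * expi t)%C). assert (Hy : Cmod y = 1) by (unfold y; rewrite Cmod_mult, Cmod_expi, Hz; ring).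
  assert (Hzy : Cmod (z - y) <= 2 * t).
  { unfold y. replace (z - z * expi t)%C with (z * (expi 0 - expi t))%C by (rewrite expi_0; ring). rewrite Cmod_mult, Hz, Rmult_1_l.
    eapply Rle_trans; [apply expi_lip|]. rewrite Rabs_left; lra. }
  assert (Hsin : 0 < sin t) by (apply sin_gt_0; [auto|assert (HP := PI_gt_3); lra]).
  assert (Hyr : Im y <> 0).
  { unfold y. destruct Hpm as [-> | ->]; unfold expi, Cmult, Im, RtoC; simpl; lra. }
  assert (Hy1 : y <> 1%C) by (intros Ey; apply Hyr; rewrite Ey; reflexivity).
  assert (Hy2 : y <> (-1)%C) by (intros Ey; apply Hyr; rewrite Ey; unfold Copp, RtoC, Im; simpl; ring).
  specialize (U1 z y ltac:(lra) ltac:(lra) ltac:(lra)). specialize (U2 z y ltac:(lra) ltac:(lra) ltac:(lra)). rewrite E in U2.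
  replace (0 - ev V y)%C with (- ev V y)%C in U2 by ring. rewrite Cmod_opp in U2.
  assert (T := Cmod_triangle (ev e z - ev e y) (ev e y)). replace (ev e z - ev e y + ev e y)%C with (ev e z) in T by ring. fold d0 in T.
  assert (Hyd : disc y) by (unfold disc; lra).
  assert (HEy : 0 < Cmod (E' y)).
  { apply Cmod_gt_0. intros E0. apply (ww_circle_neq0 y Hy Hy1 Hy2). rewrite Hw, E0 by auto. ring. }
  assert (L := ww_lower y Hy). rewrite <- HE, Hw in L by auto. rewrite !Cmod_mult in L.
  assert (Cmod (ev e y) <= Cmod (ev V y)) by nra. lra.
- intros E0. assert (H0 : disc 0) by (unfold disc; rewrite Cmod_0; lra). assert (H := Hw 0%C H0). rewrite ww_0, E0, Cmult_0_r in H. apply RtoC_inj in H. lra.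
Qed.

(** E' is 1, z - 1, z + 1 or 1 - z^2 according to the edges where the Wronskian vanishes, and e
    completes it to 1 - z^2. Genericity excludes such zeros; otherwise the second moment makes the
    quotients summable. *)
Lemma edge_factor_exists : (~ generic q -> wl1 2 q) -> exists e V, edge_factor e V.
Proof.
intros Hng. destruct wc_spec as [[B HB] Hev].
assert (D1 : disc 1) by (unfold disc; rewrite Cmod_1; lra). assert (Dm1 : disc (-1)) by (unfold disc; rewrite Cmod_R, Rabs_left; lra).
assert (L2 : l1 (fun k => (-1) * sh (sh delta0) k)%C (Cmod (-1) * 1)) by (apply l1_scal; repeat apply l1_sh; apply l1_delta0).
set (e0 := fun k => (delta0 k + (-1) * sh (sh delta0) k)%C).
assert (He0 : forall z, disc z -> ev e0 z = (1 - z * z)%C).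
{ intros z Hz. unfold e0. rewrite (ev_plus _ _ _ _ z l1_delta0 L2 Hz), (ev_scal _ _ 1) by (auto; repeat apply l1_sh; apply l1_delta0).
  rewrite !(ev_sh _ 1), ev_delta0 by (auto; repeat apply l1_sh; apply l1_delta0). ring. }
assert (G0 : ww 1 <> 0%C -> ww (-1) <> 0%C -> exists e V, edge_factor e V).
{ intros N1 N2. exists e0, wc. apply (edge_factor_intro e0 wc (fun _ => RtoC 1) (1 + Cmod (-1) * 1) B); auto.
  - exact (l1_plus _ _ _ _ l1_delta0 L2).
  - intros z Hz. rewrite Hev by auto. ring.
  - intros z Hz. rewrite He0 by auto. ring.
  - intros a [-> | ->]; left; auto. }
destruct (classic (generic q)) as [Hg|Hg].
{ apply G0.
  - replace (RtoC 1) with (expi (- 0)) by (rewrite Ropp_0; apply expi_0). apply generic_ww; auto.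
  - replace (RtoC (-1)) with (expi (- PI)). + apply generic_ww; auto. + unfold expi, RtoC. rewrite cos_neg, sin_neg, cos_PI, sin_PI. f_equal; ring. }
destruct (wc_w1 (Hng Hg)) as [Bw HBw].
assert (A1 : RtoC 1 <> 0%C) by (intros E; apply RtoC_inj in E; lra). assert (Am1 : RtoC (-1) <> 0%C) by (intros E; apply RtoC_inj in E; lra).
assert (Cm1 : Cmod (-1) = 1) by (rewrite Cmod_R, Rabs_left; lra).
set (V1 := quot wc 1). set (V2 := quot wc (-1)).
assert (Q1 : ww 1 = 0%C -> l1 V1 (2 * Bw) /\ forall z, disc z -> ww z = ((z - 1) * ev V1 z)%C).
{ intros E. assert (L : l1 V1 (2 * Bw)) by (apply (quot_l1_boundary wc 1 B Bw HB HBw Cmod_1); now rewrite Hev).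
  split; auto. intros z Hz. rewrite <- Hev by auto. apply (quot_ev wc 1 z _ B HB L A1 Hz). }
assert (Q2 : ww (-1) = 0%C -> l1 V2 (2 * Bw) /\ forall z, disc z -> ww z = ((z + 1) * ev V2 z)%C).
{ intros E. assert (L : l1 V2 (2 * Bw)) by (apply (quot_l1_boundary wc (-1) B Bw HB HBw Cm1); now rewrite Hev).
  split; auto. intros z Hz. rewrite <- Hev by auto. rewrite (quot_ev wc (-1) z _ B HB L Am1 Hz). fold V2.
  replace (z - (-1))%C with (z + 1)%C; auto. unfold Cminus, Cplus, Copp, RtoC; simpl; f_equal; ring. }
assert (Lsh : l1 (sh delta0) 1) by (apply l1_sh, l1_delta0).
assert (Esh : forall c, forall z, disc z -> ev (fun k => (delta0 k + c * sh delta0 k)%C) z = (1 + c * z)%C).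
{ intros c z Hz. rewrite (ev_plus _ _ _ _ z l1_delta0 (l1_scal c _ _ Lsh) Hz), (ev_scal _ _ 1), (ev_sh _ 1), ev_delta0; auto using l1_delta0. ring. }
destruct (classic (ww 1 = 0%C)) as [E1|E1]; destruct (classic (ww (-1) = 0%C)) as [E2|E2].
- destruct (Q1 E1) as [L1 F1]. destruct (Q2 E2) as [L2' F2].
  (* Partial fractions: w / (1 - z^2) is half of w / (z + 1) - w / (z - 1). Two quotients of w
     itself are combined, because a second division would ask for the weighted norm of the first
     quotient. *)
  set (hf := RtoC (/ 2)). assert (Hhf : (hf + hf)%C = 1%C) by (unfold hf; rewrite <- RtoC_plus; f_equal; field).
  set (V := fun k => (hf * V2 k + (- hf) * V1 k)%C).
  assert (LV := l1_plus _ _ _ _ (l1_scal hf _ _ L2') (l1_scal (- hf) _ _ L1)).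
  exists delta0, V. apply (edge_factor_intro delta0 V (fun z => (1 - z * z)%C) 1 _ l1_delta0 LV).
  + intros z Hz. unfold V. rewrite (ev_plus _ _ _ _ z (l1_scal hf _ _ L2') (l1_scal (- hf) _ _ L1) Hz).
    rewrite (ev_scal _ _ _ z L2' Hz), (ev_scal _ _ _ z L1 Hz).
    transitivity (hf * ((1 - z) * ((z + 1) * ev V2 z)) + hf * ((1 + z) * ((z - 1) * ev V1 z)))%C; [|ring].
    rewrite <- F1, <- F2 by auto.
    transitivity ((hf + hf) * ww z)%C; [rewrite Hhf|]; ring.
  + intros z Hz. rewrite ev_delta0 by auto. ring.
  + intros a Ha. right. rewrite ev_delta0; auto. destruct Ha as [-> | ->]; auto.
- destruct (Q1 E1) as [L1 F1].
  set (e := fun k => (-1 * (delta0 k + 1 * sh delta0 k))%C).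
  assert (Le := l1_plus _ _ _ _ l1_delta0 (l1_scal 1 _ _ Lsh)).
  assert (Ee : forall z, disc z -> ev e z = (-1 * (1 + z))%C).
  { intros z Hz. unfold e. rewrite (ev_scal _ _ _ z Le Hz), Esh by auto. ring. }
  exists e, V1. apply (edge_factor_intro e V1 (fun z => (z - 1)%C) _ _ (l1_scal (-1) _ _ Le) L1 F1).
  + intros z Hz. rewrite Ee by auto. transitivity ((-1) * ((1 + z) * (z - 1)))%C; [ring|].
    replace (RtoC (-1)) with (- (1))%C by (unfold Copp, RtoC; simpl; f_equal; ring). ring.
  + intros a [-> | ->]; [right|now left]. rewrite Ee by auto. intros E. apply (f_equal fst) in E. simpl in E. lra.
- destruct (Q2 E2) as [L2' F2].
  set (e := fun k => (delta0 k + (-1) * sh delta0 k)%C).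
  assert (Le := l1_plus _ _ _ _ l1_delta0 (l1_scal (-1) _ _ Lsh)).
  exists e, V2. apply (edge_factor_intro e V2 (fun z => (z + 1)%C) _ _ Le L2' F2).
  + intros z Hz. unfold e. rewrite Esh by auto.
    replace (RtoC (-1)) with (- (1))%C by (unfold Copp, RtoC; simpl; f_equal; ring). ring.
  + intros a [-> | ->]; [now left|right]. unfold e. rewrite Esh by auto. intros E. apply (f_equal fst) in E. simpl in E. lra.
- now apply G0.
Qed.

End Potential.

(** * The spectral kernel *)

Definition HR (q : Z -> R) (x : Z -> R) (n : Z) : R := (2 + q n) * x n - x (n + 1)%Z - x (n - 1)%Z.

Definition lam (z : C) : C := (1 + 1 - z - / z)%C.

(** On the unit circle, wherever w does not vanish, this is the transmission coefficient (1 - z^2) /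
    w; at a resonant edge it is the continuous extension. *)
Definition That (e V : nat -> C) (z : C) : C := (ev e z / ev V z)%C.

(* The resolvent kernel at [lam z] multiplied by 1/z - z. *)
Definition hk (q : Z -> R) (e V : nat -> C) (n m : Z) (z : C) : C := kern (Pl q z) (Mi q z) (That e V z) z n m.

Definition rho q e V (n m : Z) (t : R) : R := Re (hk q e V n m (expi t)).

Definition dlt (n m : Z) : R := if Z.eq_dec n m then 1 else 0.

(** H acts on the second variable. For m <> n this is the recursion of m_- or m_+; at m = n the two
    pieces mismatch by the Wronskian, and w T = 1 - z^2 produces the source. *)
Lemma hk_eq q e V n m z : wl1 1 q -> edge_factor q e V -> disc z -> z <> 0%C -> ev V z <> 0%C ->
  ((2 + q m)%R * hk q e V n m z - hk q e V n (m + 1) z - hk q e V n (m - 1) z)%C = (lam z * hk q e V n m z + dlt n m * (/ z - z))%C.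
Proof.
intros Hq [_ [_ [_ [_ He]]]] Hz Hz0 HV. unfold hk.
assert (HT : (That e V z * ww q z)%C = (1 - z * z)%C).
{ unfold That. transitivity (ev e z * ww q z / ev V z)%C; [field; auto|]. rewrite He by auto. field. auto. }
set (T := That e V z) in *. unfold kern, lam. rewrite RtoC_plus.
replace (RtoC 2) with (1 + 1)%C by (rewrite <- RtoC_plus; f_equal; ring).
unfold dlt. destruct (Z.eq_dec n m) as [E|E]; [subst m|destruct (Z_lt_le_dec m n) as [L|L]].
- rewrite Z.max_id, Z.min_id. rewrite !Z.max_r, !Z.min_l by lia. rewrite (Z.max_l n (n - 1)), (Z.min_r n (n - 1)) by lia.
  replace (Z.abs_nat (n - n)) with 0%nat by lia. replace (Z.abs_nat (n - (n + 1))) with 1%nat by lia. replace (Z.abs_nat (n - (n - 1))) with 1%nat by lia.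
  assert (Hw := ww_const q Hq z n Hz). unfold wronsk in Hw. rewrite (Mi_rec q Hq z n Hz) in Hw.
  set (X := Mi q z (n - 1)) in *. set (M := Mi q z n) in *. set (P := Pl q z n) in *. set (P1 := Pl q z (n + 1)) in *.
  simpl (z ^ 0)%C. simpl (z ^ 1)%C.
  transitivity ((1 + 1 - z - / z) * (1 * P * M * T) + T * (P * ((1 + z * z + z * q n) * M - z * z * X) - z * z * P1 * M) * / z)%C; [field; auto|].
  rewrite Hw, HT. field. auto.
- rewrite !(Z.max_l n), !(Z.min_r n) by lia.
  set (k := Z.abs_nat (n - (m + 1))). replace (Z.abs_nat (n - m)) with (S k) by (unfold k; lia). replace (Z.abs_nat (n - (m - 1))) with (S (S k)) by (unfold k; lia).
  rewrite (Mi_rec q Hq z m Hz). simpl Cpow. field. auto.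
- rewrite !(Z.max_r n), !(Z.min_l n) by lia.
  set (k := Z.abs_nat (n - (m - 1))). replace (Z.abs_nat (n - m)) with (S k) by (unfold k; lia). replace (Z.abs_nat (n - (m + 1))) with (S (S k)) by (unfold k; lia).
  rewrite (Pl_rec q Hq z m Hz). simpl Cpow. field. auto.
Qed.

Lemma Cinv_expi t : (/ expi t)%C = Cconj (expi t).
Proof.
assert (H := expi_conj_mult t). assert (Hn : expi t <> 0%C).
{ apply Cmod_gt_0. rewrite Cmod_expi. lra. }
replace (/ expi t)%C with (/ expi t * (expi t * Cconj (expi t)))%C by (rewrite H; ring). field. auto.
Qed.

Lemma lam_expi t : lam (expi t) = RtoC (2 - 2 * cos t).
Proof.
unfold lam. rewrite Cinv_expi. unfold expi, Cconj, RtoC, Cminus, Cplus, Copp; simpl. f_equal; ring.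
Qed.

(** On the circle 1/z - z is imaginary and lam is real, so taking the real part removes the delta
    source: each row of the spectral density is a generalised eigenfunction. *)
Lemma rho_eq q e V n m t : wl1 1 q -> edge_factor q e V -> HR q (fun m => rho q e V n m t) m = (2 - 2 * cos t) * rho q e V n m t.
Proof.
intros Hq He. assert (H := hk_eq q e V n m (expi t) Hq He (expi_unit t)).
assert (Hn : expi t <> 0%C) by (apply Cmod_gt_0; rewrite Cmod_expi; lra).
assert (HV : ev V (expi t) <> 0%C) by (destruct He as [_ [_ [HV _]]]; apply HV, Cmod_expi).
specialize (H Hn HV). rewrite lam_expi, Cinv_expi in H. apply (f_equal Re) in H. unfold HR, rho.
set (a := hk q e V n m (expi t)) in *. set (b := hk q e V n (m + 1) (expi t)) in *. set (c := hk q e V n (m - 1) (expi t)) in *.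
unfold expi, Cconj, RtoC, Cminus, Cplus, Copp, Cmult, Re in *. simpl in *. lra.
Qed.

(** * Functions regular on annuli and continuous up to the circle *)

Lemma ucont_minus D f g : ucont D f -> ucont D g -> ucont D (fun z => (f z - g z)%C).
Proof.
intros Hf Hg. destruct (ucont_plus D f (fun z => (-1) * g z)%C Hf (ucont_mult D (fun _ => RtoC (-1)) g (ucont_const D _) Hg)) as [[K [HK H1]] H2].
assert (E : forall z, (f z + -1 * g z)%C = (f z - g z)%C).
{ intros z. unfold Cminus. f_equal. unfold Copp, Cmult, RtoC; simpl; f_equal; ring. }
split. - exists K. split; auto. intros z Hz. rewrite <- E. auto.
- intros eps He. destruct (H2 eps He) as [d [Hd H3]]. exists d. split; auto. intros z z' Hz Hz' Hd'. rewrite <- !E. auto.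
Qed.

Lemma ucont_pow D f k : ucont D f -> ucont D (fun z => (f z ^ k)%C).
Proof. intros Hf. induction k as [|k IH]; simpl; [apply ucont_const|now apply ucont_mult]. Qed.

Lemma ucont_lprod D (f : C -> C -> C) l : (forall a, In a l -> ucont D (f a)) -> ucont D (fun z => lprod (fun a => f a z) l).
Proof.
induction l as [|a l IH]; intros H; simpl; [apply ucont_const|]. apply ucont_mult; [apply H; now left|apply IH; intros; apply H; now right].
Qed.

Definition holoE D f := exists f1, holo D f f1.

Lemma holoE_mult D f g : in_disc D -> holoE D f -> holoE D g -> holoE D (fun z => (f z * g z)%C).
Proof. intros HD [f1 Hf] [g1 Hg]. eexists. now apply holo_mult; eauto. Qed.

Lemma holoE_const D c : holoE D (fun _ => c).
Proof. eexists. apply holo_const. Qed.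

Lemma holo_feq D f g f1 : (forall z, f z = g z) -> holo D f f1 -> holo D g f1.
Proof. intros E [K [HK H]]. exists K. split; auto. intros z z' Hz Hz'. rewrite <- !E. auto. Qed.

Lemma holoE_minus D f g : in_disc D -> holoE D f -> holoE D g -> holoE D (fun z => (f z - g z)%C).
Proof.
intros HD [f1 Hf] Hg. destruct (holoE_mult D (fun _ => RtoC (-1)) g HD (holoE_const D _) Hg) as [g1 Hg'].
eexists. apply holo_feq with (fun z => (f z + -1 * g z)%C); [|apply holo_plus; eauto].
intros z. unfold Cminus. f_equal. unfold Copp, Cmult, RtoC; simpl; f_equal; ring.
Qed.

Lemma holoE_pow D f k : in_disc D -> holoE D f -> holoE D (fun z => (f z ^ k)%C).
Proof. intros HD Hf. induction k as [|k IH]; simpl; [apply holoE_const|now apply holoE_mult]. Qed.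

Section Good.
Variable r0 : R.
Hypothesis Hr0 : 0 < r0 <= 1 / 2.

(** Annuli instead of discs, since lam has a pole at 0. Inside the unit circle the function is
    differentiable with quadratic remainder; up to the circle it is uniformly continuous, which is
    what absolutely summable series provide. *)
Definition good (f : C -> C) : Prop :=
  (forall r, r < 1 -> holoE (fun z => r0 <= Cmod z <= r) f) /\ ucont (fun z => 1 / 2 <= Cmod z <= 1) f.

Lemma good_dom1 r : r < 1 -> in_disc (fun z => r0 <= Cmod z <= r).
Proof. intros Hr z Hz. lra. Qed.

Lemma good_dom2 : in_disc (fun z => 1 / 2 <= Cmod z <= 1).
Proof. intros z Hz. lra. Qed.

Lemma good_const c : good (fun _ => c).
Proof. split; [intros; apply holoE_const|apply ucont_const]. Qed.

Lemma good_id : good (fun z => z).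
Proof. split; [intros r Hr; eexists; apply holo_id, good_dom1; auto|apply ucont_id, good_dom2]. Qed.

Lemma good_mult f g : good f -> good g -> good (fun z => (f z * g z)%C).
Proof.
intros [F1 F2] [G1 G2]. split; [intros r Hr; apply holoE_mult; auto using good_dom1|now apply ucont_mult].
Qed.

Lemma good_minus f g : good f -> good g -> good (fun z => (f z - g z)%C).
Proof.
intros [F1 F2] [G1 G2]. split; [intros r Hr; apply holoE_minus; auto using good_dom1|now apply ucont_minus].
Qed.

Lemma good_pow f k : good f -> good (fun z => (f z ^ k)%C).
Proof. intros Hf. induction k as [|k IH]; simpl; [apply good_const|now apply good_mult]. Qed.

Lemma good_inv f c : good f -> 0 < c -> (forall z, r0 <= Cmod z <= 1 -> c <= Cmod (f z)) -> good (fun z => (/ f z)%C).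
Proof.
intros [F1 F2] Hc Hl. split.
- intros r Hr. destruct (F1 r Hr) as [f1 Hf]. eexists. apply (holo_inv _ f f1 c); auto using good_dom1. intros z Hz. apply Hl. lra.
- apply (ucont_inv _ f c); auto. intros z Hz. apply Hl. lra.
Qed.

Lemma good_ev x B : l1 x B -> good (ev x).
Proof.
intros Hx. split.
- intros r Hr. destruct (Rlt_dec 0 r).
  + exists (dev x). apply (holo_sub (fun z => Cmod z <= r)); [intros z Hz; lra|]. apply (holo_ev x B); auto.
  (* For r <= 0 the annulus is empty, because r0 > 0. *)
  + exists (fun _ => RtoC 0). exists 0. split; [lra|]. intros z z' Hz. lra.
- apply (ucont_ev x B); auto using good_dom2.
Qed.

Lemma good_lprod (f : C -> C -> C) l : (forall a, In a l -> good (f a)) -> good (fun z => lprod (fun a => f a z) l).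
Proof.
induction l as [|a l IH]; intros H; simpl; [apply good_const|]. apply good_mult; [apply H; now left|apply IH; intros; apply H; now right].
Qed.

Lemma good_mean F : good F -> mean F 1 = mean F r0.
Proof.
intros [F1 F2]. apply (mean_boundary (fun z => 1 / 2 <= Cmod z <= 1)); auto.
intros r Hr. destruct (F1 r ltac:(lra)) as [f1 Hf]. symmetry.
apply (mean_const _ F f1 r0 r (good_dom1 r ltac:(lra)) Hf); try lra. auto.
Qed.

End Good.

Lemma mean_lin r c f g : 0 < r <= 1 -> ucont (fun z => Cmod z = r) f -> ucont (fun z => Cmod z = r) g ->
  mean (fun z => (RtoC c * f z + g z)%C) r = c * mean f r + mean g r.
Proof.
intros Hr Hf Hg.
assert (Hc : forall t, Cmod (r * expi t) = r) by (intros t; apply Cmod_circle; lra).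
assert (If := RInt_correct (V := R_CompleteNormedModule) _ _ _ (ex_RInt_mean _ f r (- PI) PI Hr Hf Hc)).
assert (Ig := RInt_correct (V := R_CompleteNormedModule) _ _ _ (ex_RInt_mean _ g r (- PI) PI Hr Hg Hc)).
apply (is_RInt_unique (V := R_CompleteNormedModule)).
apply (is_RInt_ext (fun t => plus (scal c (Re (f (r * expi t)%C))) (Re (g (r * expi t)%C)))).
- intros t _. unfold plus, scal; simpl; unfold mult; simpl. unfold Cmult, Cplus, RtoC, Re; simpl. ring.
- apply (is_RInt_plus (V := R_NormedModule)); [apply (is_RInt_scal (V := R_NormedModule)); exact If|exact Ig].
Qed.

Lemma mean_ext r f g : (forall z, Cmod z = r -> f z = g z) -> 0 <= r -> mean f r = mean g r.
Proof. intros H Hr. apply RInt_ext. intros t _. rewrite H; auto. now apply Cmod_circle. Qed.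

Lemma CDer_pow f t f' k : CDer f t f' -> CDer (fun t => (f t ^ (S k))%C) t (INR (S k) * f t ^ k * f')%C.
Proof.
intros Hf. induction k as [|k IH].
- simpl. apply (CDer_eq _ _ (f' * 1 + f t * 0)%C). { simpl. ring. }
  apply (CDer_mult f (fun _ => RtoC 1)); auto. apply CDer_const.
- apply (CDer_eq _ _ (f' * f t ^ S k + f t * (INR (S k) * f t ^ k * f'))%C).
  + rewrite (S_INR (S k)), RtoC_plus. simpl Cpow. ring.
  + apply (CDer_mult f (fun t => (f t ^ S k)%C)); auto.
Qed.

(** The angular derivative of lam is i (1/z - z), so the integrand is the derivative of Im lam^(k+1)
    / (k + 1), a periodic function. *)
Lemma mean_lam_pow r k : 0 < r <= 1 -> mean (fun z => (lam z ^ k * (/ z - z))%C) r = 0.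
Proof.
intros Hr.
assert (Hrn : RtoC r <> 0%C) by (intros E; apply RtoC_inj in E; lra).
assert (Hn : forall t, (r * expi t)%C <> 0%C) by (intros t; apply Cmod_gt_0; rewrite Cmod_circle; lra).
assert (Hz : forall t, CDer (fun t => (r * expi t)%C) t (Ci * (r * expi t))%C).
{ intros t. apply (CDer_eq _ _ (0 * expi t + r * (Ci * expi t))%C); [ring|]. apply (CDer_mult (fun _ => RtoC r) expi); [apply CDer_const|apply CDer_expi]. }
assert (Hl : forall t, CDer (fun t => lam (r * expi t)%C) t (Ci * (/ (r * expi t) - r * expi t))%C).
{ intros t. unfold lam. apply (CDer_eq _ _ (0 - Ci * (r * expi t) - (- (Ci * (r * expi t)) / ((r * expi t) * (r * expi t))))%C); [field; split; auto|].
  - apply Cmod_gt_0. rewrite Cmod_expi. lra.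
  - apply CDer_minus; [apply CDer_minus; [apply CDer_const|apply Hz]|apply CDer_inv; auto; apply Hz]. }
assert (HSk : INR (S k) <> 0) by (apply not_0_INR; lia).
apply (is_RInt_unique (V := R_CompleteNormedModule)).
set (G := fun t => / INR (S k) * Im (lam (r * expi t) ^ (S k))%C).
set (g := fun t => Re (lam (r * expi t) ^ k * (/ (r * expi t) - r * expi t))%C).
assert (HG : forall t, is_derive G t (g t)).
{ intros t. destruct (CDer_pow _ t _ k (Hl t)) as [_ D].
  replace (g t) with (/ INR (S k) * Im (INR (S k) * lam (r * expi t) ^ k * (Ci * (/ (r * expi t) - r * expi t)))%C).
  - apply is_derive_scal. exact D.
  - unfold g. set (A := (lam (r * expi t) ^ k)%C). set (B := (/ (r * expi t) - r * expi t)%C). set (s := INR (S k)) in *.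
    destruct A as [a1 a2], B as [b1 b2]. unfold Cmult, RtoC, Ci, Re, Im; simpl. field. auto. }
assert (H : is_RInt g (- PI) PI (minus (G PI) (G (- PI)))).
{ apply (is_RInt_derive G g).
  - intros t _. apply HG.
  - intros t _. unfold g.
    assert (U : ucont (fun z => Cmod z = r) (fun z => (lam z ^ k * (/ z - z))%C)).
    { assert (HD : in_disc (fun z => Cmod z = r)) by (intros z Hzz; lra).
      assert (Ui := ucont_id _ HD). assert (Uv : ucont (fun z => Cmod z = r) (fun z => (/ z)%C)) by (apply (ucont_inv _ _ r); auto; [lra|intros; lra]).
      apply ucont_mult; [apply ucont_pow|now apply ucont_minus]. unfold lam. apply ucont_minus; auto. apply ucont_minus; auto. apply ucont_const. }
    apply (cont_circle _ (fun z => (lam z ^ k * (/ z - z))%C) r t Hr U). intros t'. apply Cmod_circle. lra. }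
replace (minus (G PI) (G (- PI))) with 0 in H; [exact H|].
unfold G. replace (expi (- PI)) with (expi PI).
2:{ unfold expi. rewrite cos_neg, sin_neg, sin_PI. f_equal. ring. }
symmetry. apply (plus_opp_r (G := R_AbelianGroup)).
Qed.

(** * Polynomials of H removing the poles of the kernel *)

(** (L - lam a) (L - conj (lam a)): the conjugate factor makes the polynomial real without knowing
    that lam a is real. *)
Definition pfac (a L : C) : C := (L * L - (lam a + Cconj (lam a)) * L + lam a * Cconj (lam a))%C.
Definition pfacR (a : C) (L : R) : R := L * L - 2 * Re (lam a) * L + Cmod (lam a) ^ 2.
Definition opA (q : Z -> R) (a : C) (x : Z -> R) (n : Z) : R := HR q (HR q x) n - 2 * Re (lam a) * HR q x n + Cmod (lam a) ^ 2 * x n.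
Definition polC (l : list C) (L : C) : C := lprod (fun a => pfac a L) l.
Fixpoint polR (l : list C) (L : R) : R := match l with nil => 1 | a :: l => pfacR a L * polR l L end.
Fixpoint polop (q : Z -> R) (l : list C) (x : Z -> R) : Z -> R := match l with nil => x | a :: l => opA q a (polop q l x) end.

Lemma pfac_eq a L : pfac a L = (L * L + (RtoC (- (2 * Re (lam a))) * L + RtoC (Cmod (lam a) ^ 2) * 1))%C.
Proof.
unfold pfac. rewrite Cmod2_conj.
replace (lam a + Cconj (lam a))%C with (RtoC (2 * Re (lam a))).
- rewrite RtoC_opp. ring.
- destruct (lam a) as [x y]. unfold Cconj, Cplus, RtoC; simpl. f_equal; ring.
Qed.

Lemma pfac_R a L : pfac a (RtoC L) = RtoC (pfacR a L).
Proof. rewrite pfac_eq. unfold pfacR. rewrite RtoC_plus, RtoC_minus, !RtoC_mult, RtoC_opp, !RtoC_mult. ring. Qed.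

Lemma polC_R l L : polC l (RtoC L) = RtoC (polR l L).
Proof. induction l as [|a l IH]; [reflexivity|]. unfold polC in *. simpl. rewrite IH, pfac_R, RtoC_mult. reflexivity. Qed.

Lemma HR_ext q x y n : (forall m, x m = y m) -> HR q x n = HR q y n.
Proof. intros H. unfold HR. now rewrite !H. Qed.

Lemma opA_ext q a x y n : (forall m, x m = y m) -> opA q a x n = opA q a y n.
Proof. intros H. unfold opA. rewrite H, (HR_ext q x y) by auto. rewrite (HR_ext q (HR q x) (HR q y)); auto. intros; now apply HR_ext. Qed.

Section PoleRemoval.
Variables (q : Z -> R) (e V : nat -> C).
Hypothesis Hq : wl1 1 q.
Hypothesis He : edge_factor q e V.

Lemma ucont_Pl D n : in_disc D -> ucont D (fun z => Pl q z n).
Proof. intros HD. destruct (blim_l1 q (wl1_moment q Hq) n) as [A HA]. apply (ucont_ev (blim q n) A); auto. Qed.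

Lemma ucont_Mi D n : in_disc D -> ucont D (fun z => Mi q z n).
Proof. intros HD. destruct (blim_l1 (refl q) (wl1_moment _ (wl1_refl 1 q Hq)) (- n)) as [A HA]. apply (ucont_ev (blim (refl q) (- n)) A); auto. Qed.

Lemma ucont_That D c : in_disc D -> 0 < c -> (forall z, D z -> c <= Cmod (ev V z)) -> ucont D (That e V).
Proof.
intros HD Hc Hl. destruct He as [[B HB] [[BV HBV] _]]. unfold That, Cdiv.
apply ucont_mult; [now apply (ucont_ev e B)|]. apply (ucont_inv _ _ c); auto. now apply (ucont_ev V BV).
Qed.

Lemma ucont_hk D c n m : in_disc D -> 0 < c -> (forall z, D z -> c <= Cmod (ev V z)) -> ucont D (hk q e V n m).
Proof.
intros HD Hc Hl. unfold hk, kern.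
apply ucont_mult; [|now apply (ucont_That D c)]. apply ucont_mult; [|now apply ucont_Mi]. apply ucont_mult; [|now apply ucont_Pl].
apply ucont_pow. now apply ucont_id.
Qed.

Lemma V_circle_lower : exists c, 0 < c /\ forall z, Cmod z = 1 -> c <= Cmod (ev V z).
Proof. destruct He as [_ [[B HB] [HV _]]]. now apply (circle_lower_bound V B). Qed.

Lemma rho_cont n m t : continuous (rho q e V n m) t.
Proof.
destruct V_circle_lower as [c [Hc Hl]].
apply (continuous_ext (fun t => Re (hk q e V n m (1 * expi t)%C))). { intros t'. unfold rho. now rewrite Cmult_1_l. }
apply (cont_circle (fun z => Cmod z = 1)); [lra| |].
- apply (ucont_hk _ c); auto. intros z Hz; lra.
- intros t'. rewrite Cmult_1_l. apply Cmod_expi.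
Qed.

Definition intr (phi : R -> R) (n m : Z) : R := RInt (fun t => phi t * rho q e V n m t) 0 PI.

Lemma ex_RInt_phi_rho phi n m a b : (forall t, continuous phi t) -> ex_RInt (fun t => phi t * rho q e V n m t) a b.
Proof.
intros Hphi. apply (ex_RInt_continuous (V := R_CompleteNormedModule)). intros t _.
apply (continuous_mult phi (rho q e V n m)); auto. apply rho_cont.
Qed.

Lemma intr_lin (f g : R -> R) c n m : (forall t, continuous f t) -> (forall t, continuous g t) ->
  intr (fun t => c * f t + g t) n m = c * intr f n m + intr g n m.
Proof.
intros Hf Hg. unfold intr. apply (is_RInt_unique (V := R_CompleteNormedModule)).
apply (is_RInt_ext (fun t => plus (scal c (f t * rho q e V n m t)) (g t * rho q e V n m t))).
- intros t _. unfold plus, scal; simpl; unfold mult; simpl. ring.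
- apply (is_RInt_plus (V := R_NormedModule)); [apply (is_RInt_scal (V := R_NormedModule))|]; apply (RInt_correct (V := R_CompleteNormedModule)); now apply ex_RInt_phi_rho.
Qed.

Lemma intr_HR phi n m : (forall t, continuous phi t) -> HR q (fun m => intr phi n m) m = intr (fun t => (2 - 2 * cos t) * phi t) n m.
Proof.
intros Hphi. unfold HR, intr. symmetry. apply (is_RInt_unique (V := R_CompleteNormedModule)).
apply (is_RInt_ext (fun t => minus (minus (scal (2 + q m) (phi t * rho q e V n m t)) (phi t * rho q e V n (m + 1) t)) (phi t * rho q e V n (m - 1) t))).
- intros t _. rewrite (Rmult_comm (2 - 2 * cos t)), Rmult_assoc, <- (rho_eq q e V n m t Hq He). unfold HR. unfold minus, plus, opp, scal; simpl; unfold mult; simpl. ring.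
- apply (is_RInt_minus (V := R_NormedModule)); [apply (is_RInt_minus (V := R_NormedModule)); [apply (is_RInt_scal (V := R_NormedModule))|]|];
  apply (RInt_correct (V := R_CompleteNormedModule)); now apply ex_RInt_phi_rho.
Qed.

Lemma cont_lamphi phi : (forall t, continuous phi t) -> forall t, continuous (fun t => (2 - 2 * cos t) * phi t) t.
Proof.
intros H t. apply (continuous_mult (fun t => 2 - 2 * cos t) phi); auto. apply (is_derive_cont _ _ (2 * sin t)). auto_derive; [exact I|ring].
Qed.

Lemma intr_ext f g n m : (forall t, f t = g t) -> intr f n m = intr g n m.
Proof. intros H. apply RInt_ext. intros t _. now rewrite H. Qed.

Lemma cont_polR l : forall t, continuous (fun t => polR l (2 - 2 * cos t)) t.
Proof.
induction l as [|a l IH]; intros t; simpl; [apply continuous_const|].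
apply (continuous_mult (fun t => pfacR a (2 - 2 * cos t)) (fun t => polR l (2 - 2 * cos t))); auto.
unfold pfacR. eapply is_derive_cont. auto_derive; [exact I|reflexivity].
Qed.

Lemma polop_intr l n m : polop q l (fun m => intr (fun _ => 1) n m) m = intr (fun t => polR l (2 - 2 * cos t)) n m.
Proof.
revert m. induction l as [|a l IH]; intros m; [reflexivity|]. simpl polop.
rewrite (opA_ext q a _ (fun m => intr (fun t => polR l (2 - 2 * cos t)) n m)) by auto.
unfold opA.
rewrite (HR_ext q (HR q _) (fun m => intr (fun t => (2 - 2 * cos t) * polR l (2 - 2 * cos t)) n m)) by (intros; apply intr_HR, cont_polR).
rewrite intr_HR by (apply cont_lamphi, cont_polR). rewrite intr_HR by apply cont_polR.
set (c1 := - (2 * Re (lam a))). set (c2 := Cmod (lam a) ^ 2).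
transitivity (c1 * intr (fun t => (2 - 2 * cos t) * polR l (2 - 2 * cos t)) n m + (c2 * intr (fun t => polR l (2 - 2 * cos t)) n m + intr (fun t => (2 - 2 * cos t) * ((2 - 2 * cos t) * polR l (2 - 2 * cos t))) n m)).
{ unfold c1. ring. }
rewrite <- intr_lin by (auto using cont_polR, cont_lamphi). rewrite <- intr_lin.
- apply intr_ext. intros t. simpl. unfold pfacR, c1, c2. ring.
- intros t. apply cont_lamphi, cont_polR.
- intros t. apply (continuous_plus (fun t => c2 * polR l (2 - 2 * cos t)) (fun t => (2 - 2 * cos t) * ((2 - 2 * cos t) * polR l (2 - 2 * cos t)))).
  + apply (continuous_scal_r c2 (fun t => polR l (2 - 2 * cos t))), cont_polR.
  + apply cont_lamphi, cont_lamphi, cont_polR.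
Qed.

(* On a circle inside the zero-free disc of V the circular mean of the kernel is the identity matrix. *)
Section SmallCircle.
Variable r : R.
Hypothesis Hr : 0 < r <= 1 / 2.
Variable c : R.
Hypothesis Hc : 0 < c.
Hypothesis HV : forall z, Cmod z <= r -> c <= Cmod (ev V z).

Let D (z : C) := Cmod z = r.

Lemma D_disc : in_disc D.
Proof. intros z Hz. unfold D in Hz. lra. Qed.

Lemma ucont_invz : ucont D (fun z => (/ z)%C).
Proof. apply (ucont_inv _ _ r); [apply ucont_id, D_disc|lra|]. intros z Hz. unfold D in Hz. lra. Qed.

Lemma ucont_lam : ucont D lam.
Proof.
unfold lam. apply ucont_minus; [|apply ucont_invz]. apply ucont_minus; [|apply ucont_id, D_disc]. apply ucont_const.
Qed.

Lemma ucont_polC l : ucont D (fun z => polC l (lam z)).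
Proof.
unfold polC. apply (ucont_lprod D (fun a z => pfac a (lam z))). intros a _. unfold pfac.
apply ucont_plus; [|apply ucont_const]. apply ucont_minus; [|apply ucont_mult; [apply ucont_const|]]; [apply ucont_mult|]; apply ucont_lam.
Qed.

Lemma ucont_hkD n m : ucont D (hk q e V n m).
Proof. apply (ucont_hk D c); auto using D_disc. intros z Hz. apply HV. unfold D in Hz. lra. Qed.

Definition mom (k : nat) (l : list C) (f : C -> C) : R := mean (fun z => (lam z ^ k * polC l (lam z) * f z)%C) r.

Lemma ucont_mom k l f : ucont D f -> ucont D (fun z => (lam z ^ k * polC l (lam z) * f z)%C).
Proof. intros Hf. apply ucont_mult; auto. apply ucont_mult; [apply ucont_pow, ucont_lam|apply ucont_polC]. Qed.

Lemma mom_cons k a l f : ucont D f -> mom k (a :: l) f = mom (S (S k)) l f - 2 * Re (lam a) * mom (S k) l f + Cmod (lam a) ^ 2 * mom k l f.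
Proof.
intros Hf. unfold mom.
transitivity (- (2 * Re (lam a)) * mom (S k) l f + (Cmod (lam a) ^ 2 * mom k l f + mom (S (S k)) l f)); [|unfold mom; ring].
unfold mom. rewrite <- (mean_lin r _ (fun z => lam z ^ k * polC l (lam z) * f z)%C) by (try lra; now apply ucont_mom).
rewrite <- (mean_lin r _ (fun z => lam z ^ (S k) * polC l (lam z) * f z)%C); [|lra|now apply ucont_mom|].
- apply mean_ext; [|lra]. intros z _. unfold polC. simpl lprod. rewrite pfac_eq. simpl Cpow. ring.
- apply (ucont_plus D (fun z => RtoC (Cmod (lam a) ^ 2) * (lam z ^ k * polC l (lam z) * f z))%C); [|now apply ucont_mom].
  apply ucont_mult; [apply ucont_const|now apply ucont_mom].
Qed.

Lemma mom_zero l k : mom k l (fun z => (/ z - z)%C) = 0.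
Proof.
assert (U : ucont D (fun z => (/ z - z)%C)) by (apply ucont_minus; [apply ucont_invz|apply ucont_id, D_disc]).
revert k. induction l as [|a l IH]; intros k.
- unfold mom. rewrite (mean_ext r _ (fun z => (lam z ^ k * (/ z - z))%C)); [apply mean_lam_pow; lra| |lra].
  intros z _. unfold polC; simpl lprod. ring.
- rewrite mom_cons by auto. rewrite !IH. ring.
Qed.

(** A factor lam under the mean acts as H on the row, because the source term of [hk_eq], multiplied
    by a polynomial in lam, has mean zero on the circle. *)
Lemma mom_HR k l n m : mom (S k) l (hk q e V n m) = HR q (fun m => mom k l (hk q e V n m)) m.
Proof.
unfold HR.
assert (U : ucont D (fun z => (/ z - z)%C)) by (apply ucont_minus; [apply ucont_invz|apply ucont_id, D_disc]).
assert (U1 := ucont_mom k l _ (ucont_hkD n m)). assert (U2 := ucont_mom k l _ (ucont_hkD n (m + 1))). assert (U3 := ucont_mom k l _ (ucont_hkD n (m - 1))).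
assert (U4 := ucont_mom k l _ U).
transitivity ((2 + q m) * mom k l (hk q e V n m) + (-1 * mom k l (hk q e V n (m + 1)) + (-1 * mom k l (hk q e V n (m - 1)) + (- dlt n m) * mom k l (fun z => (/ z - z)%C)))); [|rewrite mom_zero; ring].
assert (U0 : ucont D (fun _ => RtoC 0)) by apply ucont_const.
assert (Mz : mean (fun _ => RtoC 0) r = 0).
{ unfold mean. rewrite (RInt_const (V := R_CompleteNormedModule)). unfold scal; simpl; unfold mult; simpl. ring. }
replace (- dlt n m * mom k l (fun z => (/ z - z)%C)) with (- dlt n m * mom k l (fun z => (/ z - z)%C) + mean (fun _ => RtoC 0) r) by (rewrite Mz; ring).
unfold mom.
assert (Ul : forall x f g, ucont D f -> ucont D g -> ucont D (fun z => (RtoC x * f z + g z)%C)).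
{ intros x f g Hf Hg. apply ucont_plus; auto. apply ucont_mult; auto. apply ucont_const. }
rewrite <- (mean_lin r (- dlt n m)) by (try lra; auto).
rewrite <- (mean_lin r (-1)) by (try lra; auto).
rewrite <- (mean_lin r (-1)) by (try lra; auto).
rewrite <- (mean_lin r (2 + q m)) by (try lra; auto).
apply mean_ext; [|lra]. intros z Hz.
assert (Hz0 : z <> 0%C) by (apply Cmod_gt_0; lra).
assert (HVz : ev V z <> 0%C) by (apply Cmod_gt_0; specialize (HV z ltac:(lra)); lra).
assert (E := hk_eq q e V n m z Hq He ltac:(unfold disc; lra) Hz0 HVz).
set (A := (lam z ^ k * polC l (lam z))%C).
transitivity (A * (lam z * hk q e V n m z + dlt n m * (/ z - z)) - A * dlt n m * (/ z - z))%C.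
{ unfold A. simpl Cpow. ring. }
rewrite <- E. rewrite RtoC_opp. replace (RtoC (-1)) with (- (1))%C by (unfold Copp, RtoC; simpl; f_equal; ring). fold A. ring.
Qed.

(** The kernel is holomorphic on the small disc, so its mean is governed by the value at 0, where
    m_+, m_- and T are 1 and z^|n-m| leaves only the diagonal. *)
Lemma hk_center n m : mean (hk q e V n m) r = 2 * PI * dlt n m.
Proof.
destruct He as [[B HB] [[BV HBV] [_ [HV0 Hew]]]].
assert (HD : in_disc (fun z => Cmod z <= r)) by (intros z Hz; lra).
assert (Hev : forall x A, l1 x A -> holoE (fun z => Cmod z <= r) (ev x)) by (intros x A HA; exists (dev x); apply (holo_ev x A); auto; lra).
assert (Hh : holoE (fun z => Cmod z <= r) (hk q e V n m)).
{ unfold hk, kern, That, Cdiv, Pl, Mi, mlim. destruct (blim_l1 q (wl1_moment q Hq) (Z.max n m)) as [A1 HA1].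
  destruct (blim_l1 (refl q) (wl1_moment _ (wl1_refl 1 q Hq)) (- Z.min n m)) as [A2 HA2].
  apply holoE_mult; auto; [apply holoE_mult; auto; [apply holoE_mult; auto|]|].
  - apply holoE_pow; auto. eexists. now apply holo_id.
  - eapply Hev; eauto.
  - eapply Hev; eauto.
  - apply holoE_mult; auto; [eapply Hev; eauto|]. destruct (Hev V BV HBV) as [V1 HV1]. eexists. apply (holo_inv _ _ V1 c); auto. }
destruct Hh as [h1 Hh]. rewrite (mean_center _ h1 r) by (auto; lra). f_equal.
unfold hk, kern. unfold Pl, Mi. rewrite (mlim_at_0 q (wl1_moment q Hq)), (mlim_at_0 (refl q) (wl1_moment _ (wl1_refl 1 q Hq))).
assert (HT : That e V 0 = 1%C).
{ unfold That. assert (E := Hew 0%C ltac:(unfold disc; rewrite Cmod_0; lra)). rewrite ww_0 in E by auto.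
  replace (ev e 0) with (ev e 0 * 1)%C by ring. rewrite E. field. exact HV0. }
rewrite HT. unfold dlt. destruct (Z.eq_dec n m) as [->|E].
- replace (Z.abs_nat (m - m)) with O by lia. simpl. ring.
- destruct (Z.abs_nat (n - m)) as [|k] eqn:Ek; [lia|]. simpl. ring.
Qed.

Lemma mom_polop l n : forall k m, mom k l (hk q e V n m) = Nat.iter k (HR q) (fun m => 2 * PI * polop q l (dlt n) m) m.
Proof.
induction l as [|a l IH]; induction k as [|k IHk]; intros m.
- unfold mom. rewrite (mean_ext r _ (hk q e V n m)); [apply hk_center| |lra]. intros z _. unfold polC; simpl. ring.
- rewrite mom_HR. simpl. apply HR_ext. auto.
- rewrite mom_cons by apply ucont_hkD. rewrite !IH. simpl Nat.iter. simpl polop. unfold opA. unfold HR. ring.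
- rewrite mom_HR. simpl. apply HR_ext. auto.
Qed.

End SmallCircle.

Lemma small_circle_exists : exists r c, 0 < r <= 1 / 2 /\ 0 < c /\ forall z, Cmod z <= r -> c <= Cmod (ev V z).
Proof.
destruct He as [_ [[BV HBV] [_ [HV0 _]]]]. apply Cmod_gt_0 in HV0. set (c := Cmod (ev V 0)) in *.
destruct (ev_uc V BV HBV (c / 2) ltac:(lra)) as [d [Hd Hu]].
exists (Rmin (1 / 2) (d / 2)), (c / 2). assert (H1 := Rmin_l (1 / 2) (d / 2)). assert (H2 := Rmin_r (1 / 2) (d / 2)).
split; [split; auto; apply Rmin_glb_lt; lra|]. split; [lra|]. intros z Hz.
assert (Hd' : Cmod (0 - z) < d) by (replace (0 - z)%C with (- z)%C by ring; rewrite Cmod_opp; lra).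
specialize (Hu 0%C z ltac:(rewrite Cmod_0; lra) ltac:(lra) Hd').
assert (T := Cmod_triangle (ev V 0 - ev V z) (ev V z)). replace (ev V 0 - ev V z + ev V z)%C with (ev V 0) in T by ring. fold c in T. lra.
Qed.

(* The kernel of P_c(H), by Stone's formula. *)
Definition qn (n m : Z) : R := / PI * intr (fun _ => 1) n m.

Lemma hk_conj n m t : 0 < t < PI -> hk q e V n m (expi (- t)) = Cconj (hk q e V n m (expi t)).
Proof.
intros Ht. rewrite <- expi_conj. set (z := expi t).
assert (Hz : disc z) by apply expi_unit. assert (Hcz : disc (Cconj z)) by (unfold z; rewrite expi_conj; apply expi_unit).
destruct He as [_ [_ [HV [_ Hew]]]].
assert (Hsin : 0 < sin t) by (apply sin_gt_0; lra).
assert (Hw : forall z', z' = z \/ z' = Cconj z -> ww q z' <> 0%C).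
{ intros z' Hz'. apply ww_circle_neq0; auto.
  - destruct Hz' as [-> | ->]; unfold z; rewrite ?Cmod_conj; apply Cmod_expi.
  - intros E. destruct Hz' as [-> | ->]; apply (f_equal snd) in E; unfold z, expi, Cconj in E; simpl in E; lra.
  - intros E. destruct Hz' as [-> | ->]; apply (f_equal snd) in E; unfold z, expi, Cconj in E; simpl in E; lra. }
assert (HT : forall z', z' = z \/ z' = Cconj z -> That e V z' = ((1 - z' * z') / ww q z')%C).
{ intros z' Hz'. assert (Hd : disc z') by (destruct Hz' as [-> | ->]; auto). assert (Hv : ev V z' <> 0%C).
  { apply HV. destruct Hz' as [-> | ->]; unfold z; rewrite ?Cmod_conj; apply Cmod_expi. }
  assert (Hwz := Hw z' Hz'). unfold That. transitivity (ev e z' * ww q z' / (ev V z' * ww q z'))%C; [field; auto|]. rewrite Hew by auto. field; auto. }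
unfold hk, kern. rewrite !HT by auto. rewrite ww_conj by auto. unfold Pl, Mi.
rewrite (mlim_conj q (wl1_moment q Hq)), (mlim_conj (refl q) (wl1_moment _ (wl1_refl 1 q Hq))) by auto.
rewrite !Cmult_conj, Cdiv_conj, Cminus_conj, Cmult_conj, Cpow_conj by auto. rewrite Cconj_R. reflexivity.
Qed.

(** The kernel takes conjugate values at conjugate points, which folds the circle onto its upper
    half; lam is real there, so the real part falls on the kernel alone. *)
Lemma mean_half (l : list C) n m : mean (fun z => (polC l (lam z) * hk q e V n m z)%C) 1 = 2 * intr (fun t => polR l (2 - 2 * cos t)) n m.
Proof.
unfold mean. set (f := fun t => polR l (2 - 2 * cos t) * rho q e V n m t).
assert (E : forall t, Re ((fun z => (polC l (lam z) * hk q e V n m z)%C) (1 * expi t)%C) = f t).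
{ intros t. cbv beta. rewrite Cmult_1_l, lam_expi, polC_R. unfold f, rho. unfold Cmult, RtoC, Re; simpl. ring. }
rewrite (RInt_ext _ f) by (intros; apply E).
assert (Hex : forall a b, ex_RInt f a b) by (intros a b; apply ex_RInt_phi_rho, cont_polR).
rewrite <- (RInt_Chasles (V := R_CompleteNormedModule) f (- PI) 0 PI) by auto.
assert (H := RInt_comp_lin (V := R_CompleteNormedModule) f (-1) 0 0 PI).
assert (Hs : RInt f (- PI) 0 = RInt f 0 PI).
{ rewrite <- (opp_RInt_swap (V := R_CompleteNormedModule)) by auto.
  replace (-1 * 0 + 0) with 0 in H by ring. replace (-1 * PI + 0) with (- PI) in H by ring.
  rewrite <- H by auto. rewrite <- (RInt_opp (V := R_CompleteNormedModule)).
  - apply RInt_ext. rewrite Rmin_left, Rmax_right by (assert (HP := PI_RGT_0); lra). intros t Ht. unfold opp, scal; simpl; unfold mult; simpl.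
    replace (-1 * t + 0) with (- t) by ring. unfold f. rewrite cos_neg. unfold rho. rewrite hk_conj by auto. rewrite re_conj. ring.
  - apply (ex_RInt_comp_lin (V := R_NormedModule) f (-1) 0). auto. }
rewrite Hs. unfold intr, plus; simpl. fold f. ring.
Qed.

Lemma polop_scal l c x m : polop q l (fun m => c * x m) m = c * polop q l x m.
Proof.
revert m. induction l as [|a l IH]; intros m; [reflexivity|]. simpl. rewrite (opA_ext q a _ (fun m => c * polop q l x m)) by auto.
unfold opA, HR. ring.
Qed.

Lemma lam_factor (a z : C) : a <> 0%C -> z <> 0%C -> (lam z - lam a)%C = ((z - a) * ((1 - a * z) * / a * / z))%C.
Proof. intros Ha Hz. unfold lam. field. auto. Qed.

Theorem pole_removal : exists l, forall n m, polop q l (qn n) m = polop q l (dlt n) m.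
Proof.
assert (He' := He). destruct He' as [[B HB] [[BV HBV] [HVc [HV0 Hew]]]].
destruct (blaschke_factorisation V BV HBV) as [l [U [[BU HU] [Hl [Hfac [c [Hc HcU]]]]]]]; auto.
{ rewrite <- (ev_0 V BV HBV). exact HV0. }
destruct small_circle_exists as [r0 [c0 [Hr0 [Hc0 HV1]]]].
exists l. intros n m.
(* [Ra] is the cofactor of z - a in [pfac a (lam z)], and [Ga] adds the Blaschke factor 1 - conj a
   z. With 1/V expressed by U and the Blaschke product, the factors z - a cancel, and F continues
   the polynomial times the kernel across the zeros of V. *)
set (Ra := fun a z => ((1 - a * z) * / a * / z * (lam z - Cconj (lam a)))%C).
set (Ga := fun a z => ((1 - Cconj a * z) * Ra a z)%C).
set (F := fun z => (z ^ (Z.abs_nat (n - m)) * Pl q z (Z.max n m) * Mi q z (Z.min n m) * ev e z * / ev U z * lprod (fun a => Ga a z) l)%C).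
assert (HF : forall z : C, z <> 0%C -> disc z -> ev V z <> 0%C -> (polC l (lam z) * hk q e V n m z)%C = F z).
{ intros z Hz Hd HVz. unfold F, hk, kern, That.
  assert (HUz : ev U z <> 0%C) by (apply Cmod_gt_0; specialize (HcU z Hd); lra).
  assert (E1 : polC l (lam z) = (lprod (fun a => (z - a)%C) l * lprod (fun a => Ra a z) l)%C).
  { unfold polC. clear - Hl Hz. induction l as [|a l IH]; simpl; [ring|].
    assert (Ha : a <> 0%C) by (apply Cmod_gt_0; apply Hl; now left). rewrite IH by (intros b Hb; apply Hl; now right).
    unfold pfac. assert (E := lam_factor a z Ha Hz).
    transitivity ((lam z - lam a) * (lam z - Cconj (lam a)) * (lprod (fun a0 => (z - a0)%C) l * lprod (fun a0 => Ra a0 z) l))%C; [ring|].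
    rewrite E. unfold Ra. ring. }
  assert (E2 : lprod (fun a => Ga a z) l = (lprod (fun a => (1 - Cconj a * z)%C) l * lprod (fun a => Ra a z) l)%C).
  { clear. induction l as [|a l IH]; simpl; [ring|]. rewrite IH. unfold Ga. ring. }
  assert (E3 := Hfac z Hd). rewrite E1, E2.
  set (Pz := lprod (fun a => (z - a)%C) l) in *. set (Pc := lprod (fun a => (1 - Cconj a * z)%C) l) in *. set (PR := lprod (fun a => Ra a z) l).
  set (K := (z ^ (Z.abs_nat (n - m)) * Pl q z (Z.max n m) * Mi q z (Z.min n m) * ev e z)%C).
  transitivity (K * PR * (ev U z * Pz) / (ev V z * ev U z))%C; [unfold K; field; auto|].
  rewrite <- E3. unfold K. field. auto. }
assert (HG : good r0 F).
{ assert (Gi := good_id r0).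
  assert (Gz : good r0 (fun z => (/ z)%C)) by (apply (good_inv r0 Hr0 (fun z => z) r0); [exact Gi|lra|intros z Hz; lra]).
  assert (Gl : good r0 lam) by (unfold lam; apply good_minus; auto; apply good_minus; auto; apply good_const).
  unfold F, Pl, Mi, mlim. destruct (blim_l1 q (wl1_moment q Hq) (Z.max n m)) as [A1 HA1].
  destruct (blim_l1 (refl q) (wl1_moment _ (wl1_refl 1 q Hq)) (- Z.min n m)) as [A2 HA2].
  repeat apply good_mult; auto.
  - now apply good_pow.
  - now apply (good_ev r0 Hr0 _ A1).
  - now apply (good_ev r0 Hr0 _ A2).
  - now apply (good_ev r0 Hr0 _ B).
  - apply (good_inv r0 Hr0 (ev U) c); auto; [now apply (good_ev r0 Hr0 _ BU)|]. intros z Hz. apply HcU. lra.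
  - apply good_lprod; auto. intros a _. unfold Ga, Ra.
    assert (G1 : forall x, good r0 (fun z => (1 - x * z)%C)) by (intros x; apply good_minus; auto; [apply good_const|apply good_mult; auto; apply good_const]).
    apply good_mult; auto. apply good_mult; auto; [|apply good_minus; auto; apply good_const].
    apply good_mult; auto. apply good_mult; auto. apply good_const. }
assert (HM := good_mean r0 Hr0 F HG).
assert (HPI := PI_RGT_0).
assert (E1 : mean F 1 = 2 * intr (fun t => polR l (2 - 2 * cos t)) n m).
{ rewrite <- mean_half. apply mean_ext; [|lra]. intros z Hz. symmetry. apply HF; auto. apply Cmod_gt_0; lra. unfold disc; lra. }
assert (E2 : mean F r0 = 2 * PI * polop q l (dlt n) m).
{ etransitivity; [|exact (mom_polop r0 Hr0 c0 Hc0 HV1 l n 0 m)]. unfold mom. apply mean_ext; [|lra]. intros z Hz. rewrite <- HF.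
  - simpl. ring.
  - apply Cmod_gt_0; lra.
  - unfold disc; lra.
  - apply Cmod_gt_0. specialize (HV1 z ltac:(lra)). lra. }
unfold qn. rewrite (polop_scal l (/ PI)). rewrite polop_intr.
apply Rmult_eq_reg_l with (2 * PI); [|lra]. rewrite <- E2, <- HM, E1. field. lra.
Qed.

End PoleRemoval.

(** * Uniform bounds for the spectral kernel *)

Lemma wave_cont B g M x : camplitude sin B g -> 0 < x < PI -> continuous (fun t => Re (expi (M * t) * g t)%C) x.
Proof.
intros [g1 Hg] Hx. destruct (Hg x Hx) as [[H1 H2] _].
apply (continuous_ext (fun t => minus (cos (M * t) * Re (g t)) (sin (M * t) * Im (g t)))); [intros t; reflexivity|].
apply (continuous_minus (fun t => cos (M * t) * Re (g t)) (fun t => sin (M * t) * Im (g t))).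
- apply (continuous_mult (fun t => cos (M * t)) (fun t => Re (g t))); [|now apply (is_derive_cont _ _ _ H1)].
  apply (is_derive_cont _ _ (- M * sin (M * x))). auto_derive; [exact I|ring].
- apply (continuous_mult (fun t => sin (M * t)) (fun t => Im (g t))); [|now apply (is_derive_cont _ _ _ H2)].
  apply (is_derive_cont _ _ (M * cos (M * x))). auto_derive; [exact I|ring].
Qed.

Lemma wave_bound B g M x : camplitude sin B g -> 0 < x < PI -> Rabs (Re (expi (M * x) * g x)%C) <= B.
Proof.
intros [g1 Hg] Hx. destruct (Hg x Hx) as [_ [H _]]. eapply Rle_trans; [apply re_le_Cmod|]. rewrite Cmod_mult, Cmod_expi, Rmult_1_l. exact H.
Qed.

Lemma two_waves_cont B L r x : two_waves B L r -> 0 < x < PI -> continuous r x.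
Proof.
intros [M1 [M2 [g1 [g2 [_ [_ [G1 [G2 E]]]]]]]] Hx.
apply (continuous_ext_loc _ (fun t => plus (Re (expi (IZR M1 * t) * g1 t)%C) (Re (expi (IZR M2 * t) * g2 t)%C))).
- apply (locally_interval _ x 0 PI); simpl; try lra. intros y Hy1 Hy2. symmetry. now apply E.
- apply (continuous_plus (fun t => Re (expi (IZR M1 * t) * g1 t)%C) (fun t => Re (expi (IZR M2 * t) * g2 t)%C)); eapply wave_cont; eauto.
Qed.

Lemma two_waves_bound B L r x : two_waves B L r -> 0 < x < PI -> Rabs (r x) <= 2 * B.
Proof.
intros [M1 [M2 [g1 [g2 [_ [_ [G1 [G2 E]]]]]]]] Hx. rewrite E by auto. eapply Rle_trans; [apply Rabs_triang|].
assert (H1 := wave_bound B g1 (IZR M1) x G1 Hx). assert (H2 := wave_bound B g2 (IZR M2) x G2 Hx). lra.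
Qed.

Lemma two_waves_osc B L r t c tau e : two_waves B L r -> 2 <= tau -> tau ^ 3 <= 2 * Rabs t -> 0 < e <= / tau ->
  Rabs (RInt (fun x => cos (t * (2 - 2 * cos x) + c) * r x) e (PI - e)) <= 640 * B / tau.
Proof.
intros [M1 [M2 [g1 [g2 [_ [_ [G1 [G2 E]]]]]]]] Htau Ht He. assert (H3 := PI_gt_3).
assert (Hit2 : / tau <= / 2) by (apply Rinv_le_contravar; lra).
assert (Hc : forall x, continuous (fun x => cos (t * (2 - 2 * cos x) + c)) x).
{ intros x. eapply is_derive_cont. auto_derive; [exact I|reflexivity]. }
rewrite (RInt_two (fun x => cos (t * (2 - 2 * cos x) + c) * Re (expi (IZR M1 * x) * g1 x)%C) (fun x => cos (t * (2 - 2 * cos x) + c) * Re (expi (IZR M2 * x) * g2 x)%C)); [|lra| | |].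
- eapply Rle_trans; [apply Rabs_triang|].
  assert (H1 := osc_Re B g1 t (IZR M1) c tau e G1 Htau Ht He). assert (H2 := osc_Re B g2 t (IZR M2) c tau e G2 Htau Ht He).
  replace (640 * B / tau) with (320 * B / tau + 320 * B / tau) by (field; lra). lra.
- intros x Hx. apply (continuous_mult (fun x => cos (t * (2 - 2 * cos x) + c)) (fun x => Re (expi (IZR M1 * x) * g1 x)%C)); auto. eapply wave_cont; eauto.
- intros x Hx. apply (continuous_mult (fun x => cos (t * (2 - 2 * cos x) + c)) (fun x => Re (expi (IZR M2 * x) * g2 x)%C)); auto. eapply wave_cont; eauto.
- intros x Hx. rewrite E by auto. ring.
Qed.

Lemma sqrt4_div_le x y : 1 <= x <= y -> sqrt (sqrt y) / y <= sqrt (sqrt x) / x.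
Proof.
intros [Hx Hxy].
assert (E : forall z, 1 <= z -> 0 < sqrt (sqrt z) /\ z = sqrt (sqrt z) * (sqrt (sqrt z) * sqrt z)).
{ intros z Hz. assert (Hs : 0 < sqrt z) by (apply sqrt_lt_R0; lra). split; [now apply sqrt_lt_R0|].
  rewrite <- Rmult_assoc, sqrt_sqrt by lra. rewrite sqrt_sqrt; lra. }
destruct (E x Hx) as [Px Ex]. destruct (E y ltac:(lra)) as [Py Ey].
assert (Hs : sqrt x <= sqrt y) by (apply sqrt_le_1_alt; lra). assert (Hs4 : sqrt (sqrt x) <= sqrt (sqrt y)) by now apply sqrt_le_1_alt.
assert (Psx : 0 < sqrt x) by (apply sqrt_lt_R0; lra).
assert (F : forall z a b, 0 < a -> 0 < b -> z = a * (a * b) -> a / z = / (a * b)) by (intros z a b Ha Hb ->; field; lra).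
rewrite (F y _ _ Py (Rlt_le_trans _ _ _ Psx Hs) Ey), (F x _ _ Px Psx Ex).
apply Rinv_le_contravar; [now apply Rmult_lt_0_compat|]. apply Rmult_le_compat; lra.
Qed.

Lemma two_waves_dec B L r : 0 <= B -> two_waves B L r -> (1 <= L)%Z ->
  Rabs (RInt r (/ IZR L) (PI - / IZR L)) <= 324 * B * sqrt (sqrt (IZR L)) / IZR L.
Proof.
intros HB Hr HL. assert (Hc := two_waves_cont B L r). assert (Hb := two_waves_bound B L r).
destruct Hr as [M1 [M2 [g1 [g2 [HM1 [HM2 [G1 [G2 E]]]]]]]] eqn:EE. clear EE. specialize (fun x => Hc x Hr). specialize (fun x => Hb x Hr).
assert (H3 := PI_gt_3). apply IZR_le in HL, HM1, HM2. rewrite abs_IZR in HM1, HM2. set (l := IZR L) in *.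
assert (Hil : 0 < / l <= 1). { split; [apply Rinv_0_lt_compat; lra|]. rewrite <- Rinv_1. apply Rinv_le_contravar; lra. }
assert (Hi : forall M, l <= Rabs M -> 0 < / Rabs M <= / l). { intros M HM. split; [apply Rinv_0_lt_compat; lra|]. apply Rinv_le_contravar; lra. }
(* The decay estimate needs a cut-off below 1/|M1| and 1/|M2|. The two strips between [e] and 1/l
   are estimated by the sup bound 2 B and raise the constant from 320 to 324. *)
set (e := Rmin (/ Rabs (IZR M1)) (/ Rabs (IZR M2))).
assert (He1 := Rmin_l (/ Rabs (IZR M1)) (/ Rabs (IZR M2))). assert (He2 := Rmin_r (/ Rabs (IZR M1)) (/ Rabs (IZR M2))). fold e in He1, He2.
assert (He : 0 < e) by (apply Rmin_glb_lt; apply Hi; auto).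
assert (Hel : e <= / l) by (eapply Rle_trans; [exact He1|now apply Hi]).
assert (H1 : Rabs (RInt r e (PI - e)) <= 320 * B * sqrt (sqrt l) / l).
{ rewrite (RInt_two (fun x => Re (expi (IZR M1 * x) * g1 x)%C) (fun x => Re (expi (IZR M2 * x) * g2 x)%C)); [|lra| | |].
  - eapply Rle_trans; [apply Rabs_triang|].
    assert (K1 := dec_Re B g1 (IZR M1) e G1 ltac:(lra) ltac:(lra)). assert (K2 := dec_Re B g2 (IZR M2) e G2 ltac:(lra) ltac:(lra)).
    assert (S1 := sqrt4_div_le l (Rabs (IZR M1)) ltac:(lra)). assert (S2 := sqrt4_div_le l (Rabs (IZR M2)) ltac:(lra)).
    unfold Rdiv in *. rewrite Rmult_assoc in K1, K2 |- *.
    apply (Rmult_le_compat_l (160 * B)) in S1; [|lra]. apply (Rmult_le_compat_l (160 * B)) in S2; [|lra]. lra.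
  - intros x Hx. eapply wave_cont; eauto.
  - intros x Hx. eapply wave_cont; eauto.
  - exact E. }
assert (HX : forall a b, 0 < a -> a <= b -> b < PI -> ex_RInt r a b) by (intros a b Ha Hab Hbb; apply (ex_RInt_open r 0 PI); auto).
assert (E1 : RInt r e (PI - e) = RInt r e (/ l) + RInt r (/ l) (PI - / l) + RInt r (PI - / l) (PI - e)).
{ rewrite <- (RInt_Chasles (V := R_CompleteNormedModule) r e (/ l) (PI - e)) by (apply HX; lra).
  rewrite <- (RInt_Chasles (V := R_CompleteNormedModule) r (/ l) (PI - / l) (PI - e)) by (apply HX; lra). unfold plus; simpl. ring. }
assert (A1 := abs_RInt_short r 0 PI e (/ l) (2 * B) He Hel ltac:(lra) Hc ltac:(intros; apply Hb; lra)).
assert (A2 := abs_RInt_short r 0 PI (PI - / l) (PI - e) (2 * B) ltac:(lra) ltac:(lra) ltac:(lra) Hc ltac:(intros; apply Hb; lra)).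
assert (Hs : 1 <= sqrt (sqrt l)). { replace 1 with (sqrt (sqrt 1)) by (rewrite !sqrt_1; reflexivity). apply sqrt_le_1_alt, sqrt_le_1_alt. lra. }
replace (324 * B * sqrt (sqrt l) / l) with (320 * B * sqrt (sqrt l) / l + 4 * B * / l * sqrt (sqrt l)) by (field; lra).
assert (4 * B * / l * 1 <= 4 * B * / l * sqrt (sqrt l)) by (apply Rmult_le_compat_l; nra).
assert (T : forall a b c d : R, a = b + c + d -> Rabs c <= Rabs a + Rabs b + Rabs d).
{ intros a b c d ->. replace c with ((b + c + d) + (- b) + (- d)) at 1 by ring. eapply Rle_trans; [apply Rabs_triang|]. rewrite Rabs_Ropp.
  assert (X := Rabs_triang (b + c + d) (- b)). rewrite Rabs_Ropp in X. lra. }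
assert (T1 := T _ _ _ _ E1). assert (e * (2 * B) >= 0) by nra. nra.
Qed.

(** * From the truncations to the spectral kernel of q *)

Section SpectralKernel.
Variables (q : Z -> R) (e V : nat -> C).
Hypothesis Hq1 : wl1 1 q.
Hypothesis Hq2 : ~ generic q -> wl1 2 q.
Hypothesis He : edge_factor q e V.

(** In the generic case the Wronskian of q has no zero on the circle; its lower bound c passes to c
    / 2 for late truncations by uniform convergence. Otherwise the second moments of the truncations
    are bounded by those of q and of its reflection. *)
Lemma regular_cut : exists N0 S2 c, 0 < c <= 1 /\ forall N, (N0 <= N)%nat -> regular (cut q N) N S2 c.
Proof.
destruct (classic (generic q)) as [Hg|Hg].
- destruct (wc_spec q Hq1) as [[B HB] Hev].
  destruct (circle_lower_bound (wc q) B HB) as [c [Hc Hl]].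
  { intros z Hz. rewrite Hev by (unfold disc; lra). destruct (classic (z = 1%C)) as [->|H1]; [|destruct (classic (z = (-1)%C)) as [->|H2]].
    - replace (RtoC 1) with (expi (- 0)) by (unfold expi, RtoC; rewrite Ropp_0, cos_0, sin_0; reflexivity). apply generic_ww; auto.
    - replace (RtoC (-1)) with (expi (- PI)) by (unfold expi, RtoC; rewrite cos_neg, sin_neg, cos_PI, sin_PI, Ropp_0; reflexivity). apply generic_ww; auto.
    - apply ww_circle_neq0; auto. }
  destruct (uconv_ww q Hq1) as [_ Hu]. set (d := Rmin 1 (c / 2)). assert (D1 := Rmin_l 1 (c / 2)). assert (D2 := Rmin_r 1 (c / 2)). fold d in D1, D2.
  assert (Hd : 0 < d) by (apply Rmin_glb_lt; lra).
  destruct (Hu (c / 2) ltac:(lra)) as [N0 HN0]. exists N0, 0, d. split; [lra|]. intros N HN. left. intros t _.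
  specialize (HN0 N HN (expi t) (expi_unit t)). specialize (Hl (expi t) (Cmod_expi t)). rewrite Hev in Hl by apply expi_unit. unfold wfin.
  set (a := wronsk _ _ _ _) in *. assert (H := Cmod_triangle (ww q (expi t) - a) a). replace (ww q (expi t) - a + a)%C with (ww q (expi t)) in H by ring.
  rewrite <- Cmod_opp in HN0. replace (- (a - ww q (expi t)))%C with (ww q (expi t) - a)%C in HN0 by ring. lra.
- specialize (Hq2 Hg). destruct (wl1_moment2 q Hq2 1) as [B1 H1]. destruct (wl1_moment2 (refl q) (wl1_refl 2 q Hq2) 1) as [B2 H2].
  exists O, (Rmax B1 B2), 1. split; [lra|]. intros N _. right. split.
  + apply jost_S2_cut. intros k. eapply Rle_trans; [apply H1|apply Rmax_l].
  + apply (jost_S2_ext (cut (refl q) N)); [intros n; symmetry; apply cut_refl|]. apply jost_S2_cut. intros k. eapply Rle_trans; [apply H2|apply Rmax_r].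
Qed.

Lemma cut_two_waves : exists N0 B, 1 <= B /\ forall N, (N0 <= N)%nat -> forall n m, two_waves B (Z.abs (Z.abs n - Z.abs m)) (rho_fin (cut q N) N n m).
Proof.
destruct regular_cut as [N0 [S2 [c [Hc Hreg]]]].
destruct (wl1_moment q Hq1 1) as [B1 H1]. destruct (wl1_moment (refl q) (wl1_refl 1 q Hq1) 1) as [B2 H2].
destruct (rho_two_waves (Rmax B1 B2) S2 c Hc) as [B [HB HW]]. exists N0, B. split; auto. intros N HN n m.
apply HW; auto.
- apply cut_supported.
- apply jost_S1_cut. intros k. eapply Rle_trans; [apply H1|apply Rmax_l].
- apply (jost_S1_ext (cut (refl q) N)); [intros k; symmetry; apply cut_refl|]. apply jost_S1_cut. intros k. eapply Rle_trans; [apply H2|apply Rmax_r].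
Qed.

Lemma That_ww z : Cmod z = 1 -> ww q z <> 0%C -> That e V z = ((1 - z * z) / ww q z)%C.
Proof.
intros Hz Hw. destruct He as [_ [_ [HV [_ Hew]]]]. assert (Hv := HV z Hz). unfold That.
transitivity (ev e z * ww q z / (ev V z * ww q z))%C; [field; auto|]. rewrite Hew by (unfold disc; lra). field; auto.
Qed.

(** On [d, PI - d] unitarity bounds the Wronskians of q and of every truncation below by 2 sin d,
    resonant or not. At a resonant edge there is no such uniform bound, hence the restriction to a
    compact part. *)
Lemma rho_fin_conv n m d eps : 0 < d <= PI / 2 -> 0 < eps ->
  exists N0, forall N, (N0 <= N)%nat -> forall t, d <= t <= PI - d -> Rabs (rho_fin (cut q N) N n m t - rho q e V n m t) <= eps.
Proof.
intros Hd Heps. assert (HPI := PI_gt_3).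
set (D := fun z => exists t, d <= t <= PI - d /\ z = expi t).
assert (DD : forall z, D z -> disc z) by (intros z [t [_ ->]]; apply expi_unit).
assert (Hsd : 0 < sin d) by (apply sin_gt_0; lra).
assert (Hs : forall t, d <= t <= PI - d -> sin d <= sin t).
{ intros t Ht. destruct (Rle_dec t (PI / 2)); [apply sin_incr_1; lra|]. rewrite <- (sin_PI_x t). apply sin_incr_1; lra. }
assert (Hz : forall z, D z -> 2 * sin d <= Cmod (1 - z * z)).
{ intros z [t [Ht ->]]. rewrite Cmod_1_minus_expi2 by lra. specialize (Hs t Ht). lra. }
assert (Hww : forall z, D z -> 2 * sin d <= Cmod (ww q z)).
{ intros z Dz. eapply Rle_trans; [apply Hz, Dz|]. apply ww_lower; auto. destruct Dz as [t [_ ->]]. apply Cmod_expi. }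
assert (HwN : forall N z, D z -> 2 * sin d <= Cmod (wronsk (mplus (cut q N) N z) (mminus (cut q N) N z) z 0)).
{ intros N z Dz. eapply Rle_trans; [apply Hz, Dz|]. destruct Dz as [t [Ht ->]].
  assert (U := unitarity (cut q N) N (expi t) (cut_supported q N) (expi_conj_mult t)).
  set (a := Cmod (wronsk _ _ _ _)) in *. assert (0 <= a) by apply Cmod_ge_0. match type of U with _ = ?x ^ 2 + ?y ^ 2 => assert (X := pow2_ge_0 x); assert (0 <= y) by apply Cmod_ge_0 end. nra. }
assert (UP := uconv_sub disc D _ _ DD (uconv_Pl q Hq1 (Z.max n m))).
assert (UM := uconv_sub disc D _ _ DD (uconv_Mi q Hq1 (Z.min n m))).
assert (UW := uconv_inv D _ _ (2 * sin d) (uconv_sub disc D _ _ DD (uconv_ww q Hq1)) ltac:(lra) Hww HwN).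
assert (UZ : uconv D (fun _ z => (1 - z * z)%C) (fun z => (1 - z * z)%C)).
{ apply (uconv_const D (fun z => (1 - z * z)%C)). exists 2. split; [lra|]. intros z Dz. apply DD in Dz. unfold disc in Dz. unfold Cminus. eapply Rle_trans; [apply Cmod_triangle|]. rewrite Cmod_opp, Cmod_1, Cmod_mult. assert (0 <= Cmod z) by apply Cmod_ge_0. nra. }
assert (UK : uconv D (fun _ z => (z ^ (Z.abs_nat (n - m)))%C) (fun z => (z ^ (Z.abs_nat (n - m)))%C)).
{ apply (uconv_const D (fun z => (z ^ (Z.abs_nat (n - m)))%C)). exists 1. split; [lra|]. intros z [t [_ ->]]. rewrite Cmod_pow, Cmod_expi, pow1. lra. }
destruct (uconv_mult D _ _ _ _ (uconv_mult D _ _ _ _ (uconv_mult D _ _ _ _ UK UP) UM) (uconv_mult D _ _ _ _ UZ UW)) as [_ HU].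
destruct (HU eps Heps) as [N0 HN0]. exists N0. intros N HN t Ht.
specialize (HN0 N HN (expi t) ltac:(exists t; auto)). cbv beta in HN0.
unfold rho_fin, rho, hk, kern. cbv zeta. rewrite (That_ww (expi t)).
- eapply Rle_trans; [|exact HN0]. match goal with |- Rabs (Re ?a - Re ?b) <= _ => apply (re_le_Cmod (a - b)%C) end.
- apply Cmod_expi.
- apply Cmod_gt_0. specialize (Hww (expi t) ltac:(exists t; auto)). lra.
Qed.

Lemma rho_RInt_limit (phi : R -> R) B K n m d N0 : 0 < d <= PI / 2 -> (forall x, continuous phi x) -> (forall x, Rabs (phi x) <= 1) ->
  (forall N, (N0 <= N)%nat -> exists L, two_waves B L (rho_fin (cut q N) N n m)) ->
  (forall N, (N0 <= N)%nat -> Rabs (RInt (fun x => phi x * rho_fin (cut q N) N n m x) d (PI - d)) <= K) ->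
  Rabs (RInt (fun x => phi x * rho q e V n m x) d (PI - d)) <= K.
Proof.
intros Hd Hphi Hphi1 HW HK. assert (HPI := PI_gt_3). apply le_epsilon. intros eps Heps.
destruct (rho_fin_conv n m d (eps / PI) Hd ltac:(apply Rdiv_lt_0_compat; lra)) as [N1 HN1].
set (N := Nat.max N0 N1). specialize (HN1 N ltac:(unfold N; lia)). specialize (HK N ltac:(unfold N; lia)). destruct (HW N ltac:(unfold N; lia)) as [L HL].
set (f := rho_fin (cut q N) N n m) in *. assert (Hf := fun x => two_waves_cont B L f x HL).
assert (Hr := rho_cont q e V Hq1 He n m).
assert (C1 : forall x, 0 < x < PI -> continuous (fun x => phi x * f x) x) by (intros x Hx; apply (continuous_mult phi f); auto).
assert (C2 : forall x, 0 < x < PI -> continuous (fun x => phi x * (rho q e V n m x - f x)) x).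
{ intros x Hx. apply (continuous_mult phi (fun x => rho q e V n m x - f x)); auto. apply (continuous_minus (rho q e V n m) f); auto. }
rewrite (RInt_two (fun x => phi x * f x) (fun x => phi x * (rho q e V n m x - f x))); auto; [|intros; ring].
assert (A := abs_RInt_short (fun x => phi x * (rho q e V n m x - f x)) 0 PI d (PI - d) (eps / PI) ltac:(lra) ltac:(lra) ltac:(lra) C2).
assert (A' : Rabs (RInt (fun x => phi x * (rho q e V n m x - f x)) d (PI - d)) <= (PI - d - d) * (eps / PI)).
{ apply A. intros x Hx. rewrite Rabs_mult, Rabs_minus_sym. specialize (HN1 x Hx). specialize (Hphi1 x). assert (H1 := Rabs_pos (phi x)). assert (H2 := Rabs_pos (f x - rho q e V n m x)). nra. }
eapply Rle_trans; [apply Rabs_triang|].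
assert ((PI - d - d) * (eps / PI) <= PI * (eps / PI)) by (apply Rmult_le_compat_r; [left; apply Rdiv_lt_0_compat|]; lra).
replace (PI * (eps / PI)) with eps in * by (field; lra). lra.
Qed.

Lemma bracket_sq t : bracket t * bracket t = 1 + t ^ 2.
Proof. unfold bracket. apply sqrt_sqrt. assert (H := pow2_ge_0 t). lra. Qed.

Lemma bound_closure (f : R -> R) B : (forall x, continuous f x) -> (forall x, 0 < x < PI -> Rabs (f x) <= B) -> forall x, 0 <= x <= PI -> Rabs (f x) <= B.
Proof.
intros Hf HB. assert (HPI := PI_gt_3).
intros x Hx. apply le_epsilon. intros eps Heps.
  assert (Hc : continuity_pt f x) by (apply continuity_pt_filterlim; apply Hf).
  destruct (Hc eps Heps) as [del [Hdel Hlim]]. unfold dist in Hlim; simpl in Hlim; unfold Rdist in Hlim.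
  destruct (Rle_dec x (PI / 2)).
  - set (y := x + Rmin (del / 2) 1). assert (M1 := Rmin_l (del / 2) 1). assert (M2 := Rmin_r (del / 2) 1). assert (M3 : 0 < Rmin (del / 2) 1) by (apply Rmin_glb_lt; lra).
    assert (Hy : Rabs (f y) <= B) by (apply HB; unfold y; lra).
    assert (Hyx : Rabs (f y - f x) < eps). { apply Hlim. split; [split; [exact I|unfold y; lra]|unfold y; rewrite Rabs_right; lra]. }
    assert (T := Rabs_triang_inv (f x) (f y)). rewrite Rabs_minus_sym in T. lra.
  - set (y := x - Rmin (del / 2) 1). assert (M1 := Rmin_l (del / 2) 1). assert (M2 := Rmin_r (del / 2) 1). assert (M3 : 0 < Rmin (del / 2) 1) by (apply Rmin_glb_lt; lra).
    assert (Hy : Rabs (f y) <= B) by (apply HB; unfold y; lra).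
    assert (Hyx : Rabs (f y - f x) < eps). { apply Hlim. split; [split; [exact I|unfold y; lra]|unfold y; rewrite Rabs_left; lra]. }
    assert (T := Rabs_triang_inv (f x) (f y)). rewrite Rabs_minus_sym in T. lra.
Qed.

Lemma RInt_trim (f : R -> R) B d : 0 < d <= PI / 2 -> (forall x, continuous f x) -> (forall x, 0 < x < PI -> Rabs (f x) <= B) ->
  Rabs (RInt f 0 PI) <= Rabs (RInt f d (PI - d)) + 2 * d * B.
Proof.
intros Hd Hf HB. assert (HPI := PI_gt_3).
assert (HX : forall a b, ex_RInt f a b) by (intros a b; apply (ex_RInt_continuous (V := R_CompleteNormedModule)); auto).
assert (HBc := bound_closure f B Hf HB).
rewrite <- (RInt_Chasles (V := R_CompleteNormedModule) f 0 d PI) by auto. rewrite <- (RInt_Chasles (V := R_CompleteNormedModule) f d (PI - d) PI) by auto.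
assert (A1 : Rabs (RInt f 0 d) <= (d - 0) * B) by (apply abs_RInt_le_const; auto; [lra|intros; apply HBc; lra]).
assert (A2 : Rabs (RInt f (PI - d) PI) <= (PI - (PI - d)) * B) by (apply abs_RInt_le_const; auto; [lra|intros; apply HBc; lra]).
unfold plus; simpl. eapply Rle_trans; [apply Rabs_triang|]. assert (T := Rabs_triang (RInt f d (PI - d)) (RInt f (PI - d) PI)). lra.
Qed.

Theorem kernel_bounds : exists K, 1 <= K /\
  (forall n m t, 0 < t < PI -> Rabs (rho q e V n m t) <= K) /\
  (forall t c n m, Rabs (RInt (fun x => cos (t * (2 - 2 * cos x) + c) * rho q e V n m x) 0 PI) <= K * Rpower (bracket t) (- (1 / 3))) /\
  (forall n m, (1 <= Z.abs (Z.abs n - Z.abs m))%Z ->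
     Rabs (RInt (fun x => 1 * rho q e V n m x) 0 PI) <= K * (sqrt (sqrt (IZR (Z.abs (Z.abs n - Z.abs m)))) / IZR (Z.abs (Z.abs n - Z.abs m)))).
Proof.
destruct cut_two_waves as [N0 [B [HB HW]]]. assert (HPI := PI_gt_3). assert (HPI4 := PI_4).
assert (Hb : forall n m t, 0 < t < PI -> Rabs (rho q e V n m t) <= 2 * B).
{ intros n m t Ht. apply le_epsilon. intros eps Heps. set (d := Rmin t (PI - t)). assert (M1 := Rmin_l t (PI - t)). assert (M2 := Rmin_r t (PI - t)). fold d in M1, M2.
  assert (M3 : 0 < d) by (apply Rmin_glb_lt; lra).
  destruct (rho_fin_conv n m d eps ltac:(lra) Heps) as [N1 HN1]. specialize (HN1 (Nat.max N0 N1) ltac:(lia) t ltac:(lra)).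
  assert (H := two_waves_bound _ _ _ t (HW (Nat.max N0 N1) ltac:(lia) n m) Ht). rewrite Rabs_minus_sym in HN1.
  assert (T := Rabs_triang_inv (rho q e V n m t) (rho_fin (cut q (Nat.max N0 N1)) (Nat.max N0 N1) n m t)). lra. }
assert (Hcc : forall t c x, continuous (fun x => cos (t * (2 - 2 * cos x) + c)) x).
{ intros t c x. eapply is_derive_cont. auto_derive; [exact I|reflexivity]. }
assert (Hc1 : forall a, Rabs (cos a) <= 1) by (intros a; apply Rabs_le, COS_bound).
assert (Hr := rho_cont q e V Hq1 He).
(* 640 comes from the oscillatory estimate on [1/tau, PI - 1/tau] and 4 from the two strips of width
   1/tau, where |rho| <= 2 B. *)
exists (644 * B). split; [lra|]. split; [intros n m t Ht; specialize (Hb n m t Ht); lra|]. split.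
- intros t c n m. set (tau := Rpower (bracket t) (1 / 3)). assert (Hbr := bracket_ge1 t).
  assert (Htau : 0 < tau) by apply exp_pos.
  replace (Rpower (bracket t) (- (1 / 3))) with (/ tau) by (unfold tau; now rewrite Rpower_Ropp).
  assert (Ht3 : tau ^ 3 = bracket t).
  { rewrite <- Rpower_pow by auto. unfold tau. rewrite Rpower_mult. replace (1 / 3 * INR 3) with 1 by (simpl; field). apply Rpower_1. lra. }
  assert (Hfc : forall x, continuous (fun x => cos (t * (2 - 2 * cos x) + c) * rho q e V n m x) x).
  { intros x. apply (continuous_mult (fun x => cos (t * (2 - 2 * cos x) + c)) (rho q e V n m)); auto. }
  assert (Hfb : forall x, 0 < x < PI -> Rabs (cos (t * (2 - 2 * cos x) + c) * rho q e V n m x) <= 2 * B).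
  { intros x Hx. rewrite Rabs_mult. specialize (Hb n m x Hx). specialize (Hc1 (t * (2 - 2 * cos x) + c)). assert (H1 := Rabs_pos (cos (t * (2 - 2 * cos x) + c))). assert (H2 := Rabs_pos (rho q e V n m x)). nra. }
  destruct (Rle_dec 2 tau) as [H2|H2].
  (* For tau >= 2 the bracket is at least 8, and then it is at most 2 |t|. *)
  + assert (Htt : tau ^ 3 <= 2 * Rabs t).
    { assert (H8 : 8 <= bracket t) by (rewrite <- Ht3; assert (4 <= tau ^ 2) by nra; simpl in *; nra).
      rewrite Ht3. assert (S := bracket_sq t). rewrite <- (pow2_abs t) in S. assert (0 <= Rabs t) by apply Rabs_pos. nra. }
    assert (Hi : 0 < / tau <= / 2) by (split; [apply Rinv_0_lt_compat; lra|apply Rinv_le_contravar; lra]).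
    eapply Rle_trans; [apply (RInt_trim _ (2 * B) (/ tau)); auto; lra|].
    assert (H := rho_RInt_limit (fun x => cos (t * (2 - 2 * cos x) + c)) B (640 * B / tau) n m (/ tau) N0 ltac:(lra) (Hcc t c) ltac:(intros; apply Hc1)).
    assert (H' := H ltac:(intros N HN; eexists; apply HW; auto)).
    assert (H'' : Rabs (RInt (fun x => cos (t * (2 - 2 * cos x) + c) * rho q e V n m x) (/ tau) (PI - / tau)) <= 640 * B / tau).
    { apply H'. intros N HN. eapply two_waves_osc; [apply HW; auto|auto|auto|lra]. }
    unfold Rdiv in H''. lra.
  + assert (Hi : / 2 <= / tau) by (apply Rinv_le_contravar; lra).
    eapply Rle_trans; [apply (RInt_trim _ (2 * B) 1); auto; lra|].
    assert (H := abs_RInt_le_const (fun x => cos (t * (2 - 2 * cos x) + c) * rho q e V n m x) 1 (PI - 1) (2 * B)).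
    assert (H' : Rabs (RInt (fun x => cos (t * (2 - 2 * cos x) + c) * rho q e V n m x) 1 (PI - 1)) <= (PI - 1 - 1) * (2 * B)).
    { apply H; [lra| |intros; apply Hfb; lra]. apply (ex_RInt_continuous (V := R_CompleteNormedModule)); auto. }
    nra.
- intros n m HL. set (L := Z.abs (Z.abs n - Z.abs m)) in *. assert (HL' := IZR_le _ _ HL). set (l := IZR L) in *.
  assert (Hil : 0 < / l <= 1). { split; [apply Rinv_0_lt_compat; lra|]. rewrite <- Rinv_1. apply Rinv_le_contravar; lra. }
  assert (H1c : forall x : R, continuous (fun _ : R => 1) x) by (intros; apply continuous_const).
  eapply Rle_trans; [apply (RInt_trim _ (2 * B) (/ l))|].
  + lra.
  + intros x. apply (continuous_mult (fun _ => 1) (rho q e V n m)); auto.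
  + intros x Hx. rewrite Rmult_1_l. auto.
  + assert (H := rho_RInt_limit (fun _ => 1) B (324 * B * sqrt (sqrt l) / l) n m (/ l) N0 ltac:(lra) H1c ltac:(intros; cbv beta; rewrite Rabs_R1; lra)).
    assert (H' := H ltac:(intros N HN; eexists; apply HW; auto)).
    assert (H'' : Rabs (RInt (fun x => 1 * rho q e V n m x) (/ l) (PI - / l)) <= 324 * B * sqrt (sqrt l) / l).
    { apply H'. intros N HN. replace (RInt _ _ _) with (RInt (rho_fin (cut q N) N n m) (/ l) (PI - / l)) by (apply RInt_ext; intros x _; symmetry; apply Rmult_1_l).
      apply two_waves_dec; [lra|apply HW; auto|auto]. }
    assert (Hs : 1 <= sqrt (sqrt l)). { replace 1 with (sqrt (sqrt 1)) by (rewrite !sqrt_1; reflexivity). apply sqrt_le_1_alt, sqrt_le_1_alt. lra. }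
    unfold Rdiv in *. assert (/ l * 1 <= / l * sqrt (sqrt l)) by (apply Rmult_le_compat_l; lra). nra.
Qed.

End SpectralKernel.

(** * Summation over the integers *)

Lemma symsum_0 f : symsum f 0 = f 0%Z.
Proof. reflexivity. Qed.

Lemma symsum_S f N : symsum f (S N) = symsum f N + (f (Z.of_nat (S N)) + f (- Z.of_nat (S N))%Z).
Proof.
rewrite !symsum_psum. replace (S (2 * S N)) with (1 + S (S (2 * N)))%nat by lia. rewrite psum_add.
replace (psum _ 1) with (f (- Z.of_nat (S N))%Z) by (simpl; rewrite Rplus_0_l; f_equal; lia).
change (psum ?a (S (S (2 * N)))) with (psum a (S (2 * N)) + a (S (2 * N))).
rewrite (psum_ext _ (fun k => f (Z.of_nat k - Z.of_nat N)%Z)) by (intros i _; f_equal; lia).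
replace (Z.of_nat (1 + S (2 * N)) - Z.of_nat (S N))%Z with (Z.of_nat (S N)) by lia. ring.
Qed.

Lemma symsum_ext f g N : (forall n, f n = g n) -> symsum f N = symsum g N.
Proof. intros H. induction N as [|N IH]; [apply H|rewrite !symsum_S, IH, !H; ring]. Qed.

Lemma symsum_lin c f g N : symsum (fun n => c * f n + g n) N = c * symsum f N + symsum g N.
Proof. induction N as [|N IH]; [rewrite !symsum_0; ring|rewrite !symsum_S, IH; ring]. Qed.

Lemma symsum_scal c f N : symsum (fun n => c * f n) N = c * symsum f N.
Proof. induction N as [|N IH]; [rewrite !symsum_0; ring|rewrite !symsum_S, IH; ring]. Qed.

Lemma symsum_plus f g N : symsum (fun n => f n + g n) N = symsum f N + symsum g N.
Proof. induction N as [|N IH]; [rewrite !symsum_0; ring|rewrite !symsum_S, IH; ring]. Qed.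

Lemma symsum_le f g N : (forall n, f n <= g n) -> symsum f N <= symsum g N.
Proof.
intros H. induction N as [|N IH]; [apply H|rewrite !symsum_S].
assert (H1 := H (Z.of_nat (S N))). assert (H2 := H (- Z.of_nat (S N))%Z). lra.
Qed.

Lemma symsum_pos f N : (forall n, 0 <= f n) -> 0 <= symsum f N.
Proof.
intros H. induction N as [|N IH]; [apply H|rewrite !symsum_S].
assert (H1 := H (Z.of_nat (S N))). assert (H2 := H (- Z.of_nat (S N))%Z). lra.
Qed.

Lemma symsum_mono f N M : (forall n, 0 <= f n) -> (N <= M)%nat -> symsum f N <= symsum f M.
Proof.
intros H. induction 1 as [|M _ IH]; [lra|rewrite symsum_S].
assert (H1 := H (Z.of_nat (S M))). assert (H2 := H (- Z.of_nat (S M))%Z). lra.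
Qed.

Lemma symsum_term f N m : (forall n, 0 <= f n) -> (Z.abs m <= Z.of_nat N)%Z -> f m <= symsum f N.
Proof.
intros H. induction N as [|N IH]; intros Hm; [replace m with 0%Z by lia; rewrite symsum_0; lra|]. rewrite symsum_S.
assert (H1 := H (Z.of_nat (S N))). assert (H2 := H (- Z.of_nat (S N))%Z).
destruct (Z.eq_dec m (Z.of_nat (S N))) as [->|Hm1]; [|destruct (Z.eq_dec m (- Z.of_nat (S N))) as [->|Hm2]].
- assert (H3 := symsum_pos f N H). lra.
- assert (H3 := symsum_pos f N H). lra.
- specialize (IH ltac:(lia)). lra.
Qed.

Lemma symsum_abs f N : Rabs (symsum f N) <= symsum (fun n => Rabs (f n)) N.
Proof.
induction N as [|N IH]; [rewrite !symsum_0; lra|rewrite !symsum_S]. eapply Rle_trans; [apply Rabs_triang|].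
assert (H := Rabs_triang (f (Z.of_nat (S N))) (f (- Z.of_nat (S N))%Z)). lra.
Qed.

Lemma symsum_shift f N : symsum (fun n => f (n + 1)%Z) N = symsum f N + (f (Z.of_nat N + 1)%Z - f (- Z.of_nat N)%Z).
Proof.
induction N as [|N IH]; [rewrite !symsum_0; simpl; ring|]. rewrite !symsum_S, IH.
replace (- Z.of_nat (S N) + 1)%Z with (- Z.of_nat N)%Z by lia. replace (Z.of_nat N + 1)%Z with (Z.of_nat (S N)) by lia. ring.
Qed.

Lemma symsum_lim (F : nat -> Z -> R) (f : Z -> R) N : (forall m, is_lim_seq (fun J => F J m) (f m)) -> is_lim_seq (fun J => symsum (F J) N) (symsum f N).
Proof.
intros H. induction N as [|N IH]; [apply H|].
apply (is_lim_seq_ext (fun J => symsum (F J) N + (F J (Z.of_nat (S N)) + F J (- Z.of_nat (S N))%Z))); [intros J; now rewrite symsum_S|].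
rewrite symsum_S. apply is_lim_seq_plus'; [exact IH|apply is_lim_seq_plus'; apply H].
Qed.

Definition summ (f : Z -> R) : Prop := exists B, forall N, symsum (fun n => Rabs (f n)) N <= B.
Definition ZS (f : Z -> R) : R := real (Lim_seq (symsum f)).

Lemma lim_symsum_pos f B : (forall n, 0 <= f n) -> (forall N, symsum f N <= B) -> exists l : R, is_lim_seq (symsum f) l.
Proof.
intros Hf HB. apply (ex_finite_lim_seq_incr (symsum f) B); auto. intros N. apply symsum_mono; auto.
Qed.

Lemma ZS_lim f : summ f -> is_lim_seq (symsum f) (ZS f).
Proof.
intros [B HB].
destruct (lim_symsum_pos (fun n => Rabs (f n)) B) as [l1 H1]; auto using Rabs_pos.
destruct (lim_symsum_pos (fun n => Rabs (f n) + f n) (2 * B)) as [l2 H2].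
- intros n. assert (H := Rle_abs (- f n)). rewrite Rabs_Ropp in H. lra.
- intros N. rewrite symsum_plus. assert (H := symsum_abs f N). assert (H' := Rle_abs (symsum f N)). specialize (HB N). lra.
- assert (H : is_lim_seq (symsum f) (l2 - l1)).
  { apply (is_lim_seq_ext (fun N => symsum (fun n => Rabs (f n) + f n) N - symsum (fun n => Rabs (f n)) N)); [intros N; rewrite symsum_plus; ring|].
    now apply is_lim_seq_minus'. }
  unfold ZS. rewrite (is_lim_seq_unique _ _ H). exact H.
Qed.

Lemma ZS_unique f (l : R) : is_lim_seq (symsum f) l -> ZS f = l.
Proof. intros H. unfold ZS. now rewrite (is_lim_seq_unique _ _ H). Qed.

Lemma ZS_ext f g : (forall n, f n = g n) -> ZS f = ZS g.
Proof. intros H. unfold ZS. f_equal. apply Lim_seq_ext. intros N. now apply symsum_ext. Qed.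

Lemma summ_le f g : (forall n, Rabs (f n) <= Rabs (g n)) -> summ g -> summ f.
Proof. intros H [B HB]. exists B. intros N. eapply Rle_trans; [|apply HB]. now apply symsum_le. Qed.

Lemma summ_ext f g : (forall n, f n = g n) -> summ f -> summ g.
Proof. intros H. apply summ_le. intros n. rewrite H; lra. Qed.

Lemma summ_lin c f g : summ f -> summ g -> summ (fun n => c * f n + g n).
Proof.
intros [B HB] [B' HB']. exists (Rabs c * B + B'). intros N.
apply Rle_trans with (symsum (fun n => Rabs c * Rabs (f n) + Rabs (g n)) N).
- apply symsum_le. intros n. eapply Rle_trans; [apply Rabs_triang|]. rewrite Rabs_mult. lra.
- rewrite symsum_lin. specialize (HB N). specialize (HB' N). assert (H := Rmult_le_compat_l (Rabs c) _ _ (Rabs_pos c) HB). lra.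
Qed.

Lemma ZS_lin c f g : summ f -> summ g -> ZS (fun n => c * f n + g n) = c * ZS f + ZS g.
Proof.
intros Hf Hg. apply ZS_unique. apply (is_lim_seq_ext (fun N => c * symsum f N + symsum g N)); [intros N; now rewrite symsum_lin|].
apply is_lim_seq_plus'; [|now apply ZS_lim]. apply (is_lim_seq_scal_l _ c (ZS f)). now apply ZS_lim.
Qed.

Lemma summ_0 : summ (fun _ => 0).
Proof. exists 0. intros N. rewrite (symsum_ext _ (fun _ => 0 * 0)) by (intros; rewrite Rabs_R0; ring). rewrite symsum_scal. lra. Qed.

Lemma ZS_0 : ZS (fun _ => 0) = 0.
Proof.
apply ZS_unique. apply (is_lim_seq_ext (fun _ => 0)); [|apply is_lim_seq_const]. intros N.
rewrite (symsum_ext _ (fun _ => 0 * 0)) by (intros; ring). rewrite symsum_scal. ring.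
Qed.

Lemma summ_scal c f : summ f -> summ (fun n => c * f n).
Proof. intros H. apply (summ_ext (fun n => c * f n + 0)); [intros; ring|]. apply (summ_lin c f (fun _ => 0)); auto using summ_0. Qed.

Lemma ZS_scal c f : summ f -> ZS (fun n => c * f n) = c * ZS f.
Proof. intros H. rewrite (ZS_ext _ (fun n => c * f n + 0)) by (intros; ring). rewrite (ZS_lin c f (fun _ => 0)); auto using summ_0. rewrite ZS_0. ring. Qed.

Lemma ZS_bound f B : (forall N, symsum (fun n => Rabs (f n)) N <= B) -> Rabs (ZS f) <= B.
Proof.
intros HB. assert (H := ZS_lim f ltac:(now exists B)). apply is_lim_seq_abs in H.
apply (is_lim_seq_le _ (fun _ => B) _ B) with (2 := H); [|apply is_lim_seq_const].
intros N. eapply Rle_trans; [apply symsum_abs|apply HB].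
Qed.

Lemma summ_shift f : summ f -> summ (fun n => f (n + 1)%Z).
Proof.
intros [B HB]. exists B. intros N. rewrite symsum_psum.
rewrite (psum_ext _ (fun k => (fun n => Rabs (f n)) (Z.of_nat k + (1 - Z.of_nat N))%Z)) by (intros i _; do 2 f_equal; lia).
apply (symsum_range (fun n => Rabs (f n)) B); auto using Rabs_pos.
Qed.

Lemma summ_shift' f : summ f -> summ (fun n => f (n - 1)%Z).
Proof.
intros [B HB]. exists B. intros N. rewrite symsum_psum.
rewrite (psum_ext _ (fun k => (fun n => Rabs (f n)) (Z.of_nat k + (- 1 - Z.of_nat N))%Z)) by (intros i _; do 2 f_equal; lia).
apply (symsum_range (fun n => Rabs (f n)) B); auto using Rabs_pos.
Qed.

(** The symmetric sums of f and of its shift differ by two boundary terms, which are bounded by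
    increments of a convergent sum of absolute values. *)
Lemma ZS_shift f : summ f -> ZS (fun n => f (n + 1)%Z) = ZS f.
Proof.
intros Hf. apply ZS_unique.
assert (Ha : summ (fun n => Rabs (f n))) by (apply (summ_le _ f); auto; intros; rewrite Rabs_Rabsolu; lra).
apply ZS_lim in Ha.
assert (Hb : is_lim_seq (fun N => symsum (fun n => Rabs (f n)) (S N) - symsum (fun n => Rabs (f n)) N) (ZS (fun n => Rabs (f n)) - ZS (fun n => Rabs (f n)))).
{ apply is_lim_seq_minus'; auto. now apply (is_lim_seq_incr_1 (symsum (fun n => Rabs (f n)))). }
replace (ZS (fun n => Rabs (f n)) - ZS (fun n => Rabs (f n))) with 0 in Hb by ring.
assert (Hc : is_lim_seq (fun N => f (Z.of_nat (S N) + 1)%Z - f (- Z.of_nat (S N))%Z) 0).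
{ apply is_lim_seq_abs_0. apply (is_lim_seq_le_le (fun _ => 0) _ (fun N => (symsum (fun n => Rabs (f n)) (S (S N)) - symsum (fun n => Rabs (f n)) (S N)) + (symsum (fun n => Rabs (f n)) (S N) - symsum (fun n => Rabs (f n)) N))).
  - intros N. split; [apply Rabs_pos|]. rewrite !symsum_S. unfold Rminus at 1. eapply Rle_trans; [apply Rabs_triang|]. rewrite Rabs_Ropp.
    replace (Z.of_nat (S N) + 1)%Z with (Z.of_nat (S (S N))) by lia.
    assert (H1 := Rabs_pos (f (- Z.of_nat (S (S N)))%Z)). assert (H2 := Rabs_pos (f (Z.of_nat (S N)))). lra.
  - apply is_lim_seq_const.
  - replace (Finite 0) with (Finite (0 + 0)) by (f_equal; ring). apply is_lim_seq_plus'; auto.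
    now apply (is_lim_seq_incr_1 (fun N => symsum (fun n => Rabs (f n)) (S N) - symsum (fun n => Rabs (f n)) N)). }
apply is_lim_seq_incr_1.
apply (is_lim_seq_ext (fun N => symsum f (S N) + (f (Z.of_nat (S N) + 1)%Z - f (- Z.of_nat (S N))%Z))); [intros N; now rewrite symsum_shift|].
replace (ZS f) with (ZS f + 0) by ring. apply is_lim_seq_plus'; auto.
apply (is_lim_seq_incr_1 (symsum f)). now apply ZS_lim.
Qed.

Definition bdd (b : Z -> R) : Prop := exists K, forall n, Rabs (b n) <= K.

Lemma summ_bdd b f : bdd b -> summ f -> summ (fun n => b n * f n).
Proof.
intros [K HK] Hf. apply (summ_le _ (fun n => K * f n)); [|now apply summ_scal].
intros n. rewrite !Rabs_mult. apply Rmult_le_compat_r; [apply Rabs_pos|]. eapply Rle_trans; [apply HK|apply Rle_abs].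
Qed.

Lemma wl1_bdd q : wl1 1 q -> bdd q.
Proof.
intros [B HB]. exists B. intros n. eapply Rle_trans; [|apply (HB (Z.abs_nat n))].
eapply Rle_trans; [|apply (symsum_term (fun n => bracket (IZR n) ^ 1 * Rabs (q n)) _ n); [|lia]].
- cbv beta. assert (H := bracket_ge1 (IZR n)). assert (H' := Rabs_pos (q n)). simpl. nra.
- intros k. apply Rmult_le_pos; [|apply Rabs_pos]. assert (H := bracket_ge1 (IZR k)). simpl. lra.
Qed.

(** What summation by parts needs; it covers the pairing of two square-summable sequences as well as
    that of a bounded with a summable one. *)
Definition dual (x y : Z -> R) : Prop :=
  summ (fun n => x n * y n) /\ summ (fun n => x (n + 1)%Z * y n) /\ summ (fun n => x n * y (n + 1)%Z).

Lemma dual_sym x y : dual x y -> dual y x.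
Proof. intros [H1 [H2 H3]]. split; [|split]; [apply (summ_ext _ _ (fun n => Rmult_comm _ _) H1)|apply (summ_ext _ _ (fun n => Rmult_comm _ _) H3)|apply (summ_ext _ _ (fun n => Rmult_comm _ _) H2)]. Qed.

Lemma ZS_HR_l q x y : bdd q -> dual x y ->
  ZS (fun n => HR q x n * y n) = ZS (fun n => (2 + q n) * (x n * y n)) - ZS (fun n => x (n + 1)%Z * y n) - ZS (fun n => x n * y (n + 1)%Z).
Proof.
intros [K HK] [H1 [H2 H3]].
assert (H0 : summ (fun n => (2 + q n) * (x n * y n))).
{ apply summ_bdd; auto. exists (2 + K). intros n. eapply Rle_trans; [apply Rabs_triang|]. rewrite (Rabs_right 2) by lra. specialize (HK n). lra. }
assert (H3' := summ_shift' _ H3). cbv beta in H3'.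
rewrite (ZS_ext _ (fun n => (-1) * (x (n - 1)%Z * y (n - 1 + 1)%Z) + ((-1) * (x (n + 1)%Z * y n) + (2 + q n) * (x n * y n)))).
2:{ intros n. unfold HR. replace (n - 1 + 1)%Z with n by lia. ring. }
rewrite (ZS_lin (-1) (fun n => x (n - 1)%Z * y (n - 1 + 1)%Z)), (ZS_lin (-1) (fun n => x (n + 1)%Z * y n)); auto; [|now apply summ_lin].
rewrite <- (ZS_shift (fun n => x (n - 1)%Z * y (n - 1 + 1)%Z)) by auto.
rewrite (ZS_ext (fun n => x (n + 1 - 1)%Z * y (n + 1 - 1 + 1)%Z) (fun n => x n * y (n + 1)%Z)) by (intros n; now replace (n + 1 - 1)%Z with n by lia).
ring.
Qed.

Lemma ZS_HR_sym q x y : bdd q -> dual x y -> ZS (fun n => HR q x n * y n) = ZS (fun n => x n * HR q y n).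
Proof.
intros Hq Hd. rewrite ZS_HR_l by auto. rewrite (ZS_ext (fun n => x n * HR q y n) (fun n => HR q y n * x n)) by (intros; ring).
rewrite ZS_HR_l by (auto using dual_sym).
rewrite (ZS_ext (fun n => (2 + q n) * (x n * y n)) (fun n => (2 + q n) * (y n * x n))) by (intros; ring).
rewrite (ZS_ext (fun n => y (n + 1)%Z * x n) (fun n => x n * y (n + 1)%Z)) by (intros; ring).
rewrite (ZS_ext (fun n => y n * x (n + 1)%Z) (fun n => x (n + 1)%Z * y n)) by (intros; ring).
ring.
Qed.

(** * Real square-summable sequences *)

Definition sq2 (x : Z -> R) : Prop := exists B, forall N, symsum (fun n => x n ^ 2) N <= B.

Lemma sq2_summ x y : sq2 x -> sq2 y -> summ (fun n => x n * y n).
Proof.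
intros [B HB] [B' HB']. exists (1 * B + B'). intros N. eapply Rle_trans; [apply (symsum_le _ (fun n => 1 * x n ^ 2 + y n ^ 2))|].
- intros n. rewrite Rabs_mult. rewrite <- (pow2_abs (x n)), <- (pow2_abs (y n)). assert (H1 := Rabs_pos (x n)). assert (H2 := Rabs_pos (y n)). nra.
- rewrite symsum_lin. specialize (HB N). specialize (HB' N). lra.
Qed.

Lemma sq2_of_summ x : summ (fun n => x n ^ 2) -> sq2 x.
Proof. intros [B HB]. exists B. intros N. eapply Rle_trans; [|apply (HB N)]. apply symsum_le. intros n. apply Rle_abs. Qed.

Lemma sq2_sq x : sq2 x -> summ (fun n => x n ^ 2).
Proof. intros H. apply (summ_ext (fun n => x n * x n)); [intros; ring|]. now apply sq2_summ. Qed.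

Lemma sq2_lin c x y : sq2 x -> sq2 y -> sq2 (fun n => c * x n + y n).
Proof.
intros Hx Hy. apply sq2_of_summ.
apply (summ_ext (fun n => c ^ 2 * x n ^ 2 + ((2 * c) * (x n * y n) + y n ^ 2))); [intros; ring|].
apply (summ_lin (c ^ 2) (fun n => x n ^ 2)); [now apply sq2_sq|]. apply (summ_lin (2 * c) (fun n => x n * y n)); [now apply sq2_summ|now apply sq2_sq].
Qed.

Lemma sq2_ext x y : (forall n, x n = y n) -> sq2 x -> sq2 y.
Proof. intros H [B HB]. exists B. intros N. rewrite <- (HB N). right. apply symsum_ext. intros n. now rewrite H. Qed.

Lemma sq2_le x y : (forall n, Rabs (x n) <= Rabs (y n)) -> sq2 y -> sq2 x.
Proof.
intros H [B HB]. exists B. intros N. eapply Rle_trans; [|apply (HB N)]. apply symsum_le. intros n.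
rewrite <- (pow2_abs (x n)), <- (pow2_abs (y n)). apply pow_incr. split; [apply Rabs_pos|apply H].
Qed.

Lemma sq2_scal c x : sq2 x -> sq2 (fun n => c * x n).
Proof. intros H. apply (sq2_ext (fun n => (c - 1) * x n + x n)); [intros; ring|]. now apply sq2_lin. Qed.

Lemma sq2_shift x : sq2 x -> sq2 (fun n => x (n + 1)%Z).
Proof. intros H. apply sq2_of_summ. apply (summ_shift (fun n => x n ^ 2)). now apply sq2_sq. Qed.

Lemma sq2_shift' x : sq2 x -> sq2 (fun n => x (n - 1)%Z).
Proof. intros H. apply sq2_of_summ. apply (summ_shift' (fun n => x n ^ 2)). now apply sq2_sq. Qed.

Lemma sq2_dual x y : sq2 x -> sq2 y -> dual x y.
Proof. intros Hx Hy. split; [|split]; apply sq2_summ; auto using sq2_shift. Qed.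

Lemma sq2_bdd b x : bdd b -> sq2 x -> sq2 (fun n => b n * x n).
Proof.
intros [K HK] H. apply (sq2_le _ (fun n => K * x n)); [|now apply sq2_scal].
intros n. rewrite !Rabs_mult. apply Rmult_le_compat_r; [apply Rabs_pos|]. eapply Rle_trans; [apply HK|apply Rle_abs].
Qed.

Lemma sq2_HR q x : bdd q -> sq2 x -> sq2 (HR q x).
Proof.
intros Hq H. apply (sq2_ext (fun n => (-1) * x (n - 1)%Z + ((-1) * x (n + 1)%Z + (2 * x n + q n * x n)))); [intros; unfold HR; ring|].
apply (sq2_lin (-1) (fun n => x (n - 1)%Z)); [now apply sq2_shift'|]. apply (sq2_lin (-1) (fun n => x (n + 1)%Z)); [now apply sq2_shift|].
apply sq2_lin; auto. now apply sq2_bdd.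
Qed.

Definition ip (x y : Z -> R) : R := ZS (fun n => x n * y n).

Lemma ip_sym x y : ip x y = ip y x.
Proof. apply ZS_ext. intros; ring. Qed.

Lemma ip_lin_l c x y z : sq2 x -> sq2 y -> sq2 z -> ip (fun n => c * x n + y n) z = c * ip x z + ip y z.
Proof.
intros Hx Hy Hz. unfold ip. rewrite <- (ZS_lin c (fun n => x n * z n) (fun n => y n * z n)) by now apply sq2_summ. apply ZS_ext. intros; ring.
Qed.

Lemma ip_HR q x y : bdd q -> sq2 x -> sq2 y -> ip (HR q x) y = ip x (HR q y).
Proof. intros Hq Hx Hy. apply ZS_HR_sym; auto. now apply sq2_dual. Qed.

Lemma ip_ext x x' y y' : (forall n, x n = x' n) -> (forall n, y n = y' n) -> ip x y = ip x' y'.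
Proof. intros H H'. apply ZS_ext. intros; now rewrite H, H'. Qed.

Lemma symsum_le_ip x N : sq2 x -> symsum (fun n => x n ^ 2) N <= ip x x.
Proof.
intros Hx. assert (H := ZS_lim _ (sq2_summ x x Hx Hx)). fold (ip x x) in H.
assert (H' : is_lim_seq (fun M => symsum (fun n => x n * x n) (M + N)) (ip x x)) by now apply (is_lim_seq_incr_n (symsum (fun n => x n * x n)) N).
apply (is_lim_seq_le (fun _ => symsum (fun n => x n ^ 2) N) _ (symsum (fun n => x n ^ 2) N) (ip x x)) with (3 := H'); [|apply is_lim_seq_const].
intros M. rewrite (symsum_ext (fun n => x n ^ 2) (fun n => x n * x n)) by (intros; ring). apply symsum_mono; [intros; nra|lia].
Qed.

Lemma ip_pos x : sq2 x -> 0 <= ip x x.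
Proof. intros H. eapply Rle_trans; [|apply (symsum_le_ip x 0 H)]. rewrite symsum_0. apply pow2_ge_0. Qed.

Lemma ip_eq0 x : sq2 x -> ip x x = 0 -> forall n, x n = 0.
Proof.
intros H E n. assert (H1 := symsum_le_ip x (Z.abs_nat n) H).
assert (H2 := symsum_term (fun n => x n ^ 2) (Z.abs_nat n) n ltac:(intros; apply pow2_ge_0) ltac:(lia)). cbv beta in H2. nra.
Qed.

Lemma ZS_le f g : summ f -> summ g -> (forall n, f n <= g n) -> ZS f <= ZS g.
Proof.
intros Hf Hg H. apply (is_lim_seq_le (symsum f) (symsum g) (ZS f) (ZS g)); [|now apply ZS_lim|now apply ZS_lim]. intros N. now apply symsum_le.
Qed.

(** * The shifted operator H - mu and its damping polynomial *)

Section Shifted.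
Variables (q : Z -> R) (mu : R).
Hypothesis Hq : bdd q.

Definition opS (x : Z -> R) (n : Z) : R := (- mu) * x n + HR q x n.

Lemma sq2_opS x : sq2 x -> sq2 (opS x).
Proof. intros Hx. apply (sq2_lin (- mu) x (HR q x)); auto. now apply sq2_HR. Qed.

Lemma ip_opS x y : sq2 x -> sq2 y -> ip (opS x) y = ip x (opS y).
Proof.
intros Hx Hy. unfold opS. rewrite ip_lin_l by (auto using sq2_HR). rewrite (ip_sym x (fun n => - mu * y n + HR q y n)), ip_lin_l by (auto using sq2_HR).
rewrite ip_HR by auto. rewrite (ip_sym y), (ip_sym (HR q y)). reflexivity.
Qed.

Lemma opS_bound : exists c, 0 < c /\ forall x, sq2 x -> ip (opS x) (opS x) <= c * ip x x.
Proof.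
destruct Hq as [K HK]. set (b := 2 + Rabs K + Rabs mu). exists (3 * (b ^ 2 + 2)). split; [assert (H := pow2_ge_0 b); lra|]. intros x Hx.
assert (S0 := sq2_sq x Hx). assert (S1 := summ_shift _ S0). assert (S2 := summ_shift' _ S0). cbv beta in S1, S2.
assert (Hpt : forall n, opS x n * opS x n <= (3 * b ^ 2) * x n ^ 2 + (3 * x (n + 1)%Z ^ 2 + 3 * x (n - 1)%Z ^ 2)).
{ intros n. unfold opS, HR. set (a := 2 + q n - mu).
  assert (Ha : Rabs a <= b). { unfold a, b. unfold Rminus. eapply Rle_trans; [apply Rabs_triang|]. rewrite Rabs_Ropp. assert (T := Rabs_triang 2 (q n)). rewrite (Rabs_right 2) in T by lra. specialize (HK n). assert (K' := Rle_abs K). lra. }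
  assert (Ha2 : a ^ 2 <= b ^ 2). { rewrite <- (pow2_abs a). apply pow_incr. split; [apply Rabs_pos|auto]. }
  replace (- mu * x n + ((2 + q n) * x n - x (n + 1)%Z - x (n - 1)%Z)) with (a * x n - x (n + 1)%Z - x (n - 1)%Z) by (unfold a; ring).
  set (X := x n). set (Y := x (n + 1)%Z). set (Z := x (n - 1)%Z).
  assert (H1 : (a * X - Y - Z) * (a * X - Y - Z) <= 3 * (a ^ 2 * X ^ 2) + (3 * Y ^ 2 + 3 * Z ^ 2)).
  { assert (P1 := pow2_ge_0 (a * X + Y)). assert (P2 := pow2_ge_0 (a * X + Z)). assert (P3 := pow2_ge_0 (Y - Z)). simpl in *. nra. }
  assert (H2 : a ^ 2 * X ^ 2 <= b ^ 2 * X ^ 2) by (apply Rmult_le_compat_r; [apply pow2_ge_0|auto]). lra. }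
unfold ip at 1. eapply Rle_trans; [apply ZS_le; [apply sq2_summ; now apply sq2_opS| |exact Hpt]|].
- apply (summ_lin (3 * b ^ 2) (fun n => x n ^ 2)); auto. apply (summ_lin 3 (fun n => x (n + 1)%Z ^ 2)); auto. now apply summ_scal.
- rewrite (ZS_lin (3 * b ^ 2) (fun n => x n ^ 2)), (ZS_lin 3 (fun n => x (n + 1)%Z ^ 2)), ZS_scal; auto.
  + rewrite (ZS_shift (fun n => x n ^ 2)) by auto. rewrite <- (ZS_shift (fun n => x (n - 1)%Z ^ 2)) by auto.
    rewrite (ZS_ext (fun n => x (n + 1 - 1)%Z ^ 2) (fun n => x n ^ 2)) by (intros n; now replace (n + 1 - 1)%Z with n by lia).
    unfold ip. rewrite (ZS_ext (fun n => x n * x n) (fun n => x n ^ 2)) by (intros; ring). lra.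
  + now apply summ_scal.
  + apply (summ_lin 3 (fun n => x (n + 1)%Z ^ 2)); auto. now apply summ_scal.
Qed.

Definition damp (c : R) (x : Z -> R) (n : Z) : R := (- / c) * opS (opS x) n + x n.

Lemma sq2_damp c x : sq2 x -> sq2 (damp c x).
Proof. intros H. apply (sq2_lin (- / c) (opS (opS x)) x); auto using sq2_opS. Qed.

(** Expanding, |chi x|^2 = |x|^2 - (2/c) a + b / c^2 with a = |(H - mu) x|^2 and b = |(H - mu)^2
    x|^2 <= c a. *)
Lemma damp_contracts c x : 0 < c -> (forall x, sq2 x -> ip (opS x) (opS x) <= c * ip x x) -> sq2 x -> ip (damp c x) (damp c x) <= ip x x.
Proof.
intros Hc H Hx. assert (H1 := sq2_opS x Hx). assert (H2 := sq2_opS _ H1). assert (Hd := sq2_damp c x Hx).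
unfold damp at 1. rewrite ip_lin_l by auto. rewrite (ip_sym _ (damp c x)), (ip_sym x).
unfold damp. rewrite !ip_lin_l by auto. rewrite (ip_sym x (opS (opS x))). rewrite (ip_opS (opS x) x) by auto.
specialize (H _ H1). set (a := ip (opS x) (opS x)) in *. set (b := ip (opS (opS x)) (opS (opS x))) in *. set (d := ip x x).
assert (0 <= a) by (now apply ip_pos). assert (Hi : 0 < / c) by now apply Rinv_0_lt_compat.
assert (/ c * (/ c * b) <= / c * (/ c * (c * a))) by (apply Rmult_le_compat_l; [lra|apply Rmult_le_compat_l; lra]).
replace (/ c * (/ c * (c * a))) with (/ c * a) in * by (field; lra). nra.
Qed.

Lemma damp_eigen c x e : sq2 x -> sq2 e -> (forall n, HR q e n = mu * e n) -> ip (damp c x) e = ip x e.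
Proof.
intros Hx He E. assert (H1 := sq2_opS x Hx). unfold damp. rewrite ip_lin_l by auto using sq2_opS. rewrite ip_opS by auto.
replace (ip (opS x) (opS e)) with 0; [ring|]. symmetry. unfold ip. rewrite (ZS_ext _ (fun _ => 0)); [apply ZS_0|].
intros n. unfold opS at 2. rewrite E. ring.
Qed.

Lemma opS_square_kernel u : sq2 u -> (forall n, opS (opS u) n = 0) -> forall n, opS u n = 0.
Proof.
intros Hu H. apply ip_eq0; [now apply sq2_opS|]. rewrite ip_opS by auto using sq2_opS. unfold ip. rewrite (ZS_ext _ (fun _ => 0)); [apply ZS_0|].
intros n. rewrite H. ring.
Qed.

Lemma opS_square_plus u s : sq2 u -> s <> 0 -> (forall n, opS (opS u) n + s ^ 2 * u n = 0) -> forall n, u n = 0.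
Proof.
intros Hu Hs H. assert (H1 := sq2_opS u Hu). apply ip_eq0; auto.
assert (E : ip (fun n => s ^ 2 * u n + opS (opS u) n) u = 0).
{ unfold ip. rewrite (ZS_ext _ (fun _ => 0)); [apply ZS_0|]. intros n. rewrite Rplus_comm, H. ring. }
rewrite ip_lin_l, ip_opS in E by auto using sq2_opS.
assert (0 <= ip (opS u) (opS u)) by now apply ip_pos. assert (0 <= ip u u) by now apply ip_pos.
assert (0 < s ^ 2) by (apply pow2_gt_0; auto). nra.
Qed.

End Shifted.

Lemma tail_bound x e N M eta : 0 < eta -> (N <= M)%nat ->
  Rabs (symsum (fun n => x n * e n) M - symsum (fun n => x n * e n) N) <=
  eta / 2 * (symsum (fun n => x n ^ 2) M - symsum (fun n => x n ^ 2) N) + / (2 * eta) * (symsum (fun n => e n ^ 2) M - symsum (fun n => e n ^ 2) N).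
Proof.
intros Heta. induction 1 as [|M _ IH].
- rewrite !Rminus_diag, Rabs_R0. lra.
- rewrite !symsum_S.
  assert (P : forall a b, Rabs (a * b) <= eta / 2 * a ^ 2 + / (2 * eta) * b ^ 2).
  { intros a b. assert (Q : 0 <= / (2 * eta) * (eta * Rabs a - Rabs b) ^ 2) by (apply Rmult_le_pos; [left; apply Rinv_0_lt_compat; lra|apply pow2_ge_0]).
    replace (/ (2 * eta) * (eta * Rabs a - Rabs b) ^ 2) with (eta / 2 * Rabs a ^ 2 + / (2 * eta) * Rabs b ^ 2 - Rabs a * Rabs b) in Q by (field; lra).
    rewrite !pow2_abs, <- Rabs_mult in Q. lra. }
  set (i := Z.of_nat (S M)). assert (P1 := P (x i) (e i)). assert (P2 := P (x (- i)%Z) (e (- i)%Z)).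
  set (A := symsum (fun n => x n * e n) M) in *. set (B := symsum (fun n => x n * e n) N) in *.
  replace (A + (x i * e i + x (- i)%Z * e (- i)%Z) - B) with ((A - B) + (x i * e i + x (- i)%Z * e (- i)%Z)) by ring.
  eapply Rle_trans; [apply Rabs_triang|]. assert (T := Rabs_triang (x i * e i) (x (- i)%Z * e (- i)%Z)). lra.
Qed.

(** A bounded sequence converging to 0 pointwise converges weakly to 0, and the pairing is constant
    in k. The tail of the pairing is estimated by a weighted Young inequality, with eta making the
    bounded part small and N chosen afterwards. *)
Lemma weak_limit (x : nat -> Z -> R) e B l : (forall k, sq2 (x k)) -> (forall k, ip (x k) (x k) <= B) -> sq2 e ->
  (forall m, is_lim_seq (fun k => x k m) 0) -> (forall k, ip (x k) e = l) -> l = 0.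
Proof.
intros Hx HB He Hp Hl.
assert (HB0 : 0 <= B) by (eapply Rle_trans; [apply (ip_pos (x O))|]; auto).
assert (H : forall eps, 0 < eps -> Rabs l <= eps).
{ intros eps Heps. set (eta := eps / (B + 1)). assert (Heta : 0 < eta) by (apply Rdiv_lt_0_compat; lra).
  assert (HE : is_lim_seq (symsum (fun n => e n ^ 2)) (ip e e)).
  { apply (is_lim_seq_ext (symsum (fun n => e n * e n))); [intros N; apply symsum_ext; intros; ring|]. apply ZS_lim. now apply sq2_summ. }
  assert (Hp' : 0 < 2 * eta * (eps / 4)) by (apply Rmult_lt_0_compat; lra).
  assert (HE' := HE). apply is_lim_seq_spec in HE'. destruct (HE' (mkposreal _ Hp')) as [N HN]. specialize (HN N (le_n N)). cbv [pos] in HN.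
  assert (Hf : is_lim_seq (fun k => symsum (fun n => x k n * e n) N) 0).
  { replace (Finite 0) with (Finite (symsum (fun n => 0 * e n) N)) by (f_equal; rewrite (symsum_ext _ (fun _ => 0 * 0)) by (intros; ring); rewrite symsum_scal; ring).
    apply (symsum_lim (fun k n => x k n * e n) (fun n => 0 * e n)). intros m. apply (is_lim_seq_scal_r (fun k => x k m) (e m) 0). apply Hp. }
  apply is_lim_seq_spec in Hf. assert (Hq : 0 < eps / 4) by lra. destruct (Hf (mkposreal _ Hq)) as [k Hk]. specialize (Hk k (le_n k)). cbv [pos] in Hk. rewrite Rminus_0_r in Hk.
  assert (Hd : Rabs (ip (x k) e - symsum (fun n => x k n * e n) N) <= eta / 2 * B + / (2 * eta) * (ip e e - symsum (fun n => e n ^ 2) N)).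
  { assert (L1 := ZS_lim _ (sq2_summ _ _ (Hx k) He)). fold (ip (x k) e) in L1.
    apply (is_lim_seq_le (fun M => Rabs (symsum (fun n => x k n * e n) (M + N) - symsum (fun n => x k n * e n) N)) (fun _ => eta / 2 * B + / (2 * eta) * (ip e e - symsum (fun n => e n ^ 2) N))
      (Rabs (ip (x k) e - symsum (fun n => x k n * e n) N)) (eta / 2 * B + / (2 * eta) * (ip e e - symsum (fun n => e n ^ 2) N))).
    - intros M. eapply Rle_trans; [apply (tail_bound (x k) e N (M + N) eta); auto; lia|].
      assert (T1 := symsum_le_ip (x k) (M + N) (Hx k)). assert (T2 := symsum_pos (fun n => x k n ^ 2) N ltac:(intros; apply pow2_ge_0)). specialize (HB k).
      assert (T3 := symsum_le_ip e (M + N) He).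
      assert (0 < / (2 * eta)) by (apply Rinv_0_lt_compat; lra). apply Rplus_le_compat; apply Rmult_le_compat_l; lra.
    - apply (is_lim_seq_abs (fun M => symsum (fun n => x k n * e n) (M + N) - symsum (fun n => x k n * e n) N) (ip (x k) e - symsum (fun n => x k n * e n) N)).
      apply is_lim_seq_minus'; [|apply is_lim_seq_const]. now apply (is_lim_seq_incr_n (symsum (fun n => x k n * e n)) N).
    - apply is_lim_seq_const. }
  rewrite Hl in Hd.
  assert (E1 : eta / 2 * B <= eps / 2). { unfold eta. replace (eps / (B + 1) / 2 * B) with (eps / 2 * (B / (B + 1))) by (field; lra). assert (0 < / (B + 1)) by (apply Rinv_0_lt_compat; lra). replace (B / (B + 1)) with (1 - / (B + 1)) by (field; lra). nra. }
  assert (E2 : / (2 * eta) * (ip e e - symsum (fun n => e n ^ 2) N) <= eps / 4).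
  { apply Rabs_lt_between in HN. replace (eps / 4) with (/ (2 * eta) * (2 * eta * (eps / 4))) by (field; lra). apply Rmult_le_compat_l; [left; apply Rinv_0_lt_compat; lra|lra]. }
  assert (T := Rabs_triang (l - symsum (fun n => x k n * e n) N) (symsum (fun n => x k n * e n) N)).
  replace (l - symsum (fun n => x k n * e n) N + symsum (fun n => x k n * e n) N) with l in T by ring. lra. }
destruct (Req_dec l 0) as [|Hn]; auto. exfalso. apply Rabs_pos_lt in Hn. specialize (H (Rabs l / 2) ltac:(lra)). lra.
Qed.

(** With d = (b - a)/2 and s = (a + b)/2 the difference is 2 sin s sin d, and d <= s <= PI - d gives
    sin s >= sin d >= d/3. The bound is quadratic because the derivative of cos vanishes at both
    ends. *)
Lemma cos_diff_lower a b : 0 <= a -> a <= b -> b <= PI -> (b - a) ^ 2 / 18 <= cos a - cos b.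
Proof.
intros Ha Hab Hb. assert (HPI := PI_gt_3). rewrite form2.
set (d := (b - a) / 2). set (s := (a + b) / 2). replace ((a - b) / 2) with (- d) by (unfold d; field). rewrite sin_neg.
assert (Hd : 0 <= d) by (unfold d; lra). assert (Hd3 := sin_ge_third d ltac:(unfold d; lra)).
assert (Hs : sin d <= sin s).
{ destruct (Rle_dec s (PI / 2)); [apply sin_incr_1; unfold d, s in *; lra|]. rewrite <- (sin_PI_x s). apply sin_incr_1; unfold d, s in *; lra. }
replace ((b - a) ^ 2 / 18) with (2 * (d / 3) * (d / 3)) by (unfold d; field). nra.
Qed.

(** For mu in [0, 4] th0 is the point where 2 - 2 cos equals mu; otherwise it is the nearer end of
    the interval. The powers of the damping factor therefore tend to 0 off a single point. *)
Lemma level_separation mu : exists th0, forall t, 0 <= t <= PI -> (t - th0) ^ 2 / 9 <= Rabs (2 - 2 * cos t - mu).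
Proof.
assert (HPI := PI_gt_3).
destruct (Rlt_dec mu 0) as [H|H]; [|destruct (Rlt_dec 4 mu) as [H'|H']].
- exists 0. intros t Ht. assert (C := cos_diff_lower 0 t ltac:(lra) ltac:(lra) ltac:(lra)). rewrite cos_0 in C. rewrite Rabs_right by (assert (B := COS_bound t); lra). lra.
- exists PI. intros t Ht. assert (C := cos_diff_lower t PI ltac:(lra) ltac:(lra) ltac:(lra)). rewrite cos_PI in C. rewrite Rabs_left by (assert (B := COS_bound t); lra).
  replace ((t - PI) ^ 2) with ((PI - t) ^ 2) by ring. lra.
- exists (acos (1 - mu / 2)). assert (B := acos_bound (1 - mu / 2)). assert (E := cos_acos (1 - mu / 2) ltac:(lra)). set (th := acos (1 - mu / 2)) in *.
  intros t Ht. replace (2 - 2 * cos t - mu) with (2 * (cos th - cos t)) by lra. destruct (Rle_dec th t).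
  + assert (C := cos_diff_lower th t ltac:(lra) ltac:(lra) ltac:(lra)). assert (0 <= (t - th) ^ 2) by apply pow2_ge_0. rewrite Rabs_right by lra. lra.
  + assert (C := cos_diff_lower t th ltac:(lra) ltac:(lra) ltac:(lra)). assert (0 <= (th - t) ^ 2) by apply pow2_ge_0. rewrite Rabs_left1 by lra. replace ((t - th) ^ 2) with ((th - t) ^ 2) by ring. lra.
Qed.

Lemma pow_damped x k : 0 <= x <= 1 -> 0 <= (1 - x) ^ k <= / (1 + INR k * x).
Proof.
intros Hx. split; [apply pow_le; lra|]. assert (Hk := pos_INR k). assert (Hp : 0 < 1 + INR k * x) by nra.
apply Rmult_le_reg_r with (1 + INR k * x); [auto|]. rewrite Rinv_l by lra.
induction k as [|k IH]; [simpl; lra|]. assert (Hk' := pos_INR k). rewrite S_INR in *.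
assert (IH' := IH Hk' ltac:(nra)). assert (0 <= (1 - x) ^ k) by (apply pow_le; lra). simpl.
assert ((1 - x) * (1 - x) ^ k * (1 + (INR k + 1) * x) = (1 - x) ^ k * (1 + INR k * x) - (1 - x) ^ k * (x * x * (INR k + 1))) by ring.
assert (0 <= (1 - x) ^ k * (x * x * (INR k + 1))) by (apply Rmult_le_pos; nra). lra.
Qed.

Lemma atan_majorant b th0 : 0 < b -> is_RInt (fun t => 2 / (1 + b ^ 2 * (t - th0) ^ 2)) 0 PI (2 / b * atan (b * (PI - th0)) - 2 / b * atan (b * (0 - th0))).
Proof.
intros Hb. apply (is_RInt_derive (V := R_CompleteNormedModule) (fun t => 2 / b * atan (b * (t - th0)))).
- intros t _. auto_derive; [exact I|]. assert (0 <= (b * (t - th0)) ^ 2) by apply pow2_ge_0. assert (0 <= b ^ 2 * (t - th0) ^ 2) by (rewrite <- Rpow_mult_distr; auto).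
  unfold Rsqr. field. repeat split; apply Rgt_not_eq; nra.
- intros t _. assert (0 <= b ^ 2 * (t - th0) ^ 2) by (rewrite <- Rpow_mult_distr; apply pow2_ge_0).
  eapply is_derive_cont. auto_derive; [lra|reflexivity].
Qed.

(** * Rows of the kernel: square summability and orthogonality to eigenvectors *)

Section Resolution.
Variables (q : Z -> R) (e V : nat -> C) (K : R).
Hypothesis Hq1 : wl1 1 q.
Hypothesis He : edge_factor q e V.
Hypothesis HK : 1 <= K.
Hypothesis Hbound : forall n m t, 0 < t < PI -> Rabs (rho q e V n m t) <= K.
Hypothesis Hdecay : forall n m, (1 <= Z.abs (Z.abs n - Z.abs m))%Z ->
     Rabs (RInt (fun x => 1 * rho q e V n m x) 0 PI) <= K * (sqrt (sqrt (IZR (Z.abs (Z.abs n - Z.abs m)))) / IZR (Z.abs (Z.abs n - Z.abs m))).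

Lemma intr_majorant phi g l n m : (forall t, continuous phi t) -> (forall t, 0 <= t <= PI -> Rabs (phi t) <= g t) -> is_RInt g 0 PI l ->
  Rabs (intr q e V phi n m) <= K * l.
Proof.
intros Hc Hg Hl. assert (HPI := PI_gt_3). unfold intr.
apply (norm_RInt_le (V := R_NormedModule) (fun t => phi t * rho q e V n m t) (fun t => scal K (g t)) 0 PI); [lra| | |].
- intros t Ht. change (Rabs (phi t * rho q e V n m t) <= K * g t). rewrite Rabs_mult, Rmult_comm.
  assert (Hr := bound_closure (rho q e V n m) K (fun t => rho_cont q e V Hq1 He n m t) (Hbound n m) t Ht). apply Rmult_le_compat; auto using Rabs_pos.
- apply (RInt_correct (V := R_CompleteNormedModule)). now apply ex_RInt_phi_rho.
- apply (is_RInt_scal (V := R_NormedModule) g 0 PI K l Hl).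
Qed.

Lemma intr_sup phi s n m : (forall t, continuous phi t) -> (forall t, 0 <= t <= PI -> Rabs (phi t) <= s) -> Rabs (intr q e V phi n m) <= K * (PI * s).
Proof.
intros Hc Hs. apply (intr_majorant phi (fun _ => s)); auto.
replace (PI * s) with (scal (PI - 0) s) by (unfold scal; simpl; unfold mult; simpl; ring). apply (is_RInt_const (V := R_NormedModule)).
Qed.

Lemma qn_bound n m : Rabs (qn q e V n m) <= K.
Proof.
assert (HPI := PI_gt_3). unfold qn. rewrite Rabs_mult, Rabs_right by (apply Rle_ge; left; apply Rinv_0_lt_compat; lra).
assert (H : Rabs (intr q e V (fun _ => 1) n m) <= K * (PI * 1)) by (apply (intr_sup (fun _ => 1) 1); [intros; apply continuous_const|intros; rewrite Rabs_R1; lra]).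
apply Rmult_le_reg_l with PI; [lra|]. rewrite <- Rmult_assoc, Rinv_r by lra. lra.
Qed.

Lemma qn_decay n m : (1 <= Z.abs m - Z.abs n)%Z -> qn q e V n m ^ 2 <= K ^ 2 / (IZR (Z.abs m - Z.abs n) * sqrt (IZR (Z.abs m - Z.abs n))).
Proof.
intros Hm. assert (HPI := PI_gt_3). assert (H := Hdecay n m ltac:(lia)). replace (Z.abs (Z.abs n - Z.abs m)) with (Z.abs m - Z.abs n)%Z in H by lia.
apply IZR_le in Hm. set (l := IZR (Z.abs m - Z.abs n)) in *.
assert (Hs : 0 < sqrt l) by (apply sqrt_lt_R0; lra). assert (Hss : 0 < sqrt (sqrt l)) by now apply sqrt_lt_R0.
assert (Hq : Rabs (qn q e V n m) <= K * (sqrt (sqrt l) / l)).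
{ unfold qn. rewrite Rabs_mult, Rabs_right by (apply Rle_ge; left; apply Rinv_0_lt_compat; lra).
  assert (Hi : / PI <= 1) by (rewrite <- Rinv_1; apply Rinv_le_contravar; lra). assert (0 < / PI) by (apply Rinv_0_lt_compat; lra).
  unfold intr. assert (Hp := Rabs_pos (RInt (fun t => 1 * rho q e V n m t) 0 PI)). nra. }
rewrite <- pow2_abs. apply Rle_trans with ((K * (sqrt (sqrt l) / l)) ^ 2); [apply pow_incr; split; [apply Rabs_pos|auto]|]. right.
assert (E1 : sqrt l * sqrt l = l) by (apply sqrt_sqrt; lra). assert (E2 : sqrt (sqrt l) * sqrt (sqrt l) = sqrt l) by (apply sqrt_sqrt; lra).
replace ((K * (sqrt (sqrt l) / l)) ^ 2) with (K ^ 2 * (sqrt (sqrt l) * sqrt (sqrt l)) / (l * l)) by (field; lra). rewrite E2.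
rewrite <- E1 at 3. field. lra.
Qed.

Lemma sqrt_telescope x : 1 <= x -> / (x * sqrt x) <= 4 * (/ sqrt x - / sqrt (x + 1)).
Proof.
intros Hx. set (a := sqrt x). set (b := sqrt (x + 1)).
assert (Ha : a * a = x) by (apply sqrt_sqrt; lra). assert (Hb : b * b = x + 1) by (apply sqrt_sqrt; lra).
assert (Pa : 0 < a) by (apply sqrt_lt_R0; lra). assert (Pb : 0 < b) by (apply sqrt_lt_R0; lra).
assert (Hba : b * (b + a) <= 4 * x) by nra.
replace (/ a - / b) with ((b * b - a * a) / (a * b * (b + a))) by (field; repeat split; nra). replace (b * b - a * a) with 1 by lra.
replace (4 * (1 / (a * b * (b + a)))) with (/ (a * (b * (b + a) / 4))) by (field; repeat split; nra).
apply Rinv_le_contravar; [apply Rmult_lt_0_compat; nra|]. rewrite (Rmult_comm x a). apply Rmult_le_compat_l; lra.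
Qed.

(** The finitely many sites |m| <= |n| use the sup bound. Beyond them |q_n(m)|^2 is at most K^2
    l^(-3/2) with l = |m| - |n|, which is summed by telescoping 1 / sqrt l. *)
Lemma sq2_qn n : sq2 (qn q e V n).
Proof.
set (p := Z.abs_nat n).
assert (HK2 : forall m, qn q e V n m ^ 2 <= K ^ 2) by (intros m; rewrite <- pow2_abs; apply pow_incr; split; [apply Rabs_pos|apply qn_bound]).
assert (H1 : forall N, symsum (fun m => qn q e V n m ^ 2) N <= (2 * INR N + 1) * K ^ 2).
{ induction N as [|N IH]; [rewrite symsum_0; specialize (HK2 0%Z); simpl in *; lra|]. rewrite symsum_S, S_INR.
  assert (A := HK2 (Z.of_nat (S N))). assert (B := HK2 (- Z.of_nat (S N))%Z). lra. }
assert (H2 : forall i, symsum (fun m => qn q e V n m ^ 2) (p + i) <= (2 * INR p + 1) * K ^ 2 + 8 * K ^ 2 * (1 - / sqrt (INR i + 1))).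
{ induction i as [|i IH].
  - rewrite Nat.add_0_r. simpl INR. rewrite Rplus_0_l, sqrt_1. specialize (H1 p). lra.
  - rewrite Nat.add_succ_r, symsum_S.
    assert (A := qn_decay n (Z.of_nat (S (p + i))) ltac:(lia)). assert (B := qn_decay n (- Z.of_nat (S (p + i))) ltac:(lia)).
    replace (Z.abs (Z.of_nat (S (p + i))) - Z.abs n)%Z with (Z.of_nat (S i)) in A by lia.
    replace (Z.abs (- Z.of_nat (S (p + i))) - Z.abs n)%Z with (Z.of_nat (S i)) in B by lia.
    rewrite <- INR_IZR_INZ, S_INR in A, B. set (x := INR i + 1) in *. rewrite S_INR. fold x.
    assert (Hx : 1 <= x) by (unfold x; assert (T := pos_INR i); lra). assert (T := sqrt_telescope x Hx).
    assert (K ^ 2 * / (x * sqrt x) <= K ^ 2 * (4 * (/ sqrt x - / sqrt (x + 1)))) by (apply Rmult_le_compat_l; [apply pow2_ge_0|auto]).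
    unfold Rdiv in A, B. lra. }
exists ((2 * INR p + 1) * K ^ 2 + 8 * K ^ 2). intros N. apply Rle_trans with (symsum (fun m => qn q e V n m ^ 2) (p + N)).
- apply symsum_mono; [intros; apply pow2_ge_0|lia].
- specialize (H2 N). assert (0 < / sqrt (INR N + 1)) by (apply Rinv_0_lt_compat, sqrt_lt_R0; assert (T := pos_INR N); lra).
  assert (0 <= K ^ 2) by apply pow2_ge_0. nra.
Qed.

Lemma opS_intr mu phi n m : (forall t, continuous phi t) ->
  opS q mu (fun m => intr q e V phi n m) m = intr q e V (fun t => (2 - 2 * cos t - mu) * phi t) n m.
Proof.
intros Hc. unfold opS. rewrite intr_HR by auto. rewrite <- intr_lin by (auto using cont_lamphi). apply intr_ext. intros t. ring.
Qed.

Lemma opS_ext mu x y n : (forall m, x m = y m) -> opS q mu x n = opS q mu y n.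
Proof. intros H. unfold opS. now rewrite (HR_ext q x y n H), H. Qed.

Lemma opS_scal mu c x n : opS q mu (fun m => c * x m) n = c * opS q mu x n.
Proof. unfold opS, HR. ring. Qed.

Lemma cont_shiftlam mu phi : (forall t, continuous phi t) -> forall t, continuous (fun t => (2 - 2 * cos t - mu) * phi t) t.
Proof.
intros H t. apply (continuous_mult (fun t => 2 - 2 * cos t - mu) phi); auto. apply (is_derive_cont _ _ (2 * sin t)). auto_derive; [exact I|ring].
Qed.

Lemma cont_damp mu c k : forall t, continuous (fun t => (1 - (2 - 2 * cos t - mu) ^ 2 / c) ^ k) t.
Proof. intros t. eapply is_derive_cont. auto_derive; [exact I|reflexivity]. Qed.

Lemma damp_iter mu c n k m : Nat.iter k (damp q mu c) (qn q e V n) m = / PI * intr q e V (fun t => (1 - (2 - 2 * cos t - mu) ^ 2 / c) ^ k) n m.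
Proof.
revert m. induction k as [|k IH]; intros m; [reflexivity|]. simpl Nat.iter.
set (phi := fun t => (1 - (2 - 2 * cos t - mu) ^ 2 / c) ^ k) in *. assert (Hc : forall t, continuous phi t) by apply cont_damp.
set (x := Nat.iter k (damp q mu c) (qn q e V n)) in *. unfold damp.
assert (E1 : forall m, opS q mu x m = / PI * intr q e V (fun t => (2 - 2 * cos t - mu) * phi t) n m).
{ intros m'. rewrite (opS_ext mu x (fun m => / PI * intr q e V phi n m)) by auto. rewrite opS_scal, opS_intr; auto. }
rewrite (opS_ext mu (opS q mu x) (fun m => / PI * intr q e V (fun t => (2 - 2 * cos t - mu) * phi t) n m)) by auto.
rewrite opS_scal, opS_intr by now apply cont_shiftlam. rewrite IH.
transitivity (/ PI * (- / c * intr q e V (fun t => (2 - 2 * cos t - mu) * ((2 - 2 * cos t - mu) * phi t)) n m + intr q e V phi n m)); [ring|].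
rewrite <- intr_lin; auto; [|apply cont_shiftlam; now apply cont_shiftlam]. f_equal. apply intr_ext. intros t. unfold phi, Rdiv. simpl. ring.
Qed.

Lemma damp_vanishes mu c n m : 0 < c -> (4 + Rabs mu) ^ 2 <= c ->
  is_lim_seq (fun k => / PI * intr q e V (fun t => (1 - (2 - 2 * cos t - mu) ^ 2 / c) ^ k) n m) 0.
Proof.
intros Hc Hmu. assert (HPI := PI_gt_3). destruct (level_separation mu) as [th0 Hth].
(* b_k^4 = (k + 1) / (81 c) is chosen so that y = b_k^2 (t - th0)^2 satisfies y^2 <= (k + 1) x with
   x = (lam - mu)^2 / c. Then (1 - x)^(k+1) <= 1 / (1 + y^2) <= 2 / (1 + y), whose integral is of
   order 1 / b_k. *)
set (b := fun k => sqrt (sqrt (INR (S k) * / (81 * c)))).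
assert (Hb : forall k, 0 < b k).
{ intros k. unfold b. apply sqrt_lt_R0, sqrt_lt_R0. apply Rmult_lt_0_compat; [apply lt_0_INR; lia|apply Rinv_0_lt_compat; lra]. }
assert (Hmaj : forall k t, 0 <= t <= PI -> Rabs ((1 - (2 - 2 * cos t - mu) ^ 2 / c) ^ S k) <= 2 / (1 + b k ^ 2 * (t - th0) ^ 2)).
{ intros k t Ht. set (x := (2 - 2 * cos t - mu) ^ 2 / c).
  assert (Hx : 0 <= x <= 1).
  { split; [apply Rmult_le_pos; [apply pow2_ge_0|left; now apply Rinv_0_lt_compat]|]. unfold x. apply Rmult_le_reg_r with c; auto. unfold Rdiv. rewrite Rmult_assoc, Rinv_l, Rmult_1_r, Rmult_1_l by lra.
    eapply Rle_trans; [|exact Hmu]. rewrite <- pow2_abs. apply pow_incr. split; [apply Rabs_pos|]. assert (B := COS_bound t).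
    assert (T := Rabs_triang (2 - 2 * cos t) (- mu)). rewrite Rabs_Ropp, (Rabs_right (2 - 2 * cos t)) in T by lra. unfold Rminus in *. lra. }
  destruct (pow_damped x (S k) Hx) as [P1 P2]. rewrite Rabs_right by lra. eapply Rle_trans; [exact P2|].
  set (y := b k ^ 2 * (t - th0) ^ 2).
  assert (Hy : 0 <= y) by (unfold y; rewrite <- Rpow_mult_distr; apply pow2_ge_0).
  assert (Hy2 : y ^ 2 <= INR (S k) * x).
  { specialize (Hth t Ht). set (s2 := (t - th0) ^ 2) in *. assert (0 <= s2) by apply pow2_ge_0.
    assert (E : b k ^ 2 * b k ^ 2 = INR (S k) * / (81 * c)).
    { assert (Z0 : 0 <= INR (S k) * / (81 * c)) by (apply Rmult_le_pos; [apply pos_INR|left; apply Rinv_0_lt_compat; lra]).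
      assert (E1 : b k ^ 2 = sqrt (INR (S k) * / (81 * c))) by (unfold b; rewrite pow2_sqrt; [auto|apply sqrt_pos]). rewrite E1. now apply sqrt_sqrt. }
    replace (y ^ 2) with (b k ^ 2 * b k ^ 2 * (s2 * s2)) by (unfold y; ring). rewrite E.
    assert (s2 / 9 * (s2 / 9) <= Rabs (2 - 2 * cos t - mu) * Rabs (2 - 2 * cos t - mu)) by (apply Rmult_le_compat; lra).
    replace (Rabs (2 - 2 * cos t - mu) * Rabs (2 - 2 * cos t - mu)) with ((2 - 2 * cos t - mu) ^ 2) in H0 by (rewrite <- pow2_abs; ring).
    replace (INR (S k) * / (81 * c) * (s2 * s2)) with (INR (S k) * (s2 / 9 * (s2 / 9) / c)) by (field; lra).
    apply Rmult_le_compat_l; [apply pos_INR|]. unfold x. apply Rmult_le_compat_r; [left; now apply Rinv_0_lt_compat|auto]. }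
  unfold Rdiv. replace (2 * / (1 + y)) with (/ ((1 + y) / 2)) by (field; lra). apply Rinv_le_contravar; [lra|]. nra. }
apply is_lim_seq_incr_1. apply is_lim_seq_abs_0.
apply (is_lim_seq_le_le (fun _ => 0) _ (fun k => 2 * K * / b k)).
- intros k. split; [apply Rabs_pos|]. rewrite Rabs_mult, (Rabs_right (/ PI)) by (apply Rle_ge; left; apply Rinv_0_lt_compat; lra).
  assert (H := intr_majorant _ _ _ n m (cont_damp mu c (S k)) (Hmaj k) (atan_majorant (b k) th0 (Hb k))).
  assert (A1 := atan_bound (b k * (PI - th0))). assert (A2 := atan_bound (b k * (0 - th0))). specialize (Hb k).
  set (a1 := atan _) in *. set (a2 := atan (b k * (0 - th0))) in *.
  assert (Hi : 0 < / b k) by now apply Rinv_0_lt_compat.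
  assert (H2 : K * (2 / b k * a1 - 2 / b k * a2) <= K * (2 / b k * PI)).
  { apply Rmult_le_compat_l; [lra|]. replace (2 / b k * a1 - 2 / b k * a2) with (2 / b k * (a1 - a2)) by ring. apply Rmult_le_compat_l; [unfold Rdiv; lra|lra]. }
  apply Rmult_le_reg_l with PI; [lra|]. rewrite <- Rmult_assoc, Rinv_r, Rmult_1_l by lra. eapply Rle_trans; [exact H|]. unfold Rdiv in H2. lra.
- apply is_lim_seq_const.
- replace (Finite 0) with (Rbar_mult (2 * K) 0) by (simpl; f_equal; ring). apply is_lim_seq_scal_l.
  apply (is_lim_seq_inv b p_infty); [|discriminate].
  assert (Hsq : forall u, is_lim_seq u p_infty -> is_lim_seq (fun k => sqrt (u k)) p_infty).
  { intros u Hu. apply (filterlim_comp _ _ _ u sqrt eventually (Rbar_locally p_infty) (Rbar_locally p_infty) Hu filterlim_sqrt_p). }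
  unfold b. do 2 apply Hsq.
  apply (is_lim_seq_ext (fun k => / (81 * c) * INR (S k))); [intros; ring|].
  replace p_infty with (Rbar_mult (/ (81 * c)) p_infty).
  + apply is_lim_seq_scal_l. apply (is_lim_seq_incr_1 INR). apply is_lim_seq_INR.
  + assert (0 < / (81 * c)) by (apply Rinv_0_lt_compat; lra). unfold Rbar_mult; simpl. destruct (Rle_dec 0 (/ (81 * c))); [|lra]. destruct (Rle_lt_or_eq_dec 0 (/ (81 * c)) r); [auto|lra].
Qed.

Theorem qn_orth_eigen n mu x : sq2 x -> (forall m, HR q x m = mu * x m) -> ip (qn q e V n) x = 0.
Proof.
intros Hx Ex. assert (Hq := wl1_bdd q Hq1). destruct (opS_bound q mu Hq) as [c0 [Hc0 Hb]].
(* The term c0 serves the contraction, the other one keeps (lam - mu)^2 / c in [0, 1] on the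
   band. *)
set (c := c0 + (4 + Rabs mu) ^ 2). assert (H4 := pow2_ge_0 (4 + Rabs mu)). assert (Hc : 0 < c) by (unfold c; lra).
assert (Hb' : forall x, sq2 x -> ip (opS q mu x) (opS q mu x) <= c * ip x x).
{ intros y Hy. eapply Rle_trans; [now apply Hb|]. apply Rmult_le_compat_r; [now apply ip_pos|unfold c; lra]. }
assert (Hs : forall k, sq2 (Nat.iter k (damp q mu c) (qn q e V n))) by (induction k as [|k IH]; [apply sq2_qn|now apply sq2_damp]).
apply (weak_limit (fun k => Nat.iter k (damp q mu c) (qn q e V n)) x (ip (qn q e V n) (qn q e V n))); auto.
- induction k as [|k IH]; [simpl; lra|]. eapply Rle_trans; [|exact IH]. now apply damp_contracts.
- intros m. eapply is_lim_seq_ext; [intros k; symmetry; apply damp_iter|]. apply damp_vanishes; auto. unfold c; lra.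
- induction k as [|k IH]; [reflexivity|]. rewrite <- IH. now apply damp_eigen.
Qed.

End Resolution.

(** * Orthogonality to the kernel of a polynomial of H *)

Section Span.
Variable q : Z -> R.
Hypothesis Hq : bdd q.

Definition orth_eigen (a : Z -> R) : Prop := forall mu x, sq2 x -> (forall m, HR q x m = mu * x m) -> ip a x = 0.

(** Completing the square in the real quadratic factor; positivity of the two squares then decides
    its kernel on square-summable sequences. *)
Lemma opA_opS b x n : opA q b x n = opS q (Re (lam b)) (opS q (Re (lam b)) x) n + Im (lam b) ^ 2 * x n.
Proof.
unfold opA, opS, HR.
replace (Cmod (lam b) ^ 2) with (Re (lam b) ^ 2 + Im (lam b) ^ 2); [ring|].
unfold Cmod. rewrite pow2_sqrt; [reflexivity|]. apply Rplus_le_le_0_compat; apply pow2_ge_0.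
Qed.

Lemma sq2_opA b x : sq2 x -> sq2 (opA q b x).
Proof.
intros Hx. apply (sq2_ext (fun n => Im (lam b) ^ 2 * x n + opS q (Re (lam b)) (opS q (Re (lam b)) x) n)); [intros n; rewrite opA_opS; ring|].
apply sq2_lin; auto using sq2_opS.
Qed.

Lemma sq2_polop l x : sq2 x -> sq2 (polop q l x).
Proof. intros Hx. induction l as [|b l IH]; simpl; auto. now apply sq2_opA. Qed.

Lemma ip_opA b x y : sq2 x -> sq2 y -> ip (opA q b x) y = ip x (opA q b y).
Proof.
intros Hx Hy. set (s := Im (lam b) ^ 2). set (r := Re (lam b)).
rewrite (ip_ext (opA q b x) (fun n => s * x n + opS q r (opS q r x) n) y y) by (intros; auto; rewrite opA_opS; fold s r; ring).
rewrite (ip_ext x x (opA q b y) (fun n => s * y n + opS q r (opS q r y) n)) by (intros; auto; rewrite opA_opS; fold s r; ring).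
rewrite ip_lin_l by auto using sq2_opS. rewrite (ip_sym x (fun n => s * y n + opS q r (opS q r y) n)), ip_lin_l by auto using sq2_opS.
rewrite !ip_opS by auto using sq2_opS. rewrite (ip_sym y x), (ip_sym y (opS q r (opS q r x))), !ip_opS by auto using sq2_opS. reflexivity.
Qed.

Lemma polop_opA l b x n : polop q l (opA q b x) n = opA q b (polop q l x) n.
Proof.
revert n. induction l as [|a l IH]; intros n; simpl; auto. rewrite (opA_ext q a _ (opA q b (polop q l x)) n IH).
generalize (polop q l x). clear. intros y. unfold opA, HR. ring.
Qed.

Lemma ip_polop l x y : sq2 x -> sq2 y -> ip (polop q l x) y = ip x (polop q l y).
Proof.
intros Hx Hy. revert y Hy. induction l as [|b l IH]; intros y Hy; simpl; auto.
rewrite ip_opA by auto using sq2_polop. rewrite IH by now apply sq2_opA. apply ip_ext; auto. intros n. apply polop_opA.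
Qed.

Lemma polop_lin l c x y n : polop q l (fun m => c * x m + y m) n = c * polop q l x n + polop q l y n.
Proof.
revert n. induction l as [|a l IH]; intros n; simpl; auto. rewrite (opA_ext q a _ (fun m => c * polop q l x m + polop q l y m) n IH). unfold opA, HR. ring.
Qed.

Lemma polop_eigen l mu u n : (forall m, HR q u m = mu * u m) -> polop q l u n = polR l mu * u n.
Proof.
intros Hu. revert n. induction l as [|a l IH]; intros n; simpl; [ring|]. rewrite (opA_ext q a _ (fun m => polR l mu * u m) n IH).
unfold opA. rewrite (HR_ext q (HR q (fun m => polR l mu * u m)) (fun m => polR l mu * (mu * u m))).
- assert (E : forall c x m, HR q (fun m => c * x m) m = c * HR q x m) by (intros; unfold HR; ring). rewrite !E, Hu. unfold pfacR. ring.
- intros m. unfold HR. rewrite <- Hu. unfold HR. ring.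
Qed.

(* In the factor (H - x)^2 + s^2 either s <> 0 and the factor is injective on l^2, or its kernel consists of
   eigenvectors u for x; such a u in the range of the remaining product Q(H) is removed by subtracting u / Q(x),
   and if Q(x) = 0 it satisfies |u|^2 = <y, Q(H) u> = 0. *)
Theorem polop_kernel_orth a : sq2 a -> orth_eigen a -> forall l y, sq2 y -> (forall n, polop q l y n = 0) -> ip a y = 0.
Proof.
intros Ha Ho. induction l as [|b l IH]; intros y Hy Hp.
- simpl in Hp. unfold ip. rewrite (ZS_ext _ (fun _ => 0)); [apply ZS_0|]. intros n. rewrite Hp. ring.
- simpl in Hp. set (u := polop q l y) in *. assert (Hu : sq2 u) by now apply sq2_polop.
  set (x := Re (lam b)) in *. destruct (Req_dec (Im (lam b)) 0) as [Hs|Hs].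
  + assert (E : forall m, HR q u m = x * u m).
    { assert (Z := opS_square_kernel q x Hq u Hu). intros m. assert (Z' : opS q x u m = 0); [|unfold opS in Z'; lra]. apply Z. intros n. specialize (Hp n). rewrite opA_opS, Hs in Hp. fold x in Hp. lra. }
    destruct (Req_dec (polR l x) 0) as [Hr|Hr].
    * apply IH; auto. apply ip_eq0; auto. change (ip (polop q l y) u = 0). rewrite ip_polop by auto. unfold ip. rewrite (ZS_ext _ (fun _ => 0)); [apply ZS_0|]. intros n. rewrite (polop_eigen l x u n E), Hr. ring.
    * assert (Hy' : ip a (fun n => - / polR l x * u n + y n) = 0).
      { apply IH; [now apply sq2_lin|]. intros n. rewrite polop_lin, (polop_eigen l x u n E). fold u. field. auto. }
      rewrite ip_sym, ip_lin_l, (ip_sym u), (Ho x u Hu E), (ip_sym y) in Hy' by auto. lra.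
  + apply IH; auto. apply (opS_square_plus q x Hq u (Im (lam b)) Hu Hs). intros n. specialize (Hp n). rewrite opA_opS in Hp. exact Hp.
Qed.

End Span.

(** * The evolution *)

Lemma psum_exp x J : 0 <= x -> psum (fun k => x ^ k / INR (fact k)) J <= exp x.
Proof.
intros Hx. assert (E := proj2_sig (exist_exp x)). fold (exp x) in E. unfold exp_in in E.
assert (P : forall k, 0 <= / INR (fact k) * x ^ k) by (intros k; apply Rmult_le_pos; [left; apply Rinv_0_lt_compat, INR_fact_lt_0|now apply pow_le]).
rewrite (psum_ext _ (fun k => / INR (fact k) * x ^ k)) by (intros; unfold Rdiv; ring).
apply Rle_trans with (psum (fun k => / INR (fact k) * x ^ k) (S J)); [simpl; specialize (P J); lra|].
replace (psum _ (S J)) with (sum_f_R0 (fun k => / INR (fact k) * x ^ k) J); [now apply sum_incr|].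
induction J as [|J IH]; [simpl; ring|]. rewrite tech5, IH. reflexivity.
Qed.

Definition ca t k := fst (expcoef t k).
Definition cb t k := snd (expcoef t k).

Lemma expcoef_rec t k : INR (S k) * ca t (S k) = - t * cb t k /\ INR (S k) * cb t (S k) = t * ca t k.
Proof.
unfold ca, cb, expcoef. change (fact (S k)) with (S k * fact k)%nat. rewrite mult_INR. assert (F := INR_fact_neq_0 k).
assert (N : INR (S k) <> 0) by (apply not_0_INR; lia). simpl Defs.Cpow. unfold Cscal, Cmul. cbn [fst snd]. split; field; auto.
Qed.

Lemma expcoef_bound t k : Rabs (ca t k) <= Rabs t ^ k / INR (fact k) /\ Rabs (cb t k) <= Rabs t ^ k / INR (fact k).
Proof.
induction k as [|k [IH1 IH2]].
- unfold ca, cb, expcoef, Cscal. simpl. rewrite Rmult_0_r, Rabs_R0, Rmult_1_r. unfold Rdiv. rewrite !Rinv_1, Rabs_R1. lra.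
- destruct (expcoef_rec t k) as [E1 E2]. assert (N : 0 < INR (S k)) by (apply lt_0_INR; lia). assert (F := INR_fact_lt_0 k).
  assert (G : forall a b, INR (S k) * a = b -> Rabs b <= Rabs t * (Rabs t ^ k / INR (fact k)) -> Rabs a <= Rabs t ^ S k / INR (fact (S k))).
  { intros a b E Hb. apply Rmult_le_reg_l with (INR (S k)); auto. rewrite <- (Rabs_right (INR (S k))) at 1 by lra. rewrite <- Rabs_mult, E.
    change (fact (S k)) with (S k * fact k)%nat. rewrite mult_INR. replace (INR (S k) * (Rabs t ^ S k / (INR (S k) * INR (fact k)))) with (Rabs t * (Rabs t ^ k / INR (fact k))) by (simpl pow; field; lra). exact Hb. }
  split; [apply (G _ _ E1)|apply (G _ _ E2)]; rewrite Rabs_mult, ?Rabs_Ropp; apply Rmult_le_compat_l; auto using Rabs_pos.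
Qed.

Lemma is_derive_psum a J (x : R) : is_derive (fun x => psum (fun k => a k * x ^ k) (S J)) x (psum (fun k => INR (S k) * a (S k) * x ^ k) J).
Proof.
induction J as [|J IH].
- simpl. apply (is_derive_ext (fun _ => a O)); [intros; simpl; ring|]. apply (is_derive_const (K := R_AbsRing) (V := R_NormedModule)).
- change (is_derive (fun x => plus (psum (fun k => a k * x ^ k) (S J)) (a (S J) * x ^ S J)) x (plus (psum (fun k => INR (S k) * a (S k) * x ^ k) J) (INR (S J) * a (S J) * x ^ J))).
  apply (is_derive_plus (K := R_AbsRing) (V := R_NormedModule)); [exact IH|]. auto_derive; [exact I|].
  change (a (S J) * (1 * (INR (S J) * x ^ J)) = INR (S J) * a (S J) * x ^ J). ring.
Qed.

Lemma psum_at_0 a J : psum (fun k => a k * 0 ^ k) (S J) = a O.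
Proof. induction J as [|J IH]; [simpl; ring|]. change (psum (fun k => a k * 0 ^ k) (S J) + a (S J) * 0 ^ S J = a O). rewrite IH. simpl. ring. Qed.

Lemma trig_taylor t J : forall x, 0 <= x ->
  Rabs (cos (t * x) - psum (fun k => ca t k * x ^ k) J) <= (Rabs t * x) ^ J / INR (fact J) /\
  Rabs (sin (t * x) - psum (fun k => cb t k * x ^ k) J) <= (Rabs t * x) ^ J / INR (fact J).
Proof.
induction J as [|J IH]; intros x Hx.
- simpl. rewrite !Rminus_0_r. unfold Rdiv. rewrite Rinv_1, Rmult_1_r. split; apply Rabs_le; [apply COS_bound|apply SIN_bound].
- assert (F := INR_fact_lt_0 J). assert (N : 0 < INR (S J)) by (apply lt_0_INR; lia).
  assert (HB : forall y, is_derive (fun y => (Rabs t * y) ^ S J / INR (fact (S J))) y (Rabs t * ((Rabs t * y) ^ J / INR (fact J)))).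
  { intros y. change (fact (S J)) with (S J * fact J)%nat. rewrite mult_INR. auto_derive; [exact I|]. change (match J with 0%nat => 1 | S _ => INR J + 1 end) with (INR (S J)). field. split; lra. }
  assert (H0 : (Rabs t * 0) ^ S J / INR (fact (S J)) = 0) by (rewrite Rmult_0_r, pow_i by lia; unfold Rdiv; ring).
  assert (G : forall (f f' : R -> R), f 0 = 0 -> (forall y, is_derive f y (f' y)) -> (forall y, 0 <= y -> Rabs (f' y) <= Rabs t * ((Rabs t * y) ^ J / INR (fact J))) ->
    Rabs (f x) <= (Rabs t * x) ^ S J / INR (fact (S J))).
  { intros f f' Hf0 Hf Hb. assert (C := derive_compare f f' (fun y => (Rabs t * y) ^ S J / INR (fact (S J))) (fun y => Rabs t * ((Rabs t * y) ^ J / INR (fact J))) 0 x Hx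
      (fun y _ => Hf y) (fun y _ => HB y) (fun y Hy => Hb y (proj1 Hy))). cbv beta in C. rewrite Hf0, H0, !Rminus_0_r in C. exact C. }
  split.
  + apply (G (fun x => cos (t * x) - psum (fun k => ca t k * x ^ k) (S J)) (fun x => - t * (sin (t * x) - psum (fun k => cb t k * x ^ k) J))).
    * rewrite psum_at_0, Rmult_0_r, cos_0. unfold ca, expcoef, Cscal; simpl. field.
    * intros y. replace (- t * (sin (t * y) - psum (fun k => cb t k * y ^ k) J)) with (minus (- t * sin (t * y)) (psum (fun k => INR (S k) * ca t (S k) * y ^ k) J)).
      { apply (is_derive_minus (K := R_AbsRing) (V := R_NormedModule) (fun y => cos (t * y))); [auto_derive; [exact I|ring]|apply is_derive_psum]. }
      rewrite (psum_ext _ (fun k => - t * (cb t k * y ^ k))) by (intros k _; rewrite (proj1 (expcoef_rec t k)); ring). rewrite psum_scal. unfold minus, plus, opp; simpl. ring.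
    * intros y Hy. rewrite Rabs_mult, Rabs_Ropp. apply Rmult_le_compat_l; [apply Rabs_pos|apply IH; auto].
  + apply (G (fun x => sin (t * x) - psum (fun k => cb t k * x ^ k) (S J)) (fun x => t * (cos (t * x) - psum (fun k => ca t k * x ^ k) J))).
    * rewrite psum_at_0, Rmult_0_r, sin_0. unfold cb, expcoef, Cscal; simpl. field.
    * intros y. replace (t * (cos (t * y) - psum (fun k => ca t k * y ^ k) J)) with (minus (t * cos (t * y)) (psum (fun k => INR (S k) * cb t (S k) * y ^ k) J)).
      { apply (is_derive_minus (K := R_AbsRing) (V := R_NormedModule) (fun y => sin (t * y))); [auto_derive; [exact I|ring]|apply is_derive_psum]. }
      rewrite (psum_ext _ (fun k => t * (ca t k * y ^ k))) by (intros k _; rewrite (proj2 (expcoef_rec t k)); ring). rewrite psum_scal. unfold minus, plus, opp; simpl. ring.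
    * intros y Hy. rewrite Rabs_mult. apply Rmult_le_compat_l; [apply Rabs_pos|apply IH; auto].
Qed.

Definition l1z (x : Z -> R) (B : R) : Prop := forall N, symsum (fun n => Rabs (x n)) N <= B.

Lemma l1z_HR q Kq x B : (forall n, Rabs (q n) <= Kq) -> l1z x B -> l1z (HR q x) ((4 + Kq) * B).
Proof.
intros HK Hx N.
assert (Hs : forall a, symsum (fun n => Rabs (x (n + a)%Z)) N <= B).
{ intros a. rewrite symsum_psum. rewrite (psum_ext _ (fun k => (fun n => Rabs (x n)) (Z.of_nat k + (a - Z.of_nat N))%Z)) by (intros i _; do 2 f_equal; lia).
  apply (symsum_range (fun n => Rabs (x n)) B); auto using Rabs_pos. }
apply Rle_trans with (symsum (fun n => (2 + Kq) * Rabs (x n) + (Rabs (x (n + 1)%Z) + Rabs (x (n + -1)%Z))) N).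
- apply symsum_le. intros n. unfold HR. change (n - 1)%Z with (n + -1)%Z. unfold Rminus.
  assert (T1 := Rabs_triang ((2 + q n) * x n + - x (n + 1)%Z) (- x (n + -1)%Z)). assert (T2 := Rabs_triang ((2 + q n) * x n) (- x (n + 1)%Z)).
  rewrite Rabs_Ropp in T1, T2. rewrite Rabs_mult in T2. assert (T3 := Rabs_triang 2 (q n)). rewrite (Rabs_right 2) in T3 by lra. specialize (HK n).
  assert (Rabs (2 + q n) * Rabs (x n) <= (2 + Kq) * Rabs (x n)) by (apply Rmult_le_compat_r; [apply Rabs_pos|lra]). lra.
- rewrite symsum_lin, symsum_plus. assert (H1 := Hs 1%Z). assert (H2 := Hs (-1)%Z). specialize (Hx N).
  assert (0 <= Kq) by (eapply Rle_trans; [apply Rabs_pos|apply (HK 0%Z)]).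
  assert ((2 + Kq) * symsum (fun n => Rabs (x n)) N <= (2 + Kq) * B) by (apply Rmult_le_compat_l; lra). lra.
Qed.

Lemma l1z_iter q Kq x B k : (forall n, Rabs (q n) <= Kq) -> l1z x B -> l1z (Nat.iter k (HR q) x) ((4 + Kq) ^ k * B).
Proof.
intros HK Hx. induction k as [|k IH]; [simpl; now rewrite Rmult_1_l|]. simpl. rewrite Rmult_assoc. now apply l1z_HR.
Qed.

Lemma bdd_HR q y : bdd q -> bdd y -> bdd (HR q y).
Proof.
intros [Kq HK] [Y HY]. exists ((2 + Kq) * Y + Y + Y). intros n. unfold HR, Rminus.
assert (T1 := Rabs_triang ((2 + q n) * y n + - y (n + 1)%Z) (- y (n + - (1))%Z)). assert (T2 := Rabs_triang ((2 + q n) * y n) (- y (n + 1)%Z)).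
rewrite Rabs_Ropp in T1, T2. rewrite Rabs_mult in T2. assert (T3 := Rabs_triang 2 (q n)). rewrite (Rabs_right 2) in T3 by lra.
assert (Rabs (2 + q n) * Rabs (y n) <= (2 + Kq) * Y) by (apply Rmult_le_compat; auto using Rabs_pos; specialize (HK n); lra).
assert (H1 := HY (n + 1)%Z). assert (H2 := HY (n - 1)%Z). change (n + - (1))%Z with (n - 1)%Z in T1. lra.
Qed.

Lemma bdd_dual x y : bdd y -> summ x -> dual y x.
Proof.
intros Hy Hx. split; [|split].
- now apply summ_bdd.
- apply (summ_bdd (fun n => y (n + 1)%Z)); auto. destruct Hy as [Y HY]. now exists Y.
- apply (summ_bdd y (fun n => x (n + 1)%Z)); auto. now apply summ_shift.
Qed.

Lemma summ_HR q x : bdd q -> summ x -> summ (HR q x).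
Proof. intros [Kq HK] [B HB]. eexists. exact (l1z_HR q Kq x B HK HB). Qed.

Lemma ZS_iter q k : bdd q -> forall x y, summ x -> bdd y -> ZS (fun m => y m * Nat.iter k (HR q) x m) = ZS (fun m => Nat.iter k (HR q) y m * x m).
Proof.
intros Hq. induction k as [|k IH]; intros x y Hx Hy; [reflexivity|].
assert (Hk : summ (Nat.iter k (HR q) x)) by (clear - Hq Hx; induction k; [auto|now apply summ_HR]).
simpl Nat.iter at 1. rewrite <- (ZS_HR_sym q y) by (auto using bdd_dual). rewrite (IH x (HR q y)) by (auto using bdd_HR).
apply ZS_ext. intros m. now rewrite Nat.iter_succ_r.
Qed.

Lemma psum_lim (F : nat -> nat -> R) (f : nat -> R) J : (forall k, is_lim_seq (F k) (f k)) -> is_lim_seq (fun N => psum (fun k => F k N) J) (psum f J).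
Proof.
intros H. induction J as [|J IH]; [apply is_lim_seq_const|]. simpl. apply is_lim_seq_plus'; auto.
Qed.

Lemma symsum_psum_swap (X : nat -> Z -> R) J N : symsum (fun m => psum (fun k => X k m) J) N = psum (fun k => symsum (X k) N) J.
Proof.
induction J as [|J IH]; simpl.
- rewrite (symsum_ext _ (fun _ => 0 * 0)) by (intros; ring). rewrite symsum_scal. ring.
- rewrite symsum_plus, IH. reflexivity.
Qed.

(** The terms are dominated in l^1 by a convergent series, so the tail of the sum over k is small in
    l^1, uniformly over the windows [-N, N]. The pairing with v enters as a given limit of symmetric
    sums. *)
Lemma series_exchange (X : nat -> Z -> R) (v y : Z -> R) (c : nat -> R) (Y T0 L : R) :
  (forall m, Rabs (y m) <= Y) -> (forall k, l1z (X k) (c k)) -> (forall J, psum c J <= T0) ->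
  (forall m, is_lim_seq (fun J => psum (fun k => X k m) J) (v m)) -> is_lim_seq (symsum (fun m => y m * v m)) L ->
  is_lim_seq (fun J => psum (fun k => ZS (fun m => y m * X k m)) J) L.
Proof.
intros HY HX Hc Hv HL.
assert (HY0 : 0 <= Y) by (eapply Rle_trans; [apply Rabs_pos|apply (HY 0%Z)]).
assert (Hc0 : forall k, 0 <= c k) by (intros k; eapply Rle_trans; [|apply (HX k O)]; apply symsum_pos; intros; apply Rabs_pos).
destruct (ex_finite_lim_seq_incr (psum c) T0) as [T HT]; auto. { intros n. simpl. specialize (Hc0 n). lra. }
assert (HcT : forall J, psum c J <= T).
{ intros J. apply (is_lim_seq_incr_compare (psum c)); auto. intros n. simpl. specialize (Hc0 n). lra. }
assert (Hdiff : forall J J' m, Rabs (psum (fun k => X k m) (J + J') - psum (fun k => X k m) J) <= psum (fun k => Rabs (X (J + k)%nat m)) J').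
{ intros J J' m. rewrite psum_add. replace (_ + _ - _) with (psum (fun k => X (J + k)%nat m) J') by ring.
  induction J' as [|J' IH]; simpl; [rewrite Rabs_R0; lra|]. eapply Rle_trans; [apply Rabs_triang|]. lra. }
assert (Htail : forall J N, symsum (fun m => Rabs (v m - psum (fun k => X k m) J)) N <= T - psum c J).
{ intros J N. apply (is_lim_seq_le (fun J' => symsum (fun m => Rabs (psum (fun k => X k m) (J' + J) - psum (fun k => X k m) J)) N) (fun _ => T - psum c J)
    (symsum (fun m => Rabs (v m - psum (fun k => X k m) J)) N) (T - psum c J)).
  - intros J'. rewrite (Nat.add_comm J' J). eapply Rle_trans; [apply symsum_le; intros m; apply Hdiff|].
    rewrite (symsum_psum_swap (fun k m => Rabs (X (J + k)%nat m))). assert (E := psum_add c J J'). specialize (HcT (J + J')%nat).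
    apply Rle_trans with (psum (fun k => c (J + k)%nat) J'); [|lra]. clear E HcT. induction J' as [|J' IH]; simpl; [lra|]. assert (H := HX (J + J')%nat N). lra.
  - apply (symsum_lim (fun J' m => Rabs (psum (fun k => X k m) (J' + J) - psum (fun k => X k m) J)) (fun m => Rabs (v m - psum (fun k => X k m) J))).
    intros m. apply (is_lim_seq_abs (fun J' => psum (fun k => X k m) (J' + J) - psum (fun k => X k m) J) (v m - psum (fun k => X k m) J)).
    apply is_lim_seq_minus'; [|apply is_lim_seq_const]. now apply (is_lim_seq_incr_n (fun J => psum (fun k => X k m) J) J).
  - apply is_lim_seq_const. }
assert (Hs : forall k, summ (fun m => y m * X k m)) by (intros k; apply summ_bdd; [now exists Y|eexists; apply HX]).
assert (Hmain : forall J, Rabs (psum (fun k => ZS (fun m => y m * X k m)) J - L) <= Y * (T - psum c J)).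
{ intros J. rewrite Rabs_minus_sym.
  apply (is_lim_seq_le (fun N => Rabs (symsum (fun m => y m * v m) N - psum (fun k => symsum (fun m => y m * X k m) N) J)) (fun _ => Y * (T - psum c J))
    (Rabs (L - psum (fun k => ZS (fun m => y m * X k m)) J)) (Y * (T - psum c J))).
  - intros N. rewrite <- (symsum_psum_swap (fun k m => y m * X k m)).
    replace (_ - _) with (symsum (fun m => y m * (v m - psum (fun k => X k m) J)) N).
    + eapply Rle_trans; [apply symsum_abs|]. apply Rle_trans with (symsum (fun m => Y * Rabs (v m - psum (fun k => X k m) J)) N).
      * apply symsum_le. intros m. rewrite Rabs_mult. apply Rmult_le_compat_r; auto using Rabs_pos.
      * rewrite symsum_scal. apply Rmult_le_compat_l; auto.
    + rewrite (symsum_ext _ (fun m => (-1) * psum (fun k => y m * X k m) J + y m * v m)) by (intros m; rewrite psum_scal; ring). rewrite symsum_lin. ring.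
  - apply (is_lim_seq_abs (fun N => symsum (fun m => y m * v m) N - psum (fun k => symsum (fun m => y m * X k m) N) J) (L - psum (fun k => ZS (fun m => y m * X k m)) J)).
    apply is_lim_seq_minus'; auto. apply (psum_lim (fun k N => symsum (fun m => y m * X k m) N)). intros k. now apply ZS_lim.
  - apply is_lim_seq_const. }
assert (Hz : is_lim_seq (fun J => psum (fun k => ZS (fun m => y m * X k m)) J - L) 0).
{ apply is_lim_seq_abs_0. apply (is_lim_seq_le_le (fun _ => 0) _ (fun J => Y * (T - psum c J))).
  - intros J. split; [apply Rabs_pos|apply Hmain].
  - apply is_lim_seq_const.
  - replace (Finite 0) with (Rbar_mult Y (T - T)) by (simpl; f_equal; ring). apply is_lim_seq_scal_l. apply is_lim_seq_minus'; [apply is_lim_seq_const|exact HT]. }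
apply (is_lim_seq_ext (fun J => (psum (fun k => ZS (fun m => y m * X k m)) J - L) + L)); [intros; ring|].
replace (Finite L) with (Finite (0 + L)) by (f_equal; ring). apply is_lim_seq_plus'; [exact Hz|apply is_lim_seq_const].
Qed.

Section Evolution.
Variables (q : Z -> R) (e V : nat -> C) (K : R).
Hypothesis Hq1 : wl1 1 q.
Hypothesis He : edge_factor q e V.
Hypothesis HK : 1 <= K.
Hypothesis Hbound : forall n m t, 0 < t < PI -> Rabs (rho q e V n m t) <= K.
Hypothesis Hosc : forall t c n m, Rabs (RInt (fun x => cos (t * (2 - 2 * cos x) + c) * rho q e V n m x) 0 PI) <= K * Rpower (bracket t) (- (1 / 3)).

Lemma cont_lampow k : forall t, continuous (fun t => (2 - 2 * cos t) ^ k) t.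
Proof. intros t. eapply is_derive_cont. auto_derive; [exact I|reflexivity]. Qed.

Lemma cont_lamsum a J : forall t, continuous (fun t => psum (fun k => a k * (2 - 2 * cos t) ^ k) J) t.
Proof.
intros t. induction J as [|J IH]; [apply continuous_const|]. simpl.
apply (continuous_plus (fun t => psum (fun k => a k * (2 - 2 * cos t) ^ k) J) (fun t => a J * (2 - 2 * cos t) ^ J)); auto.
apply (continuous_mult (fun _ => a J) (fun t => (2 - 2 * cos t) ^ J)); [apply continuous_const|apply cont_lampow].
Qed.

Lemma iter_HR_qn n k m : Nat.iter k (HR q) (qn q e V n) m = / PI * intr q e V (fun t => (2 - 2 * cos t) ^ k) n m.
Proof.
revert m. induction k as [|k IH]; intros m; [reflexivity|]. simpl Nat.iter.
rewrite (HR_ext q _ (fun m => / PI * intr q e V (fun t => (2 - 2 * cos t) ^ k) n m)) by auto.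
transitivity (/ PI * HR q (fun m => intr q e V (fun t => (2 - 2 * cos t) ^ k) n m) m); [unfold HR; ring|].
rewrite intr_HR; auto. apply cont_lampow.
Qed.

Lemma bdd_intr phi s n : (forall t, continuous phi t) -> (forall t, 0 <= t <= PI -> Rabs (phi t) <= s) -> bdd (fun m => / PI * intr q e V phi n m).
Proof.
intros Hc Hs. exists (/ PI * (K * (PI * s))). intros m. assert (HPI := PI_gt_3). assert (0 < / PI) by (apply Rinv_0_lt_compat; lra).
rewrite Rabs_mult, (Rabs_right (/ PI)) by lra. apply Rmult_le_compat_l; [lra|]. now apply (intr_sup q e V K).
Qed.

Lemma lam_range t : 0 <= 2 - 2 * cos t <= 4.
Proof. assert (B := COS_bound t). lra. Qed.

Lemma bdd_iter n k : bdd (fun m => / PI * intr q e V (fun t => (2 - 2 * cos t) ^ k) n m).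
Proof.
apply (bdd_intr _ (4 ^ k)); [apply cont_lampow|]. intros t _. assert (L := lam_range t). rewrite Rabs_right by (apply Rle_ge, pow_le; lra). apply pow_incr. lra.
Qed.

(** A polynomial in H moves onto the row q_n, where H^k acts as the factor lam^k under the
    integral. *)
Lemma lamsum_pairing a x n J : summ x ->
  summ (fun m => / PI * intr q e V (fun t => psum (fun k => a k * (2 - 2 * cos t) ^ k) J) n m * x m) /\
  psum (fun k => a k * ZS (fun m => qn q e V n m * Nat.iter k (HR q) x m)) J =
  ZS (fun m => / PI * intr q e V (fun t => psum (fun k => a k * (2 - 2 * cos t) ^ k) J) n m * x m).
Proof.
intros Hx. induction J as [|J [IH1 IH2]].
- assert (E : forall m, / PI * intr q e V (fun t => psum (fun k => a k * (2 - 2 * cos t) ^ k) 0) n m * x m = 0 * x m).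
  { intros m. replace (intr q e V _ n m) with 0; [ring|]. simpl. symmetry.
    assert (H := intr_lin q e V Hq1 He (fun _ => 0) (fun _ => 0) (-1) n m ltac:(intros; apply continuous_const) ltac:(intros; apply continuous_const)).
    rewrite (intr_ext q e V _ (fun _ => 0)) in H by (intros; ring). lra. }
  split; [apply (summ_ext (fun m => 0 * x m)); [intros m; now rewrite E|now apply summ_scal]|]. simpl psum at 1. rewrite (ZS_ext _ _ E), ZS_scal by auto. ring.
- assert (E : forall m, / PI * intr q e V (fun t => psum (fun k => a k * (2 - 2 * cos t) ^ k) (S J)) n m * x m =
    a J * (/ PI * intr q e V (fun t => (2 - 2 * cos t) ^ J) n m * x m) + / PI * intr q e V (fun t => psum (fun k => a k * (2 - 2 * cos t) ^ k) J) n m * x m).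
  { intros m. rewrite (intr_ext q e V _ (fun t => a J * (2 - 2 * cos t) ^ J + psum (fun k => a k * (2 - 2 * cos t) ^ k) J)) by (intros; simpl; ring).
    rewrite intr_lin; auto; [ring|apply cont_lampow|apply cont_lamsum]. }
  assert (S1 : summ (fun m => / PI * intr q e V (fun t => (2 - 2 * cos t) ^ J) n m * x m)) by (apply summ_bdd; [apply bdd_iter|auto]).
  split; [eapply summ_ext; [intros m; symmetry; apply E|]; now apply (summ_lin (a J) (fun m => / PI * intr q e V (fun t => (2 - 2 * cos t) ^ J) n m * x m))|].
  rewrite (ZS_ext _ _ E), (ZS_lin (a J) (fun m => / PI * intr q e V (fun t => (2 - 2 * cos t) ^ J) n m * x m)) by auto.
  simpl psum. simpl in IH2. rewrite IH2. rewrite (ZS_iter q J (wl1_bdd q Hq1) x (qn q e V n) Hx).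
  + rewrite (ZS_ext (fun m => Nat.iter J (HR q) (qn q e V n) m * x m) (fun m => / PI * intr q e V (fun t => (2 - 2 * cos t) ^ J) n m * x m)) by (intros m; now rewrite iter_HR_qn).
    ring.
  + exists K. intros m. now apply qn_bound.
Qed.

(** The Taylor polynomial in place of cos (t lam + c) changes the integrand by at most K s, while
    the exact function obeys the oscillatory bound. *)
Lemma propagator_bound t a c n m J s : (forall x, 0 <= x <= 4 -> Rabs (cos (t * x + c) - psum (fun k => a k * x ^ k) J) <= s) ->
  Rabs (/ PI * intr q e V (fun x => psum (fun k => a k * (2 - 2 * cos x) ^ k) J) n m) <= K * Rpower (bracket t) (- (1 / 3)) + K * s.
Proof.
intros Hs. assert (HPI := PI_gt_3).
set (f := fun x => psum (fun k => a k * (2 - 2 * cos x) ^ k) J). set (g := fun x => cos (t * (2 - 2 * cos x) + c)).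
assert (Hf : forall x, continuous f x) by (apply cont_lamsum).
assert (Hg : forall x, continuous g x) by (intros x; eapply is_derive_cont; unfold g; auto_derive; [exact I|reflexivity]).
set (h := fun x : R => (-1) * g x + f x).
assert (Hd : forall x, continuous h x).
{ intros x. apply (continuous_plus (fun x => (-1) * g x) f); auto. apply (continuous_mult (fun _ => -1) g); auto. apply continuous_const. }
assert (E : intr q e V f n m = 1 * intr q e V g n m + intr q e V h n m).
{ rewrite <- (intr_lin q e V Hq1 He g h 1 n m Hg Hd). apply intr_ext. intros x. unfold h. ring. }
assert (B1 := Hosc t c n m). change (Rabs (intr q e V g n m) <= K * Rpower (bracket t) (- (1 / 3))) in B1.
assert (B2 : Rabs (intr q e V h n m) <= K * (PI * s)).
{ apply (intr_sup q e V K); auto. intros x _. unfold h, f, g.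
  rewrite <- Rabs_Ropp. replace (- (-1 * cos (t * (2 - 2 * cos x) + c) + psum (fun k => a k * (2 - 2 * cos x) ^ k) J)) with (cos (t * (2 - 2 * cos x) + c) - psum (fun k => a k * (2 - 2 * cos x) ^ k) J) by ring.
  apply Hs. apply lam_range. }
rewrite Rabs_mult, (Rabs_right (/ PI)) by (apply Rle_ge; left; apply Rinv_0_lt_compat; lra). rewrite E.
apply Rmult_le_reg_l with PI; [lra|]. rewrite <- Rmult_assoc, Rinv_r, Rmult_1_l by lra.
eapply Rle_trans; [apply Rabs_triang|]. rewrite Rmult_1_l.
assert (0 < Rpower (bracket t) (- (1 / 3))) by apply exp_pos.
set (tau := Rpower (bracket t) (- (1 / 3))) in *. assert (0 < K * tau) by (apply Rmult_lt_0_compat; lra). nra.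
Qed.

Lemma ZS_pairing_bound y x Y S : (forall m, Rabs (y m) <= Y) -> l1z x S -> Rabs (ZS (fun m => y m * x m)) <= Y * S.
Proof.
intros HY Hx. apply ZS_bound. intros N. apply Rle_trans with (symsum (fun m => Y * Rabs (x m)) N).
- apply symsum_le. intros m. rewrite Rabs_mult. apply Rmult_le_compat_r; auto using Rabs_pos.
- rewrite symsum_scal. apply Rmult_le_compat_l; [eapply Rle_trans; [apply Rabs_pos|apply (HY 0%Z)]|apply Hx].
Qed.

(** The real part of the evolution of u corresponds to (x1, x2) = (Re u, - Im u), the imaginary part
    to (Im u, Re u). The partial sums of the exponential series satisfy the estimate up to an error
    proportional to (4 |t|)^J / J!, which tends to 0. *)
Theorem evolution_bound n t x1 x2 S (v : Z -> R) (L : R) : l1z x1 S -> l1z x2 S ->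
  (forall m, is_lim_seq (fun J => psum (fun k => ca t k * Nat.iter k (HR q) x1 m + cb t k * Nat.iter k (HR q) x2 m) J) (v m)) ->
  is_lim_seq (symsum (fun m => qn q e V n m * v m)) L -> Rabs L <= 2 * K * Rpower (bracket t) (- (1 / 3)) * S.
Proof.
intros H1 H2 Hv HL. set (X := fun k m => ca t k * Nat.iter k (HR q) x1 m + cb t k * Nat.iter k (HR q) x2 m).
assert (Hq := wl1_bdd q Hq1). destruct Hq as [Kq HKq].
assert (HKq0 : 0 <= Kq) by (eapply Rle_trans; [apply Rabs_pos|apply (HKq 0%Z)]).
assert (HS : 0 <= S) by (eapply Rle_trans; [|apply (H1 O)]; apply Rabs_pos).
set (c := fun k => 2 * S * ((Rabs t * (4 + Kq)) ^ k / INR (fact k))).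
assert (HX : forall k, l1z (X k) (c k)).
{ intros k N. assert (I1 := l1z_iter q Kq x1 S k HKq H1 N). assert (I2 := l1z_iter q Kq x2 S k HKq H2 N). destruct (expcoef_bound t k) as [C1 C2].
  set (d := Rabs t ^ k / INR (fact k)) in *.
  apply Rle_trans with (symsum (fun m => d * Rabs (Nat.iter k (HR q) x1 m) + d * Rabs (Nat.iter k (HR q) x2 m)) N).
  - apply symsum_le. intros m. unfold X. eapply Rle_trans; [apply Rabs_triang|]. rewrite !Rabs_mult. apply Rplus_le_compat; apply Rmult_le_compat_r; auto using Rabs_pos.
  - rewrite symsum_plus, !symsum_scal. assert (0 <= d) by (eapply Rle_trans; [apply Rabs_pos|exact C1]).
    replace (c k) with (d * ((4 + Kq) ^ k * S) + d * ((4 + Kq) ^ k * S)) by (unfold c, d; rewrite Rpow_mult_distr; field; apply INR_fact_neq_0).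
    apply Rplus_le_compat; apply Rmult_le_compat_l; auto. }
assert (Hlim := series_exchange X v (qn q e V n) c K (2 * S * exp (Rabs t * (4 + Kq))) L (fun m => qn_bound q e V K Hq1 He Hbound n m) HX).
assert (Hl := Hlim ltac:(intros J; unfold c; rewrite (psum_scal (2 * S)); apply Rmult_le_compat_l; [lra|apply psum_exp; apply Rmult_le_pos; [apply Rabs_pos|lra]]) Hv HL). clear Hlim.
set (tau := Rpower (bracket t) (- (1 / 3))) in *.
set (s := fun J => (4 * Rabs t) ^ J / INR (fact J)).
assert (Hb : forall J, Rabs (psum (fun k => ZS (fun m => qn q e V n m * X k m)) J) <= (K * tau + K * s J) * (2 * S)).
{ intros J. assert (S1 : summ x1) by (eexists; exact H1). assert (S2 : summ x2) by (eexists; exact H2).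
  assert (Hqb : bdd (qn q e V n)) by (exists K; intros; now apply qn_bound).
  assert (Hit : forall k x, summ x -> summ (fun m => qn q e V n m * Nat.iter k (HR q) x m)).
  { intros k x [B HB]. apply summ_bdd; auto. eexists. exact (l1z_iter q Kq x B k HKq HB). }
  rewrite (psum_ext _ (fun k => ca t k * ZS (fun m => qn q e V n m * Nat.iter k (HR q) x1 m) + cb t k * ZS (fun m => qn q e V n m * Nat.iter k (HR q) x2 m))).
  2:{ intros k _. rewrite <- (ZS_scal (cb t k)) by auto. rewrite <- (ZS_lin (ca t k) (fun m => qn q e V n m * Nat.iter k (HR q) x1 m)); auto; [|apply (summ_scal (cb t k) (fun m => qn q e V n m * Nat.iter k (HR q) x2 m)); auto].
      apply ZS_ext. intros m. unfold X. ring. }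
  assert (Ep : forall a b, psum (fun k => a k + b k) J = psum a J + psum b J) by (intros a b; clear; induction J as [|J IH]; simpl; [ring|rewrite IH; ring]).
  rewrite Ep. rewrite (proj2 (lamsum_pairing (ca t) x1 n J S1)), (proj2 (lamsum_pairing (cb t) x2 n J S2)).
  assert (Hsx : forall x, 0 <= x <= 4 -> (Rabs t * x) ^ J / INR (fact J) <= s J).
  { intros x Hx. unfold s, Rdiv. apply Rmult_le_compat_r; [left; apply Rinv_0_lt_compat, INR_fact_lt_0|]. apply pow_incr. assert (T := Rabs_pos t). split; nra. }
  (* The constant phase - PI/2 turns the cosine of [Hosc] into the sine that multiplies x2. *)
  assert (P1 := fun m => propagator_bound t (ca t) 0 n m J (s J)). assert (P2 := fun m => propagator_bound t (cb t) (- (PI / 2)) n m J (s J)). fold tau in P1, P2.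
  assert (B1 : Rabs (ZS (fun m => / PI * intr q e V (fun x => psum (fun k => ca t k * (2 - 2 * cos x) ^ k) J) n m * x1 m)) <= (K * tau + K * s J) * S).
  { apply (ZS_pairing_bound (fun m => / PI * intr q e V (fun x => psum (fun k => ca t k * (2 - 2 * cos x) ^ k) J) n m)); auto. intros m. apply P1.
    intros x Hx. rewrite Rplus_0_r. eapply Rle_trans; [apply trig_taylor; lra|auto]. }
  assert (B2 : Rabs (ZS (fun m => / PI * intr q e V (fun x => psum (fun k => cb t k * (2 - 2 * cos x) ^ k) J) n m * x2 m)) <= (K * tau + K * s J) * S).
  { apply (ZS_pairing_bound (fun m => / PI * intr q e V (fun x => psum (fun k => cb t k * (2 - 2 * cos x) ^ k) J) n m)); auto. intros m. apply P2.
    intros x Hx. replace (cos (t * x + - (PI / 2))) with (sin (t * x)) by (rewrite <- cos_shift, <- cos_neg; f_equal; ring). eapply Rle_trans; [apply trig_taylor; lra|auto]. }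
  eapply Rle_trans; [apply Rabs_triang|]. lra. }
assert (Hs0 : is_lim_seq s 0). { apply is_lim_seq_Reals. apply cv_speed_pow_fact. }
replace (2 * K * tau * S) with ((K * tau + K * 0) * (2 * S)) by ring.
apply (is_lim_seq_le (fun J => Rabs (psum (fun k => ZS (fun m => qn q e V n m * X k m)) J)) (fun J => (K * tau + K * s J) * (2 * S)) (Rabs L) ((K * tau + K * 0) * (2 * S))); auto.
- now apply (is_lim_seq_abs (fun J => psum (fun k => ZS (fun m => qn q e V n m * X k m)) J) L).
- apply (is_lim_seq_scal_r (fun J => K * tau + K * s J) (2 * S) (K * tau + K * 0)). apply is_lim_seq_plus'; [apply is_lim_seq_const|]. now apply (is_lim_seq_scal_l s K 0).
Qed.

End Evolution.

(** * Complex sequences and the spectral projection *)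

Lemma Hop_fst q u n : fst (Hop q u n) = HR q (fun m => fst (u m)) n.
Proof. reflexivity. Qed.

Lemma Hop_snd q u n : snd (Hop q u n) = HR q (fun m => snd (u m)) n.
Proof. reflexivity. Qed.

Lemma Hpow_fst q k u n : fst (Hpow q k u n) = Nat.iter k (HR q) (fun m => fst (u m)) n.
Proof. revert n. induction k as [|k IH]; intros n; [reflexivity|]. unfold Hpow. simpl Nat.iter. rewrite Hop_fst. now apply HR_ext. Qed.

Lemma Hpow_snd q k u n : snd (Hpow q k u n) = Nat.iter k (HR q) (fun m => snd (u m)) n.
Proof. revert n. induction k as [|k IH]; intros n; [reflexivity|]. unfold Hpow. simpl Nat.iter. rewrite Hop_snd. now apply HR_ext. Qed.

Lemma iter_HR_opp q k x n : Nat.iter k (HR q) (fun m => - x m) n = - Nat.iter k (HR q) x n.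
Proof.
revert n. induction k as [|k IH]; intros n; [reflexivity|]. simpl Nat.iter. rewrite (HR_ext q _ (fun m => - Nat.iter k (HR q) x m)) by auto. unfold HR. ring.
Qed.

Lemma infinite_sum_psum s l : infinite_sum s l -> is_lim_seq (psum s) l.
Proof.
intros H. apply is_lim_seq_incr_1. apply is_lim_seq_Reals. intros eps Heps. destruct (H eps Heps) as [N HN]. exists N. intros n Hn. specialize (HN n Hn).
replace (psum s (S n)) with (sum_f_R0 s n); [exact HN|]. clear. induction n as [|n IH]; [simpl; ring|]. rewrite tech5, IH. reflexivity.
Qed.

Lemma Cmod_sq (a : Cx) : Defs.Cmod a ^ 2 = fst a ^ 2 + snd a ^ 2.
Proof. unfold Defs.Cmod. apply pow2_sqrt. apply Rplus_le_le_0_compat; apply pow2_ge_0. Qed.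

Lemma Cmod_parts (a : Cx) : Rabs (fst a) <= Defs.Cmod a /\ Rabs (snd a) <= Defs.Cmod a /\ Defs.Cmod a <= Rabs (fst a) + Rabs (snd a).
Proof.
assert (E := Cmod_sq a). assert (P := sqrt_pos (fst a ^ 2 + snd a ^ 2)). fold (Defs.Cmod a) in P.
assert (A := pow2_abs (fst a)). assert (B := pow2_abs (snd a)). assert (PA := Rabs_pos (fst a)). assert (PB := Rabs_pos (snd a)).
split; [|split]; nra.
Qed.

Lemma InL2_parts u : InL2 u -> sq2 (fun n => fst (u n)) /\ sq2 (fun n => snd (u n)).
Proof.
intros [B HB]. split; exists B; intros N; eapply Rle_trans; [|apply (HB N)| |apply (HB N)]; apply symsum_le; intros n; rewrite Cmod_sq;
  assert (A1 := pow2_ge_0 (fst (u n))); assert (A2 := pow2_ge_0 (snd (u n))); lra.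
Qed.

Lemma InL2_intro u : sq2 (fun n => fst (u n)) -> sq2 (fun n => snd (u n)) -> InL2 u.
Proof.
intros [B HB] [B' HB']. exists (B + B'). intros N. rewrite (symsum_ext _ (fun n => fst (u n) ^ 2 + snd (u n) ^ 2)) by (intros; apply Cmod_sq).
rewrite symsum_plus. specialize (HB N). specialize (HB' N). lra.
Qed.

Lemma InL2_real x : sq2 x -> InL2 (fun n => (x n, 0)).
Proof. intros H. apply InL2_intro; simpl; auto. exists 0. intros N. rewrite (symsum_ext _ (fun _ => 0 * 0)) by (intros; simpl; ring). rewrite symsum_scal. lra. Qed.

Lemma Un_cv_ip x y f l : sq2 x -> sq2 y -> (forall n, f n = x n * y n) -> Un_cv (fun N => symsum f N) l -> ip x y = l.
Proof.
intros Hx Hy E H. apply is_lim_seq_Reals in H. unfold ip. rewrite (ZS_ext _ f) by (intros; now rewrite E). now apply ZS_unique.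
Qed.

Lemma contsub_orth_eigen q w : ContSub q w -> orth_eigen q (fun n => fst (w n)) /\ orth_eigen q (fun n => snd (w n)).
Proof.
intros [Hw Ho]. destruct (InL2_parts w Hw) as [W1 W2].
assert (Key : forall mu x, sq2 x -> (forall m, HR q x m = mu * x m) -> ip (fun n => fst (w n)) x = 0 /\ ip (fun n => snd (w n)) x = 0).
{ intros mu x Hx E. destruct (classic (exists n, x n <> 0)) as [[n0 Hn0]|Hz].
  - assert (Hev : Eigvec q (fun n => (x n, 0))).
    { split; [now apply InL2_real|]. split; [exists n0; intros E'; apply Hn0; now apply (f_equal fst) in E'|]. exists (mu, 0). intros n.
      apply injective_projections; [rewrite Hop_fst|rewrite Hop_snd]; simpl; [rewrite E; ring|unfold HR; ring]. }
    destruct (Ho _ Hev) as [O1 O2]. split; [apply (Un_cv_ip _ _ _ _ W1 Hx) with (2 := O1)|apply (Un_cv_ip _ _ _ _ W2 Hx) with (2 := O2)]; intros n; simpl; ring.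
  - assert (Z : forall n, x n = 0) by (intros n; destruct (Req_dec (x n) 0); auto; exfalso; apply Hz; eauto).
    split; unfold ip; rewrite (ZS_ext _ (fun _ => 0)) by (intros n; rewrite Z; ring); apply ZS_0. }
split; intros mu x Hx E; apply (Key mu x Hx E).
Qed.

(** An eigenvector may be complex, with a complex eigenvalue. Symmetry of H forces the eigenvalue to
    be real, and then the real and imaginary parts solve the real eigenvalue equation, to which the
    hypothesis on x applies. *)
Lemma real_contsub q x : bdd q -> sq2 x -> orth_eigen q x -> ContSub q (fun n => (x n, 0)).
Proof.
intros Hq Hx Ho. split; [now apply InL2_real|]. intros f [Hf [[n0 Hn0] [lam Hlam]]]. destruct (InL2_parts f Hf) as [F1 F2].
set (a := fun n => fst (f n)) in *. set (b := fun n => snd (f n)) in *. set (r := fst lam). set (s := snd lam).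
assert (Ea : forall n, HR q a n = r * a n - s * b n) by (intros n; assert (E := f_equal fst (Hlam n)); rewrite Hop_fst in E; exact E).
assert (Eb : forall n, HR q b n = r * b n + s * a n) by (intros n; assert (E := f_equal snd (Hlam n)); rewrite Hop_snd in E; exact E).
assert (Hs : s = 0).
(* Writing out <H a, b> = <a, H b> gives s (|a|^2 + |b|^2) = 0. *)
{ assert (S := ip_HR q a b Hq F1 F2).
  rewrite (ip_ext (HR q a) (fun n => (- s) * b n + r * a n) b b) in S by (intros; auto; rewrite Ea; ring).
  rewrite (ip_ext a a (HR q b) (fun n => s * a n + r * b n)) in S by (intros; auto; rewrite Eb; ring).
  assert (Hr : forall y, sq2 y -> sq2 (fun n => r * y n)) by (intros; now apply sq2_scal).
  rewrite (ip_sym a (fun n => s * a n + r * b n)), (ip_lin_l (- s) b (fun n => r * a n) b), (ip_lin_l s a (fun n => r * b n) a) in S by auto.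
  assert (Er : forall y z, sq2 y -> sq2 z -> ip (fun n => r * y n) z = r * ip y z).
  { intros y z Hy Hz. unfold ip. rewrite <- ZS_scal by now apply sq2_summ. apply ZS_ext. intros; ring. }
  rewrite !Er, (ip_sym b a) in S by auto.
  assert (A := ip_pos a F1). assert (B := ip_pos b F2).
  destruct (Req_dec s 0) as [|Hs]; auto. exfalso. apply Hn0.
  assert (Z : s * (ip a a + ip b b) = 0) by lra. apply Rmult_integral in Z. destruct Z as [Z|Z]; [contradiction|].
  apply injective_projections; simpl; [apply (ip_eq0 a F1); lra|apply (ip_eq0 b F2); lra]. }
assert (Ia := Ho r a F1 ltac:(intros n; rewrite Ea, Hs; ring)). assert (Ib := Ho r b F2 ltac:(intros n; rewrite Eb, Hs; ring)).
split; apply is_lim_seq_Reals.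
- apply (is_lim_seq_ext (symsum (fun n => x n * a n))); [intros N; apply symsum_ext; intros n; unfold a; simpl; ring|].
  rewrite <- Ia. apply ZS_lim. now apply sq2_summ.
- apply (is_lim_seq_ext (fun N => (-1) * symsum (fun n => x n * b n) N)); [intros N; rewrite <- symsum_scal; apply symsum_ext; intros n; unfold b; simpl; ring|].
  replace (Finite 0) with (Rbar_mult (-1) 0) by (simpl; f_equal; ring). apply is_lim_seq_scal_l. rewrite <- Ib. apply ZS_lim. now apply sq2_summ.
Qed.

Lemma symsum_dlt x n N : (Z.abs n <= Z.of_nat N)%Z -> symsum (fun m => x m * dlt n m) N = x n.
Proof.
assert (Hz : forall N, (Z.of_nat N < Z.abs n)%Z -> symsum (fun m => x m * dlt n m) N = 0).
{ induction N0 as [|N0 IH]; intros H; unfold dlt in *; [rewrite symsum_0|rewrite symsum_S, IH by lia]; repeat destruct (Z.eq_dec _ _); try lia; ring. }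
induction N as [|N IH]; intros H.
- replace n with 0%Z by lia. rewrite symsum_0. unfold dlt. destruct (Z.eq_dec 0 0); [ring|lia].
- rewrite symsum_S. destruct (Z_le_dec (Z.abs n) (Z.of_nat N)) as [H1|H1].
  + rewrite IH by auto. unfold dlt. repeat destruct (Z.eq_dec _ _); try lia; ring.
  + rewrite Hz by lia. unfold dlt. repeat destruct (Z.eq_dec _ _); subst; try lia; ring.
Qed.

Lemma sq2_dlt n : sq2 (dlt n).
Proof.
exists 1. intros N. rewrite (symsum_ext _ (fun m => 1 * dlt n m)) by (intros m; unfold dlt; destruct (Z.eq_dec n m); ring).
apply Rle_trans with (symsum (fun m => 1 * dlt n m) (Nat.max N (Z.abs_nat n))).
- apply symsum_mono; [|lia]. intros m. unfold dlt. destruct (Z.eq_dec n m); lra.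
- rewrite (symsum_dlt (fun _ => 1)) by lia. lra.
Qed.

Lemma ip_dlt x n : ip x (dlt n) = x n.
Proof.
apply ZS_unique. apply (is_lim_seq_incr_n _ (Z.abs_nat n)). apply (is_lim_seq_ext (fun _ => x n)); [|apply is_lim_seq_const].
intros N. symmetry. apply symsum_dlt. lia.
Qed.

Section Assembly.
Variables (q : Z -> R) (e V : nat -> C) (K : R).
Hypothesis Hq1 : wl1 1 q.
Hypothesis He : edge_factor q e V.
Hypothesis HK : 1 <= K.
Hypothesis Hbound : forall n m t, 0 < t < PI -> Rabs (rho q e V n m t) <= K.
Hypothesis Hosc : forall t c n m, Rabs (RInt (fun x => cos (t * (2 - 2 * cos x) + c) * rho q e V n m x) 0 PI) <= K * Rpower (bracket t) (- (1 / 3)).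
Hypothesis Hdecay : forall n m, (1 <= Z.abs (Z.abs n - Z.abs m))%Z ->
     Rabs (RInt (fun x => 1 * rho q e V n m x) 0 PI) <= K * (sqrt (sqrt (IZR (Z.abs (Z.abs n - Z.abs m)))) / IZR (Z.abs (Z.abs n - Z.abs m))).

Let Hb := wl1_bdd q Hq1.

Lemma qn_sq2 n : sq2 (qn q e V n).
Proof. now apply (sq2_qn q e V K). Qed.

Lemma qn_contsub n : ContSub q (fun m => (qn q e V n m, 0)).
Proof.
apply real_contsub; auto; [apply qn_sq2|]. intros mu x Hx E. now apply (qn_orth_eigen q e V K) with (mu := mu).
Qed.

Lemma qn_reproduces x n : sq2 x -> orth_eigen q x -> x n = ip x (qn q e V n).
Proof.
intros Hx Ho. destruct (pole_removal q e V Hq1 He) as [l Hl].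
assert (H := polop_kernel_orth q Hb x Hx Ho l (fun m => (-1) * qn q e V n m + dlt n m) (sq2_lin (-1) _ _ (qn_sq2 n) (sq2_dlt n))).
rewrite ip_sym, ip_lin_l, (ip_sym (dlt n)), ip_dlt, (ip_sym (qn q e V n)) in H by (auto using qn_sq2, sq2_dlt).
assert (Z : -1 * ip x (qn q e V n) + x n = 0); [|lra]. apply H. intros m. rewrite polop_lin, Hl. ring.
Qed.

Lemma projection_kernel v w n : IsPc q v w ->
  is_lim_seq (symsum (fun m => qn q e V n m * fst (v m))) (fst (w n)) /\ is_lim_seq (symsum (fun m => qn q e V n m * snd (v m))) (snd (w n)).
Proof.
intros [Hw Ho]. destruct (contsub_orth_eigen q w Hw) as [O1 O2]. destruct (InL2_parts w (proj1 Hw)) as [W1 W2].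
destruct (Ho _ (qn_contsub n)) as [P1 P2]. apply is_lim_seq_Reals in P1, P2.
assert (Key : forall (a b : Z -> R) f, sq2 b -> orth_eigen q b -> (forall m, f m = (a m - b m) * qn q e V n m) -> is_lim_seq (symsum f) 0 ->
  is_lim_seq (symsum (fun m => qn q e V n m * a m)) (b n)).
{ intros a b f Hb2 Hob Hf Hl. rewrite (qn_reproduces b n) by auto.
  apply (is_lim_seq_ext (fun N => symsum f N + symsum (fun m => b m * qn q e V n m) N)).
  - intros N. rewrite <- symsum_plus. apply symsum_ext. intros m. rewrite Hf. ring.
  - replace (Finite (ip b (qn q e V n))) with (Finite (0 + ip b (qn q e V n))) by (f_equal; ring). apply is_lim_seq_plus'; auto. apply ZS_lim. apply sq2_summ; auto. apply qn_sq2. }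
split; [apply (Key _ _ _ W1 O1) with (2 := P1)|apply (Key _ _ _ W2 O2) with (2 := P2)]; intros m; simpl; ring.
Qed.

Lemma dispersive_bound t u S v w n : Un_cv (fun N => symsum (fun n => Defs.Cmod (u n)) N) S -> ExpItH q t u v -> IsPc q v w ->
  Defs.Cmod (w n) <= 4 * K * Rpower (bracket t) (- (1 / 3)) * S.
Proof.
intros HS Hexp Hpc. destruct (projection_kernel v w n Hpc) as [L1 L2].
assert (HSN : forall N, symsum (fun n => Defs.Cmod (u n)) N <= S).
{ apply (growing_ineq (symsum (fun n => Defs.Cmod (u n)))); auto. intros N. apply symsum_mono; [intros; apply sqrt_pos|lia]. }
assert (U1 : l1z (fun m => fst (u m)) S) by (intros N; eapply Rle_trans; [|apply (HSN N)]; apply symsum_le; intros; apply Cmod_parts).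
assert (U2 : l1z (fun m => snd (u m)) S) by (intros N; eapply Rle_trans; [|apply (HSN N)]; apply symsum_le; intros; apply Cmod_parts).
assert (U3 : l1z (fun m => - snd (u m)) S) by (intros N; rewrite (symsum_ext _ (fun m => Rabs (snd (u m)))) by (intros; apply Rabs_Ropp); apply U2).
assert (B1 := evolution_bound q e V K Hq1 He HK Hbound Hosc n t _ _ S (fun m => fst (v m)) (fst (w n)) U1 U3).
assert (B2 := evolution_bound q e V K Hq1 He HK Hbound Hosc n t _ _ S (fun m => snd (v m)) (snd (w n)) U2 U1).
assert (B1' : Rabs (fst (w n)) <= 2 * K * Rpower (bracket t) (- (1 / 3)) * S).
{ apply B1; auto. intros m. destruct (Hexp m) as [E _]. apply infinite_sum_psum in E. eapply is_lim_seq_ext; [|exact E]. intros J. apply psum_ext. intros k _.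
  rewrite iter_HR_opp, <- Hpow_fst, <- Hpow_snd. unfold ca, cb. simpl. ring. }
assert (B2' : Rabs (snd (w n)) <= 2 * K * Rpower (bracket t) (- (1 / 3)) * S).
{ apply B2; auto. intros m. destruct (Hexp m) as [_ E]. apply infinite_sum_psum in E. eapply is_lim_seq_ext; [|exact E]. intros J. apply psum_ext. intros k _.
  rewrite <- Hpow_fst, <- Hpow_snd. unfold ca, cb. simpl. ring. }
destruct (Cmod_parts (w n)) as [_ [_ H]]. lra.
Qed.

End Assembly.

Import Defs.

Theorem theorem1p3 (q : Z -> R)
  (Hq1 : wl1 1 q) (Hq2 : ~ generic q -> wl1 2 q) :
  exists Cst : R, 0 < Cst /\
    forall (t : R) (u : Z -> Cx) (S : R) (v w : Z -> Cx),
      Un_cv (fun N => symsum (fun n => Cmod (u n)) N) S ->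
      ExpItH q t u v ->
      IsPc q v w ->
      forall n : Z, Cmod (w n) <= Cst * Rpower (bracket t) (- (1 / 3)) * S.
Proof.
destruct (edge_factor_exists q Hq1 Hq2) as [e [V He]].
destruct (kernel_bounds q e V Hq1 Hq2 He) as [K [HK [Hbound [Hosc Hdecay]]]].
exists (4 * K). split; [lra|]. intros t u S v w HS Hexp Hpc n. now apply (dispersive_bound q e V K Hq1 He HK Hbound Hosc Hdecay t u S v w n).
Qed.
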